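(* Assume the Riemann Hypothesis. Let $k \ge 2$ be a fixed integer and let $\alpha$ be a fixed constant with $0<\alpha\le 1$. Then, for $T^{\alpha} \le H = H(T) \le T$, $$ \int_T^{T+H}(Z'(t))^2Z^{2k-2}(t)\,dt \;\gg_{k,\alpha}\; H(\log T)^{k^2+2}. $$
   Context: $\zeta(s)$ denotes the Riemann zeta-function. The Riemann Hypothesis (RH) is the statement that all complex (non-trivial) zeros of $\zeta(s)$ satisfy $\Re s = \tfrac12$. The functional equation is $\zeta(s)=\chi(s)\zeta(1-s)$ with $$\chi(s) := \frac{\Gamma(\frac12(1-s))}{\Gamma(\frac12 s)}\pi^{s-1/2}.$$ Hardy's function is $$Z(t) := \zeta(\tfrac12+it)\bigl(\chi(\tfrac12+it)\bigr)^{-1/2}\qquad (t\in\mathbb{R}),$$ where the square root is the branch continuous in $t$ with value $1$ at $t=0$ (note $|\chi(\frac12+it)|=1$ and $\chi(\frac12)=1$). $Z(t)$ is real for real $t$ and $|Z(t)|=|\zeta(\frac12+it)|$. $Z'$ is the derivative of $Z$, and $Z^{2k-2}(t)=(Z(t))^{2k-2}$. The notation $A\gg_{k,\alpha} B$ (with $B>0$) means that there are constants $c>0$ and $T_0$ depending only on $k$ and $\alpha$ such that $A\ge cB$ for all $T\ge T_0$ and all $H$ in the stated range. *)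

(* Defs.v *)
(* Stdlib reals with Coquelicot. *)
From Stdlib Require Export Reals Factorial ClassicalEpsilon.
From Coquelicot Require Export Coquelicot.

Open Scope R_scope.

Definition Cexp (z : C) : C :=
  (exp (Re z) * cos (Im z), exp (Re z) * sin (Im z)).

(* [a^s] with the real logarithm of [a]; meaningful for [0 < a]. *)
Definition Rcpow (a : R) (s : C) : C := Cexp (s * RtoC (ln a))%C.

(* [ex_derive] is at type [C -> C], so the derivative is the complex one and
   [f] is required to be holomorphic on C \ {1}.  By the identity theorem these
   conditions determine [f] everywhere except for its value at the pole [1],
   which is left arbitrary. *)
Definition is_riemann_zeta (f : C -> C) : Prop :=
  (forall s : C, 1 < Re s ->
     is_series (fun n : nat => Rcpow (INR (S n)) (- s)%C) (f s)) /\
  (forall s : C, s <> RtoC 1 -> ex_derive f s).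

Definition zeta : C -> C :=
  epsilon (inhabits (fun _ : C => RtoC 0)) is_riemann_zeta.

(* The zeros at -2, -4, -6, ... are the trivial ones; [s <> 1] only discards
   the arbitrary value of [zeta] at the pole. *)
Definition riemann_hypothesis : Prop :=
  forall s : C,
    s <> RtoC 1 ->
    (forall n : nat, s <> RtoC (- 2 * INR (S n))) ->
    zeta s = RtoC 0 ->
    Re s = 1 / 2.

(* s (s + 1) ... (s + n), with n + 1 factors. *)
Fixpoint rising (s : C) (n : nat) : C :=
  match n with
  | O => s
  | S m => (rising s m * (s + RtoC (INR n)))%C
  end.

(* Euler's limit n! n^s / (s (s + 1) ... (s + n)), which exists for every
   complex [s] other than 0, -1, -2, ...; the limit in C is taken on the real
   and imaginary parts. *)
Definition Cgamma (s : C) : C :=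
  let u n := (RtoC (INR (fact n)) * Rcpow (INR n) s / rising s n)%C in
  (real (Lim_seq (fun n => Re (u n))), real (Lim_seq (fun n => Im (u n)))).

Definition chi (s : C) : C :=
  (Cgamma ((1 - s) / 2) / Cgamma (s / 2) * Rcpow PI (s - RtoC (1 / 2)))%C.

Definition crit (t : R) : C := (1 / 2, t).

(* [w t = chi (1/2 + i t) ^ (-1/2)], on the branch that is continuous in [t]
   with [w 0 = 1]; such a [w] is unique. *)
Definition is_chi_inv_sqrt (w : R -> C) : Prop :=
  (forall t : R, continuous w t) /\
  w 0 = RtoC 1 /\
  (forall t : R, (w t * w t * chi (crit t) = RtoC 1)%C).

Definition chi_inv_sqrt : R -> C :=
  epsilon (inhabits (fun _ : R => RtoC 0)) is_chi_inv_sqrt.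

(* The product is real for real [t], so [Re] only changes its type. *)
Definition hardy_Z (t : R) : R := Re (zeta (crit t) * chi_inv_sqrt t)%C.

(* Main.v *)
(* Put [G = Z ^ k], so that [G' ^ 2 = k ^ 2 Z' ^ 2 Z ^ (2 k - 2)].  On a window
   of width [D = T ^ be] with a Gaussian weight, Cauchy-Schwarz bounds the second
   moment of [G'] from below by [I ^ 2 / J], where [G'] is tested against
   [e ^ (- i k theta) A(s)], [A(s) = sum m ^ (s - 1)] over the products [m] of [k]
   integers up to a small power of [T], [I] is the first moment and [J] the mean
   square of [A].  Integration by parts turns [I] into the integral of
   [zeta ^ k (k theta' A - A')] on the critical line.  With [theta'] replaced by a
   rational function it moves to [Re s = 2], where [zeta] is nearly a Dirichlet
   polynomial, and the diagonal terms give [log T * D * S] with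
   [S = sum 1 / (x_1 ... x_k)] over [x_1 ... x_k = y_1 ... y_k].  The mean square
   is [D * S], so the window contributes [(log T) ^ 2 * D * S], and
   [S >> (log T) ^ (k ^ 2)].  The Gaussian weight lets the off-diagonal terms be
   removed by shifting the contour by [D]. *)

Require Import Defs.
From Stdlib Require Import ZArith Lra Lia Psatz List Classical.
Import ListNotations.

(** * Complex differentiability and contour integrals *)

(** [zeta] is chosen by [epsilon], so any property of it requires a witness that is holomorphic on
    the whole punctured plane; this is why the continuation is built from the theta identity. The
    same formula shows that zeta times [e ^ (i theta)] is real on the critical line, which lets
    [hardy_Z ^ k] be written as a phase times [zeta ^ k]. Beyond this only polynomial bounds for
    zeta enter: every error carries either [exp (- (ln T) ^ 2)] or a negative power of [T]. The
    scales are tied together by the spacing of logarithms: for products up to [K] the gaps are at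
    least [1 / (2 K)], so [K <= T ^ (be / 2)] and [D = T ^ be] make the decay [exp (- D / (2 K))]
    smaller than any power of [T], while the length of the factors stays a power of [T]. The bound
    for [S] uses neither primes nor a sieve. A [k] by [k] matrix with pairwise coprime entries gives
    two tuples, its row products and its column products, with equal total product, and it can be
    recovered from them. The [k ^ 2] free entries produce the power [k ^ 2] of the logarithm. *)

Definition cder (f : C -> C) (z l : C) : Prop :=
  forall eps, 0 < eps -> exists del, 0 < del /\
    forall h : C, Cmod h < del -> Cmod (f (z + h) - f z - l * h)%C <= eps * Cmod h.

Definition hol (f : C -> C) (z : C) : Prop := exists l, cder f z l.

Definition ccont (f : C -> C) (z : C) : Prop :=
  forall eps, 0 < eps -> exists del, 0 < del /\
    forall h : C, Cmod h < del -> Cmod (f (z + h) - f z)%C < eps.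

(** Componentwise, to match the componentwise integral [CI] and to reuse continuity of real
    functions. *)
Definition rcont (g : R -> C) (t : R) : Prop :=
  continuous (fun t => Re (g t)) t /\ continuous (fun t => Im (g t)) t.

Lemma Ceq (z w : C) : Re z = Re w -> Im z = Im w -> z = w.
Proof. destruct z, w; simpl; intros; subst; reflexivity. Qed.

Ltac csimp := unfold Cminus, Cplus, Copp, Cmult, RtoC, Re, Im in *; simpl in *.

Lemma im_le_Cmod (c : C) : Rabs (Im c) <= Cmod c.
Proof. eapply Rle_trans; [| apply Rmax_Cmod]. apply Rmax_r. Qed.

Lemma Cmod_le_abs (c : C) : Cmod c <= Rabs (Re c) + Rabs (Im c).
Proof.
  replace c with (RtoC (Re c) + Ci * RtoC (Im c))%C at 1.
  2: { apply Ceq; destruct c; csimp; ring. }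
  eapply Rle_trans; [apply Cmod_triangle|].
  rewrite Cmod_mult, Cmod_Ci, !Cmod_R. lra.
Qed.

Lemma Cmod_minus_sym (a b : C) : Cmod (a - b) = Cmod (b - a).
Proof. rewrite <- Cmod_opp. f_equal. ring. Qed.

Lemma Cmod_tri_minus (a b : C) : Cmod (a - b) <= Cmod a + Cmod b.
Proof. unfold Cminus. eapply Rle_trans; [apply Cmod_triangle|]. rewrite Cmod_opp. lra. Qed.

Lemma Cmod_tri_rev (a b : C) : Cmod a - Cmod b <= Cmod (a + b).
Proof.
  assert (Cmod a <= Cmod (a + b) + Cmod b); [|lra].
  replace a with ((a + b) - b)%C at 1 by ring. apply Cmod_tri_minus.
Qed.

(** Bridge between the filter derivative in the definition of [zeta] and the epsilon-delta form in
    which all estimates are made. *)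
Lemma is_derive_cder (f : C -> C) (z l : C) : is_derive f z l <-> cder f z l.
Proof.
  split.
  - intros [_ H] eps Heps.
    specialize (H z (fun P HP => HP) (mkposreal eps Heps)).
    destruct H as [d Hd]. exists d. split; [apply cond_pos|].
    intros h Hh. specialize (Hd (z + h)%C).
    assert (E : forall z h : C, ((z + h) - z)%C = h) by (intros; ring).
    assert (Hb : @ball (AbsRing_UniformSpace C_AbsRing) z d (z + h)%C).
    { change (Cmod ((z + h) - z)%C < d). rewrite E. exact Hh. }
    specialize (Hd Hb).
    change (Cmod ((f (z + h) - f z) - ((z + h) - z) * l)%C <= eps * Cmod ((z + h) - z)%C) in Hd.
    rewrite E in Hd.
    rewrite (Cmult_comm l h). exact Hd.
  - intros H. split; [apply is_linear_scal_l|].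
    intros x Hx eps.
    assert (x = z) as ->.
    { symmetry. apply (is_filter_lim_locally_unique (V := AbsRing_NormedModule C_AbsRing)). exact Hx. }
    destruct (H eps (cond_pos eps)) as [d [Hd0 Hd]].
    exists (mkposreal d Hd0). intros y Hy.
    change (Cmod (y - z)%C < d) in Hy.
    change (Cmod ((f y - f z) - (y - z) * l)%C <= eps * Cmod (y - z)%C).
    specialize (Hd _ Hy).
    assert (E : forall z y : C, (z + (y - z))%C = y) by (intros; ring).
    rewrite E in Hd. rewrite (Cmult_comm _ l). exact Hd.
Qed.

Lemma ex_derive_hol (f : C -> C) (z : C) : ex_derive f z <-> hol f z.
Proof. split; intros [l Hl]; exists l; apply is_derive_cder; exact Hl. Qed.

Lemma cder_ext_loc (f g : C -> C) z l :
  (exists d, 0 < d /\ forall h, Cmod h < d -> f (z + h)%C = g (z + h)%C) ->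
  cder f z l -> cder g z l.
Proof.
  intros [d [Hd He]] H eps Heps. destruct (H eps Heps) as [d' [Hd' H']].
  exists (Rmin d d'). split; [apply Rmin_pos; assumption|].
  intros h Hh.
  assert (E0 : f z = g z).
  { specialize (He 0%C). rewrite Cmod_0 in He. rewrite !Cplus_0_r in He. apply He, Hd. }
  rewrite <- E0, <- He.
  - apply H'. eapply Rlt_le_trans; [exact Hh|apply Rmin_r].
  - eapply Rlt_le_trans; [exact Hh|apply Rmin_l].
Qed.

Lemma cder_ext (f g : C -> C) z l : (forall w, f w = g w) -> cder f z l -> cder g z l.
Proof. intros H. apply cder_ext_loc. exists 1. split; [lra|]. auto. Qed.

Lemma cder_const (c z : C) : cder (fun _ => c) z 0.
Proof.
  intros eps H. exists 1. split; [lra|]. intros h _.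
  replace (c - c - 0 * h)%C with (RtoC 0) by ring. rewrite Cmod_0.
  apply Rmult_le_pos; [lra|apply Cmod_ge_0].
Qed.

Lemma cder_id (z : C) : cder (fun w => w) z 1.
Proof.
  intros eps H. exists 1. split; [lra|]. intros h _.
  replace (z + h - z - 1 * h)%C with (RtoC 0) by ring. rewrite Cmod_0.
  apply Rmult_le_pos; [lra|apply Cmod_ge_0].
Qed.

Lemma cder_ccont f z l : cder f z l -> ccont f z.
Proof.
  intros H eps Heps. destruct (H 1 Rlt_0_1) as [d [Hd H1]].
  assert (K : 0 < 1 + Cmod l) by (generalize (Cmod_ge_0 l); lra).
  exists (Rmin d (eps / (1 + Cmod l))). split.
  { apply Rmin_pos; [assumption|]. apply Rdiv_lt_0_compat; assumption. }
  intros h Hh. specialize (H1 h (Rlt_le_trans _ _ _ Hh (Rmin_l _ _))).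
  assert (Hh2 := Rlt_le_trans _ _ _ Hh (Rmin_r _ _)).
  replace (f (z + h) - f z)%C with ((f (z + h) - f z - l * h) + l * h)%C by ring.
  eapply Rle_lt_trans; [apply Cmod_triangle|]. rewrite Cmod_mult.
  apply Rle_lt_trans with ((1 + Cmod l) * Cmod h); [lra|].
  apply Rmult_lt_compat_l with (r := 1 + Cmod l) in Hh2; [|assumption].
  replace ((1 + Cmod l) * (eps / (1 + Cmod l))) with eps in Hh2 by (field; lra). lra.
Qed.

Lemma hol_ccont f z : hol f z -> ccont f z.
Proof. intros [l H]. eapply cder_ccont; exact H. Qed.

Lemma cder_plus f g z a b : cder f z a -> cder g z b -> cder (fun w => f w + g w)%C z (a + b).
Proof.
  intros Hf Hg eps He.
  destruct (Hf (eps/2)) as [d1 [D1 H1]]; [lra|].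
  destruct (Hg (eps/2)) as [d2 [D2 H2]]; [lra|].
  exists (Rmin d1 d2). split; [apply Rmin_pos; assumption|]. intros h Hh.
  specialize (H1 h (Rlt_le_trans _ _ _ Hh (Rmin_l _ _))).
  specialize (H2 h (Rlt_le_trans _ _ _ Hh (Rmin_r _ _))).
  replace (f (z + h) + g (z + h) - (f z + g z) - (a + b) * h)%C with
    ((f (z + h) - f z - a * h) + (g (z + h) - g z - b * h))%C by ring.
  eapply Rle_trans; [apply Cmod_triangle|]. lra.
Qed.

Lemma cder_mult f g z a b :
  cder f z a -> cder g z b -> cder (fun w => f w * g w)%C z (a * g z + f z * b).
Proof.
  intros Hf Hg eps He.
  set (A := 1 + Cmod (f z) + Cmod (g z) + Cmod a).
  assert (A0 : 1 <= A) by (unfold A; generalize (Cmod_ge_0 (f z)) (Cmod_ge_0 (g z)) (Cmod_ge_0 a); lra).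
  set (e := eps / (3 * A)).
  assert (e0 : 0 < e) by (apply Rdiv_lt_0_compat; lra).
  destruct (Hf e e0) as [d1 [D1 H1]].
  destruct (Hg e e0) as [d2 [D2 H2]].
  destruct (cder_ccont _ _ _ Hg e e0) as [d3 [D3 H3]].
  destruct (cder_ccont _ _ _ Hg 1 Rlt_0_1) as [d4 [D4 H4]].
  exists (Rmin (Rmin d1 d2) (Rmin d3 d4)). split; [repeat apply Rmin_pos; assumption|]. intros h Hh.
  assert (Hh1 : Cmod h < Rmin d1 d2) by (eapply Rlt_le_trans; [exact Hh|apply Rmin_l]).
  assert (Hh2 : Cmod h < Rmin d3 d4) by (eapply Rlt_le_trans; [exact Hh|apply Rmin_r]).
  specialize (H1 h (Rlt_le_trans _ _ _ Hh1 (Rmin_l _ _))).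
  specialize (H2 h (Rlt_le_trans _ _ _ Hh1 (Rmin_r _ _))).
  specialize (H3 h (Rlt_le_trans _ _ _ Hh2 (Rmin_l _ _))).
  replace (f (z + h) * g (z + h) - f z * g z - (a * g z + f z * b) * h)%C with
    ((f (z + h) - f z - a * h) * g z + (f (z+h) - f z - a * h) * (g (z+h) - g z)
      + f z * (g (z + h) - g z - b * h) + a * h * (g (z+h) - g z))%C by ring.
  specialize (H4 h (Rlt_le_trans _ _ _ Hh2 (Rmin_r _ _))).
  eapply Rle_trans; [apply Cmod_triangle|].
  eapply Rle_trans; [apply Rplus_le_compat_r, Cmod_triangle|].
  eapply Rle_trans; [apply Rplus_le_compat_r, Rplus_le_compat_r, Cmod_triangle|].
  rewrite !Cmod_mult.
  assert (Ee : eps = 3 * A * e) by (unfold e; field; lra).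
  generalize (Cmod_ge_0 (f z)) (Cmod_ge_0 (g z)) (Cmod_ge_0 a) (Cmod_ge_0 h)
   (Cmod_ge_0 (f (z + h) - f z - a * h)%C) (Cmod_ge_0 (g (z+h) - g z)%C) (Cmod_ge_0 (g (z + h) - g z - b * h)%C).
  intros. set (F := Cmod (f z)) in *. set (G := Cmod (g z)) in *. set (A' := Cmod a) in *.
  set (H' := Cmod h) in *. set (X := Cmod (f (z + h) - f z - a * h)%C) in *.
  set (Y := Cmod (g (z+h) - g z)%C) in *. set (Z := Cmod (g (z + h) - g z - b * h)%C) in *.
  clearbody F G A' H' X Y Z.
  assert (eH : 0 <= e * H') by nra.
  assert (X * G <= e * H' * G) by nra.
  assert (X * Y <= e * H' * 1) by nra.
  assert (F * Z <= F * (e * H')) by nra.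
  assert (A' * H' * Y <= A' * (e * H')).
  { replace (A' * (e * H')) with (A' * H' * e) by ring. apply Rmult_le_compat_l; nra. }
  rewrite Ee. replace (3 * A * e * H') with (3 * (A * (e * H'))) by ring.
  assert (A * (e * H') = e * H' + F * (e*H') + G * (e*H') + A' * (e * H')) by (unfold A; ring).
  nra.
Qed.

Lemma cder_scal (c : C) f (z l : C) : cder f z l -> cder (fun w => c * f w)%C z (c * l).
Proof.
  intros H. replace (c * l)%C with (0 * f z + c * l)%C by ring.
  apply (cder_mult (fun _ => c) f); [apply cder_const|exact H].
Qed.

Lemma cder_opp f z l : cder f z l -> cder (fun w => - f w)%C z (- l).
Proof.
  intros H. replace (- l)%C with ((-1) * l)%C by ring.
  eapply cder_ext; [|apply cder_scal, H]. intros; simpl. ring.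
Qed.

Lemma cder_minus f g z a b : cder f z a -> cder g z b -> cder (fun w => f w - g w)%C z (a - b).
Proof. intros Hf Hg. apply (cder_plus f (fun w => - g w)%C); [exact Hf|]. apply cder_opp, Hg. Qed.

Lemma cder_comp f g z a b :
  cder f z a -> cder g (f z) b -> cder (fun w => g (f w)) z (b * a).
Proof.
  intros Hf Hg eps He.
  set (A := 1 + Cmod a + Cmod b).
  assert (A0 : 1 <= A) by (unfold A; generalize (Cmod_ge_0 a) (Cmod_ge_0 b); lra).
  set (e := Rmin 1 (eps / (2 * A))).
  assert (e0 : 0 < e) by (apply Rmin_pos; [lra|apply Rdiv_lt_0_compat; lra]).
  assert (e1 : e <= 1) by apply Rmin_l.
  assert (e2 : 2 * A * e <= eps).
  { assert (e <= eps / (2 * A)) by apply Rmin_r.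
    apply Rmult_le_compat_l with (r := 2 * A) in H; [|lra].
    replace (2 * A * (eps / (2 * A))) with eps in H by (field; lra). lra. }
  destruct (Hf e e0) as [d1 [D1 H1]].
  destruct (Hg e e0) as [d2 [D2 H2]].
  destruct (cder_ccont _ _ _ Hf d2 D2) as [d3 [D3 H3]].
  exists (Rmin d1 d3). split; [apply Rmin_pos; assumption|]. intros h Hh.
  specialize (H1 h (Rlt_le_trans _ _ _ Hh (Rmin_l _ _))).
  specialize (H3 h (Rlt_le_trans _ _ _ Hh (Rmin_r _ _))).
  specialize (H2 _ H3).
  replace (f z + (f (z + h) - f z))%C with (f (z + h)%C) in H2 by ring.
  replace (g (f (z + h)) - g (f z) - b * a * h)%C with
   ((g (f (z + h)) - g (f z) - b * (f (z + h) - f z)) + b * (f (z + h) - f z - a * h))%C by ring.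
  eapply Rle_trans; [apply Cmod_triangle|]. rewrite Cmod_mult.
  assert (Cmod (f (z + h) - f z)%C <= e * Cmod h + Cmod a * Cmod h).
  { replace (f (z + h) - f z)%C with ((f (z + h) - f z - a * h) + a * h)%C by ring.
    eapply Rle_trans; [apply Cmod_triangle|]. rewrite Cmod_mult. lra. }
  generalize (Cmod_ge_0 a) (Cmod_ge_0 b) (Cmod_ge_0 h); intros.
  assert (e * Cmod (f (z + h) - f z)%C <= e * (e * Cmod h + Cmod a * Cmod h)) by (apply Rmult_le_compat_l; lra).
  assert (Cmod b * Cmod (f (z + h) - f z - a * h)%C <= Cmod b * (e * Cmod h)) by (apply Rmult_le_compat_l; lra).
  assert (2 * A * e * Cmod h <= eps * Cmod h) by (apply Rmult_le_compat_r; lra).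
  assert (e * e * Cmod h <= e * Cmod h) by (apply Rmult_le_compat_r; nra).
  assert (0 <= e * Cmod h) by nra.
  assert (0 <= Cmod a * (e * Cmod h)) by (apply Rmult_le_pos; lra).
  assert (0 <= Cmod b * (e * Cmod h)) by (apply Rmult_le_pos; lra).
  unfold A in *. nra.
Qed.

Lemma cder_inv (z : C) : z <> 0%C -> cder (fun w => / w)%C z (- / (z * z)).
Proof.
  intros Hz eps He. assert (m := proj1 (Cmod_gt_0 z) Hz).
  set (m0 := Cmod z) in *.
  exists (Rmin (m0 / 2) (eps * (m0 * m0 * m0) / 2)).
  assert (0 < m0 * m0 * m0) by (repeat apply Rmult_lt_0_compat; lra).
  split. { apply Rmin_pos; [lra|]. apply Rdiv_lt_0_compat; [apply Rmult_lt_0_compat; lra|lra]. }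
  intros h Hh.
  assert (Hh1 := Rlt_le_trans _ _ _ Hh (Rmin_l _ _)).
  assert (Hh2 := Rlt_le_trans _ _ _ Hh (Rmin_r _ _)).
  assert (Hm : m0 / 2 <= Cmod (z + h)).
  { generalize (Cmod_tri_rev z h). fold m0. lra. }
  assert (Hzh : (z + h)%C <> 0%C) by (apply Cmod_gt_0; lra).
  replace (/ (z + h) - / z - - / (z * z) * h)%C with (h * h * / (z + h) * / (z * z))%C by (field; auto).
  rewrite !Cmod_mult, Cmod_inv, Cmod_inv, Cmod_mult by (auto; apply Cmult_neq_0; auto).
  fold m0.
  assert (I1 : / Cmod (z + h) <= 2 / m0).
  { replace (2 / m0) with (/ (m0 / 2)) by (field; lra). apply Rinv_le_contravar; lra. }
  replace (Cmod h * Cmod h * / Cmod (z + h) * / (m0 * m0)) with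
     ((Cmod h * / (m0 * m0) * / Cmod (z+h)) * Cmod h) by ring.
  apply Rmult_le_compat_r; [apply Cmod_ge_0|].
  assert (P0 : 0 < / (m0 * m0)) by (apply Rinv_0_lt_compat; nra).
  apply Rle_trans with (Cmod h * / (m0 * m0) * (2 / m0)).
  { apply Rmult_le_compat_l; [|exact I1]. apply Rmult_le_pos; [apply Cmod_ge_0|lra]. }
  apply Rle_trans with ((eps * (m0 * m0 * m0) / 2) * / (m0 * m0) * (2 / m0)).
  { apply Rmult_le_compat_r; [apply Rlt_le, Rdiv_lt_0_compat; lra|].
    apply Rmult_le_compat_r; lra. }
  right. field. lra.
Qed.

Lemma hol_const (c z : C) : hol (fun _ => c) z. Proof. eexists; apply cder_const. Qed.

Lemma hol_id z : hol (fun w => w) z. Proof. eexists; apply cder_id. Qed.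

Lemma hol_plus f g z : hol f z -> hol g z -> hol (fun w => f w + g w)%C z.
Proof. intros [a Ha] [b Hb]. eexists; apply cder_plus; eassumption. Qed.

Lemma hol_minus f g z : hol f z -> hol g z -> hol (fun w => f w - g w)%C z.
Proof. intros [a Ha] [b Hb]. eexists; apply cder_minus; eassumption. Qed.

Lemma hol_opp f z : hol f z -> hol (fun w => - f w)%C z.
Proof. intros [a Ha]. eexists; apply cder_opp; eassumption. Qed.

Lemma hol_mult f g z : hol f z -> hol g z -> hol (fun w => f w * g w)%C z.
Proof. intros [a Ha] [b Hb]. eexists; apply cder_mult; eassumption. Qed.

Lemma hol_comp f g z : hol f z -> hol g (f z) -> hol (fun w => g (f w)) z.
Proof. intros [a Ha] [b Hb]. eexists; apply cder_comp; eassumption. Qed.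

Lemma hol_inv f (z : C) : hol f z -> f z <> 0%C -> hol (fun w => / f w)%C z.
Proof. intros H H0. apply (hol_comp f Cinv); [exact H|]. eexists; apply cder_inv; exact H0. Qed.

Lemma hol_div f g z : hol f z -> hol g z -> g z <> 0%C -> hol (fun w => f w / g w)%C z.
Proof. intros Hf Hg H0. apply (hol_mult f (fun w => / g w)%C); [exact Hf|]. apply hol_inv; assumption. Qed.

Lemma hol_pow f n z : hol f z -> hol (fun w => f w ^ n)%C z.
Proof. intros H. induction n; simpl; [apply hol_const|]. apply (hol_mult f (fun w => f w ^ n)%C); assumption. Qed.

Lemma hol_ext_loc f g z d :
  0 < d -> (forall h, Cmod h < d -> f (z + h)%C = g (z + h)%C) -> hol f z -> hol g z.
Proof. intros Hd He [l Hl]. exists l. eapply cder_ext_loc; [|exact Hl]. exists d; auto. Qed.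

(** * The complex exponential *)

Lemma Cexp_plus z w : Cexp (z + w) = (Cexp z * Cexp w)%C.
Proof.
  unfold Cexp. destruct z as [a b], w as [c d]. csimp.
  rewrite exp_plus, cos_plus, sin_plus. f_equal; ring.
Qed.

Lemma Cmod_Cexp z : Cmod (Cexp z) = exp (Re z).
Proof.
  unfold Cexp, Cmod. destruct z as [a b]. unfold Re, Im. cbn [fst snd].
  rewrite <- (sqrt_Rsqr (exp a)) at 3 by (left; apply exp_pos). f_equal. unfold Rsqr.
  generalize (sin2_cos2 b). unfold Rsqr. intros H.
  transitivity (exp a * exp a * (sin b * sin b + cos b * cos b)); [ring|]. rewrite H. ring.
Qed.

Lemma Cexp_0 : Cexp 0 = 1%C.
Proof. unfold Cexp. csimp. rewrite exp_0, cos_0, sin_0. f_equal; ring. Qed.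

Lemma Cexp_R x : Cexp (RtoC x) = RtoC (exp x).
Proof. unfold Cexp. csimp. rewrite cos_0, sin_0. unfold RtoC. f_equal; ring. Qed.

Lemma Cexp_neq0 z : Cexp z <> 0%C.
Proof. apply Cmod_gt_0. rewrite Cmod_Cexp. apply exp_pos. Qed.

Lemma Cexp_opp z : Cexp (- z) = (/ Cexp z)%C.
Proof.
  assert (H : (Cexp z * Cexp (- z))%C = 1%C).
  { rewrite <- Cexp_plus, <- Cexp_0. f_equal. ring. }
  assert (N := Cexp_neq0 z).
  replace (Cexp (- z)) with (/ Cexp z * (Cexp z * Cexp (- z)))%C by (field; exact N).
  rewrite H. ring.
Qed.

(** * Continuity and integration of complex functions of a real parameter *)

Lemma rcont_const c t : rcont (fun _ => c) t.
Proof. split; apply continuous_const. Qed.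

Lemma rcont_plus f g t : rcont f t -> rcont g t -> rcont (fun u => f u + g u)%C t.
Proof.
  intros [F1 F2] [G1 G2]. split.
  - apply (continuous_plus (fun u => Re (f u)) (fun u => Re (g u))); assumption.
  - apply (continuous_plus (fun u => Im (f u)) (fun u => Im (g u))); assumption.
Qed.

Lemma rcont_opp f t : rcont f t -> rcont (fun u => - f u)%C t.
Proof.
  intros [F1 F2]. split.
  - apply (continuous_opp (fun u => Re (f u))); assumption.
  - apply (continuous_opp (fun u => Im (f u))); assumption.
Qed.

Lemma rcont_minus f g t : rcont f t -> rcont g t -> rcont (fun u => f u - g u)%C t.
Proof. intros F G. apply (rcont_plus f (fun u => - g u)%C); [exact F|]. apply rcont_opp, G. Qed.

Lemma rcont_mult f g t : rcont f t -> rcont g t -> rcont (fun u => f u * g u)%C t.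
Proof.
  intros [F1 F2] [G1 G2]. split.
  - apply (continuous_minus (fun u => Re (f u) * Re (g u)) (fun u => Im (f u) * Im (g u)));
    [apply (continuous_mult (fun u => Re (f u)) (fun u => Re (g u)))|
     apply (continuous_mult (fun u => Im (f u)) (fun u => Im (g u)))]; assumption.
  - apply (continuous_plus (fun u => Re (f u) * Im (g u)) (fun u => Im (f u) * Re (g u)));
    [apply (continuous_mult (fun u => Re (f u)) (fun u => Im (g u)))|
     apply (continuous_mult (fun u => Im (f u)) (fun u => Re (g u)))]; assumption.
Qed.

Lemma rcont_RtoC (f : R -> R) t : continuous f t -> rcont (fun u => RtoC (f u)) t.
Proof. intros H. split; [exact H|]. apply continuous_const. Qed.

Lemma rcont_pow f n t : rcont f t -> rcont (fun u => f u ^ n)%C t.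
Proof.
  intros H; induction n; [apply rcont_const|]. apply (rcont_mult f (fun u => f u ^ n)%C); assumption.
Qed.

Lemma continuous_eps (f : R -> R) x :
  (forall eps, 0 < eps -> exists del, 0 < del /\ forall y, Rabs (y - x) < del -> Rabs (f y - f x) < eps) <->
  continuous f x.
Proof.
  split.
  - intros H P [e He]. destruct (H e (cond_pos e)) as [d [Hd Hd']].
    exists (mkposreal d Hd). intros y Hy. apply He. apply Hd'. exact Hy.
  - intros H eps He. assert (L : locally (f x) (fun y => Rabs (y - f x) < eps)).
    { exists (mkposreal eps He). intros y Hy. exact Hy. }
    destruct (H _ L) as [d Hd]. exists d. split; [apply cond_pos|]. intros y Hy. apply Hd. exact Hy.
Qed.

Lemma rcont_comp f (g : R -> C) t : ccont f (g t) -> rcont g t -> rcont (fun u => f (g u)) t.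
Proof.
  intros Hf [H1 H2].
  assert (K : forall eps, 0 < eps -> exists del, 0 < del /\
    forall y, Rabs (y - t) < del -> Cmod (f (g y) - f (g t))%C < eps).
  { intros eps He. destruct (Hf eps He) as [d [Hd Hd']].
    destruct (proj2 (continuous_eps _ _) H1 (d/2)) as [d1 [D1 E1]]; [lra|].
    destruct (proj2 (continuous_eps _ _) H2 (d/2)) as [d2 [D2 E2]]; [lra|].
    exists (Rmin d1 d2). split; [apply Rmin_pos; assumption|]. intros y Hy.
    specialize (E1 y (Rlt_le_trans _ _ _ Hy (Rmin_l _ _))).
    specialize (E2 y (Rlt_le_trans _ _ _ Hy (Rmin_r _ _))).
    replace (g y) with (g t + (g y - g t))%C by ring. apply Hd'.
    eapply Rle_lt_trans; [apply Cmod_le_abs|].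
    replace (Re (g y - g t)) with (Re (g y) - Re (g t)) by (csimp; ring).
    replace (Im (g y - g t)) with (Im (g y) - Im (g t)) by (csimp; ring). lra. }
  split; apply continuous_eps; intros eps He; destruct (K eps He) as [d [Hd Hd']];
    exists d; split; try assumption; intros y Hy; eapply Rle_lt_trans; [|apply (Hd' y Hy)| |apply (Hd' y Hy)].
  - eapply Rle_trans; [|apply re_le_Cmod]. right. f_equal.
  - eapply Rle_trans; [|apply im_le_Cmod]. right. f_equal.
Qed.

Lemma rcont_hor (y t : R) : rcont (fun u : R => (u, y) : C) t.
Proof. split; [apply continuous_id|apply continuous_const]. Qed.

Lemma rcont_ver (x t : R) : rcont (fun v : R => (x, v) : C) t.
Proof. split; [apply continuous_const|apply continuous_id]. Qed.

Lemma rcont_Cmod f t : rcont f t -> continuous (fun u => Cmod (f u)) t.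
Proof.
  intros [H1 H2]. apply continuous_eps. intros eps He.
  destruct (proj2 (continuous_eps _ _) H1 (eps/2)) as [d1 [D1 E1]]; [lra|].
  destruct (proj2 (continuous_eps _ _) H2 (eps/2)) as [d2 [D2 E2]]; [lra|].
  exists (Rmin d1 d2). split; [apply Rmin_pos; assumption|]. intros y Hy.
  specialize (E1 y (Rlt_le_trans _ _ _ Hy (Rmin_l _ _))).
  specialize (E2 y (Rlt_le_trans _ _ _ Hy (Rmin_r _ _))).
  assert (Cmod (f y - f t)%C < eps).
  { eapply Rle_lt_trans; [apply Cmod_le_abs|].
    replace (Re (f y - f t)) with (Re (f y) - Re (f t)) by (csimp; ring).
    replace (Im (f y - f t)) with (Im (f y) - Im (f t)) by (csimp; ring). lra. }
  assert (A := Cmod_tri_rev (f y) (- (f y - f t))). rewrite Cmod_opp in A.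
  replace (f y + - (f y - f t))%C with (f t) in A by ring.
  assert (B := Cmod_tri_rev (f t) (f y - f t)).
  replace (f t + (f y - f t))%C with (f y) in B by ring.
  apply Rabs_lt_between. lra.
Qed.

Definition conts (f : R -> C) (a b : R) := forall t, a <= t <= b -> rcont f t.

Definition CI (f : R -> C) (a b : R) : C :=
  (RInt (fun t => Re (f t)) a b, RInt (fun t => Im (f t)) a b).

Lemma contR_ex_RInt (f : R -> R) a b :
  a <= b -> (forall t, a <= t <= b -> continuous f t) -> ex_RInt f a b.
Proof.
  intros Hab H. apply (ex_RInt_continuous (V := R_CompleteNormedModule)).
  intros z Hz. rewrite Rmin_left, Rmax_right in Hz by lra. apply H, Hz.
Qed.

Lemma conts_ex_re f a b : a <= b -> conts f a b -> ex_RInt (fun t => Re (f t)) a b.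
Proof. intros Hab H. apply contR_ex_RInt; [exact Hab|]. intros t Ht. apply (H t Ht). Qed.

Lemma conts_ex_im f a b : a <= b -> conts f a b -> ex_RInt (fun t => Im (f t)) a b.
Proof. intros Hab H. apply contR_ex_RInt; [exact Hab|]. intros t Ht. apply (H t Ht). Qed.

Lemma CI_ext f g a b : a <= b -> (forall t, a <= t <= b -> f t = g t) -> CI f a b = CI g a b.
Proof.
  intros Hab H. unfold CI. f_equal; apply RInt_ext; intros t Ht;
  rewrite Rmin_left, Rmax_right in Ht by lra; rewrite H; auto; lra.
Qed.

Lemma CI_plus f g a b : a <= b -> conts f a b -> conts g a b ->
  CI (fun t => f t + g t)%C a b = (CI f a b + CI g a b)%C.
Proof.
  intros Hab F G. unfold CI. apply Ceq; simpl.
  - rewrite <- (RInt_plus (V := R_CompleteNormedModule)) by (apply conts_ex_re; assumption). reflexivity.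
  - rewrite <- (RInt_plus (V := R_CompleteNormedModule)) by (apply conts_ex_im; assumption). reflexivity.
Qed.

Lemma CI_scal c f a b : a <= b -> conts f a b ->
  CI (fun t => c * f t)%C a b = (c * CI f a b)%C.
Proof.
  intros Hab F. unfold CI.
  assert (R1 := conts_ex_re _ _ _ Hab F). assert (I1 := conts_ex_im _ _ _ Hab F).
  apply Ceq; simpl.
  - rewrite (RInt_ext (V := R_CompleteNormedModule) _ (fun t => minus (scal (fst c) (Re (f t))) (scal (snd c) (Im (f t))))) by reflexivity.
    rewrite (RInt_minus (V := R_CompleteNormedModule)) by (apply (ex_RInt_scal (V := R_CompleteNormedModule)); assumption).
    rewrite !(RInt_scal (V := R_CompleteNormedModule)) by assumption. reflexivity.
  - rewrite (RInt_ext (V := R_CompleteNormedModule) _ (fun t => plus (scal (fst c) (Im (f t))) (scal (snd c) (Re (f t))))) by reflexivity.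
    rewrite (RInt_plus (V := R_CompleteNormedModule)) by (apply (ex_RInt_scal (V := R_CompleteNormedModule)); assumption).
    rewrite !(RInt_scal (V := R_CompleteNormedModule)) by assumption. reflexivity.
Qed.

Lemma CI_opp f a b : a <= b -> conts f a b -> CI (fun t => - f t)%C a b = (- CI f a b)%C.
Proof.
  intros Hab F. rewrite (CI_ext _ (fun t => (-1) * f t)%C) by (auto; intros; ring).
  rewrite CI_scal by assumption. ring.
Qed.

Lemma CI_minus f g a b : a <= b -> conts f a b -> conts g a b ->
  CI (fun t => f t - g t)%C a b = (CI f a b - CI g a b)%C.
Proof.
  intros Hab F G. unfold Cminus. rewrite <- CI_opp by assumption. apply CI_plus; try assumption.
  intros t Ht. apply rcont_opp, G, Ht.
Qed.

Lemma CI_const c a b : CI (fun _ => c) a b = (RtoC (b - a) * c)%C.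
Proof.
  unfold CI. rewrite !(RInt_const (V := R_CompleteNormedModule)). apply Ceq; csimp; unfold scal; simpl; unfold mult; simpl; ring.
Qed.

Lemma CI_Chasles f a b c : a <= b -> b <= c -> conts f a c ->
  (CI f a b + CI f b c)%C = CI f a c.
Proof.
  intros H1 H2 F. unfold CI.
  assert (F1 : conts f a b) by (intros t Ht; apply F; lra).
  assert (F2 : conts f b c) by (intros t Ht; apply F; lra).
  apply Ceq; simpl.
  - apply (RInt_Chasles (V := R_CompleteNormedModule)); apply conts_ex_re; assumption.
  - apply (RInt_Chasles (V := R_CompleteNormedModule)); apply conts_ex_im; assumption.
Qed.

(** Multiplying the integrand by the conjugate of the integral [I] rotates the integral to the real
    number [|I| ^ 2]; then only real parts have to be compared. *)
Lemma CI_bound_fun f g a b : a <= b -> conts f a b -> ex_RInt g a b ->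
  (forall t, a <= t <= b -> Cmod (f t) <= g t) -> Cmod (CI f a b) <= RInt g a b.
Proof.
  intros Hab F G H.
  set (I := CI f a b).
  destruct (Req_dec (Cmod I) 0) as [Z|Z].
  { rewrite Z. apply Rle_trans with (RInt (fun _ => 0) a b).
    { right. rewrite RInt_const. unfold scal; simpl; unfold mult; simpl. ring. }
    apply RInt_le; try assumption. apply ex_RInt_const.
    intros x Hx. eapply Rle_trans; [apply Cmod_ge_0|apply H; lra]. }
  assert (P : 0 < Cmod I) by (generalize (Cmod_ge_0 I); lra).
  apply Rmult_le_reg_l with (Cmod I); [exact P|].
  assert (E : Cmod I * Cmod I = Re (CI (fun t => Cconj I * f t)%C a b)).
  { rewrite CI_scal by assumption. fold I.
    generalize (Cmod2_alt I). intros Q. replace (Cmod I * Cmod I) with (Cmod I ^ 2) by ring.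
    rewrite Q. unfold Cconj. destruct I; csimp. ring. }
  rewrite E. rewrite <- (RInt_scal (V := R_CompleteNormedModule) g) by assumption.
  unfold CI. simpl. apply RInt_le; [exact Hab| | |].
  - apply (conts_ex_re (fun t => Cconj I * f t)%C); [exact Hab|]. intros t Ht. apply rcont_mult; [apply rcont_const|apply F, Ht].
  - apply (ex_RInt_scal (V := R_CompleteNormedModule)). exact G.
  - intros t Ht. eapply Rle_trans; [apply Rle_abs|].
    eapply Rle_trans; [apply (re_le_Cmod (Cconj I * f t)%C)|]. rewrite Cmod_mult, Cmod_conj.
    apply Rmult_le_compat_l; [lra|]. apply H; lra.
Qed.

Lemma CI_bound f M a b : a <= b -> conts f a b ->
  (forall t, a <= t <= b -> Cmod (f t) <= M) -> Cmod (CI f a b) <= M * (b - a).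
Proof.
  intros Hab F H. replace (M * (b - a)) with (RInt (fun _ => M) a b).
  - apply CI_bound_fun; try assumption. apply ex_RInt_const.
  - rewrite RInt_const. unfold scal; simpl; unfold mult; simpl. ring.
Qed.

Definition rder (f : R -> C) (t : R) (l : C) : Prop :=
  is_derive (fun u => Re (f u)) t (Re l) /\ is_derive (fun u => Im (f u)) t (Im l).

Lemma rder_rcont f t l : rder f t l -> rcont f t.
Proof.
  intros [H1 H2]; split; apply (ex_derive_continuous (V := R_NormedModule)); eexists; eassumption.
Qed.

Lemma CI_deriv f f' a b : a <= b -> (forall t, a <= t <= b -> rder f t (f' t)) -> conts f' a b ->
  CI f' a b = (f b - f a)%C.
Proof.
  intros Hab D F. unfold CI. apply Ceq; simpl.
  - apply is_RInt_unique. apply (is_RInt_derive (V := R_CompleteNormedModule) (fun u => Re (f u)));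
    intros x Hx; rewrite Rmin_left, Rmax_right in Hx by lra; [apply D|apply F]; exact Hx.
  - apply is_RInt_unique. apply (is_RInt_derive (V := R_CompleteNormedModule) (fun u => Im (f u)));
    intros x Hx; rewrite Rmin_left, Rmax_right in Hx by lra; [apply D|apply F]; exact Hx.
Qed.

Lemma is_derive_eps (f : R -> R) x l :
  (forall eps, 0 < eps -> exists del, 0 < del /\ forall h, Rabs h < del -> Rabs (f (x + h) - f x - l * h) <= eps * Rabs h) ->
  is_derive f x l.
Proof.
  intros H. split; [apply is_linear_scal_l|]. intros y Hy eps.
  assert (y = x) as ->.
  { symmetry. apply (is_filter_lim_locally_unique (V := R_NormedModule)). exact Hy. }
  destruct (H eps (cond_pos eps)) as [d [Hd0 Hd]].
  exists (mkposreal d Hd0). intros z Hz.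
  change (Rabs (z - x) < d) in Hz. specialize (Hd _ Hz).
  assert (E : forall x z : R, x + (z - x) = z) by (intros; ring). rewrite E in Hd.
  change (Rabs ((f z - f x) - (z - x) * l) <= eps * Rabs (z - x)).
  rewrite (Rmult_comm _ l). exact Hd.
Qed.

Lemma rder_eps f t l :
  (forall eps, 0 < eps -> exists del, 0 < del /\ forall h, Rabs h < del -> Cmod (f (t + h)%R - f t - l * RtoC h)%C <= eps * Rabs h) ->
  rder f t l.
Proof.
  intros H; split; apply is_derive_eps; intros eps He; destruct (H eps He) as [d [Hd Hd']];
  exists d; (split; [assumption|]); intros h Hh; specialize (Hd' h Hh);
  (eapply Rle_trans; [|exact Hd']).
  - eapply Rle_trans; [|apply re_le_Cmod]. right. f_equal. csimp. ring.
  - eapply Rle_trans; [|apply im_le_Cmod]. right. f_equal. csimp. ring.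
Qed.

Lemma cder_rder f (p q : C) t l :
  cder f (p + RtoC t * q)%C l -> rder (fun u => f (p + RtoC u * q)%C) t (l * q).
Proof.
  intros H. apply rder_eps. intros eps He.
  assert (K : 0 < 1 + Cmod q) by (generalize (Cmod_ge_0 q); lra).
  destruct (H (eps / (1 + Cmod q))) as [d [Hd Hd']]; [apply Rdiv_lt_0_compat; assumption|].
  exists (d / (1 + Cmod q)). split; [apply Rdiv_lt_0_compat; assumption|]. intros h Hh.
  assert (L : Cmod (RtoC h * q)%C <= Rabs h * (1 + Cmod q)).
  { rewrite Cmod_mult, Cmod_R. apply Rmult_le_compat_l; [apply Rabs_pos|lra]. }
  assert (L2 : Rabs h * (1 + Cmod q) < d).
  { apply Rmult_lt_compat_r with (r := 1 + Cmod q) in Hh; [|assumption].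
    replace (d / (1 + Cmod q) * (1 + Cmod q)) with d in Hh by (field; lra). exact Hh. }
  specialize (Hd' (RtoC h * q)%C ltac:(lra)).
  replace (p + RtoC (t + h) * q)%C with (p + RtoC t * q + RtoC h * q)%C by (rewrite RtoC_plus; ring).
  replace (l * q * RtoC h)%C with (l * (RtoC h * q))%C by ring.
  eapply Rle_trans; [exact Hd'|].
  apply Rle_trans with (eps / (1 + Cmod q) * (Rabs h * (1 + Cmod q))).
  { apply Rmult_le_compat_l; [apply Rlt_le, Rdiv_lt_0_compat; assumption|exact L]. }
  right. field. lra.
Qed.

Lemma cder_rder_hor f (t y : R) l : cder f (t, y) l -> rder (fun u => f (u, y)) t l.
Proof.
  intros H. assert (A : cder f ((0, y) + RtoC t * 1)%C l).
  { replace ((0, y) + RtoC t * 1)%C with ((t, y) : C); [exact H|]. apply Ceq; csimp; ring. }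
  apply cder_rder in A. rewrite Cmult_1_r in A. destruct A as [A1 A2]. split.
  - eapply is_derive_ext; [|exact A1]. intros u; simpl. do 2 f_equal. apply Ceq; csimp; ring.
  - eapply is_derive_ext; [|exact A2]. intros u; simpl. do 2 f_equal. apply Ceq; csimp; ring.
Qed.

Lemma cder_rder_ver f (x t : R) l : cder f (x, t) l -> rder (fun u => f (x, u)) t (Ci * l).
Proof.
  intros H. assert (A : cder f ((x, 0) + RtoC t * Ci)%C l).
  { replace ((x, 0) + RtoC t * Ci)%C with ((x, t) : C); [exact H|]. apply Ceq; csimp; ring. }
  apply cder_rder in A. rewrite (Cmult_comm l) in A. destruct A as [A1 A2]. split.
  - eapply is_derive_ext; [|exact A1]. intros u; simpl. do 2 f_equal. apply Ceq; csimp; ring.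
  - eapply is_derive_ext; [|exact A2]. intros u; simpl. do 2 f_equal. apply Ceq; csimp; ring.
Qed.

Lemma rder_Cexp_lin (w : C) t : rder (fun u => Cexp (RtoC u * w)) t (w * Cexp (RtoC t * w)).
Proof.
  split; unfold Cexp; destruct w as [a b]; csimp.
  - auto_derive; [auto|]. unfold Rminus; ring.
  - auto_derive; [auto|]. unfold Rminus; ring.
Qed.

(** The difference is the integral over [0 <= u <= 1] of the derivative [w e ^ (u w)]. *)
Lemma Cexp_sub1_bound (w : C) : Cmod (Cexp w - 1)%C <= Cmod w * exp (Cmod w).
Proof.
  assert (E := CI_deriv (fun u => Cexp (RtoC u * w)) (fun u => w * Cexp (RtoC u * w))%C 0 1 ltac:(lra)
     (fun t _ => rder_Cexp_lin w t)).
  cbv beta in E. replace (1%R * w)%C with w in E by ring. replace (0%R * w)%C with (RtoC 0) in E by ring.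
  rewrite Cexp_0 in E.
  assert (F : conts (fun u => w * Cexp (RtoC u * w))%C 0 1).
  { intros t _. apply rcont_mult; [apply rcont_const|]. eapply rder_rcont, rder_Cexp_lin. }
  rewrite <- E by exact F.
  eapply Rle_trans; [apply (CI_bound _ (Cmod w * exp (Cmod w))); [lra|exact F|]|lra].
  intros t Ht. rewrite Cmod_mult, Cmod_Cexp. apply Rmult_le_compat_l; [apply Cmod_ge_0|].
  assert (Re (RtoC t * w) <= Cmod w).
  { replace (Re (RtoC t * w)) with (t * Re w) by (destruct w; csimp; ring).
    generalize (re_le_Cmod w) (Rle_abs (Re w)) (Cmod_ge_0 w) (Rabs_pos (Re w)). nra. }
  destruct H as [H|H]; [left; apply exp_increasing; exact H|rewrite H; lra].
Qed.

(** The same argument once more: the integrand is now [w (e ^ (u w) - 1)], bounded by the previous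
    lemma. *)
Lemma Cexp_sub2_bound (w : C) : Cmod (Cexp w - 1 - w)%C <= Cmod w ^ 2 * exp (Cmod w).
Proof.
  assert (D : forall t, 0 <= t <= 1 -> rder (fun u => Cexp (RtoC u * w) - RtoC u * w)%C t (w * (Cexp (RtoC t * w) - 1))%C).
  { intros t _. split; unfold Cexp; destruct w as [a b]; csimp; auto_derive; auto; unfold Rminus; ring. }
  assert (E := CI_deriv _ _ 0 1 ltac:(lra) D). cbv beta in E.
  cbv beta in E. replace (1%R * w)%C with w in E by ring. replace (0%R * w)%C with (RtoC 0) in E by ring.
  rewrite Cexp_0 in E.
  assert (F : conts (fun u => w * (Cexp (RtoC u * w) - 1))%C 0 1).
  { intros t _. apply rcont_mult; [apply rcont_const|]. apply rcont_minus; [|apply rcont_const]. eapply rder_rcont, rder_Cexp_lin. }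
  replace (Cexp w - 1 - w)%C with (Cexp w - w - (1 - 0))%C by ring.
  rewrite <- E by exact F.
  eapply Rle_trans; [apply (CI_bound _ (Cmod w ^ 2 * exp (Cmod w))); [lra|exact F|]|lra].
  intros t Ht. rewrite Cmod_mult.
  replace (Cmod w ^ 2 * exp (Cmod w)) with (Cmod w * (Cmod w * exp (Cmod w))) by ring.
  apply Rmult_le_compat_l; [apply Cmod_ge_0|].
  eapply Rle_trans; [apply Cexp_sub1_bound|].
  assert (Cmod (RtoC t * w) <= Cmod w).
  { rewrite Cmod_mult, Cmod_R, Rabs_pos_eq by lra. generalize (Cmod_ge_0 w). nra. }
  apply Rmult_le_compat; try apply Cmod_ge_0; [left; apply exp_pos|assumption|].
  destruct H as [H|H]; [left; apply exp_increasing; exact H|rewrite H; lra].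
Qed.

Lemma cder_Cexp z : cder Cexp z (Cexp z).
Proof.
  intros eps He.
  set (A := Cmod (Cexp z) * exp 1).
  assert (A0 : 0 < A) by (apply Rmult_lt_0_compat; [apply Cmod_gt_0, Cexp_neq0|apply exp_pos]).
  exists (Rmin 1 (eps / A)). split; [apply Rmin_pos; [lra|apply Rdiv_lt_0_compat; lra]|].
  intros h Hh.
  assert (Hh1 := Rlt_le_trans _ _ _ Hh (Rmin_l _ _)).
  assert (Hh2 := Rlt_le_trans _ _ _ Hh (Rmin_r _ _)).
  rewrite Cexp_plus. replace (Cexp z * Cexp h - Cexp z - Cexp z * h)%C with (Cexp z * (Cexp h - 1 - h))%C by ring.
  rewrite Cmod_mult.
  assert (B := Cexp_sub2_bound h).
  assert (exp (Cmod h) <= exp 1) by (left; apply exp_increasing; lra).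
  assert (P := Cmod_ge_0 h).
  assert (Cmod h ^ 2 * exp (Cmod h) <= Cmod h ^ 2 * exp 1) by (apply Rmult_le_compat_l; [nra|assumption]).
  apply Rle_trans with (Cmod (Cexp z) * (Cmod h ^ 2 * exp 1)).
  { apply Rmult_le_compat_l; [apply Cmod_ge_0|lra]. }
  replace (Cmod (Cexp z) * (Cmod h ^ 2 * exp 1)) with (A * Cmod h * Cmod h) by (unfold A; ring).
  apply Rmult_le_compat_r; [exact P|].
  apply Rmult_lt_compat_l with (r := A) in Hh2; [|exact A0].
  replace (A * (eps / A)) with eps in Hh2 by (field; lra). lra.
Qed.

Lemma hol_Cexp f z : hol f z -> hol (fun w => Cexp (f w)) z.
Proof. intros H. apply (hol_comp f Cexp); [exact H|]. eexists; apply cder_Cexp. Qed.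

(** * Goursat's theorem on rectangles *)

Lemma pow2_small eps W : 0 < eps -> exists N, forall n, (N <= n)%nat -> W / 2 ^ n < eps.
Proof.
  intros He.
  assert (L : is_lim_seq (fun n => W * (/2) ^ n) (W * 0)).
  { apply (is_lim_seq_scal_l _ W 0). apply is_lim_seq_geom. rewrite Rabs_pos_eq; lra. }
  apply is_lim_seq_spec in L. destruct (L (mkposreal eps He)) as [N HN].
  exists N. intros n Hn. specialize (HN n Hn). simpl in HN.
  replace (W / 2 ^ n) with (W * (/2) ^ n - W * 0).
  - eapply Rle_lt_trans; [apply Rle_abs|exact HN].
  - rewrite pow_inv. unfold Rdiv. ring.
Qed.

(** Compactness by bisection. If [P] failed on the whole rectangle, repeated quartering would give
    nested rectangles on which it fails, shrinking to a point; the local hypothesis at that point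
    contradicts this. *)
Lemma cousin2 (P : R -> R -> R -> R -> Prop) X1 X2 Y1 Y2 :
  X1 <= X2 -> Y1 <= Y2 ->
  (forall x1 x2 y1 y2, X1 <= x1 -> x1 <= x2 -> x2 <= X2 -> Y1 <= y1 -> y1 <= y2 -> y2 <= Y2 ->
     P x1 ((x1+x2)/2) y1 ((y1+y2)/2) -> P ((x1+x2)/2) x2 y1 ((y1+y2)/2) ->
     P x1 ((x1+x2)/2) ((y1+y2)/2) y2 -> P ((x1+x2)/2) x2 ((y1+y2)/2) y2 -> P x1 x2 y1 y2) ->
  (forall px py, X1 <= px <= X2 -> Y1 <= py <= Y2 -> exists del, 0 < del /\
     forall x1 x2 y1 y2, X1 <= x1 <= px -> px <= x2 <= X2 -> Y1 <= y1 <= py -> py <= y2 <= Y2 ->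
     x2 - x1 < del -> y2 - y1 < del -> P x1 x2 y1 y2) ->
  P X1 X2 Y1 Y2.
Proof.
  intros HX HY Hadd Hloc.
  destruct (excluded_middle_informative (P X1 X2 Y1 Y2)) as [H|Hbad]; [exact H|exfalso].
  (* Selects a quarter on which [P] fails. The fourth quarter is the default when the other three
     satisfy [P]; it is then a bad one because of [Hadd]. *)
  set (step := fun r : (R * R) * (R * R) =>
    let '((x1, x2), (y1, y2)) := r in
    let xm := (x1 + x2) / 2 in let ym := (y1 + y2) / 2 in
    if excluded_middle_informative (P x1 xm y1 ym) then
    if excluded_middle_informative (P xm x2 y1 ym) then
    if excluded_middle_informative (P x1 xm ym y2) then ((xm, x2), (ym, y2))
    else ((x1, xm), (ym, y2)) else ((xm, x2), (y1, ym)) else ((x1, xm), (y1, ym))).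
  set (q := fun n => Nat.iter n step ((X1, X2), (Y1, Y2))).
  set (a := fun n => fst (fst (q n))). set (b := fun n => snd (fst (q n))).
  set (c := fun n => fst (snd (q n))). set (d := fun n => snd (snd (q n))).
  assert (Inv : forall n, X1 <= a n /\ a n <= b n /\ b n <= X2 /\ Y1 <= c n /\ c n <= d n /\ d n <= Y2
      /\ b n - a n = (X2 - X1) / 2 ^ n /\ d n - c n = (Y2 - Y1) / 2 ^ n /\ ~ P (a n) (b n) (c n) (d n)
      /\ a n <= a (S n) /\ b (S n) <= b n /\ c n <= c (S n) /\ d (S n) <= d n).
  { assert (St : forall n, X1 <= a n -> a n <= b n -> b n <= X2 -> Y1 <= c n -> c n <= d n -> d n <= Y2 ->
       ~ P (a n) (b n) (c n) (d n) ->
       (~ P (a (S n)) (b (S n)) (c (S n)) (d (S n))) /\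
       ((a (S n) = a n /\ b (S n) = (a n + b n)/2) \/ (a (S n) = (a n + b n)/2 /\ b (S n) = b n)) /\
       ((c (S n) = c n /\ d (S n) = (c n + d n)/2) \/ (c (S n) = (c n + d n)/2 /\ d (S n) = d n))).
    { intros n. unfold a, b, c, d. change (q (S n)) with (step (q n)).
      destruct (q n) as [[x1 x2] [y1 y2]]. cbn [fst snd]. intros.
      unfold step. cbv zeta.
      repeat (destruct excluded_middle_informative; cbn [fst snd]); try (repeat split; tauto).
      split; [|repeat split; tauto]. intros K. apply H5. apply Hadd; assumption. }
    assert (Base : forall n, X1 <= a n /\ a n <= b n /\ b n <= X2 /\ Y1 <= c n /\ c n <= d n /\ d n <= Y2
      /\ b n - a n = (X2 - X1) / 2 ^ n /\ d n - c n = (Y2 - Y1) / 2 ^ n /\ ~ P (a n) (b n) (c n) (d n)).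
    { induction n as [|n IH].
      - unfold a, b, c, d, q; simpl. repeat split; try lra. exact Hbad.
      - destruct IH as (I1 & I2 & I3 & I4 & I5 & I6 & I7 & I8 & I9).
        destruct (St n I1 I2 I3 I4 I5 I6 I9) as (S1 & S2 & S3).
        assert (Ex : forall W, W / 2 ^ S n = W / 2 ^ n / 2).
        { intros W. simpl. field. apply pow_nonzero. lra. }
        rewrite !Ex, <- I7, <- I8.
        repeat split; try assumption; destruct S2 as [[? ?]|[? ?]]; destruct S3 as [[? ?]|[? ?]]; lra. }
    intros n. destruct (Base n) as (I1 & I2 & I3 & I4 & I5 & I6 & I7 & I8 & I9).
    destruct (St n I1 I2 I3 I4 I5 I6 I9) as (S1 & S2 & S3).
    repeat split; try assumption; destruct S2 as [[? ?]|[? ?]]; destruct S3 as [[? ?]|[? ?]]; lra. }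
  assert (Lx : forall W, is_lim_seq (fun n => W / 2 ^ n) 0).
  { intros W. replace (Finite 0) with (Finite (W * 0)) by (f_equal; ring).
    apply is_lim_seq_ext with (fun n => W * (/2) ^ n).
    { intros n. rewrite pow_inv. reflexivity. }
    apply (is_lim_seq_scal_l _ W 0). apply is_lim_seq_geom. rewrite Rabs_pos_eq; lra. }
  assert (Adj : forall u v : nat -> R, (forall n, u n <= u (S n)) -> (forall n, v (S n) <= v n) ->
     (exists W, forall n, v n - u n = W / 2 ^ n) -> exists p, forall n, u n <= p <= v n).
  { intros u v Hu Hv [W Hw].
    destruct (ex_lim_seq_adj u v Hu Hv) as ([l1 L1] & [l2 L2] & E).
    { apply is_lim_seq_ext with (fun n => W / 2 ^ n); [intros; symmetry; apply Hw|apply Lx]. }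
    rewrite (is_lim_seq_unique _ _ L1), (is_lim_seq_unique _ _ L2) in E. injection E as E. subst l2.
    exists l1. intros n. split.
    - apply (is_lim_seq_incr_compare u l1 L1 Hu).
    - apply (is_lim_seq_decr_compare v l1 L2 Hv). }
  destruct (Adj a b) as [px Hpx]; [apply Inv|apply Inv|exists (X2 - X1); apply Inv|].
  destruct (Adj c d) as [py Hpy]; [apply Inv|apply Inv|exists (Y2 - Y1); apply Inv|].
  destruct (Hloc px py) as [del [Hdel HP]].
  { generalize (Hpx O) (Inv O). lra. }
  { generalize (Hpy O) (Inv O). lra. }
  destruct (pow2_small del (X2 - X1) Hdel) as [N1 HN1].
  destruct (pow2_small del (Y2 - Y1) Hdel) as [N2 HN2].
  set (n := (N1 + N2)%nat).
  destruct (Inv n) as (I1 & I2 & I3 & I4 & I5 & I6 & I7 & I8 & I9 & _).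
  apply I9. apply HP; try (split; try assumption; apply Hpx || apply Hpy).
  - generalize (HN1 n ltac:(unfold n; lia)); lra.
  - generalize (HN2 n ltac:(unfold n; lia)); lra.
Qed.

(** Counterclockwise contour integral: the top and left sides are run backwards, hence the minus
    signs, and vertical sides carry [dw = i dv]. *)
Definition bdr (f : C -> C) (x1 x2 y1 y2 : R) : C :=
  (CI (fun u => f (u, y1)) x1 x2 + Ci * CI (fun v => f (x2, v)) y1 y2
   - CI (fun u => f (u, y2)) x1 x2 - Ci * CI (fun v => f (x1, v)) y1 y2)%C.

Definition bcont (f : C -> C) (x1 x2 y1 y2 : R) : Prop :=
  conts (fun u => f (u, y1)) x1 x2 /\ conts (fun v => f (x2, v)) y1 y2 /\
  conts (fun u => f (u, y2)) x1 x2 /\ conts (fun v => f (x1, v)) y1 y2.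

Definition rcontin (f : C -> C) (x1 x2 y1 y2 : R) : Prop :=
  forall x y, x1 <= x <= x2 -> y1 <= y <= y2 -> ccont f (x, y).

Definition onbd (x1 x2 y1 y2 : R) (w : C) : Prop :=
  (x1 <= Re w <= x2 /\ (Im w = y1 \/ Im w = y2)) \/ (y1 <= Im w <= y2 /\ (Re w = x1 \/ Re w = x2)).

Lemma conts_hor f y a b : (forall x, a <= x <= b -> ccont f (x, y)) -> conts (fun u => f (u, y)) a b.
Proof. intros H t Ht. apply (rcont_comp f (fun u => (u, y) : C)); [apply H, Ht|apply rcont_hor]. Qed.

Lemma conts_ver f x a b : (forall y, a <= y <= b -> ccont f (x, y)) -> conts (fun v => f (x, v)) a b.
Proof. intros H t Ht. apply (rcont_comp f (fun u => (x, u) : C)); [apply H, Ht|apply rcont_ver]. Qed.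

Lemma rcontin_bcont f x1 x2 y1 y2 : x1 <= x2 -> y1 <= y2 -> rcontin f x1 x2 y1 y2 -> bcont f x1 x2 y1 y2.
Proof.
  intros Hx Hy H. split; [|split; [|split]]; (apply conts_hor || apply conts_ver); intros; apply H; lra.
Qed.

Lemma rcontin_sub f x1 x2 y1 y2 x1' x2' y1' y2' :
  x1 <= x1' -> x2' <= x2 -> y1 <= y1' -> y2' <= y2 -> rcontin f x1 x2 y1 y2 -> rcontin f x1' x2' y1' y2'.
Proof. intros ? ? ? ? H x y Hx Hy. apply H; lra. Qed.

Lemma bdr_split_x f x1 xm x2 y1 y2 : x1 <= xm <= x2 -> y1 <= y2 -> rcontin f x1 x2 y1 y2 ->
  bdr f x1 x2 y1 y2 = (bdr f x1 xm y1 y2 + bdr f xm x2 y1 y2)%C.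
Proof.
  intros Hx Hy H. unfold bdr.
  rewrite <- (CI_Chasles (fun u => f (u, y1)) x1 xm x2), <- (CI_Chasles (fun u => f (u, y2)) x1 xm x2);
   try lra; try (apply conts_hor; intros; apply H; lra). ring.
Qed.

Lemma bdr_split_y f x1 x2 y1 ym y2 : x1 <= x2 -> y1 <= ym <= y2 -> rcontin f x1 x2 y1 y2 ->
  bdr f x1 x2 y1 y2 = (bdr f x1 x2 y1 ym + bdr f x1 x2 ym y2)%C.
Proof.
  intros Hx Hy H. unfold bdr.
  rewrite <- (CI_Chasles (fun v => f (x1, v)) y1 ym y2), <- (CI_Chasles (fun v => f (x2, v)) y1 ym y2);
   try lra; try (apply conts_ver; intros; apply H; lra). ring.
Qed.

Lemma bdr_ext f g x1 x2 y1 y2 : x1 <= x2 -> y1 <= y2 ->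
  (forall w, onbd x1 x2 y1 y2 w -> f w = g w) -> bdr f x1 x2 y1 y2 = bdr g x1 x2 y1 y2.
Proof.
  intros Hx Hy H. unfold bdr.
  rewrite (CI_ext (fun u => f (u, y1)) (fun u => g (u, y1))), (CI_ext (fun u => f (u, y2)) (fun u => g (u, y2))),
    (CI_ext (fun v => f (x1, v)) (fun v => g (x1, v))), (CI_ext (fun v => f (x2, v)) (fun v => g (x2, v)));
  try reflexivity; try assumption; intros t Ht; apply H; unfold onbd; simpl; auto.
Qed.

Lemma bdr_plus f g x1 x2 y1 y2 : x1 <= x2 -> y1 <= y2 -> bcont f x1 x2 y1 y2 -> bcont g x1 x2 y1 y2 ->
  bdr (fun w => f w + g w)%C x1 x2 y1 y2 = (bdr f x1 x2 y1 y2 + bdr g x1 x2 y1 y2)%C.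
Proof.
  intros Hx Hy (F1 & F2 & F3 & F4) (G1 & G2 & G3 & G4). unfold bdr. rewrite !CI_plus by assumption. ring.
Qed.

Lemma bdr_scal c f x1 x2 y1 y2 : x1 <= x2 -> y1 <= y2 -> bcont f x1 x2 y1 y2 ->
  bdr (fun w => c * f w)%C x1 x2 y1 y2 = (c * bdr f x1 x2 y1 y2)%C.
Proof.
  intros Hx Hy (F1 & F2 & F3 & F4). unfold bdr. rewrite !CI_scal by assumption. ring.
Qed.

Lemma conts_plus f g a b : conts f a b -> conts g a b -> conts (fun t => f t + g t)%C a b.
Proof. intros F G t Ht. apply (rcont_plus f g); auto. Qed.

Lemma conts_mult f g a b : conts f a b -> conts g a b -> conts (fun t => f t * g t)%C a b.
Proof. intros F G t Ht. apply (rcont_mult f g); auto. Qed.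

Lemma conts_const c a b : conts (fun _ => c) a b.
Proof. intros t _. apply rcont_const. Qed.

Lemma bcont_plus f g x1 x2 y1 y2 : bcont f x1 x2 y1 y2 -> bcont g x1 x2 y1 y2 -> bcont (fun w => f w + g w)%C x1 x2 y1 y2.
Proof.
  intros (F1 & F2 & F3 & F4) (G1 & G2 & G3 & G4). exact (conj (conts_plus _ _ _ _ F1 G1) (conj (conts_plus _ _ _ _ F2 G2) (conj (conts_plus _ _ _ _ F3 G3) (conts_plus _ _ _ _ F4 G4)))).
Qed.

Lemma bcont_mult f g x1 x2 y1 y2 : bcont f x1 x2 y1 y2 -> bcont g x1 x2 y1 y2 -> bcont (fun w => f w * g w)%C x1 x2 y1 y2.
Proof.
  intros (F1 & F2 & F3 & F4) (G1 & G2 & G3 & G4). exact (conj (conts_mult _ _ _ _ F1 G1) (conj (conts_mult _ _ _ _ F2 G2) (conj (conts_mult _ _ _ _ F3 G3) (conts_mult _ _ _ _ F4 G4)))).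
Qed.

Lemma bcont_const c x1 x2 y1 y2 : bcont (fun _ => c) x1 x2 y1 y2.
Proof. split; [|split; [|split]]; apply conts_const. Qed.

Lemma bdr_minus f g x1 x2 y1 y2 : x1 <= x2 -> y1 <= y2 -> bcont f x1 x2 y1 y2 -> bcont g x1 x2 y1 y2 ->
  bdr (fun w => f w - g w)%C x1 x2 y1 y2 = (bdr f x1 x2 y1 y2 - bdr g x1 x2 y1 y2)%C.
Proof.
  intros Hx Hy F G.
  rewrite (bdr_ext _ (fun w => f w + (-1) * g w)%C) by (auto; intros; ring).
  rewrite bdr_plus, bdr_scal; try assumption; [ring|]. apply bcont_mult; [apply bcont_const|assumption].
Qed.

Lemma bdr_bound f M x1 x2 y1 y2 : x1 <= x2 -> y1 <= y2 -> bcont f x1 x2 y1 y2 ->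
  (forall w, onbd x1 x2 y1 y2 w -> Cmod (f w) <= M) ->
  Cmod (bdr f x1 x2 y1 y2) <= 2 * M * ((x2 - x1) + (y2 - y1)).
Proof.
  intros Hx Hy (F1 & F2 & F3 & F4) H. unfold bdr.
  eapply Rle_trans; [apply Cmod_tri_minus|].
  eapply Rle_trans; [apply Rplus_le_compat_r, Cmod_tri_minus|].
  eapply Rle_trans; [apply Rplus_le_compat_r, Rplus_le_compat_r, Cmod_triangle|].
  rewrite !Cmod_mult, Cmod_Ci.
  assert (Cmod (CI (fun u : R => f (u, y1)) x1 x2) <= M * (x2 - x1)).
  { apply CI_bound; try assumption. intros; apply H; unfold onbd; simpl; auto. }
  assert (Cmod (CI (fun u : R => f (u, y2)) x1 x2) <= M * (x2 - x1)).
  { apply CI_bound; try assumption. intros; apply H; unfold onbd; simpl; auto. }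
  assert (Cmod (CI (fun u : R => f (x1, u)) y1 y2) <= M * (y2 - y1)).
  { apply CI_bound; try assumption. intros; apply H; unfold onbd; simpl; auto. }
  assert (Cmod (CI (fun u : R => f (x2, u)) y1 y2) <= M * (y2 - y1)).
  { apply CI_bound; try assumption. intros; apply H; unfold onbd; simpl; auto. }
  lra.
Qed.

Lemma bdr_primitive F f x1 x2 y1 y2 : x1 <= x2 -> y1 <= y2 -> bcont f x1 x2 y1 y2 ->
  (forall w, onbd x1 x2 y1 y2 w -> cder F w (f w)) -> bdr f x1 x2 y1 y2 = 0%C.
Proof.
  intros Hx Hy (F1 & F2 & F3 & F4) H. unfold bdr.
  assert (E1 : forall y, (y = y1 \/ y = y2) -> conts (fun u => f (u, y)) x1 x2 -> CI (fun u => f (u, y)) x1 x2 = (F (x2, y) - F (x1, y))%C).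
  { intros y Hy' K. apply (CI_deriv (fun u => F (u, y))); try assumption. intros t Ht. apply cder_rder_hor, H. left; simpl; auto. }
  assert (E2 : forall x, (x = x1 \/ x = x2) -> conts (fun u => f (x, u)) y1 y2 -> (Ci * CI (fun u => f (x, u)) y1 y2)%C = (F (x, y2) - F (x, y1))%C).
  { intros x Hx' K. rewrite <- CI_scal by assumption. apply (CI_deriv (fun u => F (x, u)) (fun u => Ci * f (x, u))%C); try assumption.
    - intros t Ht. apply cder_rder_ver, H. right; simpl; auto.
    - intros t Ht. apply rcont_mult; [apply rcont_const|auto]. }
  rewrite !E1, !E2 by auto. ring.
Qed.

(** Near a point [f] is affine up to [eps |w - p|], and an affine function has a primitive, so a
    small rectangle contributes at most [eps] times the square of its semiperimeter. This bound
    passes from four quarters to the whole, because quartering halves the semiperimeter. *)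
Theorem goursat f x1 x2 y1 y2 : x1 <= x2 -> y1 <= y2 ->
  (forall x y, x1 <= x <= x2 -> y1 <= y <= y2 -> hol f (x, y)) -> bdr f x1 x2 y1 y2 = 0%C.
Proof.
  intros Hx Hy H.
  assert (HC : rcontin f x1 x2 y1 y2) by (intros x y ? ?; apply hol_ccont, H; assumption).
  assert (Main : forall eps, 0 < eps -> Cmod (bdr f x1 x2 y1 y2) <= eps * ((x2 - x1) + (y2 - y1)) ^ 2).
  { intros eps He.
    apply (cousin2 (fun a b c d => Cmod (bdr f a b c d) <= eps * ((b - a) + (d - c)) ^ 2)); try assumption.
    - intros a b c d ? ? ? ? ? ? Q1 Q2 Q3 Q4.
      assert (K : rcontin f a b c d) by (eapply rcontin_sub; [..|exact HC]; assumption).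
      rewrite (bdr_split_x f a ((a+b)/2) b c d) by (lra || assumption).
      rewrite (bdr_split_y f a ((a+b)/2) c ((c+d)/2) d), (bdr_split_y f ((a+b)/2) b c ((c+d)/2) d); try lra;
       try (eapply rcontin_sub; [..|exact K]; lra).
      eapply Rle_trans; [apply Cmod_triangle|].
      eapply Rle_trans; [apply Rplus_le_compat; apply Cmod_triangle|].
      replace (eps * (b - a + (d - c)) ^ 2) with (4 * (eps * ((b - a)/2 + (d - c)/2) ^ 2)) by field.
      replace ((a + b)/2 - a) with ((b - a)/2) in * by field. replace (b - (a + b)/2) with ((b - a)/2) in * by field.
      replace ((c + d)/2 - c) with ((d - c)/2) in * by field. replace (d - (c + d)/2) with ((d - c)/2) in * by field.
      lra.
    - intros px py Hpx Hpy. destruct (H px py Hpx Hpy) as [l Hl].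
      destruct (Hl (eps / 2)) as [del [Hdel Hd]]; [lra|].
      exists (del / 2). split; [lra|]. intros a b c d ? ? ? ? ? ?.
      set (p := (px, py) : C) in *.
      assert (K : rcontin f a b c d) by (eapply rcontin_sub; [..|exact HC]; lra).
      set (g := fun w => (f p + l * (w - p))%C).
      assert (G : forall w, cder (fun w => f p * w + l * (w * w * / 2 - p * w))%C w (g w)).
      { intros w. unfold g.
        replace (f p + l * (w - p))%C with (f p * 1 + l * (((1 * w + w * 1) * / 2 + (w * w) * 0) - p * 1))%C.
        2: { replace (1 * w + w * 1)%C with (2 * w)%C by ring. field. }
        apply cder_plus; [apply cder_scal, cder_id|]. apply cder_scal. apply cder_minus; [|apply cder_scal, cder_id].
        apply (cder_mult (fun w => w * w)%C (fun _ => / 2)%C); [|apply cder_const].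
        apply (cder_mult (fun w => w) (fun w => w)); apply cder_id. }
      assert (Gc : bcont g a b c d).
      { apply rcontin_bcont; try lra. intros x y _ _. apply hol_ccont. unfold g.
        apply hol_plus; [apply hol_const|]. apply (hol_mult (fun _ => l)); [apply hol_const|]. apply hol_minus; [apply hol_id|apply hol_const]. }
      assert (Fc : bcont f a b c d) by (apply rcontin_bcont; try lra; assumption).
      assert (Z : bdr g a b c d = 0%C).
      { eapply bdr_primitive; try lra; try assumption. intros w _. apply G. }
      replace (bdr f a b c d) with (bdr (fun w => f w - g w)%C a b c d).
      2: { rewrite bdr_minus by (assumption || lra). rewrite Z. ring. }
      eapply Rle_trans.
      { apply (bdr_bound _ (eps / 2 * ((b - a) + (d - c)))); try lra.
        - apply (bcont_plus f (fun w => - g w)%C); [exact Fc|]. destruct Gc as (G1 & G2 & G3 & G4).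
          split; [|split; [|split]]; intros t Ht; apply rcont_opp; auto.
        - intros w Hw.
          assert (L : Cmod (w - p)%C <= (b - a) + (d - c)).
          { eapply Rle_trans; [apply Cmod_le_abs|]. destruct w as [u v]. unfold p. csimp. unfold onbd in Hw; simpl in Hw.
            apply Rplus_le_compat; apply Rabs_le; lra. }
          unfold g. replace (f w - (f p + l * (w - p)))%C with (f (p + (w - p)) - f p - l * (w - p))%C.
          2: { replace (p + (w - p))%C with w by ring. ring. }
          eapply Rle_trans; [apply Hd; lra|]. apply Rmult_le_compat_l; lra. }
      right. field. }
  apply Cmod_eq_0. apply Rle_antisym; [|apply Cmod_ge_0].
  set (W := ((x2 - x1) + (y2 - y1)) ^ 2) in *. assert (0 <= W) by apply pow2_ge_0.
  apply Rnot_lt_le. intros L.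
  specialize (Main (Cmod (bdr f x1 x2 y1 y2) / (2 * (W + 1)))).
  assert (0 < Cmod (bdr f x1 x2 y1 y2) / (2 * (W + 1))) by (apply Rdiv_lt_0_compat; lra).
  specialize (Main H1).
  assert (Cmod (bdr f x1 x2 y1 y2) / (2 * (W + 1)) * W <= Cmod (bdr f x1 x2 y1 y2) / 2).
  { replace (Cmod (bdr f x1 x2 y1 y2) / (2 * (W + 1)) * W) with (Cmod (bdr f x1 x2 y1 y2) / 2 * (W / (W + 1))) by (field; lra).
    rewrite <- (Rmult_1_r (Cmod (bdr f x1 x2 y1 y2) / 2)) at 2. apply Rmult_le_compat_l; [lra|].
    apply Rle_div_l; lra. }
  lra.
Qed.

Lemma le_eps0 x A : (forall eps, 0 < eps -> x <= A * eps) -> x <= 0.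
Proof.
  intros H. apply Rnot_lt_le. intros L.
  assert (P : 0 < Rabs A + 1) by (generalize (Rabs_pos A); lra).
  specialize (H (x / (2 * (Rabs A + 1)))).
  assert (0 < x / (2 * (Rabs A + 1))) by (apply Rdiv_lt_0_compat; lra).
  specialize (H H0).
  assert (A * (x / (2 * (Rabs A + 1))) <= (Rabs A + 1) * (x / (2 * (Rabs A + 1)))).
  { apply Rmult_le_compat_r; [lra|]. generalize (Rle_abs A); lra. }
  replace ((Rabs A + 1) * (x / (2 * (Rabs A + 1)))) with (x / 2) in H1 by (field; lra). lra.
Qed.

(* Continuity at the exceptional point suffices: a small square around it
   contributes little. *)
Theorem goursat_punctured f (px py x1 x2 y1 y2 : R) : x1 < px < x2 -> y1 < py < y2 ->
  rcontin f x1 x2 y1 y2 ->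
  (forall x y, x1 <= x <= x2 -> y1 <= y <= y2 -> (x, y) <> (px, py) -> hol f (x, y)) ->
  bdr f x1 x2 y1 y2 = 0%C.
Proof.
  intros Hx Hy HC H.
  destruct (HC px py ltac:(lra) ltac:(lra) 1 Rlt_0_1) as [d [Hd Hd']].
  set (M := Cmod (f (px, py)) + 1).
  set (e0 := Rmin (d / 2) (Rmin (Rmin (px - x1) (x2 - px)) (Rmin (py - y1) (y2 - py)))).
  assert (He0 : 0 < e0) by (unfold e0; repeat apply Rmin_pos; lra).
  assert (A0 : e0 <= d / 2) by (unfold e0; apply Rmin_l).
  assert (A1 : e0 <= px - x1 /\ e0 <= x2 - px /\ e0 <= py - y1 /\ e0 <= y2 - py).
  { unfold e0. repeat split; (eapply Rle_trans; [apply Rmin_r|]).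
    - eapply Rle_trans; [apply Rmin_l|apply Rmin_l].
    - eapply Rle_trans; [apply Rmin_l|apply Rmin_r].
    - eapply Rle_trans; [apply Rmin_r|apply Rmin_l].
    - eapply Rle_trans; [apply Rmin_r|apply Rmin_r]. }
  assert (Z : forall a b c e, x1 <= a -> a <= b -> b <= x2 -> y1 <= c -> c <= e -> e <= y2 ->
     (px < a \/ b < px \/ py < c \/ e < py) -> bdr f a b c e = 0%C).
  { intros a b c e ? ? ? ? ? ? Hout. apply goursat; try assumption. intros x y ? ?. apply H; try lra.
    intros E. injection E as -> ->. lra. }
  apply Cmod_eq_0, Rle_antisym; [|apply Cmod_ge_0].
  apply (le_eps0 _ (8 * M)). intros eps He.
  set (r := Rmin (eps) (e0 / 2)).
  assert (Hr : 0 < r) by (apply Rmin_pos; lra).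
  assert (Hr1 : r <= eps) by apply Rmin_l.
  assert (Hr2 : r <= e0 / 2) by apply Rmin_r.
  rewrite (bdr_split_x f x1 (px - r) x2 y1 y2) by (lra || assumption).
  rewrite (Z x1 (px - r)) by lra.
  rewrite (bdr_split_x f (px - r) (px + r) x2 y1 y2) by first [lra | (eapply rcontin_sub; [..|exact HC]); lra].
  rewrite (Z (px + r) x2) by lra.
  rewrite (bdr_split_y f (px - r) (px + r) y1 (py - r) y2) by first [lra | (eapply rcontin_sub; [..|exact HC]); lra].
  rewrite (Z (px - r) (px + r) y1 (py - r)) by lra.
  rewrite (bdr_split_y f (px - r) (px + r) (py - r) (py + r) y2) by first [lra | (eapply rcontin_sub; [..|exact HC]); lra].
  rewrite (Z (px - r) (px + r) (py + r) y2) by lra.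
  rewrite !Cplus_0_l, !Cplus_0_r.
  eapply Rle_trans.
  { apply (bdr_bound f M); try lra.
    - apply rcontin_bcont; try lra. eapply rcontin_sub; [..|exact HC]; lra.
    - intros w Hw. replace w with ((px, py) + (w - (px, py)))%C by ring.
      assert (L : Cmod (w - (px, py))%C < d).
      { eapply Rle_lt_trans; [apply Cmod_le_abs|]. destruct w as [u v]. csimp. unfold onbd in Hw; simpl in Hw.
        apply Rle_lt_trans with (r + r); [|lra]. apply Rplus_le_compat; apply Rabs_le; lra. }
      specialize (Hd' _ L).
      replace (f ((px, py) + (w - (px, py))))%C with ((f ((px, py) + (w - (px, py))) - f (px, py)) + f (px, py))%C by ring.
      eapply Rle_trans; [apply Cmod_triangle|]. unfold M. lra. }
  assert (0 < M) by (unfold M; generalize (Cmod_ge_0 (f (px, py))); lra).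
  nra.
Qed.

(** * Cauchy's formula and its consequences *)

Definition interior (x1 x2 y1 y2 : R) (p : C) : Prop := x1 < Re p < x2 /\ y1 < Im p < y2.

Lemma onbd_neq x1 x2 y1 y2 p w : interior x1 x2 y1 y2 p -> onbd x1 x2 y1 y2 w -> w <> p.
Proof. intros [H1 H2] Hw E. subst w. unfold onbd in Hw. lra. Qed.

Lemma Cminus_neq0 (a b : C) : a <> b -> (a - b)%C <> 0%C.
Proof. intros H E. apply H. replace a with ((a - b) + b)%C by ring. rewrite E. ring. Qed.

Lemma onbd_bcont f x1 x2 y1 y2 : x1 <= x2 -> y1 <= y2 ->
  (forall w, onbd x1 x2 y1 y2 w -> ccont f w) -> bcont f x1 x2 y1 y2.
Proof.
  intros Hx Hy H. split; [|split; [|split]].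
  - apply conts_hor; intros; apply H; left; simpl; auto.
  - apply conts_ver; intros; apply H; right; simpl; auto.
  - apply conts_hor; intros; apply H; left; simpl; auto.
  - apply conts_ver; intros; apply H; right; simpl; auto.
Qed.

Lemma bcont_inv x1 x2 y1 y2 p n : x1 <= x2 -> y1 <= y2 -> interior x1 x2 y1 y2 p ->
  bcont (fun w => / (w - p) ^ n)%C x1 x2 y1 y2.
Proof.
  intros Hx Hy Hp. apply onbd_bcont; try assumption. intros w Hw. apply hol_ccont.
  apply (hol_inv (fun w => (w - p) ^ n)%C).
  - apply (hol_pow (fun w => w - p)%C). apply hol_minus; [apply hol_id|apply hol_const].
  - apply Cpow_nz. apply Cminus_neq0, (onbd_neq _ _ _ _ _ _ Hp Hw).
Qed.

Lemma rcontin_hol f x1 x2 y1 y2 : (forall x y, x1 <= x <= x2 -> y1 <= y <= y2 -> hol f (x, y)) -> rcontin f x1 x2 y1 y2.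
Proof. intros H x y ? ?. apply hol_ccont, H; assumption. Qed.

(* Equal to [2 i pi]; only its being nonzero is needed, so it is never computed. *)
Definition polec (x1 x2 y1 y2 : R) (p : C) : C := bdr (fun w => / (w - p) ^ 1)%C x1 x2 y1 y2.

(** The difference quotient [q] of [f] at [p], completed by the derivative, is continuous and is
    holomorphic off [p], so its boundary integral vanishes. *)
Theorem cauchy_formula f x1 x2 y1 y2 p : interior x1 x2 y1 y2 p ->
  (forall x y, x1 <= x <= x2 -> y1 <= y <= y2 -> hol f (x, y)) ->
  bdr (fun w => f w * / (w - p) ^ 1)%C x1 x2 y1 y2 = (f p * polec x1 x2 y1 y2 p)%C.
Proof.
  intros Hp H. destruct p as [px py]. assert (Hp' := Hp). destruct Hp' as [P1 P2]. simpl in P1, P2.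
  set (p := (px, py) : C) in *.
  destruct (H px py) as [l Hl]; try lra. fold p in Hl.
  set (q := fun w : C => if excluded_middle_informative (w = p) then l else ((f w - f p) / (w - p))%C).
  assert (Q : forall w, w <> p -> q w = ((f w - f p) / (w - p))%C).
  { intros w Hw. unfold q. destruct excluded_middle_informative; [contradiction|reflexivity]. }
  assert (Qp : q p = l).
  { unfold q. destruct excluded_middle_informative; [reflexivity|contradiction]. }
  assert (Hq : forall x y, x1 <= x <= x2 -> y1 <= y <= y2 -> (x, y) <> (px, py) -> hol q (x, y)).
  { intros x y ? ? Hne.
    assert (Hpos : 0 < Cmod ((x, y) - p)%C) by (apply Cmod_gt_0, Cminus_neq0, Hne).
    apply (hol_ext_loc (fun w => (f w - f p) / (w - p))%C q _ _ Hpos).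
    - intros h Hh. symmetry. apply Q. intros E.
      assert (h = - ((x, y) - p))%C. { rewrite <- E. ring. }
      rewrite H2, Cmod_opp in Hh. lra.
    - apply hol_div; [apply hol_minus; [apply H; assumption|apply hol_const]|apply hol_minus; [apply hol_id|apply hol_const]|].
      apply Cminus_neq0, Hne. }
  assert (HCq : rcontin q x1 x2 y1 y2).
  { intros x y ? ?. destruct (excluded_middle_informative ((x, y) = p)) as [E|E].
    - rewrite E. intros eps He. destruct (Hl (eps / 2)) as [d [Hd Hd']]; [lra|].
      exists d. split; [exact Hd|]. intros h Hh. rewrite Qp.
      destruct (excluded_middle_informative (h = 0%C)) as [E0|E0].
      + rewrite E0, Cplus_0_r, Qp. replace (l - l)%C with (RtoC 0) by ring. rewrite Cmod_0. exact He.
      + rewrite Q.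
        2: { intros K. apply E0. replace h with ((p + h) - p)%C by ring. rewrite K. ring. }
        replace (p + h - p)%C with h by ring.
        replace ((f (p + h) - f p) / h - l)%C with ((f (p + h) - f p - l * h) / h)%C by (field; exact E0).
        rewrite Cmod_div by exact E0.
        specialize (Hd' h Hh). assert (m := proj1 (Cmod_gt_0 h) E0).
        apply Rle_lt_trans with (eps / 2); [|lra].
        apply Rle_div_l; assumption.
    - apply hol_ccont, Hq; assumption. }
  assert (Z : bdr q x1 x2 y1 y2 = 0%C).
  { apply (goursat_punctured q px py); try lra; assumption. }
  assert (Fb : bcont (fun w => f w * / (w - p) ^ 1)%C x1 x2 y1 y2).
  { apply bcont_mult.
    - apply rcontin_bcont; try lra. apply rcontin_hol, H.
    - apply bcont_inv; try lra. exact Hp. }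
  assert (Kb : bcont (fun w => / (w - p) ^ 1)%C x1 x2 y1 y2) by (apply bcont_inv; try lra; exact Hp).
  assert (E : bdr q x1 x2 y1 y2 = bdr (fun w => f w * / (w - p) ^ 1 - f p * / (w - p)^1)%C x1 x2 y1 y2).
  { apply bdr_ext; try lra. intros w Hw. rewrite Q by (apply (onbd_neq _ _ _ _ _ _ Hp Hw)).
    rewrite Cpow_1_r. field. apply Cminus_neq0, (onbd_neq _ _ _ _ _ _ Hp Hw). }
  rewrite Z in E. rewrite bdr_minus, bdr_scal in E; try lra; try assumption.
  2: { apply bcont_mult; [apply bcont_const|exact Kb]. }
  unfold polec.
  match type of E with (_ = ?a - ?b)%C => replace a with ((a - b) + b)%C by ring end.
  rewrite <- E. ring.
Qed.

Lemma sumsq_pos a b : a <> 0 \/ b <> 0 -> 0 < a ^ 2 + b ^ 2.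
Proof.
  intros [H|H]; apply Rsqr_pos_lt in H; unfold Rsqr in H;
  generalize (pow2_ge_0 a) (pow2_ge_0 b); simpl; lra.
Qed.

(** Each of the four sides gives a positive contribution, since along a side the relevant component
    of [1 / (w - p)] has constant sign. *)
Lemma polec_im_pos x1 x2 y1 y2 p : interior x1 x2 y1 y2 p -> 0 < Im (polec x1 x2 y1 y2 p).
Proof.
  intros Hp. assert (B := bcont_inv x1 x2 y1 y2 p 1 ltac:(destruct Hp; lra) ltac:(destruct Hp; lra) Hp).
  destruct p as [px py]. destruct Hp as [P1 P2]; simpl in P1, P2.
  destruct B as (B1 & B2 & B3 & B4).
  assert (F : forall u v : R, ((u, v) - (px, py))%C = ((u - px)%R, (v - py)%R)) by (intros; apply Ceq; csimp; ring).
  assert (ReI : forall a b : R, Re (/ (a, b))%C = a / (a ^ 2 + b ^ 2)) by reflexivity.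
  assert (ImI : forall a b : R, Im (/ (a, b))%C = - b / (a ^ 2 + b ^ 2)) by reflexivity.
  assert (I1 : 0 < Im (CI (fun u => / ((u, y1) - (px, py)) ^ 1)%C x1 x2)).
  { unfold CI; cbn [Im Re fst snd]. apply RInt_gt_0; [lra| |intros x Hx; apply (B1 x Hx)].
    intros x Hx. rewrite Cpow_1_r, F, ImI. apply Rdiv_lt_0_compat; [lra|apply sumsq_pos; first [left; lra|right; lra]]. }
  assert (I3 : Im (CI (fun u => / ((u, y2) - (px, py)) ^ 1)%C x1 x2) < 0).
  { apply Ropp_lt_cancel. rewrite Ropp_0. unfold CI; cbn [Im Re fst snd].
    rewrite <- (RInt_opp (V := R_CompleteNormedModule)) by (apply (conts_ex_im _ x1 x2 ltac:(lra) B3)).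
    apply RInt_gt_0; [lra| |].
    - intros x Hx. rewrite Cpow_1_r, F, ImI.
      match goal with |- 0 < opp (- ?a / ?b) => change (0 < - (- a / b)); replace (- (- a / b)) with (a / b) by (unfold Rdiv; ring) end.
      apply Rdiv_lt_0_compat; [lra|apply sumsq_pos; first [left; lra|right; lra]].
    - intros x Hx. apply (continuous_opp (V := R_NormedModule)), (B3 x Hx). }
  assert (I2 : 0 < Re (CI (fun v => / ((x2, v) - (px, py)) ^ 1)%C y1 y2)).
  { unfold CI; cbn [Im Re fst snd]. apply RInt_gt_0; [lra| |intros x Hx; apply (B2 x Hx)].
    intros x Hx. rewrite Cpow_1_r, F, ReI. apply Rdiv_lt_0_compat; [lra|apply sumsq_pos; first [left; lra|right; lra]]. }
  assert (I4 : Re (CI (fun v => / ((x1, v) - (px, py)) ^ 1)%C y1 y2) < 0).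
  { apply Ropp_lt_cancel. rewrite Ropp_0. unfold CI; cbn [Im Re fst snd].
    rewrite <- (RInt_opp (V := R_CompleteNormedModule)) by (apply (conts_ex_re _ y1 y2 ltac:(lra) B4)).
    apply RInt_gt_0; [lra| |].
    - intros x Hx. rewrite Cpow_1_r, F, ReI.
      match goal with |- 0 < opp (?a / ?b) => change (0 < - (a / b)); replace (- (a / b)) with ((- a) / b) by (unfold Rdiv; ring) end.
      apply Rdiv_lt_0_compat; [lra|apply sumsq_pos; first [left; lra|right; lra]].
    - intros x Hx. apply (continuous_opp (V := R_NormedModule)), (B4 x Hx). }
  unfold polec, bdr.
  set (c1 := CI (fun u => / ((u, y1) - (px, py)) ^ 1)%C x1 x2) in *.
  set (c3 := CI (fun u => / ((u, y2) - (px, py)) ^ 1)%C x1 x2) in *.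
  set (c2 := CI (fun v => / ((x2, v) - (px, py)) ^ 1)%C y1 y2) in *.
  set (c4 := CI (fun v => / ((x1, v) - (px, py)) ^ 1)%C y1 y2) in *.
  clearbody c1 c2 c3 c4. destruct c1, c2, c3, c4. csimp. lra.
Qed.

Lemma polec_neq0 x1 x2 y1 y2 p : interior x1 x2 y1 y2 p -> polec x1 x2 y1 y2 p <> 0%C.
Proof. intros H E. generalize (polec_im_pos _ _ _ _ _ H). rewrite E. simpl. lra. Qed.

Lemma conts_bounded f a b : conts f a b -> exists M, 0 <= M /\ forall t, a <= t <= b -> Cmod (f t) <= M.
Proof.
  intros H. destruct (Rle_dec a b) as [Hab|Hab].
  - destruct (continuity_ab_maj (fun t => Cmod (f t)) a b Hab) as [m [Hm _]].
    + intros c Hc. apply continuity_pt_filterlim. apply (rcont_Cmod f c (H c Hc)).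
    + exists (Cmod (f m)). split; [apply Cmod_ge_0|exact Hm].
  - exists 0. split; [lra|]. intros; lra.
Qed.

Lemma bcont_bounded f x1 x2 y1 y2 : bcont f x1 x2 y1 y2 ->
  exists M, 0 <= M /\ forall w, onbd x1 x2 y1 y2 w -> Cmod (f w) <= M.
Proof.
  intros (F1 & F2 & F3 & F4).
  destruct (conts_bounded _ _ _ F1) as [M1 [P1 H1]]. destruct (conts_bounded _ _ _ F2) as [M2 [P2 H2]].
  destruct (conts_bounded _ _ _ F3) as [M3 [P3 H3]]. destruct (conts_bounded _ _ _ F4) as [M4 [P4 H4]].
  exists (M1 + M2 + M3 + M4). split; [lra|]. intros [u v] [[A [B|B]]|[A [B|B]]]; simpl in A, B; subst.
  - specialize (H1 u A); simpl in H1; lra.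
  - specialize (H3 u A); simpl in H3; lra.
  - specialize (H4 v A); simpl in H4; lra.
  - specialize (H2 v A); simpl in H2; lra.
Qed.

Lemma onbd_dist x1 x2 y1 y2 p : interior x1 x2 y1 y2 p ->
  exists d, 0 < d /\ forall w, onbd x1 x2 y1 y2 w -> d <= Cmod (w - p)%C.
Proof.
  intros [H1 H2].
  exists (Rmin (Rmin (Re p - x1) (x2 - Re p)) (Rmin (Im p - y1) (y2 - Im p))).
  split; [repeat apply Rmin_pos; lra|].
  set (m := Rmin _ _).
  assert (A : m <= Re p - x1 /\ m <= x2 - Re p /\ m <= Im p - y1 /\ m <= y2 - Im p).
  { unfold m. repeat split.
    - eapply Rle_trans; [apply Rmin_l|apply Rmin_l].
    - eapply Rle_trans; [apply Rmin_l|apply Rmin_r].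
    - eapply Rle_trans; [apply Rmin_r|apply Rmin_l].
    - eapply Rle_trans; [apply Rmin_r|apply Rmin_r]. }
  clearbody m. intros w Hw.
  assert (E1 : Re (w - p) = Re w - Re p) by (destruct w, p; csimp; ring).
  assert (E2 : Im (w - p) = Im w - Im p) by (destruct w, p; csimp; ring).
  destruct Hw as [[_ [E|E]]|[_ [E|E]]].
  - eapply Rle_trans; [|apply im_le_Cmod]. rewrite E2, E. rewrite Rabs_left; lra.
  - eapply Rle_trans; [|apply im_le_Cmod]. rewrite E2, E. rewrite Rabs_right; lra.
  - eapply Rle_trans; [|apply re_le_Cmod]. rewrite E1, E. rewrite Rabs_left; lra.
  - eapply Rle_trans; [|apply re_le_Cmod]. rewrite E1, E. rewrite Rabs_right; lra.
Qed.

Lemma cder_quad f z l C0 d : 0 < d -> 0 <= C0 ->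
  (forall h, Cmod h < d -> Cmod (f (z + h) - f z - l * h)%C <= C0 * Cmod h ^ 2) -> cder f z l.
Proof.
  intros Hd HC H eps He. exists (Rmin d (eps / (C0 + 1))).
  split; [apply Rmin_pos; [assumption|apply Rdiv_lt_0_compat; lra]|].
  intros h Hh. assert (H1 := Rlt_le_trans _ _ _ Hh (Rmin_l _ _)). assert (H2 := Rlt_le_trans _ _ _ Hh (Rmin_r _ _)).
  eapply Rle_trans; [apply H, H1|]. replace (C0 * Cmod h ^ 2) with (C0 * Cmod h * Cmod h) by ring.
  apply Rmult_le_compat_r; [apply Cmod_ge_0|].
  apply Rmult_lt_compat_l with (r := C0 + 1) in H2; [|lra].
  replace ((C0 + 1) * (eps / (C0 + 1))) with eps in H2 by (field; lra).
  generalize (Cmod_ge_0 h); nra.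
Qed.

Lemma interior_nbhd x1 x2 y1 y2 p d : interior x1 x2 y1 y2 p ->
  (forall w, onbd x1 x2 y1 y2 w -> d <= Cmod (w - p)%C) ->
  forall h, Cmod h < d -> interior x1 x2 y1 y2 (p + h)%C.
Proof.
  intros Hp Db h Hh. destruct Hp as [P1 P2]. generalize (re_le_Cmod h) (im_le_Cmod h); intros R1 R2.
  assert (K : forall a b : R, Cmod ((a, b) : C) <= Rabs a + Rabs b) by (intros; apply Cmod_le_abs).
  assert (d <= Re p - x1 /\ d <= x2 - Re p /\ d <= Im p - y1 /\ d <= y2 - Im p).
  { repeat split.
    - specialize (Db (x1, Im p)). unfold onbd in Db; simpl in Db. specialize (Db ltac:(right; split; [lra|auto])).
      replace ((x1, Im p) - p)%C with ((x1 - Re p, 0) : C) in Db by (apply Ceq; destruct p; csimp; ring).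
      specialize (K (x1 - Re p) 0). rewrite Rabs_R0, Rabs_left in K; lra.
    - specialize (Db (x2, Im p)). unfold onbd in Db; simpl in Db. specialize (Db ltac:(right; split; [lra|auto])).
      replace ((x2, Im p) - p)%C with ((x2 - Re p, 0) : C) in Db by (apply Ceq; destruct p; csimp; ring).
      specialize (K (x2 - Re p) 0). rewrite Rabs_R0, Rabs_right in K; lra.
    - specialize (Db (Re p, y1)). unfold onbd in Db; simpl in Db. specialize (Db ltac:(left; split; [lra|auto])).
      replace ((Re p, y1) - p)%C with ((0, y1 - Im p) : C) in Db by (apply Ceq; destruct p; csimp; ring).
      specialize (K 0 (y1 - Im p)). rewrite Rabs_R0, Rabs_left in K; lra.
    - specialize (Db (Re p, y2)). unfold onbd in Db; simpl in Db. specialize (Db ltac:(left; split; [lra|auto])).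
      replace ((Re p, y2) - p)%C with ((0, y2 - Im p) : C) in Db by (apply Ceq; destruct p; csimp; ring).
      specialize (K 0 (y2 - Im p)). rewrite Rabs_R0, Rabs_right in K; lra. }
  apply Rabs_le_between in R1. apply Rabs_le_between in R2.
  unfold interior. replace (Re (p + h)) with (Re p + Re h) by reflexivity. replace (Im (p + h)) with (Im p + Im h) by reflexivity. lra.
Qed.

Lemma bcont_minus f g x1 x2 y1 y2 : bcont f x1 x2 y1 y2 -> bcont g x1 x2 y1 y2 -> bcont (fun w => f w - g w)%C x1 x2 y1 y2.
Proof.
  intros (F1 & F2 & F3 & F4) (G1 & G2 & G3 & G4).
  split; [|split; [|split]]; intros t Ht;
  [apply (rcont_minus (fun u => f (u, y1)) (fun u => g (u, y1)))|apply (rcont_minus (fun u => f (x2, u)) (fun u => g (x2, u)))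
  |apply (rcont_minus (fun u => f (u, y2)) (fun u => g (u, y2)))|apply (rcont_minus (fun u => f (x1, u)) (fun u => g (x1, u)))]; auto.
Qed.

Lemma bcont_cauchy f x1 x2 y1 y2 n z : x1 <= x2 -> y1 <= y2 -> bcont f x1 x2 y1 y2 -> interior x1 x2 y1 y2 z ->
  bcont (fun w => f w * / (w - z) ^ n)%C x1 x2 y1 y2.
Proof. intros. apply bcont_mult; [assumption|]. apply bcont_inv; assumption. Qed.

(** Differentiation under the integral sign. The boundary keeps a distance [d] from [p], so the
    kernel [1 / (w - z)] has a quadratic remainder bounded uniformly in [w]. *)
Lemma bdr_cauchy_cder f x1 x2 y1 y2 p : x1 <= x2 -> y1 <= y2 -> bcont f x1 x2 y1 y2 -> interior x1 x2 y1 y2 p ->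
  cder (fun z => bdr (fun w => f w * / (w - z) ^ 1)%C x1 x2 y1 y2) p (bdr (fun w => f w * / (w - p) ^ 2)%C x1 x2 y1 y2).
Proof.
  intros Hx Hy Hf Hp.
  destruct (bcont_bounded _ _ _ _ _ Hf) as [M [HM Mb]].
  destruct (onbd_dist _ _ _ _ _ Hp) as [d [Hd Db]].
  assert (IN := interior_nbhd _ _ _ _ _ _ Hp Db).
  set (S := 2 * ((x2 - x1) + (y2 - y1))). assert (HS : 0 <= S) by (unfold S; lra).
  assert (LOW : forall h w, Cmod h < d / 2 -> onbd x1 x2 y1 y2 w -> d / 2 <= Cmod (w - p - h)%C).
  { intros h w Hh Hw. specialize (Db w Hw). generalize (Cmod_tri_rev (w - p) (- h)). rewrite Cmod_opp.
    replace (w - p + - h)%C with (w - p - h)%C by ring. lra. }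
  apply (cder_quad _ _ _ (S * (M * (2 / (d * d * d)))) (d / 2)); [lra| |].
  { apply Rmult_le_pos; [exact HS|]. apply Rmult_le_pos; [exact HM|]. apply Rlt_le, Rdiv_lt_0_compat; [lra|]. repeat apply Rmult_lt_0_compat; assumption. }
  intros h Hh. assert (Ih := IN h ltac:(lra)).
  assert (B1 := bcont_cauchy f _ _ _ _ 1 _ Hx Hy Hf Ih).
  assert (B2 := bcont_cauchy f _ _ _ _ 1 _ Hx Hy Hf Hp).
  assert (B3 := bcont_mult _ _ _ _ _ _ (bcont_const h _ _ _ _) (bcont_cauchy f _ _ _ _ 2 _ Hx Hy Hf Hp)).
  assert (B4 := bcont_minus _ _ _ _ _ _ B1 B2).
  assert (B5 := bcont_minus _ _ _ _ _ _ B4 B3).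
  rewrite <- bdr_minus by assumption.
  rewrite (Cmult_comm _ h), <- bdr_scal by (first [assumption | apply bcont_cauchy; assumption]).
  rewrite <- bdr_minus by assumption.
  eapply Rle_trans.
  { apply (bdr_bound _ (M * (2 / (d * d * d) * Cmod h ^ 2))); try assumption.
    intros w Hw. assert (N1 := onbd_neq _ _ _ _ _ _ Hp Hw). assert (N2 := onbd_neq _ _ _ _ _ _ Ih Hw).
    apply Cminus_neq0 in N1. apply Cminus_neq0 in N2.
    assert (N3 : (w - p - h)%C <> 0%C) by (intros E; apply N2; rewrite <- E; ring).
    replace (f w * / (w - (p + h)) ^ 1 - f w * / (w - p) ^ 1 - h * (f w * / (w - p) ^ 2))%C with
      (f w * (h * h * / ((w - p) * (w - p) * (w - p - h))))%C.
    2: { rewrite !Cpow_1_r. simpl. field. auto. }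
    rewrite Cmod_mult, Cmod_mult, Cmod_inv, !Cmod_mult by (repeat apply Cmult_neq_0; auto).
    apply Rmult_le_compat; [apply Cmod_ge_0| |apply Mb, Hw|].
    { apply Rle_mult_inv_pos; [apply Rmult_le_pos; apply Cmod_ge_0|]. repeat apply Rmult_lt_0_compat; apply Cmod_gt_0; auto. }
    assert (D0 := Db w Hw). assert (D1 := LOW h w Hh Hw).
    assert (d * d * (d / 2) <= Cmod (w - p) * Cmod (w - p) * Cmod (w - p - h)).
    { apply Rmult_le_compat; try nra. }
    replace (2 / (d * d * d) * Cmod h ^ 2) with (Cmod h * Cmod h * / (d * d * (d / 2))) by (field; lra).
    apply Rmult_le_compat_l; [apply Rmult_le_pos; apply Cmod_ge_0|]. apply Rinv_le_contravar; [|assumption].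
    repeat apply Rmult_lt_0_compat; lra. }
  right. unfold S. ring.
Qed.

Lemma bdr_cauchy2_ccont f x1 x2 y1 y2 p : x1 <= x2 -> y1 <= y2 -> bcont f x1 x2 y1 y2 -> interior x1 x2 y1 y2 p ->
  ccont (fun z => bdr (fun w => f w * / (w - z) ^ 2)%C x1 x2 y1 y2) p.
Proof.
  intros Hx Hy Hf Hp.
  destruct (bcont_bounded _ _ _ _ _ Hf) as [M [HM Mb]].
  destruct (onbd_dist _ _ _ _ _ Hp) as [d [Hd Db]].
  assert (IN := interior_nbhd _ _ _ _ _ _ Hp Db).
  set (S := 2 * ((x2 - x1) + (y2 - y1))). assert (HS : 0 <= S) by (unfold S; lra).
  assert (LOW : forall h w, Cmod h < d / 2 -> onbd x1 x2 y1 y2 w -> d / 2 <= Cmod (w - p - h)%C).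
  { intros h w Hh Hw. specialize (Db w Hw). generalize (Cmod_tri_rev (w - p) (- h)). rewrite Cmod_opp.
    replace (w - p + - h)%C with (w - p - h)%C by ring. lra. }
  set (K := S * (M * (16 / (d * d * d)))).
  assert (HK : 0 <= K).
  { apply Rmult_le_pos; [exact HS|]. apply Rmult_le_pos; [exact HM|]. apply Rlt_le, Rdiv_lt_0_compat; [lra|]. repeat apply Rmult_lt_0_compat; assumption. }
  intros eps He. exists (Rmin (d / 2) (eps / (K + 1))). split; [apply Rmin_pos; [lra|apply Rdiv_lt_0_compat; lra]|].
  intros h Hh0. assert (Hh := Rlt_le_trans _ _ _ Hh0 (Rmin_l _ _)). assert (Hh2 := Rlt_le_trans _ _ _ Hh0 (Rmin_r _ _)).
  assert (Ih := IN h ltac:(lra)).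
  assert (B1 := bcont_cauchy f _ _ _ _ 2 _ Hx Hy Hf Ih).
  assert (B2 := bcont_cauchy f _ _ _ _ 2 _ Hx Hy Hf Hp).
  assert (B4 := bcont_minus _ _ _ _ _ _ B1 B2).
  rewrite <- bdr_minus by assumption.
  apply Rle_lt_trans with (K * Cmod h).
  2: { apply Rmult_lt_compat_l with (r := K + 1) in Hh2; [|lra].
    replace ((K + 1) * (eps / (K + 1))) with eps in Hh2 by (field; lra). generalize (Cmod_ge_0 h); nra. }
  eapply Rle_trans.
  { apply (bdr_bound _ (M * (16 / (d * d * d) * Cmod h))); try assumption.
    intros w Hw. assert (N1 := onbd_neq _ _ _ _ _ _ Hp Hw). assert (N2 := onbd_neq _ _ _ _ _ _ Ih Hw).
    apply Cminus_neq0 in N1. apply Cminus_neq0 in N2.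
    assert (N3 : (w - p - h)%C <> 0%C) by (intros E; apply N2; rewrite <- E; ring).
    replace (f w * / (w - (p + h)) ^ 2 - f w * / (w - p) ^ 2)%C with
      (f w * (h * / ((w - p) * ((w - p - h) * (w - p - h))) + h * / ((w - p) * ((w - p) * (w - p - h)))))%C.
    2: { simpl. field. auto. }
    rewrite Cmod_mult. apply Rmult_le_compat; [apply Cmod_ge_0|apply Cmod_ge_0|apply Mb, Hw|].
    eapply Rle_trans; [apply Cmod_triangle|].
    rewrite !Cmod_mult, !Cmod_inv, !Cmod_mult by (repeat apply Cmult_neq_0; auto).
    assert (D0 := Db w Hw). assert (D1 := LOW h w Hh Hw).
    assert (I : forall b c, d / 2 <= b -> d / 2 <= c -> / (Cmod (w - p) * (b * c)) <= 4 * / (d * d * d)).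
    { intros b c Hb Hc. replace (4 * / (d * d * d)) with (/ (d * (d / 2 * (d / 2)))) by (field; lra).
      apply Rinv_le_contravar; [repeat apply Rmult_lt_0_compat; lra|].
      apply Rmult_le_compat; try lra; try nra. }
    assert (I1 := I _ _ D1 D1). assert (D2 : d / 2 <= Cmod (w - p)) by lra. assert (I2 := I _ _ D2 D1).
    apply Rmult_le_compat_l with (r := Cmod h) in I1; [|apply Cmod_ge_0].
    apply Rmult_le_compat_l with (r := Cmod h) in I2; [|apply Cmod_ge_0].
    assert (0 <= / (d * d * d) * Cmod h).
    { apply Rmult_le_pos; [apply Rlt_le, Rinv_0_lt_compat; repeat apply Rmult_lt_0_compat; lra|apply Cmod_ge_0]. }
    unfold Rdiv. lra. }
  right. unfold K, S. ring.
Qed.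

Lemma cder_unique f z a b : cder f z a -> cder f z b -> a = b.
Proof. intros Ha Hb. apply is_derive_cder in Ha. apply is_derive_cder in Hb.
  rewrite <- (is_C_derive_unique _ _ _ Ha). apply is_C_derive_unique, Hb. Qed.

Lemma ccont_plus f g z : ccont f z -> ccont g z -> ccont (fun w => f w + g w)%C z.
Proof.
  intros F G eps He. destruct (F (eps/2)) as [d1 [D1 H1]]; [lra|]. destruct (G (eps/2)) as [d2 [D2 H2]]; [lra|].
  exists (Rmin d1 d2). split; [apply Rmin_pos; assumption|]. intros h Hh.
  specialize (H1 h (Rlt_le_trans _ _ _ Hh (Rmin_l _ _))). specialize (H2 h (Rlt_le_trans _ _ _ Hh (Rmin_r _ _))).
  replace (f (z + h) + g (z + h) - (f z + g z))%C with ((f (z + h) - f z) + (g (z + h) - g z))%C by ring.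
  eapply Rle_lt_trans; [apply Cmod_triangle|]. lra.
Qed.

Lemma ccont_mult f g z : ccont f z -> ccont g z -> ccont (fun w => f w * g w)%C z.
Proof.
  intros F G eps He.
  set (A := 1 + Cmod (f z) + Cmod (g z)). assert (HA : 1 <= A) by (unfold A; generalize (Cmod_ge_0 (f z)) (Cmod_ge_0 (g z)); lra).
  set (e := Rmin 1 (eps / (2 * A))). assert (0 < e) by (apply Rmin_pos; [lra|apply Rdiv_lt_0_compat; lra]).
  assert (e <= 1) by apply Rmin_l. assert (E2 : e <= eps / (2 * A)) by apply Rmin_r.
  apply Rmult_le_compat_l with (r := 2 * A) in E2; [|lra]. replace (2 * A * (eps / (2 * A))) with eps in E2 by (field; lra).
  destruct (F e) as [d1 [D1 H1]]; [lra|]. destruct (G e) as [d2 [D2 H2]]; [lra|].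
  exists (Rmin d1 d2). split; [apply Rmin_pos; assumption|]. intros h Hh.
  specialize (H1 h (Rlt_le_trans _ _ _ Hh (Rmin_l _ _))). specialize (H2 h (Rlt_le_trans _ _ _ Hh (Rmin_r _ _))).
  replace (f (z + h) * g (z + h) - f z * g z)%C with ((f (z + h) - f z) * (g (z + h) - g z) + ((f (z + h) - f z) * g z + f z * (g (z + h) - g z)))%C by ring.
  eapply Rle_lt_trans; [apply Cmod_triangle|].
  eapply Rle_lt_trans; [apply Rplus_le_compat_l, Cmod_triangle|]. rewrite !Cmod_mult.
  generalize (Cmod_ge_0 (f z)) (Cmod_ge_0 (g z)) (Cmod_ge_0 (f (z + h) - f z)%C) (Cmod_ge_0 (g (z + h) - g z)%C). intros.
  unfold A in *. nra.
Qed.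

Lemma ccont_ext f g z d : 0 < d -> (forall h, Cmod h < d -> f (z + h)%C = g (z + h)%C) -> ccont f z -> ccont g z.
Proof.
  intros Hd E F eps He. destruct (F eps He) as [d' [Hd' H']]. exists (Rmin d d'). split; [apply Rmin_pos; assumption|].
  intros h Hh. rewrite <- E by (eapply Rlt_le_trans; [exact Hh|apply Rmin_l]).
  assert (E0 := E 0%C). rewrite Cmod_0, Cplus_0_r in E0. rewrite <- (E0 Hd). apply H'. eapply Rlt_le_trans; [exact Hh|apply Rmin_r].
Qed.

Definition sqb (c : C) (a : R) (p : C) := interior (Re c - a) (Re c + a) (Im c - a) (Im c + a) p.

Definition sqc (f : C -> C) (c : C) (a : R) (p : C) (n : nat) :=
  bdr (fun w => f w * / (w - p) ^ n)%C (Re c - a) (Re c + a) (Im c - a) (Im c + a).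

Lemma Cmod_sq_in c a x y : Re c - a <= x <= Re c + a -> Im c - a <= y <= Im c + a -> Cmod ((x, y) - c)%C <= 2 * a.
Proof.
  intros Hx Hy. eapply Rle_trans; [apply Cmod_le_abs|].
  replace (Re ((x, y) - c)) with (x - Re c) by (destruct c; csimp; ring).
  replace (Im ((x, y) - c)) with (y - Im c) by (destruct c; csimp; ring).
  replace (2 * a) with (a + a) by ring. apply Rplus_le_compat; apply Rabs_le; lra.
Qed.

Lemma sqb_ball c a h : Cmod h < a -> sqb c a (c + h)%C.
Proof.
  intros H. unfold sqb, interior. replace (Re (c + h)) with (Re c + Re h) by reflexivity.
  replace (Im (c + h)) with (Im c + Im h) by reflexivity.
  generalize (re_le_Cmod h) (im_le_Cmod h); intros R1 R2. apply Rabs_le_between in R1. apply Rabs_le_between in R2. lra.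
Qed.

Lemma sqc_cder f c a p : 0 < a -> bcont f (Re c - a) (Re c + a) (Im c - a) (Im c + a) -> sqb c a p ->
  cder (fun z => sqc f c a z 1) p (sqc f c a p 2).
Proof. intros Ha Hf Hp. unfold sqc. apply bdr_cauchy_cder; try lra; assumption. Qed.

Lemma sqc_hol f c a p : 0 < a -> bcont f (Re c - a) (Re c + a) (Im c - a) (Im c + a) -> sqb c a p ->
  hol (fun z => sqc f c a z 1) p.
Proof. intros. eexists. apply sqc_cder; assumption. Qed.

Lemma sqc2_ccont f c a p : 0 < a -> bcont f (Re c - a) (Re c + a) (Im c - a) (Im c + a) -> sqb c a p ->
  ccont (fun z => sqc f c a z 2) p.
Proof. intros Ha Hf Hp. unfold sqc. apply bdr_cauchy2_ccont; try lra; assumption. Qed.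

(** On a square around [c], [f] is the quotient of the Cauchy integrals [N] of [f] and [K] of 1;
    differentiating the quotient expresses [D] through continuous Cauchy integrals. It will give the
    continuity of the derivative of [hardy_Z], hence integrability. *)
Theorem hol_deriv_ccont f D (c : C) r : 0 < r -> (forall h, Cmod h < r -> cder f (c + h)%C (D (c + h)%C)) -> ccont D c.
Proof.
  intros Hr H. set (a := r / 4).
  assert (Ha : 0 < a) by (unfold a; lra).
  assert (HF : forall x y, Re c - a <= x <= Re c + a -> Im c - a <= y <= Im c + a -> hol f (x, y)).
  { intros x y Hx Hy. exists (D (x, y)). replace ((x, y) : C) with (c + ((x, y) - c))%C by ring. apply H.
    eapply Rle_lt_trans; [apply (Cmod_sq_in c a); assumption|]. unfold a; lra. }
  assert (Fb : bcont f (Re c - a) (Re c + a) (Im c - a) (Im c + a)) by (apply rcontin_bcont; try lra; apply rcontin_hol, HF).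
  assert (Ob : bcont (fun _ => 1%C) (Re c - a) (Re c + a) (Im c - a) (Im c + a)) by apply bcont_const.
  set (K := fun z => sqc (fun _ => 1%C) c a z 1).
  set (N := fun z => sqc f c a z 1).
  assert (EK : forall z, sqb c a z -> K z = polec (Re c - a) (Re c + a) (Im c - a) (Im c + a) z).
  { intros z Hz. unfold K, sqc, polec. apply bdr_ext; try lra. intros. ring. }
  assert (KN : forall z, sqb c a z -> K z <> 0%C).
  { intros z Hz. rewrite EK by exact Hz. apply polec_neq0, Hz. }
  assert (FE : forall z, sqb c a z -> f z = (N z * / K z)%C).
  { intros z Hz. unfold N, sqc. rewrite (cauchy_formula f _ _ _ _ z Hz HF). rewrite EK by exact Hz. field. apply polec_neq0, Hz. }
  assert (Cc : sqb c a c) by (replace c with (c + 0)%C at 2 by ring; apply sqb_ball; rewrite Cmod_0; lra).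
  assert (DE : forall h, Cmod h < a / 2 -> D (c + h)%C =
     (sqc f c a (c + h) 2 * / K (c + h) + N (c + h) * (- / (K (c + h) * K (c + h)) * sqc (fun _ => 1) c a (c + h) 2))%C).
  { intros h Hh. assert (Hz : sqb c a (c + h)) by (apply sqb_ball; lra).
    eapply cder_unique; [apply H; unfold a in Hh; lra|].
    apply (cder_ext_loc (fun z => N z * / K z)%C).
    { exists (a / 2). split; [lra|]. intros k Hk. symmetry. apply FE. rewrite <- Cplus_assoc. apply sqb_ball.
      eapply Rle_lt_trans; [apply Cmod_triangle|lra]. }
    apply (cder_mult N (fun z => / K z)%C).
    - exact (sqc_cder f c a _ Ha Fb Hz).
    - apply (cder_comp K Cinv); [exact (sqc_cder _ c a _ Ha Ob Hz)|]. apply cder_inv, KN, Hz. }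
  assert (HK : hol K c) by exact (sqc_hol _ c a c Ha Ob Cc).
  assert (HN : hol N c) by exact (sqc_hol _ c a c Ha Fb Cc).
  assert (C1 : ccont (fun z => sqc f c a z 2) c) by exact (sqc2_ccont _ c a c Ha Fb Cc).
  assert (C2 : ccont (fun z => sqc (fun _ => 1%C) c a z 2) c) by exact (sqc2_ccont _ c a c Ha Ob Cc).
  assert (KNc := KN c Cc).
  assert (C3 : ccont (fun z => / K z)%C c) by (apply hol_ccont, hol_inv; assumption).
  assert (C4 : ccont (fun z => - / (K z * K z))%C c).
  { apply hol_ccont, hol_opp. apply (hol_inv (fun z => K z * K z)%C); [apply hol_mult; exact HK|]. apply Cmult_neq_0; exact KNc. }
  assert (C5 := ccont_mult _ _ _ C1 C3). assert (C6 := ccont_mult _ _ _ C4 C2).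
  assert (C7 := ccont_mult _ _ _ (hol_ccont _ _ HN) C6). assert (C8 := ccont_plus _ _ _ C5 C7). cbv beta in C8.
  eapply (ccont_ext _ D c (a / 2)); [lra| |exact C8].
  intros h Hh. rewrite (DE h Hh). reflexivity.
Qed.

Lemma ccont_unif_limit (fn : nat -> C -> C) f c r : 0 < r ->
  (forall n h, Cmod h < r -> ccont (fn n) (c + h)%C) ->
  (forall eps, 0 < eps -> exists N, forall n h, (N <= n)%nat -> Cmod h < r -> Cmod (fn n (c + h) - f (c + h))%C <= eps) ->
  forall h, Cmod h < r -> ccont f (c + h)%C.
Proof.
  intros Hr Hn Hu h Hh eps He.
  destruct (Hu (eps / 4)) as [N HN]; [lra|].
  destruct (Hn N h Hh (eps / 4)) as [d [Hd Hd']]; [lra|].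
  exists (Rmin d (r - Cmod h)). split; [apply Rmin_pos; lra|].
  intros k Hk. assert (K1 := Rlt_le_trans _ _ _ Hk (Rmin_l _ _)). assert (K2 := Rlt_le_trans _ _ _ Hk (Rmin_r _ _)).
  specialize (Hd' k K1).
  assert (A := HN N h (Nat.le_refl _) Hh).
  assert (B := HN N (h + k)%C (Nat.le_refl _) ltac:(eapply Rle_lt_trans; [apply Cmod_triangle|lra])).
  rewrite Cplus_assoc in B.
  replace (f (c + h + k) - f (c + h))%C with (- (fn N (c + h + k) - f (c + h + k)) + ((fn N (c + h + k) - fn N (c + h)) + (fn N (c + h) - f (c + h))))%C by ring.
  eapply Rle_lt_trans; [apply Cmod_triangle|]. eapply Rle_lt_trans; [apply Rplus_le_compat_l, Cmod_triangle|].
  rewrite Cmod_opp. lra.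
Qed.

(** Cauchy's formula for [fn n] passes to the limit and gives [f K = N], where [N] and [K] are the
    Cauchy integrals of [f] and of 1, both holomorphic in the point. *)
Theorem hol_unif_limit (fn : nat -> C -> C) f c r : 0 < r ->
  (forall n h, Cmod h < r -> hol (fn n) (c + h)%C) ->
  (forall eps, 0 < eps -> exists N, forall n h, (N <= n)%nat -> Cmod h < r -> Cmod (fn n (c + h) - f (c + h))%C <= eps) ->
  hol f c.
Proof.
  intros Hr Hn Hu. set (a := r / 4). assert (Ha : 0 < a) by (unfold a; lra).
  assert (Cf := ccont_unif_limit fn f c r Hr (fun n h Hh => hol_ccont _ _ (Hn n h Hh)) Hu).
  assert (XX : Re c - a <= Re c + a) by lra. assert (YY : Im c - a <= Im c + a) by lra.
  assert (INr : forall x y, Re c - a <= x <= Re c + a -> Im c - a <= y <= Im c + a -> Cmod ((x, y) - c)%C < r).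
  { intros x y Hx Hy. eapply Rle_lt_trans; [apply (Cmod_sq_in c a); assumption|]. unfold a; lra. }
  assert (CP : forall x y : R, ((x, y) : C) = (c + ((x, y) - c))%C) by (intros; apply Ceq; destruct c; csimp; ring).
  assert (Fb : bcont f (Re c - a) (Re c + a) (Im c - a) (Im c + a)).
  { apply rcontin_bcont; try lra. intros x y Hx Hy. rewrite CP. apply Cf, INr; assumption. }
  assert (Fn : forall n x y, Re c - a <= x <= Re c + a -> Im c - a <= y <= Im c + a -> hol (fn n) (x, y)).
  { intros n x y Hx Hy. rewrite CP. apply Hn, INr; assumption. }
  assert (Fnb : forall n, bcont (fn n) (Re c - a) (Re c + a) (Im c - a) (Im c + a)).
  { intros n. apply rcontin_bcont; try lra. apply rcontin_hol, Fn. }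
  assert (Ob : bcont (fun _ => 1%C) (Re c - a) (Re c + a) (Im c - a) (Im c + a)) by apply bcont_const.
  set (K := fun z => sqc (fun _ => 1%C) c a z 1).
  set (N := fun z => sqc f c a z 1).
  assert (EK : forall z, sqb c a z -> K z = polec (Re c - a) (Re c + a) (Im c - a) (Im c + a) z).
  { intros z Hz. unfold K, sqc, polec. apply bdr_ext; try lra. intros. ring. }
  assert (FE : forall z, sqb c a z -> (N z - f z * K z)%C = 0%C).
  { intros z Hz. apply Cmod_eq_0, Rle_antisym; [|apply Cmod_ge_0].
    destruct (onbd_dist _ _ _ _ _ Hz) as [d [Hd Db]].
    apply (le_eps0 _ (8 * a * / d + Cmod (K z))). intros eps He.
    destruct (Hu eps He) as [n Hun]. specialize (Hun n).
    assert (Q := cauchy_formula (fn n) _ _ _ _ z Hz (Fn n)). rewrite <- EK in Q by exact Hz.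
    assert (Zc : (z = c + (z - c))%C) by ring.
    assert (Hzr : Cmod (z - c)%C < r).
    { destruct z as [zx zy]. apply INr; unfold sqb, interior in Hz; simpl in Hz; lra. }
    replace (N z - f z * K z)%C with (- (bdr (fun w => fn n w * / (w - z) ^ 1)%C (Re c - a) (Re c + a) (Im c - a) (Im c + a) - N z) + (fn n z - f z) * K z)%C.
    2: { rewrite Q. ring. }
    eapply Rle_trans; [apply Cmod_triangle|]. rewrite Cmod_opp, Cmod_mult.
    rewrite Rmult_plus_distr_r. apply Rplus_le_compat.
    - unfold N, sqc.
      assert (B1 := bcont_cauchy (fn n) _ _ _ _ 1 z XX YY (Fnb n) Hz).
      assert (B2 := bcont_cauchy f _ _ _ _ 1 z XX YY Fb Hz).
      rewrite <- bdr_minus by (assumption || lra).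
      eapply Rle_trans.
      { apply (bdr_bound _ (eps * / d)); try lra; [apply bcont_minus; assumption|].
        intros w Hw. replace (fn n w * / (w - z) ^ 1 - f w * / (w - z) ^ 1)%C with ((fn n w - f w) * / (w - z) ^ 1)%C by ring.
        assert (N0 := Cminus_neq0 _ _ (onbd_neq _ _ _ _ _ _ Hz Hw)).
        rewrite Cmod_mult, Cpow_1_r, Cmod_inv by exact N0.
        apply Rmult_le_compat; [apply Cmod_ge_0| | |].
        - apply Rlt_le, Rinv_0_lt_compat, Cmod_gt_0, N0.
        - replace w with (c + (w - c))%C by ring. apply Hun; [lia|]. destruct w as [wx wy].
          apply INr; unfold onbd in Hw; simpl in Hw; lra.
        - apply Rinv_le_contravar; [exact Hd|apply Db, Hw]. }
      right. ring.
    - rewrite Rmult_comm. apply Rmult_le_compat_l; [apply Cmod_ge_0|]. rewrite Zc. apply Hun; [lia|exact Hzr]. }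
  assert (Cc : sqb c a c) by (replace c with (c + 0)%C at 2 by ring; apply sqb_ball; rewrite Cmod_0; lra).
  apply (hol_ext_loc (fun z => N z * / K z)%C f c a Ha).
  - intros h Hh. assert (Hz := sqb_ball c a h Hh). assert (E := FE _ Hz).
    assert (KN : K (c + h)%C <> 0%C) by (rewrite EK by exact Hz; apply polec_neq0, Hz).
    assert (E2 : N (c + h)%C = (f (c + h) * K (c + h))%C) by (replace (N (c + h)%C) with ((N (c + h) - f (c + h) * K (c + h)) + f (c + h) * K (c + h))%C by ring; rewrite E; ring).
    rewrite E2. field. exact KN.
  - apply (hol_mult N); [exact (sqc_hol _ c a c Ha Fb Cc)|].
    apply (hol_inv K); [exact (sqc_hol _ c a c Ha Ob Cc)|]. rewrite EK by exact Cc. apply polec_neq0, Cc.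
Qed.

(** The coefficients [co n] vanish one after the other: at zeros [c + h] of [f] with [h] tending to
    0, the remainder [E n h = co n + h E (n + 1) h] is 0 and [E (n + 1)] is bounded. Hence
    [E 0 h = h ^ n E n h] for all [n], which is of size [(|h| / a) ^ n]. *)
Theorem identity_disc f c a : 0 < a ->
  (forall x y, Re c - a <= x <= Re c + a -> Im c - a <= y <= Im c + a -> hol f (x, y)) ->
  (forall d, 0 < d -> exists h : C, h <> 0%C /\ Cmod h < d /\ f (c + h)%C = 0%C) ->
  forall h : C, Cmod h < a -> f (c + h)%C = 0%C.
Proof.
  intros Ha Hf Hz.
  set (x1 := Re c - a). set (x2 := Re c + a). set (y1 := Im c - a). set (y2 := Im c + a).
  assert (X : x1 <= x2) by (unfold x1, x2; lra). assert (Y : y1 <= y2) by (unfold y1, y2; lra).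
  assert (Fb : bcont f x1 x2 y1 y2) by (apply rcontin_bcont; try assumption; apply rcontin_hol, Hf).
  destruct (bcont_bounded _ _ _ _ _ Fb) as [M [HM Mb]].
  assert (Ic : interior x1 x2 y1 y2 c) by (unfold interior, x1, x2, y1, y2; lra).
  assert (Ih : forall h, Cmod h < a -> interior x1 x2 y1 y2 (c + h)%C) by (intros h Hh; apply sqb_ball, Hh).
  assert (Da : forall w, onbd x1 x2 y1 y2 w -> a <= Cmod (w - c)%C).
  { intros w Hw. assert (E1 : Re (w - c) = Re w - Re c) by (destruct w, c; csimp; ring).
    assert (E2 : Im (w - c) = Im w - Im c) by (destruct w, c; csimp; ring). unfold x1, x2, y1, y2 in Hw.
    destruct Hw as [[_ [E|E]]|[_ [E|E]]].
    - eapply Rle_trans; [|apply im_le_Cmod]. rewrite E2, E. rewrite Rabs_left; lra.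
    - eapply Rle_trans; [|apply im_le_Cmod]. rewrite E2, E. rewrite Rabs_right; lra.
    - eapply Rle_trans; [|apply re_le_Cmod]. rewrite E1, E. rewrite Rabs_left; lra.
    - eapply Rle_trans; [|apply re_le_Cmod]. rewrite E1, E. rewrite Rabs_right; lra. }
  assert (BI : forall n h, Cmod h < a -> bcont (fun w => f w * / (w - c) ^ n * / (w - (c + h)) ^ 1)%C x1 x2 y1 y2).
  { intros n h Hh. apply bcont_mult; [apply bcont_cauchy; assumption|]. apply bcont_inv; auto. }
  (* Remainders of the geometric expansion of [1 / (w - (c + h))] in powers of [h / (w - c)]; the
     [co n] below are the Taylor coefficients up to the factor [2 i pi]. *)
  set (E := fun n h => bdr (fun w => f w * / (w - c) ^ n * / (w - (c + h)) ^ 1)%C x1 x2 y1 y2).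
  set (co := fun n => bdr (fun w => f w * / (w - c) ^ S n)%C x1 x2 y1 y2).
  assert (Rec : forall n h, Cmod h < a -> E n h = (co n + h * E (S n) h)%C).
  { intros n h Hh. unfold E, co.
    assert (B := BI (S n) h Hh).
    rewrite <- bdr_scal by assumption.
    rewrite <- bdr_plus; try assumption; [|apply bcont_cauchy; assumption|apply bcont_mult; [apply bcont_const|assumption]].
    apply bdr_ext; try assumption. intros w Hw.
    assert (N1 := Cminus_neq0 _ _ (onbd_neq _ _ _ _ _ _ Ic Hw)).
    assert (N2 := Cminus_neq0 _ _ (onbd_neq _ _ _ _ _ _ (Ih h Hh) Hw)).
    simpl. field. split; [|split]; try assumption. apply Cpow_nz, N1. }
  assert (E0 : forall h, Cmod h < a -> E 0%nat h = (f (c + h) * polec x1 x2 y1 y2 (c + h))%C).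
  { intros h Hh. rewrite <- (cauchy_formula f) by auto. unfold E. apply bdr_ext; try assumption.
    intros w Hw. simpl. field. assert (N2 := Cminus_neq0 _ _ (onbd_neq _ _ _ _ _ _ (Ih h Hh) Hw)). exact N2. }
  assert (Bd : forall n h, Cmod h < a -> Cmod (E n h) <= 8 * a * M * / a ^ n * / (a - Cmod h)).
  { intros n h Hh. eapply Rle_trans.
    { apply (bdr_bound _ (M * / a ^ n * / (a - Cmod h)) x1 x2 y1 y2 X Y (BI n h Hh)).
      intros w Hw.
      assert (N1 := Cminus_neq0 _ _ (onbd_neq _ _ _ _ _ _ Ic Hw)).
      assert (N2 := Cminus_neq0 _ _ (onbd_neq _ _ _ _ _ _ (Ih h Hh) Hw)).
      rewrite !Cmod_mult, Cpow_1_r, !Cmod_inv, Cmod_pow by (try assumption; apply Cpow_nz; assumption).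
      assert (D := Da w Hw).
      assert (P0 : 0 < / Cmod (w - c) ^ n) by (apply Rinv_0_lt_compat, pow_lt; lra).
      apply Rmult_le_compat; [apply Rmult_le_pos; [apply Cmod_ge_0|lra]| | |].
      - apply Rlt_le, Rinv_0_lt_compat, Cmod_gt_0, N2.
      - apply Rmult_le_compat; [apply Cmod_ge_0|lra|apply Mb, Hw|].
        apply Rinv_le_contravar; [apply pow_lt, Ha|]. apply pow_incr. lra.
      - apply Rinv_le_contravar; [lra|]. generalize (Cmod_tri_rev (w - c) (- h)). rewrite Cmod_opp.
        replace (w - c + - h)%C with (w - (c + h))%C by ring. lra. }
    right. unfold x1, x2, y1, y2. ring. }
  assert (Van : forall n, (forall h, Cmod h < a -> E 0%nat h = (h ^ n * E n h)%C)).
  { induction n as [|n IH].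
    - intros h Hh. simpl. ring.
    - assert (C0 : co n = 0%C).
      { apply Cmod_eq_0, Rle_antisym; [|apply Cmod_ge_0].
        apply (le_eps0 _ (8 * a * M * / a ^ S n * / (a / 2))). intros eps He.
        destruct (Hz (Rmin eps (a / 2))) as [h [H0 [Hh Fh]]]; [apply Rmin_pos; lra|].
        assert (H1 := Rlt_le_trans _ _ _ Hh (Rmin_l _ _)). assert (H2 := Rlt_le_trans _ _ _ Hh (Rmin_r _ _)).
        assert (Hha : Cmod h < a) by lra.
        assert (Q := IH h Hha). rewrite E0, Fh, Cmult_0_l in Q by exact Hha.
        assert (Q2 : E n h = 0%C).
        { assert (Hp := Cpow_nz h n H0). replace (E n h) with (/ h ^ n * (h ^ n * E n h))%C by (field; exact Hp). rewrite <- Q. ring. }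
        rewrite Rec in Q2 by exact Hha.
        assert (Q3 : co n = (- (h * E (S n) h))%C).
        { replace (co n) with ((co n + h * E (S n) h) - h * E (S n) h)%C by ring. rewrite Q2. ring. }
        rewrite Q3, Cmod_opp, Cmod_mult. rewrite Rmult_comm.
        apply Rmult_le_compat; try apply Cmod_ge_0; [|lra].
        eapply Rle_trans; [apply Bd, Hha|]. apply Rmult_le_compat_l.
        { apply Rmult_le_pos; [apply Rmult_le_pos; lra|]. apply Rlt_le, Rinv_0_lt_compat, pow_lt, Ha. }
        apply Rinv_le_contravar; lra. }
      intros h Hh. rewrite (IH h Hh), (Rec n h Hh), C0. simpl. ring. }
  intros h Hh.
  assert (Z : E 0%nat h = 0%C).
  { apply Cmod_eq_0, Rle_antisym; [|apply Cmod_ge_0].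
    set (q := Cmod h / a). assert (Hq : 0 <= q < 1).
    { unfold q. split; [apply Rle_mult_inv_pos; [apply Cmod_ge_0|lra]|]. apply Rlt_div_l; lra. }
    apply (le_eps0 _ (8 * a * M * / (a - Cmod h))). intros eps He.
    assert (L : is_lim_seq (fun n => q ^ n) 0) by (apply is_lim_seq_geom; rewrite Rabs_pos_eq; lra).
    apply is_lim_seq_spec in L. destruct (L (mkposreal eps He)) as [n Hn]. specialize (Hn n (Nat.le_refl _)). simpl in Hn.
    rewrite Rminus_0_r in Hn. assert (Hn2 := Rle_lt_trans _ _ _ (Rle_abs _) Hn).
    rewrite (Van n h Hh), Cmod_mult, Cmod_pow.
    apply Rle_trans with (Cmod h ^ n * (8 * a * M * / a ^ n * / (a - Cmod h))).
    { apply Rmult_le_compat_l; [apply pow_le, Cmod_ge_0|apply Bd, Hh]. }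
    replace (Cmod h ^ n * (8 * a * M * / a ^ n * / (a - Cmod h))) with (8 * a * M * / (a - Cmod h) * (Cmod h ^ n * / a ^ n)) by ring.
    rewrite <- pow_inv, <- Rpow_mult_distr. apply Rmult_le_compat_l.
    - apply Rmult_le_pos; [apply Rmult_le_pos; lra|]. apply Rlt_le, Rinv_0_lt_compat; lra.
    - unfold q, Rdiv in Hn2. lra. }
  rewrite E0 in Z by exact Hh.
  assert (KN := polec_neq0 _ _ _ _ _ (Ih h Hh)).
  destruct (excluded_middle_informative (f (c + h)%C = 0%C)) as [A|A]; [exact A|].
  exfalso. apply (Cmult_neq_0 _ _ A KN Z).
Qed.

Lemma Cminus_0_r (z : C) : (z - 0)%C = z.
Proof. ring. Qed.

Lemma Cinv_neq_0 (z : C) : z <> 0%C -> (/ z)%C <> 0%C.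
Proof. intros H. apply Cmod_gt_0. rewrite Cmod_inv by exact H. apply Rinv_0_lt_compat, Cmod_gt_0, H. Qed.

(** * Complex powers of a positive base *)

Lemma Rcpow_plus a s t : Rcpow a (s + t) = (Rcpow a s * Rcpow a t)%C.
Proof. unfold Rcpow. rewrite <- Cexp_plus. f_equal. ring. Qed.

Lemma Cmod_Rcpow a s : Cmod (Rcpow a s) = Rpower a (Re s).
Proof. unfold Rcpow, Rpower. rewrite Cmod_Cexp. f_equal. destruct s; csimp; ring. Qed.

Lemma Rcpow_neq0 a s : Rcpow a s <> 0%C.
Proof. apply Cexp_neq0. Qed.

Lemma Rcpow_opp a s : Rcpow a (- s) = (/ Rcpow a s)%C.
Proof. unfold Rcpow. rewrite <- Cexp_opp. f_equal. ring. Qed.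

Lemma Rcpow_RtoC a x : Rcpow a (RtoC x) = RtoC (Rpower a x).
Proof. unfold Rcpow, Rpower. rewrite <- RtoC_mult. apply Cexp_R. Qed.

Lemma Rcpow_1 a : 0 < a -> Rcpow a 1 = RtoC a.
Proof. intros H. rewrite Rcpow_RtoC, Rpower_1 by exact H. reflexivity. Qed.

Lemma Rcpow_one s : Rcpow 1 s = 1%C.
Proof. unfold Rcpow. rewrite ln_1, Cmult_0_r. apply Cexp_0. Qed.

Lemma Rcpow_mult_base a b s : 0 < a -> 0 < b -> Rcpow (a * b) s = (Rcpow a s * Rcpow b s)%C.
Proof.
  intros Ha Hb. unfold Rcpow. rewrite ln_mult, RtoC_plus, <- Cexp_plus by assumption. f_equal. ring.
Qed.

Lemma cder_Rcpow a s : cder (fun s => Rcpow a s) s (Rcpow a s * RtoC (ln a))%C.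
Proof.
  unfold Rcpow. apply (cder_comp (fun s => s * RtoC (ln a))%C Cexp).
  - assert (A := cder_mult (fun s => s) (fun _ => RtoC (ln a)) s _ _ (cder_id s) (cder_const _ s)). cbv beta in A.
    replace (1 * RtoC (ln a) + s * 0)%C with (RtoC (ln a)) in A by ring. exact A.
  - apply cder_Cexp.
Qed.

Lemma hol_Rcpow a f z : hol f z -> hol (fun s => Rcpow a (f s)) z.
Proof. intros H. apply (hol_comp f (fun s => Rcpow a s)); [exact H|]. eexists. apply cder_Rcpow. Qed.

Lemma rder_Rcpow s u : 0 < u -> rder (fun v => Rcpow v s) u (s * Rcpow u (s - 1))%C.
Proof.
  intros Hu.
  assert (E : Rcpow u (s - 1) = (Rcpow u s * / RtoC u)%C).
  { unfold Cminus. rewrite Rcpow_plus, Rcpow_opp, Rcpow_1 by exact Hu. reflexivity. }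
  rewrite E. unfold Rcpow, Cexp. destruct s as [a b].
  split; csimp; (auto_derive; [auto|]); unfold Rminus; field; lra.
Qed.

(** * The zeta function on [Re s > 0] *)

Definition is_Clim (u : nat -> C) (l : C) : Prop :=
  forall eps, 0 < eps -> exists N, forall n, (N <= n)%nat -> Cmod (u n - l)%C <= eps.

Definition Clim (u : nat -> C) : C :=
  (real (Lim_seq (fun n => Re (u n))), real (Lim_seq (fun n => Im (u n)))).

Lemma is_Clim_re u l : is_Clim u l -> is_lim_seq (fun n => Re (u n)) (Re l).
Proof.
  intros H. apply is_lim_seq_spec. intros eps. destruct (H (eps / 2)) as [N HN]; [generalize (cond_pos eps); lra|].
  exists N. intros n Hn. specialize (HN n Hn).
  replace (Re (u n) - Re l) with (Re (u n - l)) by reflexivity.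
  generalize (re_le_Cmod (u n - l)) (cond_pos eps). lra.
Qed.

Lemma is_Clim_im u l : is_Clim u l -> is_lim_seq (fun n => Im (u n)) (Im l).
Proof.
  intros H. apply is_lim_seq_spec. intros eps. destruct (H (eps / 2)) as [N HN]; [generalize (cond_pos eps); lra|].
  exists N. intros n Hn. specialize (HN n Hn).
  replace (Im (u n) - Im l) with (Im (u n - l)) by reflexivity.
  generalize (im_le_Cmod (u n - l)) (cond_pos eps). lra.
Qed.

Lemma is_Clim_pair u l : is_lim_seq (fun n => Re (u n)) (Re l) -> is_lim_seq (fun n => Im (u n)) (Im l) -> is_Clim u l.
Proof.
  intros H1 H2 eps He. apply is_lim_seq_spec in H1. apply is_lim_seq_spec in H2.
  assert (P : 0 < eps / 2) by lra.
  destruct (H1 (mkposreal _ P)) as [N1 K1]. destruct (H2 (mkposreal _ P)) as [N2 K2].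
  exists (N1 + N2)%nat. intros n Hn. specialize (K1 n ltac:(lia)). specialize (K2 n ltac:(lia)). simpl in K1, K2.
  eapply Rle_trans; [apply Cmod_le_abs|].
  replace (Re (u n - l)) with (Re (u n) - Re l) by reflexivity.
  replace (Im (u n - l)) with (Im (u n) - Im l) by reflexivity. lra.
Qed.

Lemma is_Clim_unique u l : is_Clim u l -> Clim u = l.
Proof.
  intros H. unfold Clim. rewrite (is_lim_seq_unique _ _ (is_Clim_re _ _ H)), (is_lim_seq_unique _ _ (is_Clim_im _ _ H)).
  destruct l; reflexivity.
Qed.

Lemma is_Clim_inj u l l' : is_Clim u l -> is_Clim u l' -> l = l'.
Proof. intros H H'. rewrite <- (is_Clim_unique _ _ H). apply is_Clim_unique, H'. Qed.

Lemma is_Clim_ext u v l : (forall n, u n = v n) -> is_Clim u l -> is_Clim v l.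
Proof. intros E H eps He. destruct (H eps He) as [N HN]. exists N. intros. rewrite <- E. auto. Qed.

Lemma is_Clim_const c : is_Clim (fun _ => c) c.
Proof. intros eps He. exists O. intros. replace (c - c)%C with (RtoC 0) by ring. rewrite Cmod_0. lra. Qed.

Lemma is_Clim_bound u l b : is_lim_seq b 0 -> (forall n, Cmod (u n - l)%C <= b n) -> is_Clim u l.
Proof.
  intros Hb H eps He. apply is_lim_seq_spec in Hb. destruct (Hb (mkposreal eps He)) as [N HN].
  exists N. intros n Hn. specialize (HN n Hn). simpl in HN. rewrite Rminus_0_r in HN.
  eapply Rle_trans; [apply H|]. generalize (Rle_abs (b n)). lra.
Qed.

Lemma is_Clim_plus u v a b : is_Clim u a -> is_Clim v b -> is_Clim (fun n => u n + v n)%C (a + b).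
Proof.
  intros U V eps He. destruct (U (eps / 2)) as [N1 K1]; [lra|]. destruct (V (eps / 2)) as [N2 K2]; [lra|].
  exists (N1 + N2)%nat. intros n Hn. specialize (K1 n ltac:(lia)). specialize (K2 n ltac:(lia)).
  replace (u n + v n - (a + b))%C with ((u n - a) + (v n - b))%C by ring.
  eapply Rle_trans; [apply Cmod_triangle|]. lra.
Qed.

Lemma is_Clim_mult u v a b : is_Clim u a -> is_Clim v b -> is_Clim (fun n => u n * v n)%C (a * b).
Proof.
  intros U V. assert (U1 := is_Clim_re _ _ U). assert (U2 := is_Clim_im _ _ U).
  assert (V1 := is_Clim_re _ _ V). assert (V2 := is_Clim_im _ _ V).
  apply is_Clim_pair; cbn [Re Im Cmult fst snd].
  - apply is_lim_seq_minus'; apply is_lim_seq_mult'; assumption.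
  - apply is_lim_seq_plus'; apply is_lim_seq_mult'; assumption.
Qed.

Lemma is_Clim_scal c u a : is_Clim u a -> is_Clim (fun n => c * u n)%C (c * a).
Proof. apply is_Clim_mult, is_Clim_const. Qed.

Lemma is_Clim_incr u l k : is_Clim (fun n => u (n + k)%nat) l <-> is_Clim u l.
Proof.
  split; intros H eps He; destruct (H eps He) as [N HN].
  - exists (N + k)%nat. intros n Hn. replace n with ((n - k) + k)%nat by lia. apply HN. lia.
  - exists N. intros n Hn. apply HN. lia.
Qed.

Lemma is_Clim_Cmod u l : is_Clim u l -> is_lim_seq (fun n => Cmod (u n)) (Cmod l).
Proof.
  intros H. apply is_lim_seq_spec. intros eps. destruct (H (eps / 2)) as [N HN]; [generalize (cond_pos eps); lra|].
  exists N. intros n Hn. specialize (HN n Hn).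
  assert (A := Cmod_tri_rev (u n) (- (u n - l))). rewrite Cmod_opp in A. replace (u n + - (u n - l))%C with l in A by ring.
  assert (B := Cmod_tri_rev l (u n - l)). replace (l + (u n - l))%C with (u n) in B by ring.
  apply Rabs_lt_between. generalize (cond_pos eps). lra.
Qed.

Lemma is_Clim_inv u l : is_Clim u l -> l <> 0%C -> is_Clim (fun n => / u n)%C (/ l).
Proof.
  intros H H0. assert (m := proj1 (Cmod_gt_0 l) H0). intros eps He.
  assert (P : 0 < eps * (Cmod l * Cmod l) / 2) by (apply Rdiv_lt_0_compat; [apply Rmult_lt_0_compat; [lra|nra]|lra]).
  destruct (H (Rmin (Cmod l / 2) (eps * (Cmod l * Cmod l) / 2))) as [N HN]; [apply Rmin_pos; lra|].
  exists N. intros n Hn. specialize (HN n Hn). assert (A := Rle_trans _ _ _ HN (Rmin_l _ _)). assert (B := Rle_trans _ _ _ HN (Rmin_r _ _)).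
  assert (L : Cmod l / 2 <= Cmod (u n)).
  { generalize (Cmod_tri_rev l (u n - l)). replace (l + (u n - l))%C with (u n) by ring. lra. }
  assert (N0 : u n <> 0%C) by (apply Cmod_gt_0; lra).
  replace (/ u n - / l)%C with (- (u n - l) * / (u n * l))%C by (field; auto).
  rewrite Cmod_mult, Cmod_opp, Cmod_inv, Cmod_mult by (apply Cmult_neq_0; auto).
  apply Rle_trans with (eps * (Cmod l * Cmod l) / 2 * / (Cmod l / 2 * Cmod l)).
  - apply Rmult_le_compat; [apply Cmod_ge_0| |exact B|].
    + apply Rlt_le, Rinv_0_lt_compat, Rmult_lt_0_compat; lra.
    + apply Rinv_le_contravar; [apply Rmult_lt_0_compat; lra|]. apply Rmult_le_compat_r; lra.
  - right. field. lra.
Qed.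

(** Increments dominated by those of a null sequence give convergence with an explicit rate. The
    limits defining zeta, the reciprocal of Gamma, the Mellin integrals and the derivative of the
    argument of Gamma are all obtained in this way. *)
Lemma telescope_limit (u : nat -> C) (b : nat -> R) :
  is_lim_seq b 0 -> (forall n, Cmod (u (S n) - u n)%C <= b n - b (S n)) ->
  exists l, forall n, Cmod (u n - l)%C <= b n.
Proof.
  intros Hb Hu.
  assert (D : forall k n, Cmod (u (n + k)%nat - u n)%C <= b n - b (n + k)%nat).
  { induction k; intros n.
    - rewrite Nat.add_0_r. replace (u n - u n)%C with (RtoC 0) by ring. rewrite Cmod_0. lra.
    - replace (n + S k)%nat with (S (n + k)) by lia.
      replace (u (S (n + k)) - u n)%C with ((u (S (n + k)) - u (n + k)%nat) + (u (n + k)%nat - u n))%C by ring.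
      eapply Rle_trans; [apply Cmod_triangle|]. specialize (IHk n). specialize (Hu (n + k)%nat). lra. }
  assert (Bn : forall n, 0 <= b n).
  { intros n. assert (Dec : forall n, b (S n) <= b n) by (intros m; generalize (Hu m) (Cmod_ge_0 (u (S m) - u m)); lra).
    apply (is_lim_seq_decr_compare b 0 Hb Dec). }
  assert (Cau : forall eps, 0 < eps -> exists N, forall n m, (N <= n)%nat -> (N <= m)%nat -> Cmod (u n - u m)%C < eps).
  { intros eps He. apply is_lim_seq_spec in Hb. assert (P : 0 < eps / 2) by lra. destruct (Hb (mkposreal _ P)) as [N HN].
    exists N.
    assert (S1 : forall n k, (N <= n)%nat -> Cmod (u (n + k)%nat - u n)%C < eps).
    { intros n k Hn. eapply Rle_lt_trans; [apply D|]. specialize (HN n Hn). simpl in HN. rewrite Rminus_0_r in HN.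
      generalize (Rle_abs (b n)) (Bn (n + k)%nat). lra. }
    intros n m Hn Hm. destruct (Nat.le_ge_cases n m).
    - rewrite Cmod_minus_sym. replace m with (n + (m - n))%nat by lia. apply S1, Hn.
    - replace n with (m + (n - m))%nat by lia. apply S1, Hm. }
  assert (Lre : ex_finite_lim_seq (fun n => Re (u n))).
  { apply ex_lim_seq_cauchy_corr. intros eps. destruct (Cau eps (cond_pos eps)) as [N HN]. exists N. intros n m Hn Hm.
    eapply Rle_lt_trans; [|apply (HN n m Hn Hm)]. eapply Rle_trans; [|apply re_le_Cmod]. right. reflexivity. }
  assert (Lim : ex_finite_lim_seq (fun n => Im (u n))).
  { apply ex_lim_seq_cauchy_corr. intros eps. destruct (Cau eps (cond_pos eps)) as [N HN]. exists N. intros n m Hn Hm.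
    eapply Rle_lt_trans; [|apply (HN n m Hn Hm)]. eapply Rle_trans; [|apply im_le_Cmod]. right. reflexivity. }
  destruct Lre as [l1 L1], Lim as [l2 L2].
  exists ((l1, l2) : C). intros n.
  assert (Hl : is_Clim u (l1, l2)) by (apply is_Clim_pair; assumption).
  apply Rnot_lt_le. intros Hlt.
  destruct (Hl ((Cmod (u n - (l1, l2)) - b n) / 2)) as [N HN]; [lra|].
  specialize (HN (n + N)%nat ltac:(lia)). specialize (D N n). specialize (Bn (n + N)%nat).
  assert (T : Cmod (u n - (l1, l2)) <= Cmod (u (n + N)%nat - u n) + Cmod (u (n + N)%nat - (l1, l2))).
  { replace (u n - (l1, l2))%C with (- (u (n + N)%nat - u n) + (u (n + N)%nat - (l1, l2)))%C by ring.
    eapply Rle_trans; [apply Cmod_triangle|]. rewrite Cmod_opp. lra. }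
  lra.
Qed.

Fixpoint csum (f : nat -> C) (N : nat) : C :=
  match N with O => 0%C | S n => (csum f n + f n)%C end.

Lemma csum_ext f g N : (forall n, (n < N)%nat -> f n = g n) -> csum f N = csum g N.
Proof. induction N; intros H; simpl; [reflexivity|]. rewrite IHN, H by auto. reflexivity. Qed.

Lemma is_series_Clim f l : @is_series C_AbsRing C_NormedModule f l <-> is_Clim (csum f) l.
Proof.
  assert (Sn : forall n, @sum_n C_NormedModule f n = csum f (S n)).
  { induction n; [rewrite sum_O; symmetry; apply Cplus_0_l|]. rewrite sum_Sn, IHn. reflexivity. }
  split.
  - intros H eps He.
    assert (P : 0 < eps / 2) by lra.
    assert (L : locally (T := C_UniformSpace) l (fun y => ball l (mkposreal _ P) y)) by (exists (mkposreal _ P); auto).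
    destruct (H _ L) as [N HN]. exists (S N). intros n Hn. specialize (HN (n - 1)%nat ltac:(lia)).
    rewrite Sn in HN. replace (S (n - 1)) with n in HN by lia.
    apply C_NormedModule_mixin_compat2 in HN. change (Cmod (csum f n - l)%C < sqrt 2 * (eps / 2)) in HN.
    assert (sqrt 2 <= 2). { replace 2 with (sqrt 4) at 2. apply sqrt_le_1; lra. replace 4 with (2 * 2) by ring. apply sqrt_square; lra. }
    assert (sqrt 2 * (eps / 2) <= 2 * (eps / 2)) by (apply Rmult_le_compat_r; lra). lra.
  - intros H P [eps HP]. destruct (H (eps / 2)) as [N HN]; [generalize (cond_pos eps); lra|].
    exists N. intros n Hn. apply HP. rewrite Sn. apply C_NormedModule_mixin_compat1.
    specialize (HN (S n) ltac:(lia)). change (Cmod (csum f (S n) - l)%C < eps). generalize (cond_pos eps); lra.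
Qed.

Lemma hol_csum (f : nat -> C -> C) N z : (forall n, hol (f n) z) -> hol (fun s => csum (fun n => f n s) N) z.
Proof.
  intros H. induction N; simpl; [apply hol_const|]. apply (hol_plus (fun s => csum (fun n => f n s) N) (f N)); auto.
Qed.

Lemma is_derive_val (f : R -> R) x l l' : is_derive f x l -> l = l' -> is_derive f x l'.
Proof. intros H <-. exact H. Qed.

Lemma is_dconst (a x : R) : is_derive (fun _ : R => a) x 0.
Proof. exact (is_derive_const (K := R_AbsRing) (V := R_NormedModule) a x). Qed.

Lemma is_did (x : R) : is_derive (fun u : R => u) x 1.
Proof. exact (is_derive_id (K := R_AbsRing) x). Qed.

Lemma rder_val f t l l' : rder f t l -> l = l' -> rder f t l'.
Proof. intros H <-. exact H. Qed.

Lemma rder_const c t : rder (fun _ => c) t 0.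
Proof. split; [exact (is_dconst (Re c) t)|exact (is_dconst (Im c) t)]. Qed.

Lemma rder_RtoC f t l : is_derive f t l -> rder (fun u => RtoC (f u)) t (RtoC l).
Proof. intros H. split; [exact H|exact (is_dconst 0 t)]. Qed.

Lemma rder_plus f g t a b : rder f t a -> rder g t b -> rder (fun u => f u + g u)%C t (a + b).
Proof.
  intros [F1 F2] [G1 G2]. split.
  - apply (is_derive_plus (fun u => Re (f u)) (fun u => Re (g u))); assumption.
  - apply (is_derive_plus (fun u => Im (f u)) (fun u => Im (g u))); assumption.
Qed.

Lemma rder_mult f g t a b : rder f t a -> rder g t b -> rder (fun u => f u * g u)%C t (a * g t + f t * b).
Proof.
  intros [F1 F2] [G1 G2].
  split.
  - apply is_derive_val with (l := minus (plus (mult (Re a) (Re (g t))) (mult (Re (f t)) (Re b))) (plus (mult (Im a) (Im (g t))) (mult (Im (f t)) (Im b)))).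
    + apply (is_derive_minus (fun u => Re (f u) * Re (g u)) (fun u => Im (f u) * Im (g u))).
      * apply (is_derive_mult (fun u => Re (f u)) (fun u => Re (g u))); [exact F1|exact G1|exact Rmult_comm].
      * apply (is_derive_mult (fun u => Im (f u)) (fun u => Im (g u))); [exact F2|exact G2|exact Rmult_comm].
    + unfold minus, plus, opp, mult; csimp; unfold mult; simpl; ring.
  - apply is_derive_val with (l := plus (plus (mult (Re a) (Im (g t))) (mult (Re (f t)) (Im b))) (plus (mult (Im a) (Re (g t))) (mult (Im (f t)) (Re b)))).
    + apply (is_derive_plus (fun u => Re (f u) * Im (g u)) (fun u => Im (f u) * Re (g u))).
      * apply (is_derive_mult (fun u => Re (f u)) (fun u => Im (g u))); [exact F1|exact G2|exact Rmult_comm].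
      * apply (is_derive_mult (fun u => Im (f u)) (fun u => Re (g u))); [exact F2|exact G1|exact Rmult_comm].
    + unfold minus, plus, opp, mult; csimp; unfold mult; simpl; ring.
Qed.

Lemma INR_S_pos n : 0 < INR (S n).
Proof. apply lt_0_INR; lia. Qed.

Lemma INR_S_ge1 n : 1 <= INR (S n).
Proof. rewrite S_INR. generalize (pos_INR n). lra. Qed.

Lemma continuous_Rpower p x : 0 < x -> continuous (fun v => Rpower v p) x.
Proof.
  intros H. apply (ex_derive_continuous (V := R_NormedModule)). unfold Rpower. auto_derive. exact H.
Qed.

Lemma RInt_Rpower sg M v : 0 < sg -> 0 < M -> M <= v ->
  RInt (fun w => Rpower w (- sg - 1)) M v = / sg * (Rpower M (- sg) - Rpower v (- sg)).
Proof.
  intros Hs HM Hv.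
  replace (/ sg * (Rpower M (- sg) - Rpower v (- sg))) with (minus ((fun w => - / sg * Rpower w (- sg)) v) ((fun w => - / sg * Rpower w (- sg)) M)).
  2: { unfold minus, plus, opp; simpl. ring. }
  apply is_RInt_unique. apply (is_RInt_derive (V := R_CompleteNormedModule) (fun w => - / sg * Rpower w (- sg))).
  - intros x Hx. rewrite Rmin_left, Rmax_right in Hx by lra.
    assert (E : Rpower x (- sg - 1) = Rpower x (- sg) * / x).
    { unfold Rminus. rewrite Rpower_plus, (Rpower_Ropp x 1), Rpower_1 by lra. reflexivity. }
    rewrite E. unfold Rpower. auto_derive; [lra|]. field. lra.
  - intros x Hx. rewrite Rmin_left, Rmax_right in Hx by lra. apply continuous_Rpower. lra.
Qed.

Lemma Rcpow_conts s a b : 0 < a -> conts (fun v => Rcpow v s) a b.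
Proof. intros Ha t Ht. eapply rder_rcont, rder_Rcpow. lra. Qed.

Lemma Rcpow_diff_bound s M v : 0 < Re s -> 0 < M -> M <= v ->
  Cmod (Rcpow M (- s) - Rcpow v (- s))%C <= Cmod s / Re s * (Rpower M (- Re s) - Rpower v (- Re s)).
Proof.
  intros Hs HM Hv.
  assert (F : conts (fun w => (- s) * Rcpow w (- s - 1))%C M v).
  { apply (conts_mult (fun _ => - s)%C); [apply conts_const|apply Rcpow_conts, HM]. }
  assert (E := CI_deriv (fun w => Rcpow w (- s)) (fun w => (- s) * Rcpow w (- s - 1))%C M v Hv
    ltac:(intros t Ht; apply rder_Rcpow; lra) F). cbv beta in E.
  rewrite Cmod_minus_sym, <- E.
  assert (G : ex_RInt (fun w => Rpower w (- Re s - 1)) M v).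
  { apply contR_ex_RInt; [exact Hv|]. intros t Ht. apply continuous_Rpower. lra. }
  eapply Rle_trans.
  { apply (CI_bound_fun _ (fun w => scal (Cmod s) (Rpower w (- Re s - 1))) M v Hv F).
    - apply (ex_RInt_scal (V := R_NormedModule)), G.
    - intros t Ht. rewrite Cmod_mult, Cmod_opp, Cmod_Rcpow. right. reflexivity. }
  rewrite (RInt_scal (V := R_CompleteNormedModule)) by exact G.
  rewrite RInt_Rpower by assumption. right. unfold scal; simpl; unfold mult; simpl. field. lra.
Qed.

(* Partial sum plus the integral [N ^ (1 - s) / (s - 1)] of the tail; converges
   on [Re s > 0]. *)
Definition Z0 (N : nat) (s : C) : C :=
  (csum (fun n => Rcpow (INR (S n)) (- s)) N + Rcpow (INR (S N)) (1 - s) / (s - 1))%C.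

(** With [M = N + 1] the difference is the integral of [M ^ (- s) - v ^ (- s)] over [[M, M + 1]].
    Its integrand is bounded by [Rcpow_diff_bound], and that bound telescopes. *)
Lemma Z0_step N (s : C) : 0 < Re s -> s <> 1%C ->
  Cmod (Z0 (S N) s - Z0 N s)%C <=
    Cmod s / Re s * Rpower (INR (S N)) (- Re s) - Cmod s / Re s * Rpower (INR (S (S N))) (- Re s).
Proof.
  intros Hs H1. set (M := INR (S N)). assert (HM : 0 < M) by apply INR_S_pos.
  assert (EM : INR (S (S N)) = M + 1) by (rewrite S_INR; reflexivity).
  assert (N1 := Cminus_neq0 _ _ H1).
  unfold Z0. cbn [csum]. fold M. rewrite EM.
  assert (F : conts (fun v => Rcpow M (- s) - Rcpow v (- s))%C M (M + 1)).
  { intros t Ht. apply (rcont_minus (fun _ => Rcpow M (- s))); [apply rcont_const|]. apply (Rcpow_conts _ M (M + 1) HM t Ht). }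
  assert (E := CI_deriv (fun v => RtoC v * Rcpow M (- s) + Rcpow v (1 - s) / (s - 1))%C (fun v => Rcpow M (- s) - Rcpow v (- s))%C M (M + 1) ltac:(lra)).
  cbv beta in E.
  match goal with |- Cmod ?X <= _ => replace X with (CI (fun v => Rcpow M (- s) - Rcpow v (- s))%C M (M + 1)) end.
  2: { rewrite E; [rewrite RtoC_plus; field; exact N1| |exact F].
    intros t Ht. assert (D := rder_Rcpow (1 - s) t ltac:(lra)). replace (1 - s - 1)%C with (- s)%C in D by ring.
    apply rder_val with (l := (1 * Rcpow M (- s) + RtoC t * 0 + ((1 - s) * Rcpow t (- s) * / (s - 1) + Rcpow t (1 - s) * 0))%C).
    2: { field. exact N1. }
    apply rder_plus; (apply rder_mult; [|apply rder_const]); [apply rder_RtoC, is_did|exact D]. }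
  eapply Rle_trans.
  { apply (CI_bound _ (Cmod s / Re s * (Rpower M (- Re s) - Rpower (M + 1) (- Re s)))); [lra|exact F|].
    intros t Ht. eapply Rle_trans; [apply Rcpow_diff_bound; lra|].
    apply Rmult_le_compat_l; [apply Rle_mult_inv_pos; [apply Cmod_ge_0|exact Hs]|].
    assert (Rpower (M + 1) (- Re s) <= Rpower t (- Re s)); [|lra].
    rewrite !Rpower_Ropp. apply Rinv_le_contravar; [apply exp_pos|]. apply Rle_Rpower_l; lra. }
  right. ring.
Qed.

Lemma Rpower_INR_lim sg : 0 < sg -> is_lim_seq (fun n => Rpower (INR (S n)) (- sg)) 0.
Proof.
  intros Hs. apply is_lim_seq_spec. intros eps.
  assert (L : is_lim_seq (fun n => INR (S n)) p_infty) by apply (is_lim_seq_incr_1 INR), is_lim_seq_INR.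
  apply is_lim_seq_spec in L. destruct (L (Rpower (/ eps) (/ sg))) as [N HN].
  exists N. intros n Hn. specialize (HN n Hn). rewrite Rminus_0_r, Rabs_pos_eq by (left; apply exp_pos).
  assert (He := cond_pos eps).
  rewrite Rpower_Ropp. rewrite <- (Rinv_inv eps). apply Rinv_lt_contravar.
  { apply Rmult_lt_0_compat; [apply Rinv_0_lt_compat, He|apply exp_pos]. }
  apply Rle_lt_trans with (Rpower (Rpower (/ eps) (/ sg)) sg).
  { rewrite Rpower_mult, Rinv_l, Rpower_1 by (try lra; apply Rinv_0_lt_compat, He). lra. }
  apply Rlt_Rpower_l; [exact Hs|]. split; [apply exp_pos|exact HN].
Qed.

Definition zeta0 (s : C) : C := Clim (fun N => Z0 N s).

Lemma zeta0_approx (s : C) : 0 < Re s -> s <> 1%C ->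
  forall N, Cmod (Z0 N s - zeta0 s)%C <= Cmod s / Re s * Rpower (INR (S N)) (- Re s).
Proof.
  intros Hs H1.
  assert (B0 : is_lim_seq (fun N => Cmod s / Re s * Rpower (INR (S N)) (- Re s)) 0).
  { replace (Finite 0) with (Rbar_mult (Cmod s / Re s) 0) by (simpl; f_equal; ring).
    apply is_lim_seq_scal_l, Rpower_INR_lim, Hs. }
  destruct (telescope_limit (fun N => Z0 N s) _ B0 (fun n => Z0_step n s Hs H1)) as [l Hl].
  replace (zeta0 s) with l; [exact Hl|]. symmetry. apply is_Clim_unique. eapply is_Clim_bound; [exact B0|exact Hl].
Qed.

(** The approximation at [N = 0], where [Z0 0 s] is just [1 / (s - 1)]. This linear growth in [|s|]
    is the only bound on the size of zeta used in the moment argument. *)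
Lemma zeta0_bound (s : C) : 0 < Re s -> s <> 1%C -> Cmod (zeta0 s) <= Cmod s / Re s + / Cmod (s - 1).
Proof.
  intros Hs H1. assert (A := zeta0_approx s Hs H1 O). unfold Z0 in A. cbn [csum INR] in A.
  replace (Rpower 1 (- Re s)) with 1 in A by (unfold Rpower; rewrite ln_1, Rmult_0_r, exp_0; reflexivity).
  rewrite Rcpow_one in A. assert (N1 := Cminus_neq0 _ _ H1).
  replace (0 + 1 / (s - 1))%C with (/ (s - 1))%C in A by (field; exact N1).
  rewrite <- Cmod_inv by exact N1.
  replace (zeta0 s) with (/ (s - 1) - (/ (s - 1) - zeta0 s))%C by ring.
  eapply Rle_trans; [apply Cmod_tri_minus|]. lra.
Qed.

Lemma hol_Z0 N (s : C) : s <> 1%C -> hol (Z0 N) s.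
Proof.
  intros H1. unfold Z0. apply (hol_plus (fun s => csum (fun n => Rcpow (INR (S n)) (- s)) N)).
  - apply (hol_csum (fun n s => Rcpow (INR (S n)) (- s))). intros n. apply hol_Rcpow, hol_opp, hol_id.
  - apply hol_div; [|apply hol_minus; [apply hol_id|apply hol_const]|apply Cminus_neq0, H1].
    apply hol_Rcpow. apply hol_minus; [apply hol_const|apply hol_id].
Qed.

Lemma ball_neq (s h a : C) : Cmod h < Cmod (s - a) -> (s + h)%C <> a.
Proof.
  intros H E. assert (h = - (s - a))%C by (rewrite <- E; ring). rewrite H0, Cmod_opp in H. lra.
Qed.

Lemma hol_zeta0 (s : C) : 0 < Re s -> s <> 1%C -> hol zeta0 s.
Proof.
  intros Hs H1. assert (N1 := proj1 (Cmod_gt_0 _) (Cminus_neq0 _ _ H1)).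
  set (r := Rmin (Re s / 2) (Cmod (s - 1))). assert (Hr : 0 < r) by (apply Rmin_pos; lra).
  assert (K : forall h : C, Cmod h < r -> Re s / 2 < Re (s + h) /\ (s + h)%C <> 1%C).
  { intros h Hh. split.
    - replace (Re (s + h)) with (Re s + Re h) by reflexivity.
      assert (Cmod h < Re s / 2) by (eapply Rlt_le_trans; [exact Hh|apply Rmin_l]).
      generalize (re_le_Cmod h); intros R1. apply Rabs_le_between in R1. lra.
    - apply ball_neq. eapply Rlt_le_trans; [exact Hh|apply Rmin_r]. }
  apply (hol_unif_limit Z0 zeta0 s r Hr).
  - intros n h Hh. apply hol_Z0, K, Hh.
  - intros eps He.
    set (A := (Cmod s + r) / (Re s / 2)).
    assert (HA : 0 < A) by (unfold A; apply Rdiv_lt_0_compat; [generalize (Cmod_ge_0 s)|]; lra).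
    assert (L := Rpower_INR_lim (Re s / 2) ltac:(lra)). apply is_lim_seq_spec in L.
    assert (P : 0 < eps / A) by (apply Rdiv_lt_0_compat; lra).
    destruct (L (mkposreal _ P)) as [N HN]. exists N. intros n h Hn Hh. specialize (HN n Hn). simpl pos in HN.
    rewrite Rminus_0_r, Rabs_pos_eq in HN by (left; apply exp_pos).
    destruct (K h Hh) as [K1 K2].
    eapply Rle_trans; [apply zeta0_approx; [lra|exact K2]|].
    apply Rle_trans with (A * (eps / A)); [|right; field; lra].
    apply Rmult_le_compat; [apply Rle_mult_inv_pos; [apply Cmod_ge_0|lra]|left; apply exp_pos| |].
    + unfold A, Rdiv. apply Rmult_le_compat; [apply Cmod_ge_0|apply Rlt_le, Rinv_0_lt_compat; lra| |].
      * eapply Rle_trans; [apply Cmod_triangle|]. lra.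
      * apply Rinv_le_contravar; lra.
    + eapply Rle_trans; [|left; exact HN]. apply Rle_Rpower; [apply INR_S_ge1|lra].
Qed.

Lemma zeta0_dirichlet s : 1 < Re s -> is_Clim (csum (fun n => Rcpow (INR (S n)) (- s))) (zeta0 s).
Proof.
  intros Hs. assert (H1 : s <> 1%C) by (intros E; rewrite E in Hs; simpl in Hs; lra).
  assert (N1 := Cminus_neq0 _ _ H1).
  assert (A : is_Clim (fun N => Z0 N s) (zeta0 s)).
  { eapply is_Clim_bound; [|apply zeta0_approx; [lra|exact H1]].
    replace (Finite 0) with (Rbar_mult (Cmod s / Re s) 0) by (simpl; f_equal; ring).
    apply is_lim_seq_scal_l, Rpower_INR_lim; lra. }
  assert (B : is_Clim (fun N => (-1) * (Rcpow (INR (S N)) (1 - s) / (s - 1)))%C 0).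
  { eapply is_Clim_bound with (b := fun N => / Cmod (s - 1) * Rpower (INR (S N)) (- (Re s - 1))).
    - replace (Finite 0) with (Rbar_mult (/ Cmod (s - 1)) 0) by (simpl; f_equal; ring).
      apply is_lim_seq_scal_l, Rpower_INR_lim; lra.
    - intros n. right. replace ((-1) * (Rcpow (INR (S n)) (1 - s) / (s - 1)) - 0)%C with (- (Rcpow (INR (S n)) (1 - s) / (s - 1)))%C by ring.
      rewrite Cmod_opp, Cmod_div, Cmod_Rcpow by exact N1. unfold Rdiv. rewrite Rmult_comm. f_equal. f_equal. destruct s; csimp; ring. }
  assert (C := is_Clim_plus _ _ _ _ A B). rewrite Cplus_0_r in C.
  eapply is_Clim_ext; [|exact C]. intros n. unfold Z0. simpl. ring.
Qed.

Lemma zeta0_tail s N : 1 < Re s -> (1 <= N)%nat ->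
  Cmod (zeta0 s - csum (fun n => Rcpow (INR (S n)) (- s)) N)%C <= (Cmod s / Re s + / Cmod (s - 1)) * Rpower (INR (S N)) (- (Re s - 1)).
Proof.
  intros Hs HN. assert (H1 : s <> 1%C) by (intros E; rewrite E in Hs; simpl in Hs; lra).
  assert (N1 := Cminus_neq0 _ _ H1).
  assert (A := zeta0_approx s ltac:(lra) H1 N). unfold Z0 in A.
  replace (zeta0 s - csum (fun n => Rcpow (INR (S n)) (- s)) N)%C with
   (- (csum (fun n => Rcpow (INR (S n)) (- s)) N + Rcpow (INR (S N)) (1 - s) / (s - 1) - zeta0 s) + Rcpow (INR (S N)) (1 - s) / (s - 1))%C by ring.
  eapply Rle_trans; [apply Cmod_triangle|]. rewrite Cmod_opp, Cmod_div, Cmod_Rcpow by exact N1.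
  replace (Re (1 - s)) with (- (Re s - 1)) by (destruct s; csimp; ring).
  rewrite Rmult_plus_distr_r. apply Rplus_le_compat; [|unfold Rdiv; lra].
  eapply Rle_trans; [exact A|]. apply Rmult_le_compat_l; [apply Rle_mult_inv_pos; [apply Cmod_ge_0|lra]|].
  apply Rle_Rpower; [apply INR_S_ge1|lra].
Qed.

(** * The reciprocal of the Gamma function *)

(* Inverse of the n-th term of Euler's limit; its limit is entire. *)
Definition rg (n : nat) (z : C) : C :=
  (rising z n * / RtoC (INR (fact n)) * Rcpow (INR n) (- z))%C.

Lemma ln_ratio_bounds n : 0 < ln (INR (S (S n))) - ln (INR (S n)) - / INR (S (S n)) + / (INR (S n) * INR (S (S n))) /\
  0 <= ln (INR (S (S n))) - ln (INR (S n)) - / INR (S (S n)) <= / (INR (S n) * INR (S (S n))).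
Proof.
  set (x := INR (S n)). assert (Hx : 1 <= x) by apply INR_S_ge1.
  replace (INR (S (S n))) with (x + 1) by (rewrite (S_INR (S n)); reflexivity).
  assert (A : ln (x + 1) - ln x <= / x).
  { rewrite <- ln_div by lra.
    assert (L := exp_ineq1_le (/ x)). rewrite <- (ln_exp (/ x)).
    apply ln_le; [apply Rdiv_lt_0_compat; lra|]. replace ((x + 1) / x) with (1 + / x) by (field; lra). lra. }
  assert (B : / (x + 1) <= ln (x + 1) - ln x).
  { assert (L := exp_ineq1_le (- / (x + 1))).
    assert (E : ln (x / (x + 1)) <= - / (x + 1)).
    { rewrite <- (ln_exp (- / (x + 1))). apply ln_le; [apply Rdiv_lt_0_compat; lra|].
      replace (x / (x + 1)) with (1 + - / (x + 1)) by (field; lra). exact L. }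
    rewrite ln_div in E by lra. lra. }
  assert (P : 0 < / (x * (x + 1))) by (apply Rinv_0_lt_compat; nra).
  assert (Q : / x - / (x + 1) = / (x * (x + 1))) by (field; lra).
  repeat split; lra.
Qed.

Lemma INR_fact_neq0_C n : RtoC (INR (fact n)) <> 0%C.
Proof. intros E. apply RtoC_inj in E. apply (INR_fact_neq_0 n E). Qed.

(** The ratio of consecutive terms is split into a Weierstrass factor [(1 + z / m) e ^ (- z / m)]
    with [m = n + 2], and the exponential of [- z] times [ln (m / (m - 1)) - 1 / m]. Both differ
    from 1 by [O(1 / m ^ 2)] on bounded sets. *)
Lemma rg_step n z : rg (S (S n)) z = (rg (S n) z *
   ((1 + z * / RtoC (INR (S (S n)))) * Cexp (- z * RtoC (/ INR (S (S n)))) *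
     Cexp (- z * RtoC (ln (INR (S (S n))) - ln (INR (S n)) - / INR (S (S n))))))%C.
Proof.
  unfold rg. rewrite <- (Cmult_assoc _ (Cexp _)), <- Cexp_plus.
  replace (- z * RtoC (/ INR (S (S n))) + - z * RtoC (ln (INR (S (S n))) - ln (INR (S n)) - / INR (S (S n))))%C
    with (- z * RtoC (ln (INR (S (S n)))) + z * RtoC (ln (INR (S n))))%C.
  2: { rewrite !RtoC_minus. ring. }
  rewrite Cexp_plus. change (Cexp (- z * RtoC (ln (INR (S (S n)))))) with (Rcpow (INR (S (S n))) (- z)).
  change (Cexp (z * RtoC (ln (INR (S n))))) with (Rcpow (INR (S n)) z).
  rewrite (Rcpow_opp (INR (S n))). assert (N0 := Rcpow_neq0 (INR (S n)) z).
  change (rising z (S (S n))) with (rising z (S n) * (z + RtoC (INR (S (S n)))))%C.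
  replace (RtoC (INR (fact (S (S n))))) with (RtoC (INR (S (S n))) * RtoC (INR (fact (S n))))%C.
  2: { rewrite <- RtoC_mult, <- mult_INR. reflexivity. }
  assert (N1 := INR_fact_neq0_C (S n)).
  assert (N2 : RtoC (INR (S (S n))) <> 0%C) by (intros E; apply RtoC_inj in E; generalize (INR_S_pos (S n)); lra).
  field. auto.
Qed.

Lemma exp_le_mono a b : a <= b -> exp a <= exp b.
Proof. intros [H|H]; [left; apply exp_increasing, H|rewrite H; lra]. Qed.

Lemma rg_ratio_bound R : 0 <= R -> exists K, 0 <= K /\ forall n z, Cmod z <= R ->
  Cmod (((1 + z * / RtoC (INR (S (S n)))) * Cexp (- z * RtoC (/ INR (S (S n)))) *
     Cexp (- z * RtoC (ln (INR (S (S n))) - ln (INR (S n)) - / INR (S (S n))))) - 1)%C <= K * / (INR (S n) * INR (S (S n))).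
Proof.
  intros HR.
  set (K1 := R ^ 2 * ((1 + R) * exp R + 1)). set (K2 := R * exp R).
  assert (HK1 : 0 <= K1).
  { apply Rmult_le_pos; [apply pow2_ge_0|]. assert (0 <= (1 + R) * exp R) by (apply Rmult_le_pos; [lra|left; apply exp_pos]). lra. }
  assert (HK2 : 0 <= K2) by (apply Rmult_le_pos; [exact HR|left; apply exp_pos]).
  assert (HK12 : 0 <= K1 * K2) by (apply Rmult_le_pos; assumption).
  exists (K1 + K2 + K1 * K2). split; [lra|]. intros n z Hz.
  destruct (ln_ratio_bounds n) as [_ [L1 L2]].
  set (e := ln (INR (S (S n))) - ln (INR (S n)) - / INR (S (S n))) in *.
  set (m := INR (S (S n))) in *. set (x := INR (S n)) in *.
  assert (Hx : 1 <= x) by apply INR_S_ge1.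
  assert (Em : m = x + 1) by (unfold m; rewrite (S_INR (S n)); reflexivity).
  set (d := / (x * m)) in *.
  assert (Hd : 0 < d <= 1).
  { unfold d. split; [apply Rinv_0_lt_compat; nra|]. rewrite <- Rinv_1. apply Rinv_le_contravar; nra. }
  set (w := (- z * RtoC (/ m))%C).
  assert (Hm : 0 < / m <= 1). { split; [apply Rinv_0_lt_compat; lra|]. rewrite <- Rinv_1. apply Rinv_le_contravar; lra. }
  assert (Hm2 : / m * / m <= d).
  { unfold d. rewrite <- Rinv_mult. apply Rinv_le_contravar; nra. }
  assert (Cw : Cmod w = Cmod z * / m).
  { unfold w. rewrite Cmod_mult, Cmod_opp, Cmod_R, Rabs_pos_eq by lra. reflexivity. }
  assert (Z0 := Cmod_ge_0 z). assert (W0 := Cmod_ge_0 w).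
  assert (Hw : Cmod w <= R) by (rewrite Cw; nra).
  assert (Hw2 : Cmod w ^ 2 <= R ^ 2 * d).
  { rewrite Cw. replace ((Cmod z * / m) ^ 2) with (Cmod z ^ 2 * (/ m * / m)) by ring.
    apply Rmult_le_compat; [apply pow2_ge_0|nra|apply pow_incr; lra|exact Hm2]. }
  assert (A : Cmod ((1 - w) * Cexp w - 1)%C <= K1 * d).
  { replace ((1 - w) * Cexp w - 1)%C with ((1 - w) * (Cexp w - 1 - w) - w * w)%C by ring.
    eapply Rle_trans; [apply Cmod_tri_minus|]. rewrite !Cmod_mult.
    assert (B := Cexp_sub2_bound w).
    assert (B2 : Cmod (Cexp w - 1 - w) <= (R ^ 2 * d) * exp R).
    { eapply Rle_trans; [exact B|]. apply Rmult_le_compat; [apply pow2_ge_0|left; apply exp_pos|exact Hw2|apply exp_le_mono, Hw]. }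
    assert (B3 : Cmod (1 - w) <= 1 + R) by (eapply Rle_trans; [apply Cmod_tri_minus|]; rewrite Cmod_1; lra).
    assert (B4 : Cmod (1 - w) * Cmod (Cexp w - 1 - w) <= (1 + R) * (R ^ 2 * d * exp R)) by (apply Rmult_le_compat; try apply Cmod_ge_0; assumption).
    unfold K1. simpl in Hw2. nra. }
  assert (B : Cmod (Cexp (- z * RtoC e) - 1)%C <= K2 * d).
  { eapply Rle_trans; [apply Cexp_sub1_bound|]. rewrite Cmod_mult, Cmod_opp, Cmod_R, Rabs_pos_eq by lra.
    assert (Cmod z * e <= R * d) by nra. assert (Cmod z * e <= R) by nra.
    assert (0 <= Cmod z * e) by nra.
    replace (K2 * d) with (R * d * exp R) by (unfold K2; ring).
    apply Rmult_le_compat; [assumption|left; apply exp_pos|assumption|apply exp_le_mono; assumption]. }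
  replace (1 + z * / RtoC m)%C with (1 - w)%C.
  2: { unfold w. rewrite RtoC_inv by lra. ring. }
  set (P := ((1 - w) * Cexp w)%C) in *. set (Q := Cexp (- z * RtoC e)) in *.
  replace (P * Q - 1)%C with ((P - 1) + ((Q - 1) + (P - 1) * (Q - 1)))%C by ring.
  eapply Rle_trans; [apply Cmod_triangle|]. eapply Rle_trans; [apply Rplus_le_compat_l, Cmod_triangle|]. rewrite Cmod_mult.
  assert (Cmod (P - 1) * Cmod (Q - 1) <= (K1 * d) * (K2 * d)) by (apply Rmult_le_compat; try apply Cmod_ge_0; assumption).
  assert (K1 * d * (K2 * d) <= K1 * K2 * d).
  { replace (K1 * d * (K2 * d)) with (K1 * K2 * d * d) by ring. rewrite <- (Rmult_1_r (K1 * K2 * d)) at 2.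
    apply Rmult_le_compat_l; [|lra]. apply Rmult_le_pos; [apply Rmult_le_pos; assumption|lra]. }
  lra.
Qed.

Lemma inv_step n : / (INR (S n) * INR (S (S n))) = / INR (S n) - / INR (S (S n)).
Proof. rewrite (S_INR (S n)). generalize (INR_S_pos n). intros. field. lra. Qed.

Lemma rg_1 z : rg 1 z = (z * (z + 1))%C.
Proof. unfold rg. cbn [rising fact Nat.mul Nat.add INR]. rewrite Rcpow_one. field. Qed.

(** The ratios differ from 1 by at most [K] times a telescoping difference of reciprocals, so the
    terms stay below a fixed multiple of [exp K] and their increments telescope as well. *)
Lemma rg_conv R : 0 <= R -> exists B, 0 <= B /\ forall z, Cmod z <= R -> exists l,
  forall n, Cmod (rg (S n) z - l)%C <= B * / INR (S n).
Proof.
  intros HR. destruct (rg_ratio_bound R HR) as [K [HK Hb]].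
  set (A := R * (R + 1) * exp K).
  assert (HA : 0 <= A) by (unfold A; generalize (exp_pos K); intros; apply Rmult_le_pos; nra).
  exists (A * K). split; [apply Rmult_le_pos; assumption|]. intros z Hz.
  assert (Bd : forall n, Cmod (rg (S n) z) <= R * (R + 1) * exp (K * (1 - / INR (S n)))).
  { induction n.
    - rewrite rg_1, Cmod_mult. simpl INR. rewrite Rinv_1, Rminus_diag, Rmult_0_r, exp_0, Rmult_1_r.
      apply Rmult_le_compat; try apply Cmod_ge_0; [exact Hz|]. eapply Rle_trans; [apply Cmod_triangle|]. rewrite Cmod_1; lra.
    - rewrite rg_step, Cmod_mult. specialize (Hb n z Hz).
      match type of Hb with context [Cminus ?X _] => set (q := X) in * end.
      assert (Cmod q <= exp (K * / (INR (S n) * INR (S (S n))))).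
      { eapply Rle_trans; [|apply exp_ineq1_le]. replace q with (1 + (q - 1))%C by ring.
        eapply Rle_trans; [apply Cmod_triangle|]. rewrite Cmod_1. lra. }
      rewrite inv_step in H.
      replace (K * (1 - / INR (S (S n)))) with (K * (1 - / INR (S n)) + K * (/ INR (S n) - / INR (S (S n)))) by ring.
      rewrite exp_plus, <- Rmult_assoc. apply Rmult_le_compat; try apply Cmod_ge_0; assumption. }
  apply telescope_limit with (b := fun n => A * K * / INR (S n)).
  - replace (Finite 0) with (Rbar_mult (A * K) 0) by (simpl; f_equal; ring).
    apply is_lim_seq_scal_l.
    apply (is_lim_seq_inv (fun n => INR (S n)) p_infty); [apply (is_lim_seq_incr_1 INR), is_lim_seq_INR|discriminate].
  - intros n. rewrite rg_step. specialize (Hb n z Hz).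
    match type of Hb with context [Cminus ?X _] => set (q := X) in * end.
    replace (rg (S n) z * q - rg (S n) z)%C with (rg (S n) z * (q - 1))%C by ring. rewrite Cmod_mult, <- Rmult_minus_distr_l, <- inv_step.
    replace (A * K * / (INR (S n) * INR (S (S n)))) with (A * (K * / (INR (S n) * INR (S (S n))))) by ring.
    apply Rmult_le_compat; try apply Cmod_ge_0; [|exact Hb].
    eapply Rle_trans; [apply Bd|]. unfold A. apply Rmult_le_compat_l; [nra|]. apply exp_le_mono.
    assert (0 < / INR (S n)) by apply Rinv_0_lt_compat, INR_S_pos. nra.
Qed.

Lemma is_Clim_invINR u l B : (forall n, Cmod (u n - l)%C <= B * / INR (S n)) -> is_Clim u l.
Proof.
  intros H. eapply is_Clim_bound; [|exact H].
  replace (Finite 0) with (Rbar_mult B 0) by (simpl; f_equal; ring).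
  apply is_lim_seq_scal_l.
  apply (is_lim_seq_inv (fun n => INR (S n)) p_infty); [apply (is_lim_seq_incr_1 INR), is_lim_seq_INR|discriminate].
Qed.

Definition rG (z : C) : C := Clim (fun n => rg (S n) z).

Lemma rG_approx R : 0 <= R -> exists B, 0 <= B /\ forall z, Cmod z <= R ->
  forall n, Cmod (rg (S n) z - rG z)%C <= B * / INR (S n).
Proof.
  intros HR. destruct (rg_conv R HR) as [B [HB H]]. exists B. split; [exact HB|]. intros z Hz.
  destruct (H z Hz) as [l Hl]. replace (rG z) with l; [exact Hl|]. symmetry. apply is_Clim_unique. eapply is_Clim_invINR, Hl.
Qed.

Lemma rG_lim z : is_Clim (fun n => rg (S n) z) (rG z).
Proof. destruct (rG_approx (Cmod z) (Cmod_ge_0 z)) as [B [_ H]]. eapply is_Clim_invINR, H. lra. Qed.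

Lemma hol_rising n z : hol (fun z => rising z n) z.
Proof.
  induction n; simpl; [apply hol_id|]. apply (hol_mult (fun z => rising z n)); [exact IHn|].
  apply hol_plus; [apply hol_id|apply hol_const].
Qed.

Lemma hol_rG z : hol rG z.
Proof.
  apply (hol_unif_limit (fun n => rg (S n)) rG z 1); [lra| |].
  - intros n h _. unfold rg. apply (hol_mult (fun z => rising z (S n) * / INR (fact (S n)))%C).
    + apply (hol_mult (fun z => rising z (S n))); [apply hol_rising|apply hol_const].
    + apply hol_Rcpow, hol_opp, hol_id.
  - intros eps He. destruct (rG_approx (Cmod z + 1)) as [B [HB H]]; [generalize (Cmod_ge_0 z); lra|].
    destruct (is_Clim_invINR (fun n => RtoC (B * / INR (S n))) 0 B) with (eps := eps) as [N HN]; [|exact He|].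
    { intros n. rewrite Cminus_0_r, Cmod_R, Rabs_pos_eq; [lra|]. apply Rle_mult_inv_pos; [exact HB|apply INR_S_pos]. }
    exists N. intros n h Hn Hh. specialize (HN n Hn).
    rewrite Cminus_0_r, Cmod_R in HN. eapply Rle_trans; [apply H|eapply Rle_trans; [apply Rle_abs|exact HN]].
    eapply Rle_trans; [apply Cmod_triangle|lra].
Qed.

Lemma rising_shift n z : (z * rising (z + 1) n = rising z (S n))%C.
Proof.
  induction n; [simpl; ring|]. change (rising (z + 1) (S n)) with (rising (z + 1) n * (z + 1 + RtoC (INR (S n))))%C.
  rewrite Cmult_assoc, IHn. change (rising z (S (S n))) with (rising z (S n) * (z + RtoC (INR (S (S n)))))%C.
  rewrite (S_INR (S n)), RtoC_plus. ring.
Qed.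

Lemma rG_shift z : rG z = (z * rG (z + 1))%C.
Proof.
  apply (is_Clim_inj (fun n => z * rg (S n) (z + 1))%C); [|apply is_Clim_scal, rG_lim].
  assert (A : is_Clim (fun n => 1 + (z + 1) * RtoC (/ INR (S n)))%C (1 + (z + 1) * 0)).
  { apply is_Clim_plus; [apply is_Clim_const|]. apply is_Clim_scal.
    apply (is_Clim_invINR _ _ 1). intros n. rewrite Cminus_0_r, Cmod_R, Rabs_pos_eq; [lra|]. left; apply Rinv_0_lt_compat, INR_S_pos. }
  replace (rG z) with (rG z * (1 + (z + 1) * 0))%C by ring.
  eapply is_Clim_ext; [|apply is_Clim_mult; [apply rG_lim|exact A]].
  intros n. cbv beta. unfold rg.
  rewrite !Cmult_assoc, rising_shift. change (rising z (S (S n))) with (rising z (S n) * (z + RtoC (INR (S (S n)))))%C.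
  replace (- (z + 1))%C with (- z + - (1))%C by ring. rewrite Rcpow_plus, (Rcpow_opp _ 1), Rcpow_1 by apply INR_S_pos.
  rewrite (S_INR (S n)), RtoC_plus, RtoC_inv by (generalize (INR_S_pos n); lra).
  assert (N2 : RtoC (INR (S n)) <> 0%C) by (intros E; apply RtoC_inj in E; generalize (INR_S_pos n); lra).
  assert (N1 := INR_fact_neq0_C (S n)). field. auto.
Qed.

Lemma rising_neq0 n z : 0 < Re z -> rising z n <> 0%C.
Proof.
  intros Hz. assert (K : forall x : R, 0 <= x -> (z + RtoC x)%C <> 0%C).
  { intros x Hx E. apply (f_equal Re) in E. destruct z; csimp. lra. }
  induction n; [simpl; specialize (K 0 (Rle_refl _)); rewrite Cplus_0_r in K; exact K|].
  apply Cmult_neq_0; [exact IHn|]. apply K, pos_INR.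
Qed.

Lemma rg_neq0 n z : 0 < Re z -> rg n z <> 0%C.
Proof.
  intros Hz. unfold rg. apply Cmult_neq_0; [|apply Rcpow_neq0]. apply Cmult_neq_0; [apply rising_neq0, Hz|].
  apply Cinv_neq_0, INR_fact_neq0_C.
Qed.

(** From the index [n0] on, the remaining factors of the product lose at most half of the modulus,
    because their total deviation from 1 is at most [K / (n0 + 1) <= 1 / 2]. *)
Lemma rG_neq0 z : 0 < Re z -> rG z <> 0%C.
Proof.
  intros Hz. destruct (rg_ratio_bound (Cmod z) (Cmod_ge_0 z)) as [K [HK Hb]].
  destruct (INR_unbounded (2 * K)) as [n0 Hn0].
  assert (H0 : K * / INR (S n0) <= / 2).
  { apply Rmult_le_reg_r with (INR (S n0)); [apply INR_S_pos|]. rewrite Rmult_assoc, Rinv_l by (generalize (INR_S_pos n0); lra).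
    rewrite S_INR. lra. }
  set (c := Cmod (rg (S n0) z)). assert (Hc : 0 < c) by apply Cmod_gt_0, rg_neq0, Hz.
  assert (L : forall k, c * (1 - K * (/ INR (S n0) - / INR (S (n0 + k)))) <= Cmod (rg (S (n0 + k)) z)).
  { induction k.
    - rewrite Nat.add_0_r, Rminus_diag, Rmult_0_r, Rminus_0_r, Rmult_1_r. unfold c. lra.
    - replace (n0 + S k)%nat with (S (n0 + k)) by lia. rewrite rg_step, Cmod_mult. specialize (Hb (n0 + k)%nat z (Rle_refl _)).
      match type of Hb with context [Cminus ?X _] => set (q := X) in * end.
      rewrite inv_step in Hb. set (y := / INR (S (n0 + k)) - / INR (S (S (n0 + k)))) in *.
      set (x := / INR (S n0) - / INR (S (n0 + k))) in *.
      assert (Hq : 1 - K * y <= Cmod q).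
      { assert (T := Cmod_tri_rev 1 (q - 1)). replace (1 + (q - 1))%C with q in T by ring. rewrite Cmod_1 in T. lra. }
      replace (/ INR (S n0) - / INR (S (S (n0 + k)))) with (x + y) by (unfold x, y; ring).
      assert (Hx : 0 <= x).
      { unfold x. assert (/ INR (S (n0 + k)) <= / INR (S n0)); [|lra]. apply Rinv_le_contravar; [apply INR_S_pos|apply le_INR; lia]. }
      assert (Hy : 0 <= y).
      { unfold y. rewrite <- inv_step. left; apply Rinv_0_lt_compat, Rmult_lt_0_compat; apply INR_S_pos. }
      assert (Hxy : K * (x + y) <= / 2).
      { eapply Rle_trans; [|exact H0]. apply Rmult_le_compat_l; [exact HK|]. unfold x, y.
        assert (0 < / INR (S (S (n0 + k)))) by apply Rinv_0_lt_compat, INR_S_pos. lra. }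
      assert (0 <= K * x) by nra. assert (0 <= K * y) by nra.
      apply Rle_trans with (c * (1 - K * x) * (1 - K * y)).
      { rewrite Rmult_assoc. apply Rmult_le_compat_l; [lra|]. nra. }
      apply Rmult_le_compat; try assumption; [|lra]. apply Rmult_le_pos; lra. }
  assert (Lim := is_Clim_Cmod _ _ (rG_lim z)).
  intros E. rewrite E, Cmod_0 in Lim.
  assert (LE : Rbar_le (c / 2) 0).
  { apply (is_lim_seq_le (fun _ => c / 2) (fun n => Cmod (rg (S (n + n0)) z))).
    - intros k. replace (k + n0)%nat with (n0 + k)%nat by lia. eapply Rle_trans; [|apply L].
      assert (0 < / INR (S (n0 + k))) by apply Rinv_0_lt_compat, INR_S_pos.
      assert (0 <= K * / INR (S (n0 + k))) by (apply Rmult_le_pos; lra). unfold Rdiv. apply Rmult_le_compat_l; lra.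
    - apply is_lim_seq_const.
    - apply (is_lim_seq_incr_n (fun n => Cmod (rg (S n) z)) n0). exact Lim. }
  simpl in LE. lra.
Qed.

Lemma Cgamma_rG z : 0 < Re z -> is_Clim (fun n => / rg (S n) z)%C (Cgamma z) /\ Cgamma z = (/ rG z)%C.
Proof.
  intros Hz. assert (L := is_Clim_inv _ _ (rG_lim z) (rG_neq0 z Hz)).
  assert (E : Cgamma z = (/ rG z)%C); [|rewrite E; split; [exact L|reflexivity]].
  apply is_Clim_unique with (u := fun n => (RtoC (INR (fact n)) * Rcpow (INR n) z / rising z n)%C).
  apply (is_Clim_incr _ _ 1). eapply is_Clim_ext; [|exact L]. intros n. cbv beta. rewrite Nat.add_1_r.
  unfold rg. rewrite Rcpow_opp. field. split; [apply rising_neq0, Hz|split; [apply Rcpow_neq0|apply INR_fact_neq0_C]].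
Qed.

(** * Finite sums of reals *)

Fixpoint rsum (f : nat -> R) (N : nat) : R := match N with O => 0 | S n => rsum f n + f n end.

Lemma rsum_S f n : rsum f (S n) = rsum f n + f n.
Proof. reflexivity. Qed.

Lemma rsum_ext f g N : (forall n, (n < N)%nat -> f n = g n) -> rsum f N = rsum g N.
Proof. induction N; intros H; simpl; [reflexivity|]. rewrite IHN, H by auto. reflexivity. Qed.

Lemma rsum_plus f g N : rsum (fun n => f n + g n) N = rsum f N + rsum g N.
Proof. induction N; simpl; [ring|rewrite IHN; ring]. Qed.

Lemma rsum_scal c f N : rsum (fun n => c * f n) N = c * rsum f N.
Proof. induction N; simpl; [ring|rewrite IHN; ring]. Qed.

Lemma rsum_const c N : rsum (fun _ => c) N = INR N * c.
Proof. induction N; [simpl; ring|]. rewrite S_INR. simpl. rewrite IHN. ring. Qed.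

Lemma rsum_swap f M N : rsum (fun i => rsum (fun j => f i j) N) M = rsum (fun j => rsum (fun i => f i j) M) N.
Proof.
  induction M; simpl; [induction N; simpl; [reflexivity|rewrite <- IHN; ring]|].
  rewrite IHM, <- rsum_plus. reflexivity.
Qed.

Lemma rsum_split f a b : rsum f (a + b) = rsum f a + rsum (fun i => f (a + i)%nat) b.
Proof.
  induction b; [rewrite Nat.add_0_r; simpl; ring|]. rewrite Nat.add_succ_r. simpl. rewrite IHb. ring.
Qed.

Lemma rsum_le f g N : (forall n, (n < N)%nat -> f n <= g n) -> rsum f N <= rsum g N.
Proof. induction N; intros H; simpl; [lra|]. apply Rplus_le_compat; auto. Qed.

Lemma rsum_abs f N : Rabs (rsum f N) <= rsum (fun n => Rabs (f n)) N.
Proof. induction N; simpl; [rewrite Rabs_R0; lra|]. eapply Rle_trans; [apply Rabs_triang|]. lra. Qed.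

(** * The theta function *)

(* [cb N r] is the binomial coefficient C(2N, N + r). *)
Fixpoint cb (N : nat) (r : nat) : R :=
  match N with
  | O => match r with O => 1 | _ => 0 end
  | S n => match r with O => 2 * cb n 0 + 2 * cb n 1
           | S r' => cb n r' + 2 * cb n r + cb n (S r) end
  end.

Lemma cb_SS n r : cb (S n) (S r) = cb n r + 2 * cb n (S r) + cb n (S (S r)).
Proof. reflexivity. Qed.

Lemma cb_S0 n : cb (S n) 0 = 2 * cb n 0 + 2 * cb n 1.
Proof. reflexivity. Qed.

Lemma cb_ratio N : forall r, (INR N + INR r + 1) * cb N (S r) = (INR N - INR r) * cb N r.
Proof.
  induction N; intros r.
  - destruct r; simpl; ring.
  - destruct r.
    + rewrite cb_SS, cb_S0. assert (A := IHN 0%nat). assert (B := IHN 1%nat). rewrite S_INR. simpl INR in *.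
      nra.
    + rewrite !cb_SS. assert (A := IHN r). assert (B := IHN (S r)). assert (C := IHN (S (S r))).
      rewrite !S_INR in *. nra.
Qed.

Lemma cb_zero N : forall r, (N < r)%nat -> cb N r = 0.
Proof.
  induction N; intros r Hr; destruct r; try lia; [reflexivity|]. rewrite cb_SS, !IHN by lia. ring.
Qed.

Lemma cb_nonneg N : forall r, 0 <= cb N r.
Proof.
  induction N; intros r; destruct r; simpl; try lra; [generalize (IHN 0%nat) (IHN 1%nat)|generalize (IHN r) (IHN (S r)) (IHN (S (S r)))]; lra.
Qed.

Lemma cb_pos0 N : 0 < cb N 0.
Proof. induction N; [simpl; lra|]. rewrite cb_S0. generalize (cb_nonneg N 1). lra. Qed.

(** An even trigonometric polynomial in [2 y], with the coefficients of index [r] and [- r]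
    merged. *)
Definition cosT (c : nat -> R) (P : nat) (y : R) : R := c 0%nat + 2 * rsum (fun r => c (S r) * cos (2 * INR (S r) * y)) P.

(** Multiplication by [(2 cos y) ^ 2] acts on the coefficients by the recursion of [cb]; the
    truncation at [P] leaves two boundary terms, which vanish once [c] is 0 beyond [P]. *)
Lemma cosT_mul c c' y : c' 0%nat = 2 * c 0%nat + 2 * c 1%nat -> (forall r, c' (S r) = c r + 2 * c (S r) + c (S (S r))) ->
  forall P, (2 + 2 * cos (2 * y)) * cosT c P y = cosT c' P y + 2 * c P * cos (2 * INR (S P) * y) - 2 * c (S P) * cos (2 * INR P * y).
Proof.
  intros H0 H1. unfold cosT. induction P.
  - simpl. rewrite H0, !Rmult_1_r, Rmult_0_r, Rmult_0_l, cos_0. ring.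
  - rewrite !rsum_S.
    rewrite (Rmult_plus_distr_l 2 (rsum (fun r : nat => c (S r) * cos (2 * INR (S r) * y)) P)), <- (Rplus_assoc (c 0%nat)), Rmult_plus_distr_l, IHP.
    rewrite (H1 P).
    assert (E : 2 * cos (2 * y) * cos (2 * INR (S P) * y) = cos (2 * INR (S (S P)) * y) + cos (2 * INR P * y)).
    { replace (2 * INR (S (S P)) * y) with (2 * INR (S P) * y + 2 * y) by (rewrite (S_INR (S P)); ring).
      replace (2 * INR P * y) with (2 * INR (S P) * y - 2 * y) by (rewrite (S_INR P); ring).
      rewrite cos_plus, cos_minus. ring. }
    set (u := cos (2 * INR (S (S P)) * y)) in *. set (v := cos (2 * INR P * y)) in *. set (w := cos (2 * INR (S P) * y)) in *.
    apply Rminus_diag_uniq. transitivity (2 * c (S P) * (2 * cos (2 * y) * w - (u + v))); [ring|]. rewrite E. ring.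
Qed.

Lemma cos_pow_expand N y : forall P, (N <= P)%nat -> (2 * cos y) ^ (2 * N) = cosT (cb N) P y.
Proof.
  induction N; intros P HP.
  - simpl. unfold cosT. rewrite (rsum_ext _ (fun _ => 0)) by (intros; simpl; ring). rewrite rsum_const. simpl. ring.
  - destruct P as [|P]; [lia|].
    assert (M := cosT_mul (cb N) (cb (S N)) y eq_refl (fun r => eq_refl) (S P)).
    rewrite (cb_zero N (S P)), (cb_zero N (S (S P))) in M by lia.
    replace (2 * S N)%nat with (2 + 2 * N)%nat by lia. rewrite pow_add, (IHN (S P)) by lia.
    replace ((2 * cos y) ^ 2) with (2 + 2 * cos (2 * y)) by (rewrite cos_2a_cos; ring).
    rewrite M. ring.
Qed.

Lemma dirichlet_kernel p th : sin (th / 2) * (1 + 2 * rsum (fun k => cos (INR (S k) * th)) p) = sin (INR (2 * p + 1) * (th / 2)).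
Proof.
  induction p.
  - simpl. rewrite !Rmult_1_l. ring.
  - rewrite rsum_S, (Rmult_plus_distr_l 2), <- Rplus_assoc, Rmult_plus_distr_l, IHp.
    replace (INR (2 * S p + 1)) with (2 * INR (S p) + 1) by (rewrite plus_INR, mult_INR; simpl; ring).
    replace (INR (2 * p + 1)) with (2 * INR (S p) - 1) by (rewrite plus_INR, mult_INR, S_INR; simpl; ring).
    replace ((2 * INR (S p) + 1) * (th / 2)) with (INR (S p) * th + th / 2) by field.
    replace ((2 * INR (S p) - 1) * (th / 2)) with (INR (S p) * th - th / 2) by field.
    rewrite sin_plus, sin_minus. ring.
Qed.

Lemma sin_INR_PI r : sin (INR r * PI) = 0.
Proof. induction r; [simpl; rewrite Rmult_0_l; apply sin_0|]. rewrite S_INR, Rmult_plus_distr_r, Rmult_1_l, neg_sin, IHr. ring. Qed.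

(** The sum over [- p <= k <= p], folded by evenness; as a character sum modulo [2 p + 1] it detects
    the multiples of [2 p + 1]. *)
Definition Dk (p r : nat) : R := 1 + 2 * rsum (fun k => cos (2 * INR r * (PI * INR (S k) / INR (2 * p + 1)))) p.

Lemma Dk_val p j i : (i < 2 * p + 1)%nat -> Dk p (j * (2 * p + 1) + i) = if Nat.eqb i 0 then INR (2 * p + 1) else 0.
Proof.
  intros Hi. set (m := (2 * p + 1)%nat) in *.
  assert (Hm : 0 < INR m) by (apply lt_0_INR; unfold m; lia).
  assert (E : Dk p (j * m + i) = Dk p i).
  { unfold Dk. do 2 f_equal. apply rsum_ext. intros k _. fold m.
    replace (2 * INR (j * m + i) * (PI * INR (S k) / INR m)) with (2 * INR i * (PI * INR (S k) / INR m) + 2 * INR (j * S k) * PI).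
    2: { rewrite plus_INR, !mult_INR. field. lra. }
    apply cos_period. }
  rewrite E. destruct (Nat.eqb_spec i 0) as [->|Hi0].
  - unfold Dk. rewrite (rsum_ext _ (fun _ => 1)).
    2: { intros. cbn [INR]. rewrite Rmult_0_r, Rmult_0_l. apply cos_0. }
    rewrite rsum_const. unfold m. rewrite plus_INR, mult_INR. simpl. ring.
  - assert (K := dirichlet_kernel p (2 * INR i * PI / INR m)).
    replace (2 * INR i * PI / INR m / 2) with (INR i * PI / INR m) in K by (field; lra).
    replace (INR (2 * p + 1) * (INR i * PI / INR m)) with (INR i * PI) in K by (fold m; field; lra).
    rewrite sin_INR_PI in K. apply Rmult_integral in K. destruct K as [K|K].
    + exfalso. assert (0 < sin (INR i * PI / INR m)); [|lra].
      assert (0 < INR i) by (apply lt_0_INR; lia). assert (INR i < INR m) by (apply lt_INR; lia). assert (P := PI_RGT_0).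
      apply sin_gt_0; [apply Rdiv_lt_0_compat; nra|]. apply Rlt_div_l; [lra|]. nra.
    + unfold Dk. rewrite <- K. do 2 f_equal. apply rsum_ext. intros k _. f_equal. fold m. field. lra.
Qed.

Lemma rsum_blocks (f : nat -> R) m J : (0 < m)%nat ->
  (forall j i, (0 < i < m)%nat -> f (j * m + i)%nat = 0) ->
  rsum (fun r => f (S r)) (J * m) = rsum (fun j => f (S j * m)%nat) J.
Proof.
  intros Hm H. induction J; [reflexivity|].
  replace (S J * m)%nat with (J * m + m)%nat by lia. rewrite rsum_split, IHJ, rsum_S. f_equal.
  destruct m as [|m]; [lia|]. rewrite rsum_S.
  rewrite (rsum_ext _ (fun _ => 0)), rsum_const, Rmult_0_r, Rplus_0_l.
  - f_equal. lia.
  - intros i Hi. replace (S (J * S m + i)) with (J * S m + S i)%nat by lia. apply H. lia.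
Qed.

(* Polya's proof of the theta identity: expand [(2 cos y) ^ (2 N)] at the points
   [pi k / (2 p + 1)] and sum over [k]; with [p] of order [sqrt N] both sides
   converge to theta series. *)
Lemma polya_identity N p J : (N <= J * (2 * p + 1))%nat ->
  1 + 2 * rsum (fun k => cos (PI * INR (S k) / INR (2 * p + 1)) ^ (2 * N)) p =
  INR (2 * p + 1) * cb N 0 / 4 ^ N * (1 + 2 * rsum (fun j => cb N (S j * (2 * p + 1)) / cb N 0) J).
Proof.
  intros HJ. set (m := (2 * p + 1)%nat) in *. set (P := (J * m)%nat) in *.
  assert (H4 : 4 ^ N <> 0) by (apply pow_nonzero; lra). assert (Hc := cb_pos0 N).
  apply (Rmult_eq_reg_l (4 ^ N)); [|exact H4].
  transitivity (cosT (cb N) P 0 + 2 * rsum (fun k => cosT (cb N) P (PI * INR (S k) / INR m)) p).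
  - rewrite <- (cos_pow_expand N 0 P HJ), cos_0, Rmult_1_r.
    rewrite (rsum_ext (fun k => cosT (cb N) P (PI * INR (S k) / INR m)) (fun k => 4 ^ N * cos (PI * INR (S k) / INR m) ^ (2 * N))).
    2: { intros k _. rewrite <- (cos_pow_expand N _ P HJ), Rpow_mult_distr, (pow_mult 2). replace (2 ^ 2) with 4 by ring. reflexivity. }
    rewrite rsum_scal, (pow_mult 2). replace (2 ^ 2) with 4 by ring. ring.
  - unfold cosT. rewrite rsum_plus, rsum_const, rsum_scal, rsum_swap.
    rewrite (rsum_ext (fun r => cb N (S r) * cos (2 * INR (S r) * 0)) (fun r => cb N (S r))).
    2: { intros. rewrite Rmult_0_r, cos_0. ring. }
    rewrite (rsum_ext (fun j => rsum (fun i => cb N (S j) * cos (2 * INR (S j) * (PI * INR (S i) / INR m))) p) (fun j => cb N (S j) * rsum (fun i => cos (2 * INR (S j) * (PI * INR (S i) / INR m))) p)).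
    2: { intros. apply rsum_scal. }
    assert (B := rsum_blocks (fun r => cb N r * Dk p r) m J ltac:(unfold m; lia)). cbv beta in B.
    rewrite (rsum_ext (fun j => cb N (S j * m) * Dk p (S j * m)) (fun j => INR m * cb N 0 * (cb N (S j * m) / cb N 0))) in B.
    2: { intros j _. replace (S j * m)%nat with (S j * m + 0)%nat at 2 by lia. unfold m at 2. rewrite Dk_val by lia. simpl Nat.eqb. cbv iota. fold m. field. lra. }
    rewrite rsum_scal in B.
    replace (4 ^ N * (INR m * cb N 0 / 4 ^ N * (1 + 2 * rsum (fun j => cb N (S j * m) / cb N 0) J))) with
      (INR m * cb N 0 + 2 * (INR m * cb N 0 * rsum (fun j => cb N (S j * m) / cb N 0) J)) by (field; auto).
    rewrite <- B.
    2: { intros j i Hi. unfold m. rewrite Dk_val by (unfold m in Hi; lia). destruct (Nat.eqb_spec i 0); [lia|ring]. }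
    unfold P. fold P.
    rewrite (rsum_ext (fun r => cb N (S r) * Dk p (S r)) (fun r => cb N (S r) + 2 * (cb N (S r) * rsum (fun k => cos (2 * INR (S r) * (PI * INR (S k) / INR m))) p))).
    2: { intros. unfold Dk. fold m. ring. }
    rewrite rsum_plus, rsum_scal.
    assert (Em : INR m = 2 * INR p + 1) by (unfold m; rewrite plus_INR, mult_INR; simpl; ring). rewrite !Em.
    generalize (rsum (fun n => cb N (S n)) P). intros A.
    match goal with |- context [2 * rsum ?F P] => generalize (rsum F P); intros B2 end. ring.
Qed.

(** * Passage to the limit in Polya's identity *)

Lemma lim_scal a u (l : R) : is_lim_seq u l -> is_lim_seq (fun n => a * u n) (a * l).
Proof. intros H. apply is_lim_seq_mult'; [apply is_lim_seq_const|exact H]. Qed.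

Lemma lim_inv u (l : R) : is_lim_seq u l -> l <> 0 -> is_lim_seq (fun n => / u n) (/ l).
Proof. intros H H0. apply (is_lim_seq_inv u l H). intros E. injection E. exact H0. Qed.

Lemma lim_exp_opp u (l : R) : is_lim_seq u l -> is_lim_seq (fun n => exp (- u n)) (exp (- l)).
Proof.
  intros Hu. apply (is_lim_seq_continuous exp (fun n => - u n) (- l)); [apply derivable_continuous_pt, derivable_pt_exp|].
  apply (proj1 (is_lim_seq_opp u l) Hu).
Qed.

Lemma rsum_lim (a : nat -> nat -> R) (b : nat -> R) K : (forall k, is_lim_seq (fun N => a N k) (b k)) ->
  is_lim_seq (fun N => rsum (a N) K) (rsum b K).
Proof.
  intros H. induction K; simpl; [apply is_lim_seq_const|].
  apply is_lim_seq_plus'; auto.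
Qed.

Lemma rsum_sum_n f n : sum_n f n = rsum f (S n).
Proof.
  induction n; [rewrite sum_O; symmetry; apply Rplus_0_l|]. rewrite sum_Sn, IHn. reflexivity.
Qed.

Lemma is_series_rsum f l : is_series f l -> is_lim_seq (fun n => rsum f n) l.
Proof.
  intros H. apply is_lim_seq_incr_1. apply is_lim_seq_ext with (sum_n f); [intros; apply rsum_sum_n|exact H].
Qed.

Lemma geom_block q K j : 0 <= q < 1 -> rsum (fun i => q ^ (K + i)) j <= q ^ K / (1 - q).
Proof.
  intros Hq. assert (E : rsum (fun i => q ^ (K + i)) j = q ^ K * (1 - q ^ j) / (1 - q)).
  { induction j; [simpl; field; lra|]. rewrite rsum_S, IHj, pow_add. simpl. field. lra. }
  rewrite E. unfold Rdiv. apply Rmult_le_compat_r; [apply Rlt_le, Rinv_0_lt_compat; lra|].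
  assert (0 <= q ^ K) by (apply pow_le; lra). assert (0 <= q ^ j) by (apply pow_le; lra). nra.
Qed.

(** Dominated convergence for sums: the geometric majorant makes the tails past [K] uniformly small,
    and the first [K] terms converge one by one. *)
Lemma tannery q (P : nat -> nat) (a : nat -> nat -> R) (b : nat -> R) : 0 <= q < 1 ->
  (forall K, exists N0, forall N, (N0 <= N)%nat -> (K <= P N)%nat) ->
  (exists N0, forall N k, (N0 <= N)%nat -> (k < P N)%nat -> Rabs (a N k) <= q ^ k) ->
  (forall k, is_lim_seq (fun N => a N k) (b k)) ->
  is_lim_seq (fun N => rsum (a N) (P N)) (Series b).
Proof.
  intros Hq HP [N1 Ha] Hb.
  assert (Bb : forall k, Rabs (b k) <= q ^ k).
  { intros k. assert (L := is_lim_seq_abs _ _ (Hb k)). simpl in L.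
    destruct (HP (S k)) as [N0 HN0].
    apply (is_lim_seq_le (fun N => Rabs (a (N + (N0 + N1))%nat k)) (fun _ => q ^ k) (Rabs (b k)) (q ^ k)).
    - intros N. apply Ha; [lia|]. specialize (HN0 (N + (N0 + N1))%nat). lia.
    - apply (is_lim_seq_incr_n (fun N => Rabs (a N k)) (N0 + N1)). exact L.
    - apply is_lim_seq_const. }
  assert (Eb : ex_series b).
  { apply (ex_series_le (K := R_AbsRing) (V := R_CompleteNormedModule) b (fun k => q ^ k)); [exact Bb|]. apply ex_series_geom. rewrite Rabs_pos_eq; lra. }
  assert (Lb := is_series_rsum _ _ (Series_correct _ Eb)).
  assert (Tb : forall K, Rabs (Series b - rsum b K) <= q ^ K / (1 - q)).
  { intros K.
    assert (L : is_lim_seq (fun j => Rabs (rsum b (j + K) - rsum b K)) (Rabs (Series b - rsum b K))).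
    { apply (is_lim_seq_abs _ (Series b - rsum b K)). apply is_lim_seq_minus'; [|apply is_lim_seq_const].
      apply (is_lim_seq_incr_n (fun n => rsum b n) K). exact Lb. }
    apply (is_lim_seq_le _ (fun _ => q ^ K / (1 - q)) _ (q ^ K / (1 - q)) ) with (2 := L); [|apply is_lim_seq_const].
    intros j. rewrite Nat.add_comm, rsum_split.
    replace (rsum b K + rsum (fun i => b (K + i)%nat) j - rsum b K) with (rsum (fun i => b (K + i)%nat) j) by ring.
    eapply Rle_trans; [apply rsum_abs|]. eapply Rle_trans; [|apply (geom_block q K j Hq)].
    apply rsum_le. intros; apply Bb. }
  apply is_lim_seq_spec. intros eps. assert (He := cond_pos eps).
  assert (P1 : 0 < eps / 4 * (1 - q)) by (apply Rmult_lt_0_compat; lra).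
  assert (G : is_lim_seq (fun n => q ^ n) 0) by (apply is_lim_seq_geom; rewrite Rabs_pos_eq; lra).
  apply is_lim_seq_spec in G. destruct (G (mkposreal _ P1)) as [K HK]. specialize (HK K (Nat.le_refl _)). simpl in HK.
  rewrite Rminus_0_r in HK. assert (HK2 := Rle_lt_trans _ _ _ (Rle_abs _) HK).
  assert (HK3 : q ^ K / (1 - q) <= eps / 4) by (apply Rle_div_l; lra).
  assert (F := rsum_lim a b K Hb). apply is_lim_seq_spec in F. assert (P2 : 0 < eps / 4) by lra.
  destruct (F (mkposreal _ P2)) as [N2 HN2]. destruct (HP K) as [N0 HN0].
  exists (N0 + N1 + N2)%nat. intros N HN. specialize (HN2 N ltac:(lia)). simpl in HN2. specialize (HN0 N ltac:(lia)).
  assert (S1 : Rabs (rsum (a N) (P N) - rsum (a N) K) <= q ^ K / (1 - q)).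
  { replace (P N) with (K + (P N - K))%nat at 1 by lia. rewrite rsum_split.
    replace (rsum (a N) K + rsum (fun i => a N (K + i)%nat) (P N - K) - rsum (a N) K) with (rsum (fun i => a N (K + i)%nat) (P N - K)) by ring.
    eapply Rle_trans; [apply rsum_abs|]. eapply Rle_trans; [|apply (geom_block q K (P N - K) Hq)].
    apply rsum_le. intros; apply Ha; lia. }
  specialize (Tb K). apply Rabs_le_between in S1. apply Rabs_le_between in Tb. apply Rabs_lt_between in HN2.
  apply Rabs_lt_between. lra.
Qed.

Definition psi (x : R) : R := Series (fun k => exp (- (PI * INR (S k) ^ 2 * x))).

Definition nfl (y : R) : nat := Z.to_nat (Int_part y).

Lemma nfl_spec y : 0 <= y -> INR (nfl y) <= y < INR (nfl y) + 1.
Proof.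
  intros Hy. destruct (base_Int_part y) as [H1 H2]. unfold nfl.
  assert (0 <= Int_part y)%Z. { apply le_IZR. simpl. apply Rnot_lt_le. intros K.
    assert (Int_part y <= -1)%Z. { apply lt_IZR in K. lia. } apply IZR_le in H. lra. }
  rewrite INR_IZR_INZ, Z2Nat.id by exact H. lra.
Qed.

Lemma sin_lower y : 0 <= y -> y - y ^ 3 / 6 <= sin y.
Proof.
  intros Hy. destruct (MVT_gen (fun y => sin y - y + y ^ 3 / 6) 0 y (fun y => cos y - 1 + y ^ 2 / 2)) as [c [Hc E]].
  - intros t _. auto_derive; [auto|]. simpl. field.
  - intros t _. apply continuity_pt_filterlim, (ex_derive_continuous (V := R_NormedModule) (fun y => sin y - y + y ^ 3 / 6) t). auto_derive. auto.
  - rewrite sin_0 in E. rewrite Rmin_left, Rmax_right in Hc by lra.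
    assert (K : 0 <= cos c - 1 + c ^ 2 / 2).
    { replace c with (2 * (c / 2)) at 1 by field. rewrite cos_2a_sin.
      assert (A : Rabs (sin (c / 2)) <= Rabs (c / 2)).
      { rewrite (Rabs_pos_eq (c / 2)) by lra. destruct (Req_dec c 0) as [->|Hc0].
        - unfold Rdiv. rewrite Rmult_0_l, sin_0, Rabs_R0. lra.
        - apply Rabs_le. split; [|left; apply sin_lt_x; lra].
          assert (S := sin_lt_x (c / 2) ltac:(lra)). generalize (SIN_bound (c / 2)); intros.
          destruct (Rle_dec 1 (c / 2)); [lra|]. assert (0 <= sin (c / 2)) by (apply sin_ge_0; generalize PI2_3_2; unfold PI2; lra). lra. }
      apply Rsqr_le_abs_1 in A. unfold Rsqr in A. simpl. lra. }
    assert (0 <= (cos c - 1 + c ^ 2 / 2) * (y - 0)) by (apply Rmult_le_pos; lra). simpl in *. lra.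
Qed.

Lemma one_minus_exp_lower s : 0 <= s < 1 -> exp (- (s / (1 - s))) <= 1 - s.
Proof.
  intros Hs. rewrite exp_Ropp. rewrite <- (Rinv_inv (1 - s)). apply Rinv_le_contravar; [apply Rinv_0_lt_compat; lra|].
  eapply Rle_trans; [|apply exp_ineq1_le]. right. field. lra.
Qed.

Lemma one_minus_exp_upper s : 1 - s <= exp (- s).
Proof. eapply Rle_trans; [|apply exp_ineq1_le]. lra. Qed.

Lemma exp_INR_pow c n : exp c ^ n = exp (INR n * c).
Proof. induction n; [simpl; rewrite Rmult_0_l, exp_0; reflexivity|]. rewrite S_INR. simpl. rewrite IHn, <- exp_plus. f_equal. ring. Qed.

Lemma cos_pow_bounds y N : 0 <= y < PI / 2 ->
  exp (- (INR N * (sin y ^ 2 / (1 - sin y ^ 2)))) <= cos y ^ (2 * N) <= exp (- (INR N * sin y ^ 2)).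
Proof.
  intros Hy. rewrite pow_mult.
  assert (Hc : 0 < cos y) by (apply cos_gt_0; lra).
  assert (E : cos y ^ 2 = 1 - sin y ^ 2) by (generalize (sin2_cos2 y); unfold Rsqr; simpl; lra).
  assert (S0 : 0 <= sin y ^ 2 < 1) by (split; [apply pow2_ge_0|]; assert (0 < cos y ^ 2) by (apply pow_lt, Hc); lra).
  rewrite E. replace (- (INR N * (sin y ^ 2 / (1 - sin y ^ 2)))) with (INR N * (- (sin y ^ 2 / (1 - sin y ^ 2)))) by ring.
  replace (- (INR N * sin y ^ 2)) with (INR N * - sin y ^ 2) by ring.
  rewrite <- !exp_INR_pow. split; apply pow_incr; split; try (left; apply exp_pos); try lra.
  - apply one_minus_exp_lower, S0.
  - apply one_minus_exp_upper.
Qed.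

(** The ratio of consecutive coefficients is [1 - (2 r + 1) / (N + r + 1)], at most
    [exp (- (2 r + 1) / (N + M))], and the odd numbers sum to [r ^ 2]. *)
Lemma cb_upper N M : forall r, (r <= M)%nat -> cb N r <= cb N 0 * exp (- (INR r ^ 2 / (INR N + INR M))).
Proof.
  intros r HM. destruct (Nat.le_gt_cases r N) as [Hr|Hr].
  2: { rewrite cb_zero by exact Hr. apply Rmult_le_pos; [apply Rlt_le, cb_pos0|left; apply exp_pos]. }
  induction r.
  - simpl. unfold Rdiv. rewrite !Rmult_0_l, Ropp_0, exp_0. lra.
  - specialize (IHr ltac:(lia) ltac:(lia)). assert (Q := cb_ratio N r).
    assert (A := pos_INR r). assert (HN : INR r + 1 <= INR N) by (rewrite <- S_INR; apply le_INR, Hr).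
    assert (HM' : INR r + 1 <= INR M) by (rewrite <- S_INR; apply le_INR, HM).
    assert (E : cb N (S r) = cb N r * (1 - (2 * INR r + 1) / (INR N + INR r + 1))).
    { apply (Rmult_eq_reg_l (INR N + INR r + 1)); [|lra]. rewrite Q. field. lra. }
    rewrite E.
    replace (exp (- (INR (S r) ^ 2 / (INR N + INR M)))) with (exp (- (INR r ^ 2 / (INR N + INR M))) * exp (- ((2 * INR r + 1) / (INR N + INR M)))).
    2: { rewrite <- exp_plus. f_equal. rewrite S_INR. field. lra. }
    rewrite <- Rmult_assoc. apply Rmult_le_compat; [apply cb_nonneg| |exact IHr|].
    + assert ((2 * INR r + 1) / (INR N + INR r + 1) <= 1) by (apply Rle_div_l; lra). lra.
    + eapply Rle_trans; [apply one_minus_exp_upper|]. apply exp_le_mono. apply Ropp_le_contravar.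
      unfold Rdiv. apply Rmult_le_compat_l; [lra|]. apply Rinv_le_contravar; lra.
Qed.

Lemma cb_lower N M : (M < N)%nat -> forall r, (r <= M)%nat -> cb N 0 * exp (- (INR r ^ 2 / (INR N - INR M))) <= cb N r.
Proof.
  intros HM. assert (HM2 : INR M < INR N) by (apply lt_INR, HM). induction r; intros Hr.
  - simpl. unfold Rdiv. rewrite !Rmult_0_l, Ropp_0, exp_0. lra.
  - specialize (IHr ltac:(lia)). assert (Q := cb_ratio N r).
    assert (A := pos_INR r). assert (HN : INR r + 1 <= INR M) by (rewrite <- S_INR; apply le_INR, Hr).
    set (s := (2 * INR r + 1) / (INR N + INR r + 1)).
    assert (E : cb N (S r) = cb N r * (1 - s)).
    { apply (Rmult_eq_reg_l (INR N + INR r + 1)); [|lra]. rewrite Q. unfold s. field. lra. }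
    assert (Hs : 0 <= s < 1).
    { unfold s. split; [apply Rle_mult_inv_pos; lra|]. apply Rlt_div_l; lra. }
    rewrite E.
    replace (exp (- (INR (S r) ^ 2 / (INR N - INR M)))) with (exp (- (INR r ^ 2 / (INR N - INR M))) * exp (- ((2 * INR r + 1) / (INR N - INR M)))).
    2: { rewrite <- exp_plus. f_equal. rewrite S_INR. field. lra. }
    rewrite <- Rmult_assoc. apply Rmult_le_compat; [apply Rmult_le_pos; [apply cb_nonneg|left; apply exp_pos]|left; apply exp_pos|exact IHr|].
    eapply Rle_trans; [|apply one_minus_exp_lower, Hs]. apply exp_le_mono, Ropp_le_contravar.
    replace (s / (1 - s)) with ((2 * INR r + 1) / (INR N - INR r)) by (unfold s; field; lra).
    unfold Rdiv. apply Rmult_le_compat_l; [lra|]. apply Rinv_le_contravar; lra.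
Qed.

(** The number [mN x N] of points is chosen near this value because [cos (PI k / m) ^ (2 N)] behaves
    like [exp (- N PI ^ 2 k ^ 2 / m ^ 2)], which is [exp (- PI k ^ 2 x)] when [m ^ 2 = PI N / x]. *)
Definition sN (x : R) (N : nat) : R := sqrt (PI * INR N / x).

Definition pN (x : R) (N : nat) : nat := nfl (sN x N / 2).

Definition mN (x : R) (N : nat) : R := INR (2 * pN x N + 1).

Lemma sN_sq (x : R) N (Hx : 0 < x) : sN x N ^ 2 = PI * INR N / x.
Proof. unfold sN. apply pow2_sqrt. apply Rle_mult_inv_pos; [|exact Hx]. apply Rmult_le_pos; [generalize PI_RGT_0; lra|apply pos_INR]. Qed.

Lemma sN_nonneg x N : 0 <= sN x N. Proof. apply sqrt_pos. Qed.

Lemma mN_bounds x N : sN x N - 1 < mN x N <= sN x N + 1.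
Proof.
  unfold mN, pN. rewrite plus_INR, mult_INR. simpl INR. destruct (nfl_spec (sN x N / 2)) as [A B]; [generalize (sN_nonneg x N); lra|]. lra.
Qed.

Lemma sN_large (x : R) C (Hx : 0 < x) : exists N0, forall N, (N0 <= N)%nat -> C <= sN x N.
Proof.
  destruct (INR_unbounded (C ^ 2 * x / PI)) as [N0 H0]. exists N0. intros N HN.
  destruct (Rle_dec C 0) as [Hc|Hc]; [generalize (sN_nonneg x N); lra|].
  rewrite <- (sqrt_pow2 C) by lra. unfold sN. apply sqrt_le_1; [apply pow2_ge_0| |].
  - apply Rle_mult_inv_pos; [|exact Hx]. apply Rmult_le_pos; [generalize PI_RGT_0; lra|apply pos_INR].
  - apply -> Rle_div_r; [|exact Hx]. apply le_INR in HN. assert (P := PI_RGT_0).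
    apply Rmult_le_reg_r with (/ PI); [apply Rinv_0_lt_compat, P|].
    replace (PI * INR N * / PI) with (INR N) by (field; lra). unfold Rdiv in H0. lra.
Qed.

Lemma mN_ratio (x : R) (Hx : 0 < x) : is_lim_seq (fun N => mN x N / sN x N) 1.
Proof.
  apply is_lim_seq_spec. intros eps. assert (He := cond_pos eps).
  destruct (sN_large x (2 / eps + 1) Hx) as [N0 H0]. exists N0. intros N HN. specialize (H0 N HN).
  assert (B := mN_bounds x N). assert (0 < 2 / eps) by (apply Rdiv_lt_0_compat; lra).
  replace (mN x N / sN x N - 1) with ((mN x N - sN x N) / sN x N) by (field; lra).
  unfold Rdiv. rewrite Rabs_mult, Rabs_inv, (Rabs_pos_eq (sN x N)) by lra.
  apply Rlt_div_l; [lra|]. apply Rle_lt_trans with 1; [apply Rabs_le; lra|].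
  assert (eps * (2 / eps + 1) <= eps * sN x N) by (apply Rmult_le_compat_l; lra).
  replace (eps * (2 / eps + 1)) with (2 + eps) in H1 by (field; lra). lra.
Qed.

Lemma mN_sq_lim (x : R) (Hx : 0 < x) : is_lim_seq (fun N => INR N / mN x N ^ 2) (x / PI).
Proof.
  assert (P := PI_RGT_0).
  assert (L := is_lim_seq_inv _ _ (is_lim_seq_mult' _ _ _ _ (mN_ratio x Hx) (mN_ratio x Hx))).
  specialize (L ltac:(intros E; injection E; lra)).
  apply (is_lim_seq_scal_l _ (x / PI)) in L. simpl in L. replace (x / PI * / (1 * 1)) with (x / PI) in L by (field; lra).
  eapply is_lim_seq_ext_loc; [|exact L].
  destruct (sN_large x 2 Hx) as [N0 H0]. exists N0. intros N HN. specialize (H0 N HN). assert (B := mN_bounds x N).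
  assert (Q := sN_sq x N Hx). assert (EN : INR N = x / PI * sN x N ^ 2) by (rewrite Q; field; lra). rewrite EN. field. lra.
Qed.

Lemma mN_inv_lim (x : R) (Hx : 0 < x) : is_lim_seq (fun N => / mN x N) 0.
Proof.
  apply is_lim_seq_spec. intros eps. assert (He := cond_pos eps). destruct (sN_large x (/ eps + 2) Hx) as [N0 H0].
  exists N0. intros N HN. specialize (H0 N HN). assert (B := mN_bounds x N). assert (0 < / eps) by (apply Rinv_0_lt_compat; lra).
  rewrite Rminus_0_r, Rabs_pos_eq by (apply Rlt_le, Rinv_0_lt_compat; lra).
  rewrite <- (Rinv_inv eps). apply Rinv_lt_contravar; [apply Rmult_lt_0_compat|]; lra.
Qed.

Lemma cosN_lim (x : R) k (Hx : 0 < x) : is_lim_seq (fun N => cos (PI * INR (S k) / mN x N) ^ (2 * N)) (exp (- (PI * INR (S k) ^ 2 * x))).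
Proof.
  assert (P := PI_RGT_0). set (c := PI * INR (S k)). assert (Hc : 0 < c) by (apply Rmult_lt_0_compat; [exact P|apply INR_S_pos]).
  set (y := fun N => c / mN x N).
  assert (Ly : is_lim_seq y 0). { replace (Finite 0) with (Rbar_mult c 0) by (simpl; f_equal; ring). apply is_lim_seq_scal_l, (mN_inv_lim x Hx). }
  assert (LNy : is_lim_seq (fun N => INR N * y N ^ 2) (PI * INR (S k) ^ 2 * x)).
  { assert (L := lim_scal (c ^ 2) _ _ (mN_sq_lim x Hx)).
    replace (c ^ 2 * (x / PI)) with (PI * INR (S k) ^ 2 * x) in L by (unfold c; field; lra).
    eapply is_lim_seq_ext; [|exact L]. intros N. unfold y. field. unfold mN. rewrite Nat.add_1_r. generalize (INR_S_pos (2 * pN x N)); lra. }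
  assert (Ly2 : is_lim_seq (fun N => y N ^ 2) 0).
  { apply is_lim_seq_ext with (fun N => y N * y N); [intros; ring|]. replace (Finite 0) with (Finite (0 * 0)) by (f_equal; ring). apply is_lim_seq_mult'; exact Ly. }
  assert (Ev : Hierarchy.eventually (fun N => 0 <= y N <= 1)).
  { apply is_lim_seq_spec in Ly. destruct (Ly (mkposreal 1 Rlt_0_1)) as [N0 H0]. exists N0. intros N HN. specialize (H0 N HN). simpl in H0.
    rewrite Rminus_0_r in H0. split; [|generalize (Rle_abs (y N)); lra].
    unfold y. apply Rle_mult_inv_pos; [lra|]. unfold mN. rewrite Nat.add_1_r. apply INR_S_pos. }
  assert (LNs : is_lim_seq (fun N => INR N * sin (y N) ^ 2) (PI * INR (S k) ^ 2 * x)).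
  { apply (is_lim_seq_le_le_loc (fun N => INR N * y N ^ 2 * (1 - y N ^ 2 / 6) ^ 2) _ (fun N => INR N * y N ^ 2)); [| |exact LNy].
    - destruct Ev as [N0 H0]. exists N0. intros N HN. specialize (H0 N HN).
      assert (Lw := sin_lower (y N) ltac:(lra)). assert (Up : sin (y N) <= y N) by (destruct (Req_dec (y N) 0) as [->|]; [rewrite sin_0; lra|left; apply sin_lt_x; lra]).
      assert (Z : 0 <= y N - y N ^ 3 / 6) by (simpl; nra).
      rewrite Rmult_assoc. split; (apply Rmult_le_compat_l; [apply pos_INR|]).
      + replace (y N ^ 2 * (1 - y N ^ 2 / 6) ^ 2) with ((y N - y N ^ 3 / 6) ^ 2) by (simpl; field). apply pow_incr. lra.
      + apply pow_incr. lra.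
    - replace (Finite (PI * INR (S k) ^ 2 * x)) with (Finite (PI * INR (S k) ^ 2 * x * ((1 - 0 / 6) * (1 - 0 / 6)))) by (f_equal; field).
      apply is_lim_seq_mult'; [exact LNy|]. apply is_lim_seq_ext with (fun N => (1 - y N ^ 2 / 6) * (1 - y N ^ 2 / 6)); [intros; ring|].
      assert (Q : is_lim_seq (fun N => 1 - y N ^ 2 / 6) (1 - 0 / 6)).
      { apply is_lim_seq_minus'; [apply is_lim_seq_const|]. apply is_lim_seq_mult'; [exact Ly2|apply is_lim_seq_const]. }
      apply is_lim_seq_mult'; exact Q. }
  assert (Ls2 : is_lim_seq (fun N => sin (y N) ^ 2) 0).
  { apply (is_lim_seq_le_le_loc (fun _ => 0) _ (fun N => y N ^ 2)); [|apply is_lim_seq_const|exact Ly2].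
    destruct Ev as [N0 H0]. exists N0. intros N HN. specialize (H0 N HN). split; [apply pow2_ge_0|].
    assert (Up : sin (y N) <= y N) by (destruct (Req_dec (y N) 0) as [->|]; [rewrite sin_0; lra|left; apply sin_lt_x; lra]).
    apply pow_incr. split; [|exact Up]. apply sin_ge_0; generalize PI2_3_2; unfold PI2; lra. }
  apply (is_lim_seq_le_le_loc (fun N => exp (- (INR N * (sin (y N) ^ 2 / (1 - sin (y N) ^ 2))))) _ (fun N => exp (- (INR N * sin (y N) ^ 2)))).
  - destruct Ev as [N0 H0]. exists N0. intros N HN. specialize (H0 N HN). fold c. change (c / mN x N) with (y N).
    apply cos_pow_bounds. generalize PI2_3_2. unfold PI2. lra.
  - apply lim_exp_opp. apply is_lim_seq_ext with (fun N => INR N * sin (y N) ^ 2 * / (1 - sin (y N) ^ 2)); [intros; unfold Rdiv; ring|].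
    replace (Finite (PI * INR (S k) ^ 2 * x)) with (Finite (PI * INR (S k) ^ 2 * x * / (1 - 0))) by (f_equal; field).
    apply is_lim_seq_mult'; [exact LNs|]. apply (is_lim_seq_inv _ (1 - 0)); [|intros E; injection E; lra].
    apply is_lim_seq_minus'; [apply is_lim_seq_const|exact Ls2].
  - apply lim_exp_opp, LNs.
Qed.

Lemma cbN_lim (x : R) j (Hx : 0 < x) : is_lim_seq (fun N => cb N (S j * (2 * pN x N + 1)) / cb N 0) (exp (- (PI * INR (S j) ^ 2 * / x))).
Proof.
  assert (P := PI_RGT_0).
  assert (E : forall N, INR (S j * (2 * pN x N + 1)) = INR (S j) * mN x N) by (intros; rewrite mult_INR; reflexivity).
  assert (M0 : forall N, 0 < mN x N) by (intros; unfold mN; rewrite Nat.add_1_r; apply INR_S_pos).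
  assert (LmN : is_lim_seq (fun N => mN x N ^ 2 / INR N) (PI / x)).
  { assert (L := lim_inv _ _ (mN_sq_lim x Hx) ltac:(apply Rgt_not_eq, Rdiv_lt_0_compat; lra)).
    replace (/ (x / PI)) with (PI / x) in L by (field; lra). eapply is_lim_seq_ext_loc; [|exact L].
    exists 1%nat. intros N HN. assert (0 < INR N) by (apply lt_0_INR; lia). specialize (M0 N). field. lra. }
  assert (LrN : is_lim_seq (fun N => INR (S j) * mN x N / INR N) 0).
  { assert (L := is_lim_seq_mult' _ _ _ _ (lim_scal (INR (S j)) _ _ LmN) (mN_inv_lim x Hx)). rewrite Rmult_0_r in L.
    eapply is_lim_seq_ext_loc; [|exact L]. exists 1%nat. intros N HN. assert (0 < INR N) by (apply lt_0_INR; lia). specialize (M0 N). cbv beta. field. lra. }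
  assert (Ls : is_lim_seq (fun N => (INR (S j) * mN x N) ^ 2 / (INR N - INR (S j) * mN x N)) (PI * INR (S j) ^ 2 * / x)).
  { assert (L1 := lim_scal (INR (S j) ^ 2) _ _ LmN).
    assert (L2 := lim_inv _ _ (is_lim_seq_minus' _ _ _ _ (is_lim_seq_const 1) LrN) ltac:(lra)).
    assert (L := is_lim_seq_mult' _ _ _ _ L1 L2).
    replace (INR (S j) ^ 2 * (PI / x) * / (1 - 0)) with (PI * INR (S j) ^ 2 * / x) in L by (field; lra).
    eapply is_lim_seq_ext_loc; [|exact L].
    apply is_lim_seq_spec in LrN. destruct (LrN (mkposreal 1 Rlt_0_1)) as [N0 H0]. exists (S N0). intros N HN. specialize (H0 N ltac:(lia)). simpl pos in H0.
    rewrite Rminus_0_r in H0. assert (K := Rle_lt_trans _ _ _ (Rle_abs _) H0).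
    assert (0 < INR N) by (apply lt_0_INR; lia). apply Rlt_div_l in K; [|assumption]. cbv beta. field. split; lra. }
  assert (Lu : is_lim_seq (fun N => (INR (S j) * mN x N) ^ 2 / (INR N + INR (S j) * mN x N)) (PI * INR (S j) ^ 2 * / x)).
  { assert (L1 := lim_scal (INR (S j) ^ 2) _ _ LmN).
    assert (L2 := lim_inv _ _ (is_lim_seq_plus' _ _ _ _ (is_lim_seq_const 1) LrN) ltac:(lra)).
    assert (L := is_lim_seq_mult' _ _ _ _ L1 L2).
    replace (INR (S j) ^ 2 * (PI / x) * / (1 + 0)) with (PI * INR (S j) ^ 2 * / x) in L by (field; lra).
    eapply is_lim_seq_ext_loc; [|exact L].
    exists 1%nat. intros N HN. assert (0 < INR N) by (apply lt_0_INR; lia). specialize (M0 N). assert (Q := INR_S_pos j). cbv beta. field. split; nra. }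
  apply (is_lim_seq_le_le_loc (fun N => exp (- ((INR (S j) * mN x N) ^ 2 / (INR N - INR (S j) * mN x N)))) _ (fun N => exp (- ((INR (S j) * mN x N) ^ 2 / (INR N + INR (S j) * mN x N))))).
  2: { apply lim_exp_opp, Ls. } 2: { apply lim_exp_opp, Lu. }
  apply is_lim_seq_spec in LrN. destruct (LrN (mkposreal 1 Rlt_0_1)) as [N0 H0]. exists (S N0). intros N HN. specialize (H0 N ltac:(lia)). simpl pos in H0.
  rewrite Rminus_0_r in H0. assert (K := Rle_lt_trans _ _ _ (Rle_abs _) H0).
  assert (HN0 : 0 < INR N) by (apply lt_0_INR; lia). apply Rlt_div_l in K; [|assumption]. rewrite Rmult_1_l, <- E in K. apply INR_lt in K.
  assert (C0 := cb_pos0 N).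
  split.
  - assert (Q := cb_lower N _ K _ (Nat.le_refl _)). rewrite E in Q. apply -> Rle_div_r; [|exact C0]. lra.
  - assert (Q := cb_upper N _ _ (Nat.le_refl (S j * (2 * pN x N + 1)))). rewrite E in Q. apply Rle_div_l; [exact C0|]. lra.
Qed.

Lemma exp_geom_bound c k : 0 < c -> exp (- (c * INR (S k) ^ 2)) <= exp (- c) ^ S k.
Proof.
  intros Hc. rewrite exp_INR_pow. apply exp_le_mono. assert (A := INR_S_ge1 k).
  assert (INR (S k) <= INR (S k) ^ 2) by (simpl INR in *; nra). nra.
Qed.

Lemma exp_neg_lt1 c : 0 < c -> 0 <= exp (- c) < 1.
Proof. intros H. split; [left; apply exp_pos|]. rewrite <- exp_0. apply exp_increasing. lra. Qed.

Lemma pow_S_le q k : 0 <= q < 1 -> q ^ S k <= q ^ k.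
Proof. intros H. simpl. assert (0 <= q ^ k) by (apply pow_le; lra). nra. Qed.

Lemma psi_term_bound x k : 0 < x -> Rabs (exp (- (PI * INR (S k) ^ 2 * x))) <= exp (- (PI * x)) ^ S k.
Proof.
  intros Hx. rewrite Rabs_pos_eq by (left; apply exp_pos).
  replace (PI * INR (S k) ^ 2 * x) with (PI * x * INR (S k) ^ 2) by ring. apply exp_geom_bound.
  apply Rmult_lt_0_compat; [apply PI_RGT_0|exact Hx].
Qed.

Lemma psi_ex x : 0 < x -> ex_series (fun k => exp (- (PI * INR (S k) ^ 2 * x))).
Proof.
  intros Hx. assert (Q : 0 < PI * x) by (apply Rmult_lt_0_compat; [apply PI_RGT_0|exact Hx]).
  assert (q := exp_neg_lt1 _ Q).
  apply (ex_series_le (K := R_AbsRing) (V := R_CompleteNormedModule) _ (fun k => exp (- (PI * x)) ^ k)).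
  - intros k. eapply Rle_trans; [apply (psi_term_bound x k Hx)|]. apply pow_S_le, q.
  - apply ex_series_geom. rewrite Rabs_pos_eq; lra.
Qed.

Lemma psi_lim x : 0 < x -> is_lim_seq (fun n => rsum (fun k => exp (- (PI * INR (S k) ^ 2 * x))) n) (psi x).
Proof. intros Hx. apply is_series_rsum, Series_correct, psi_ex, Hx. Qed.

Lemma rsum_nonneg f n : (forall k, 0 <= f k) -> 0 <= rsum f n.
Proof. intros H. induction n; simpl; [lra|]. generalize (H n). lra. Qed.

Lemma psi_nonneg x : 0 < x -> 0 <= psi x.
Proof.
  intros Hx. apply (is_lim_seq_le (fun _ => 0) _ 0 (psi x)) with (3 := psi_lim x Hx); [|apply is_lim_seq_const].
  intros n. apply rsum_nonneg. intros; left; apply exp_pos.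
Qed.

Lemma cosN_sum_lim x : 0 < x -> is_lim_seq (fun N => rsum (fun k => cos (PI * INR (S k) / mN x N) ^ (2 * N)) (pN x N)) (psi x).
Proof.
  intros Hx. assert (P := PI_RGT_0). assert (P4 := PI_4). unfold psi.
  (* The majorant loses a factor 9 from [y / 3 <= sin y] and a factor 4 from [m <= 2 sN x N],
     against the limiting exponent [PI * x]. *)
  set (c := PI * x / 36). assert (Hc : 0 < c) by (unfold c; apply Rdiv_lt_0_compat; [apply Rmult_lt_0_compat|]; lra).
  apply (tannery (exp (- c)) (pN x)).
  - apply exp_neg_lt1, Hc.
  - intros K. destruct (sN_large x (2 * INR K + 2) Hx) as [N0 H0]. exists N0. intros N HN. specialize (H0 N HN).
    assert (B := mN_bounds x N). unfold mN in B. rewrite plus_INR, mult_INR in B. simpl INR in B.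
    apply INR_le. lra.
  - destruct (sN_large x 1 Hx) as [N0 H0]. exists (S N0). intros N k HN Hk. specialize (H0 N ltac:(lia)).
    assert (B := mN_bounds x N). set (m := mN x N) in *. assert (Q := sN_sq x N Hx).
    assert (Hm : 0 < m) by (unfold m, mN; rewrite Nat.add_1_r; apply INR_S_pos).
    assert (Hkm : 2 * INR (S k) < m).
    { unfold m, mN. rewrite plus_INR, mult_INR. simpl (INR 2). simpl (INR 1). assert (INR (S k) <= INR (pN x N)) by (apply le_INR; lia). lra. }
    set (y := PI * INR (S k) / m). assert (Hk1 := INR_S_ge1 k).
    assert (Hy : 0 <= y < PI / 2).
    { unfold y. split; [apply Rle_mult_inv_pos; [nra|exact Hm]|]. apply Rlt_div_l; [exact Hm|]. nra. }
    destruct (cos_pow_bounds y N Hy) as [_ U].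
    assert (Hcos : 0 <= cos y) by (apply cos_ge_0; lra).
    rewrite Rabs_pos_eq by (apply pow_le, Hcos). eapply Rle_trans; [exact U|].
    eapply Rle_trans; [|apply pow_S_le, exp_neg_lt1, Hc]. eapply Rle_trans; [|apply exp_geom_bound, Hc].
    apply exp_le_mono, Ropp_le_contravar.
    assert (L := sin_lower y ltac:(lra)).
    assert (L2 : y / 3 <= sin y). { eapply Rle_trans; [|exact L]. assert (y * y <= 4) by nra. replace (y ^ 3) with (y * (y * y)) by ring. nra. }
    assert (L3 : (y / 3) ^ 2 <= sin y ^ 2) by (apply pow_incr; lra).
    apply Rle_trans with (INR N * (y / 3) ^ 2).
    2: { apply Rmult_le_compat_l; [apply pos_INR|exact L3]. }
    assert (EN : INR N = x / PI * sN x N ^ 2) by (rewrite Q; field; lra).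
    rewrite EN. unfold y, c.
    replace (x / PI * sN x N ^ 2 * (PI * INR (S k) / m / 3) ^ 2) with (PI * x / 36 * INR (S k) ^ 2 * (4 * sN x N ^ 2 / m ^ 2)) by (field; lra).
    rewrite <- (Rmult_1_r (PI * x / 36 * INR (S k) ^ 2)) at 1. apply Rmult_le_compat_l.
    { apply Rmult_le_pos; [unfold c in Hc; lra|apply pow2_ge_0]. }
    apply -> Rle_div_r; [|apply pow_lt, Hm]. rewrite Rmult_1_l.
    replace (4 * sN x N ^ 2) with ((2 * sN x N) ^ 2) by ring. apply pow_incr. lra.
  - intros k. apply cosN_lim, Hx.
Qed.

Lemma cbN_sum_lim x : 0 < x -> is_lim_seq (fun N => rsum (fun j => cb N (S j * (2 * pN x N + 1)) / cb N 0) N) (psi (/ x)).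
Proof.
  intros Hx. assert (P := PI_RGT_0). unfold psi.
  (* The majorant loses a factor 2 from [N + r <= 2 N] in [cb_upper] and a factor 4 from
     [sN x N / 2 <= mN x N], against the limiting exponent [PI / x]. *)
  set (c := PI / (8 * x)). assert (Hc : 0 < c) by (unfold c; apply Rdiv_lt_0_compat; lra).
  apply (tannery (exp (- c)) (fun N => N)).
  - apply exp_neg_lt1, Hc.
  - intros K. exists K. auto.
  - destruct (sN_large x 2 Hx) as [N0 H0]. exists (S N0). intros N j HN Hk. specialize (H0 N ltac:(lia)).
    assert (B := mN_bounds x N). assert (Q := sN_sq x N Hx). assert (C0 := cb_pos0 N).
    set (r := (S j * (2 * pN x N + 1))%nat).
    assert (Er : INR r = INR (S j) * mN x N) by (unfold r; rewrite mult_INR; reflexivity).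
    rewrite Rabs_pos_eq by (apply Rle_mult_inv_pos; [apply cb_nonneg|exact C0]).
    eapply Rle_trans; [|apply pow_S_le, exp_neg_lt1, Hc].
    apply Rle_div_l; [exact C0|].
    destruct (Nat.le_gt_cases r N) as [Hr|Hr].
    2: { rewrite cb_zero by exact Hr. apply Rmult_le_pos; [apply pow_le, exp_neg_lt1, Hc|lra]. }
    rewrite Rmult_comm. eapply Rle_trans; [apply (cb_upper N N r Hr)|]. apply Rmult_le_compat_l; [lra|].
    eapply Rle_trans; [|apply exp_geom_bound, Hc]. apply exp_le_mono, Ropp_le_contravar.
    assert (HN0 : 0 < INR N) by (apply lt_0_INR; lia).
    rewrite Er. apply -> Rle_div_r; [|lra].
    assert (EN : INR N = x / PI * sN x N ^ 2) by (rewrite Q; field; lra).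
    rewrite EN. unfold c.
    replace (PI / (8 * x) * INR (S j) ^ 2 * (x / PI * sN x N ^ 2 + x / PI * sN x N ^ 2)) with ((INR (S j) * (sN x N / 2)) ^ 2) by (field; lra).
    apply pow_incr. assert (K := INR_S_pos j). split; [apply Rmult_le_pos; lra|]. apply Rmult_le_compat_l; lra.
  - intros j. apply cbN_lim, Hx.
Qed.

Lemma theta_quotient_lim x : 0 < x ->
  is_lim_seq (fun N => mN x N * (cb N 0 / 4 ^ N)) ((1 + 2 * psi x) * / (1 + 2 * psi (/ x))).
Proof.
  intros Hx. assert (Hx' : 0 < / x) by (apply Rinv_0_lt_compat, Hx).
  assert (N1 := psi_nonneg x Hx). assert (N2 := psi_nonneg _ Hx').
  assert (L1 := is_lim_seq_plus' _ _ _ _ (is_lim_seq_const 1) (lim_scal 2 _ _ (cosN_sum_lim x Hx))).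
  assert (L2 := is_lim_seq_plus' _ _ _ _ (is_lim_seq_const 1) (lim_scal 2 _ _ (cbN_sum_lim x Hx))).
  assert (L := is_lim_seq_mult' _ _ _ _ L1 (lim_inv _ _ L2 ltac:(lra))).
  eapply is_lim_seq_ext; [|exact L]. intros N. cbv beta.
  unfold mN. rewrite (polya_identity N (pN x N) N) by nia.
  assert (0 <= rsum (fun j => cb N (S j * (2 * pN x N + 1)) / cb N 0) N).
  { apply rsum_nonneg. intros k. apply Rle_mult_inv_pos; [apply cb_nonneg|apply cb_pos0]. }
  field. repeat split; first [lra | apply pow_nonzero; lra].
Qed.

(** The size of the central coefficient [cb N 0 / 4 ^ N] comes from the argument itself: at [x = 1]
    both theta series agree, so [mN 1 N * (cb N 0 / 4 ^ N)] tends to 1. Passing to [x] rescales the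
    number of points by [1 / sqrt x]. *)
Theorem theta_identity x : 0 < x -> 1 + 2 * psi x = / sqrt x * (1 + 2 * psi (/ x)).
Proof.
  intros Hx. assert (Hx' : 0 < / x) by (apply Rinv_0_lt_compat, Hx). assert (H1 : 0 < 1) by lra.
  assert (N1 := psi_nonneg x Hx). assert (N2 := psi_nonneg _ Hx'). assert (N3 := psi_nonneg 1 H1).
  assert (Sx : 0 < sqrt x) by (apply sqrt_lt_R0, Hx).
  assert (Lx := theta_quotient_lim x Hx). assert (L1 := theta_quotient_lim 1 H1). rewrite Rinv_1 in L1.
  rewrite Rinv_r in L1 by lra.
  assert (R : is_lim_seq (fun N => (mN x N / sN x N) * / (mN 1 N / sN 1 N) * / sqrt x) (1 * / 1 * / sqrt x)).
  { apply is_lim_seq_mult'; [|apply is_lim_seq_const]. apply is_lim_seq_mult'; [apply mN_ratio, Hx|apply lim_inv; [apply mN_ratio, H1|lra]]. }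
  assert (E : is_lim_seq (fun N => mN x N * (cb N 0 / 4 ^ N)) (1 * / 1 * / sqrt x * 1)).
  { eapply is_lim_seq_ext_loc; [|apply (is_lim_seq_mult' _ _ _ _ R L1)].
    exists 1%nat. intros N HN. cbv beta.
    assert (HN0 : 0 < INR N) by (apply lt_0_INR; lia). assert (P := PI_RGT_0).
    assert (S1 : 0 < sN 1 N). { unfold sN. apply sqrt_lt_R0. apply Rdiv_lt_0_compat; [apply Rmult_lt_0_compat|]; lra. }
    assert (Es : sN x N = sN 1 N / sqrt x).
    { unfold sN. rewrite sqrt_div by (try lra; apply Rmult_le_pos; lra). rewrite sqrt_div by (try lra; apply Rmult_le_pos; lra).
      rewrite sqrt_1. field. lra. }
    rewrite Es. assert (M0 : 0 < mN 1 N) by (unfold mN; rewrite Nat.add_1_r; apply INR_S_pos).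
    field. repeat split; first [lra | apply pow_nonzero; lra]. }
  assert (U := is_lim_seq_unique _ _ Lx). rewrite (is_lim_seq_unique _ _ E) in U. injection U as U.
  apply (Rmult_eq_reg_r (/ (1 + 2 * psi (/ x)))); [|apply Rinv_neq_0_compat; lra].
  rewrite <- U. field. lra.
Qed.

(** * The continuation of zeta *)

(* Integrand of the Gamma function after [t = e ^ v]. *)
Definition gf (x v : R) : R := exp (x * v - exp v).

Lemma continuous_ex_derive (f : R -> R) x : ex_derive f x -> continuous f x.
Proof. apply (ex_derive_continuous (V := R_NormedModule)). Qed.

Lemma is_RInt_lin2 (f g : R -> R) a b c1 c2 : ex_RInt f a b -> ex_RInt g a b ->
  is_RInt (fun v => c1 * f v + c2 * g v) a b (c1 * RInt f a b + c2 * RInt g a b).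
Proof.
  intros F G. apply (is_RInt_plus (V := R_NormedModule) (fun v => c1 * f v) (fun v => c2 * g v));
  apply (is_RInt_scal (V := R_NormedModule)); apply (RInt_correct (V := R_CompleteNormedModule)); assumption.
Qed.

Lemma RInt_lin2 (f g : R -> R) a b c1 c2 : ex_RInt f a b -> ex_RInt g a b ->
  RInt (fun v => c1 * f v + c2 * g v) a b = c1 * RInt f a b + c2 * RInt g a b.
Proof. intros F G. apply is_RInt_unique, is_RInt_lin2; assumption. Qed.

Lemma RIntD (f f' : R -> R) a b : (forall v, is_derive f v (f' v)) -> (forall v, continuous f' v) -> RInt f' a b = f b - f a.
Proof.
  intros D F. apply is_RInt_unique. apply (is_RInt_derive (V := R_CompleteNormedModule) f f'); intros; auto.
Qed.

Lemma gf_cont x v : continuous (gf x) v.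
Proof. apply continuous_ex_derive. unfold gf. auto_derive. auto. Qed.

Lemma gf_exR x a b : ex_RInt (gf x) a b.
Proof. apply (ex_RInt_continuous (V := R_CompleteNormedModule)). intros; apply gf_cont. Qed.

Lemma gf_pos x v : 0 < gf x v. Proof. apply exp_pos. Qed.

Lemma RInt_sub_le (f : R -> R) a b c d : c <= a -> a <= b -> b <= d -> (forall p q, ex_RInt f p q) -> (forall v, 0 <= f v) ->
  RInt f a b <= RInt f c d.
Proof.
  intros H1 H2 H3 E P.
  assert (E1 := RInt_Chasles (V := R_CompleteNormedModule) f c a d (E _ _) (E _ _)).
  assert (E2 := RInt_Chasles (V := R_CompleteNormedModule) f a b d (E _ _) (E _ _)).
  unfold plus in E1, E2; simpl in E1, E2. rewrite <- E1, <- E2.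
  assert (0 <= RInt f c a) by (apply RInt_ge_0; auto).
  assert (0 <= RInt f b d) by (apply RInt_ge_0; auto). lra.
Qed.

Lemma quarter_sq_le_exp v : 0 <= v -> v ^ 2 / 4 <= exp v.
Proof.
  intros Hv. assert (A := exp_ineq1_le (v / 2)). replace v with (v / 2 + v / 2) at 2 by field. rewrite exp_plus.
  assert ((1 + v / 2) * (1 + v / 2) <= exp (v / 2) * exp (v / 2)) by (apply Rmult_le_compat; lra). nra.
Qed.

Lemma gf_upper x v : 0 < x -> 0 <= v -> gf x v <= exp ((x + 1) ^ 2) * exp (- v).
Proof.
  intros Hx Hv. unfold gf. rewrite <- exp_plus. apply exp_le_mono. assert (A := quarter_sq_le_exp v Hv).
  assert (0 <= (v / 2 - (x + 1)) ^ 2) by apply pow2_ge_0. simpl in *. lra.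
Qed.

Definition gint (x : R) (n : nat) : R := RInt (gf x) (- INR n) (INR n).

Lemma gint_incr x n : gint x n <= gint x (S n).
Proof.
  unfold gint. rewrite S_INR. assert (A := pos_INR n). apply RInt_sub_le; try lra.
  - intros; apply gf_exR.
  - intros; left; apply gf_pos.
Qed.

Lemma RInt_exp_lin c a b : c <> 0 -> RInt (fun v => exp (c * v)) a b = (exp (c * b) - exp (c * a)) / c.
Proof.
  intros Hc. replace ((exp (c * b) - exp (c * a)) / c) with (minus (exp (c * b) / c) (exp (c * a) / c)) by (unfold minus, plus, opp; simpl; field; exact Hc).
  apply is_RInt_unique, (is_RInt_derive (V := R_CompleteNormedModule) (fun v => exp (c * v) / c)).
  - intros v _. auto_derive; [auto|]. field. exact Hc.
  - intros v _. apply continuous_ex_derive. auto_derive. auto.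
Qed.

Lemma exR_exp_lin c a b : ex_RInt (fun v => exp (c * v)) a b.
Proof. apply (ex_RInt_continuous (V := R_CompleteNormedModule)). intros v _. apply continuous_ex_derive. auto_derive. auto. Qed.

Lemma gint_bounded x n : 0 < x -> gint x n <= / x + exp ((x + 1) ^ 2).
Proof.
  intros Hx. unfold gint. assert (A := pos_INR n).
  assert (E1 := RInt_Chasles (V := R_CompleteNormedModule) (gf x) (- INR n) 0 (INR n) (gf_exR _ _ _) (gf_exR _ _ _)).
  unfold plus in E1; simpl in E1. rewrite <- E1. apply Rplus_le_compat.
  - apply Rle_trans with (RInt (fun v => exp (x * v)) (- INR n) 0).
    + apply RInt_le; [lra|apply gf_exR|apply exR_exp_lin|]. intros v Hv. apply exp_le_mono. generalize (exp_pos v). lra.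
    + rewrite RInt_exp_lin by lra. rewrite Rmult_0_r, exp_0. unfold Rdiv. rewrite <- (Rmult_1_l (/ x)) at 2.
      apply Rmult_le_compat_r; [left; apply Rinv_0_lt_compat, Hx|]. generalize (exp_pos (x * - INR n)). lra.
  - apply Rle_trans with (RInt (fun v => scal (exp ((x + 1) ^ 2)) (exp (- 1 * v))) 0 (INR n)).
    + apply RInt_le; [lra|apply gf_exR|apply (ex_RInt_scal (V := R_NormedModule)), exR_exp_lin|]. intros v Hv.
      eapply Rle_trans; [apply gf_upper; lra|]. right. unfold scal; simpl; unfold mult; simpl. do 2 f_equal. ring.
    + rewrite (RInt_scal (V := R_CompleteNormedModule)) by apply exR_exp_lin. rewrite RInt_exp_lin by lra. change scal with Rmult. cbv beta.
      rewrite <- (Rmult_1_r (exp ((x + 1) ^ 2))) at 2. apply Rmult_le_compat_l; [left; apply exp_pos|].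
      rewrite Rmult_0_r, exp_0. assert (Q : forall e, (e - 1) / - 1 = 1 - e) by (intros; field). rewrite Q. generalize (exp_pos (- 1 * INR n)). lra.
Qed.

(** Euler's integral at real [x]. It arises in the Mellin transform of [psi] and is identified with
    the reciprocal of [rG] in [Gam_rG]. *)
Definition Gam (x : R) : R := real (Lim_seq (gint x)).

Lemma Gam_lim x : 0 < x -> is_lim_seq (gint x) (Gam x).
Proof.
  intros Hx. destruct (ex_finite_lim_seq_incr (gint x) _ (gint_incr x) (fun n => gint_bounded x n Hx)) as [l Hl].
  unfold Gam. rewrite (is_lim_seq_unique _ _ Hl). exact Hl.
Qed.

Lemma exp_negINR_lim c : 0 < c -> is_lim_seq (fun n => exp (- (c * INR n))) 0.
Proof.
  intros Hc. apply is_lim_seq_ext with (fun n => exp (- c) ^ n).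
  - intros n. rewrite exp_INR_pow. f_equal. ring.
  - apply is_lim_seq_geom. generalize (exp_neg_lt1 c Hc). intros. rewrite Rabs_pos_eq; lra.
Qed.

Lemma gf_bdry x : 0 < x -> is_lim_seq (fun n => gf x (INR n) - gf x (- INR n)) 0.
Proof.
  intros Hx. replace (Finite 0) with (Finite (0 - 0)) by (f_equal; ring). apply is_lim_seq_minus'.
  - apply (is_lim_seq_le_le (fun _ => 0) _ (fun n => exp ((x + 1) ^ 2) * exp (- (1 * INR n)))).
    + intros n. split; [left; apply gf_pos|]. rewrite Rmult_1_l. apply gf_upper; [exact Hx|apply pos_INR].
    + apply is_lim_seq_const.
    + rewrite <- (Rmult_0_r (exp ((x + 1) ^ 2))). apply lim_scal, exp_negINR_lim. lra.
  - apply (is_lim_seq_le_le (fun _ => 0) _ (fun n => exp (- (x * INR n)))).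
    + intros n. split; [left; apply gf_pos|]. unfold gf. apply exp_le_mono. generalize (exp_pos (- INR n)). lra.
    + apply is_lim_seq_const.
    + apply exp_negINR_lim, Hx.
Qed.

Lemma Gam_shift x : 0 < x -> Gam (x + 1) = x * Gam x.
Proof.
  intros Hx.
  assert (E : forall n, gf x (INR n) - gf x (- INR n) = x * gint x n - gint (x + 1) n).
  { intros n. unfold gint.
    replace (x * RInt (gf x) (- INR n) (INR n) - RInt (gf (x + 1)) (- INR n) (INR n)) with
      (x * RInt (gf x) (- INR n) (INR n) + (-1) * RInt (gf (x + 1)) (- INR n) (INR n)) by ring.
    rewrite <- RInt_lin2 by apply gf_exR. symmetry. apply (RIntD (gf x)).
    - intros v. unfold gf. auto_derive; [auto|].
      replace ((x + 1) * v - exp v) with (v + (x * v - exp v)) by ring. rewrite (exp_plus v). unfold Rminus. ring.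
    - intros v. apply continuous_ex_derive. unfold gf. auto_derive. auto. }
  assert (L := gf_bdry x Hx). apply (is_lim_seq_ext _ _ _ E) in L.
  assert (L2 := is_lim_seq_minus' _ _ _ _ (lim_scal x _ _ (Gam_lim x Hx)) (Gam_lim (x + 1) ltac:(lra))).
  assert (U := is_lim_seq_unique _ _ L). rewrite (is_lim_seq_unique _ _ L2) in U. injection U as U. lra.
Qed.

Lemma Gam_1 : Gam 1 = 1.
Proof.
  assert (L : is_lim_seq (gint 1) (exp (- 0) - 0)).
  { apply is_lim_seq_ext with (fun n => exp (- exp (- (1 * INR n))) - exp (- exp (INR n))).
    - intros n. unfold gint. symmetry.
      rewrite (RIntD (fun v => - exp (- exp v))).
      + rewrite Rmult_1_l. ring.
      + intros v. unfold gf. auto_derive; [auto|]. replace (1 * v - exp v) with (v + - exp v) by ring. rewrite (exp_plus v). ring.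
      + intros v. apply gf_cont.
    - apply is_lim_seq_minus'; [apply lim_exp_opp, exp_negINR_lim; lra|].
      apply (is_lim_seq_le_le (fun _ => 0) _ (fun n => exp (- (1 * INR n)))); [|apply is_lim_seq_const|apply exp_negINR_lim; lra].
      intros n. split; [left; apply exp_pos|]. apply exp_le_mono. generalize (exp_ineq1_le (INR n)). lra. }
  unfold Gam. rewrite (is_lim_seq_unique _ _ L). simpl. rewrite Ropp_0, exp_0. ring.
Qed.

Lemma Gam_fact n : Gam (INR n + 1) = INR (fact n).
Proof.
  induction n; [simpl; rewrite Rplus_0_l; apply Gam_1|].
  rewrite S_INR, Gam_shift by (generalize (pos_INR n); lra). rewrite IHn, <- S_INR, <- mult_INR. reflexivity.
Qed.

Fixpoint rr (x : R) (n : nat) : R := match n with O => x | S m => rr x m * (x + INR n) end.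

Lemma rising_rr x n : rising (RtoC x) n = RtoC (rr x n).
Proof.
  induction n; [reflexivity|]. change (rising (RtoC x) (S n)) with (rising (RtoC x) n * (RtoC x + RtoC (INR (S n))))%C.
  rewrite IHn, <- RtoC_plus, <- RtoC_mult. reflexivity.
Qed.

Lemma Gam_rr x n : 0 < x -> Gam (x + INR n + 1) = rr x n * Gam x.
Proof.
  intros Hx. induction n; [simpl; rewrite Rplus_0_r; apply Gam_shift, Hx|].
  rewrite S_INR, <- Rplus_assoc. rewrite (Gam_shift (x + INR n + 1)) by (generalize (pos_INR n); lra).
  rewrite IHn. change (rr x (S n)) with (rr x n * (x + INR (S n))). rewrite S_INR. ring.
Qed.

Lemma exp_convex_upper th u : 0 <= th <= 1 -> exp (th * u) <= 1 - th + th * exp u.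
Proof.
  intros Ht. set (p := exp (th * u)). assert (P := exp_pos (th * u)). fold p in P.
  assert (A : p * (1 - th * u) <= 1).
  { assert (K := exp_ineq1_le (- (th * u))). apply Rmult_le_compat_l with (r := p) in K; [|lra].
    unfold p in K at 2. rewrite <- exp_plus in K. replace (th * u + - (th * u)) with 0 in K by ring. rewrite exp_0 in K. lra. }
  assert (B : p * (1 + (1 - th) * u) <= exp u).
  { assert (K := exp_ineq1_le ((1 - th) * u)). apply Rmult_le_compat_l with (r := p) in K; [|lra].
    unfold p in K at 2. rewrite <- exp_plus in K. replace (th * u + (1 - th) * u) with u in K by ring. lra. }
  apply Rmult_le_compat_l with (r := 1 - th) in A; [|lra]. apply Rmult_le_compat_l with (r := th) in B; [|lra]. nra.
Qed.

(** Write [e ^ (th u) = e ^ u e ^ (- (1 - th) u)] and use [e ^ v >= 1 + v] twice. Only integer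
    powers of [e ^ u] occur on the left, so that integration against [gf] yields values of [Gam] at
    integers. *)
Lemma exp_convex_lower th u : 0 <= th <= 1 -> exp u - (1 - th) * (exp u * exp u - exp u) <= exp (th * u).
Proof.
  intros Ht. set (p := exp u). assert (P := exp_pos u). fold p in P.
  replace (th * u) with (u + - ((1 - th) * u)) by ring. rewrite exp_plus. fold p.
  assert (A := exp_ineq1_le (- ((1 - th) * u))). assert (B : 1 + u <= p) by apply exp_ineq1_le.
  assert (1 - (1 - th) * (p - 1) <= exp (- ((1 - th) * u))) by nra. nra.
Qed.

Lemma Gam_le x y (c1 c2 c3 : R) (z : R) : 0 < x -> 0 < y -> 0 < z ->
  (forall v, c1 * gf x v + c2 * gf y v <= c3 * gf z v) -> c1 * Gam x + c2 * Gam y <= c3 * Gam z.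
Proof.
  intros Hx Hy Hz H.
  apply (is_lim_seq_le (fun n => c1 * gint x n + c2 * gint y n) (fun n => c3 * gint z n) (c1 * Gam x + c2 * Gam y) (c3 * Gam z)).
  - intros n. unfold gint. assert (A := pos_INR n).
    rewrite <- RInt_lin2 by apply gf_exR.
    replace (c3 * RInt (gf z) (- INR n) (INR n)) with (c3 * RInt (gf z) (- INR n) (INR n) + 0 * RInt (gf z) (- INR n) (INR n)) by ring.
    rewrite <- RInt_lin2 by apply gf_exR.
    apply RInt_le; [lra|eexists; apply is_RInt_lin2; apply gf_exR|eexists; apply is_RInt_lin2; apply gf_exR|].
    intros v _. rewrite Rmult_0_l, Rplus_0_r. apply H.
  - apply is_lim_seq_plus'; apply lim_scal, Gam_lim; assumption.
  - apply lim_scal, Gam_lim, Hz.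
Qed.

Lemma gf_shift x y v : gf (x + y) v = exp (y * v) * gf x v.
Proof. unfold gf. rewrite <- exp_plus. f_equal. ring. Qed.

(** The two convexity bounds, taken at [u = v - ln (n + 1)] and integrated against the Gamma
    integrand, squeeze the quotient between combinations of factorials that tend to 1. *)
Lemma Gam_asym th : 0 < th <= 1 -> is_lim_seq (fun n => Gam (INR (S n) + 1 + th) / (INR (fact (S n)) * Rpower (INR (S n)) th)) 1.
Proof.
  intros Ht.
  assert (Li : is_lim_seq (fun n => / INR (S n)) 0).
  { apply (is_lim_seq_inv (fun n => INR (S n)) p_infty); [apply (is_lim_seq_incr_1 INR), is_lim_seq_INR|discriminate]. }
  assert (Fn : forall n, Gam (INR (S n) + 1) = INR (fact (S n)) /\ Gam (INR (S n) + 1 + 1) = (INR (S n) + 1) * INR (fact (S n)) /\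
     Gam (INR (S n) + 1 + 2) = (INR (S n) + 2) * ((INR (S n) + 1) * INR (fact (S n)))).
  { intros n. assert (P := INR_S_pos n). assert (A := Gam_fact (S n)). assert (B := Gam_shift (INR (S n) + 1) ltac:(lra)).
    assert (C := Gam_shift (INR (S n) + 1 + 1) ltac:(lra)). replace (INR (S n) + 1 + 2) with (INR (S n) + 1 + 1 + 1) by ring.
    rewrite C, B, A. repeat split. ring. }
  assert (Py : forall n v, exp (v - ln (INR (S n))) = exp v / INR (S n)).
  { intros n v. unfold Rminus. rewrite exp_plus, exp_Ropp, exp_ln by apply INR_S_pos. reflexivity. }
  assert (Pt : forall n v, exp (th * v) = Rpower (INR (S n)) th * exp (th * (v - ln (INR (S n))))).
  { intros n v. unfold Rpower. rewrite <- exp_plus. f_equal. ring. }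
  apply (is_lim_seq_le_le (fun n => 1 + / INR (S n) - (1 - th) * ((1 + 2 * / INR (S n)) * (1 + / INR (S n)) - (1 + / INR (S n)))) _ (fun n => 1 - th + th * (1 + / INR (S n)))).
  - intros n. destruct (Fn n) as (F1 & F2 & F3). set (a := INR (S n)) in *. assert (Ha : 0 < a) by apply INR_S_pos.
    set (f := INR (fact (S n))) in *. assert (Hf : 0 < f) by apply INR_fact_lt_0.
    set (q := Rpower a th) in *. assert (Hq : 0 < q) by apply exp_pos.
    split.
    + apply -> Rle_div_r; [|apply Rmult_lt_0_compat; assumption].
      assert (K := Gam_le (a + 1 + 1) (a + 1 + 2) (q * (/ a + (1 - th) * / a)) (- (q * (1 - th) * (/ a * / a))) 1 (a + 1 + th) ltac:(lra) ltac:(lra) ltac:(lra)).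
      rewrite F2, F3, Rmult_1_l in K. eapply Rle_trans; [|apply K].
      * right. field. lra.
      * intros v. rewrite (gf_shift (a + 1) th), (gf_shift (a + 1) 1), (gf_shift (a + 1) 2). rewrite Rmult_1_l. rewrite (Pt n v). fold a q.
        assert (B := exp_convex_lower th (v - ln a) ltac:(lra)). rewrite (Py n v : exp (v - ln a) = exp v / a) in B.
        replace (exp (1 * v)) with (exp v) by (f_equal; ring). replace (exp (2 * v)) with (exp v * exp v) by (rewrite <- exp_plus; f_equal; ring).
        assert (G := gf_pos (a + 1) v).
        apply Rmult_le_compat_l with (r := q * gf (a + 1) v) in B; [|left; apply Rmult_lt_0_compat; assumption].
        eapply Rle_trans; [|eapply Rle_trans; [exact B|right; ring]]. right. field. lra.
    + apply Rle_div_l; [apply Rmult_lt_0_compat; assumption|].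
      assert (K := Gam_le (a + 1 + th) (a + 1 + th) 1 0 1 (a + 1 + th) ltac:(lra) ltac:(lra) ltac:(lra)). clear K.
      assert (K : 1 * Gam (a + 1 + th) + (- (q * th * / a)) * Gam (a + 1 + 1) <= (q * (1 - th)) * Gam (a + 1)).
      { apply Gam_le; try lra. intros v. rewrite (gf_shift (a + 1) th), (gf_shift (a + 1) 1), (Pt n v). fold a q.
        assert (B := exp_convex_upper th (v - ln a) ltac:(lra)). rewrite (Py n v : exp (v - ln a) = exp v / a) in B.
        replace (exp (1 * v)) with (exp v) by (f_equal; ring).
        assert (G := gf_pos (a + 1) v).
        apply Rmult_le_compat_l with (r := q * gf (a + 1) v) in B; [|left; apply Rmult_lt_0_compat; assumption].
        replace (q * gf (a + 1) v * (1 - th + th * (exp v / a))) with (q * (1 - th) * gf (a + 1) v + q * th * / a * (exp v * gf (a + 1) v)) in B by (field; lra).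
        lra. }
      rewrite F1, F2 in K. replace ((1 - th + th * (1 + / a)) * (f * q)) with (q * (1 - th) * f + q * th * / a * ((a + 1) * f)) by (field; lra). lra.
  - set (F := fun u => 1 + u - (1 - th) * ((1 + 2 * u) * (1 + u) - (1 + u))).
    replace (Finite 1) with (Finite (F 0)) by (unfold F; f_equal; ring).
    apply (is_lim_seq_continuous F (fun n => / INR (S n)) 0); [|exact Li].
    apply continuity_pt_filterlim, continuous_ex_derive. unfold F. auto_derive. auto.
  - set (F := fun u => 1 - th + th * (1 + u)).
    replace (Finite 1) with (Finite (F 0)) by (unfold F; f_equal; ring).
    apply (is_lim_seq_continuous F (fun n => / INR (S n)) 0); [|exact Li].
    apply continuity_pt_filterlim, continuous_ex_derive. unfold F. auto_derive. auto.
Qed.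

(** For [0 < x <= 1] the product of [Gam x] with the terms [rg] is exactly the quotient of
    [Gam_asym]; the two shift equations then raise [x] in unit steps. *)
Theorem Gam_rG x : 0 < x -> (RtoC (Gam x) * rG (RtoC x))%C = 1%C.
Proof.
  assert (B : forall x, 0 < x <= 1 -> (RtoC (Gam x) * rG (RtoC x))%C = 1%C).
  { intros th Ht. apply (is_Clim_inj (fun n => RtoC (Gam th) * rg (S n) (RtoC th))%C); [apply is_Clim_scal, rG_lim|].
    assert (L := Gam_asym th Ht).
    apply is_Clim_ext with (fun n => RtoC (Gam (INR (S n) + 1 + th) / (INR (fact (S n)) * Rpower (INR (S n)) th))).
    - intros n. unfold rg. rewrite rising_rr. replace (- RtoC th)%C with (RtoC (- th)) by (rewrite RtoC_opp; reflexivity).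
      rewrite Rcpow_RtoC, <- RtoC_inv by apply INR_fact_neq_0. rewrite <- !RtoC_mult. f_equal.
      replace (INR (S n) + 1 + th) with (th + INR (S n) + 1) by ring. rewrite Gam_rr by lra.
      rewrite Rpower_Ropp. field. split; [apply Rgt_not_eq, exp_pos|apply INR_fact_neq_0].
    - apply is_Clim_pair; [exact L|apply is_lim_seq_const]. }
  assert (C : forall n x, 0 < x <= INR n + 1 -> (RtoC (Gam x) * rG (RtoC x))%C = 1%C).
  { induction n; intros y Hy; [apply B; simpl in Hy; lra|]. rewrite S_INR in Hy.
    destruct (Rle_dec y 1) as [H|H]; [apply B; lra|].
    assert (IH := IHn (y - 1) ltac:(lra)). rewrite rG_shift in IH.
    replace (RtoC (y - 1) + 1)%C with (RtoC y) in IH by (rewrite RtoC_minus; ring).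
    replace (Gam y) with ((y - 1) * Gam (y - 1)).
    - rewrite RtoC_mult. rewrite <- IH. ring.
    - rewrite <- Gam_shift by lra. f_equal. ring. }
  intros Hx. destruct (INR_unbounded x) as [n Hn]. apply (C n). lra.
Qed.

(** * The Mellin transform of [psi] *)

Lemma RInt_mellin_shift x c n : 0 < c ->
  RInt (fun v => exp (x * v - c * exp v)) (- INR n) (INR n) = Rpower c (- x) * RInt (gf x) (- INR n + ln c) (INR n + ln c).
Proof.
  intros Hc. replace (- INR n + ln c) with (1 * - INR n + ln c) by ring. replace (INR n + ln c) with (1 * INR n + ln c) by ring.
  rewrite <- (RInt_comp_lin (V := R_CompleteNormedModule) (gf x)) by apply gf_exR.
  rewrite <- (RInt_scal (V := R_CompleteNormedModule)).
  2: { apply (ex_RInt_continuous (V := R_CompleteNormedModule)). intros v _. apply continuous_ex_derive.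
       unfold scal; simpl; unfold mult; simpl; unfold gf. auto_derive. auto. }
  apply RInt_ext. intros v _. unfold scal; simpl; unfold mult; simpl. unfold gf, Rpower. rewrite Rmult_1_l, <- exp_plus. f_equal.
  rewrite !Rmult_1_l, (exp_plus v), exp_ln by exact Hc. ring.
Qed.

Lemma mellin_lim x c : 0 < x -> 0 < c ->
  is_lim_seq (fun n => RInt (fun v => exp (x * v - c * exp v)) (- INR n) (INR n)) (Rpower c (- x) * Gam x).
Proof.
  intros Hx Hc. eapply is_lim_seq_ext; [intros n; symmetry; apply RInt_mellin_shift, Hc|]. apply lim_scal.
  destruct (INR_unbounded (Rabs (ln c))) as [k Hk]. assert (Hk2 := Rle_abs (ln c)). assert (Hk3 := Rle_abs (- ln c)). rewrite Rabs_Ropp in Hk3.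
  apply (is_lim_seq_le_le_loc (fun n => gint x (n - k)) _ (fun n => gint x (n + k))).
  - exists k. intros n Hn. unfold gint. rewrite minus_INR, plus_INR by exact Hn. apply le_INR in Hn.
    assert (0 <= INR k) by apply pos_INR.
    split; apply RInt_sub_le; try lra; try (intros; apply gf_exR); intros; left; apply gf_pos.
  - apply (is_lim_seq_incr_n _ k). apply is_lim_seq_ext with (gint x); [intros n; f_equal; lia|apply Gam_lim, Hx].
  - apply (is_lim_seq_incr_n (gint x) k). apply Gam_lim, Hx.
Qed.

Definition pterm (k : nat) (v : R) : R := exp (- (PI * INR (S k) ^ 2 * exp v)).

Definition ps (v : R) : R := psi (exp v).

Lemma pterm_bound k v v0 : v0 <= v -> 0 <= pterm k v <= exp (- (PI * exp v0)) ^ k.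
Proof.
  intros Hv. split; [left; apply exp_pos|]. assert (P := PI_RGT_0). assert (E := exp_pos v0).
  assert (Q : 0 < PI * exp v0) by (apply Rmult_lt_0_compat; lra).
  eapply Rle_trans; [|apply pow_S_le, exp_neg_lt1, Q]. eapply Rle_trans; [|apply exp_geom_bound, Q].
  unfold pterm. apply exp_le_mono, Ropp_le_contravar.
  replace (PI * INR (S k) ^ 2 * exp v) with (PI * exp v * INR (S k) ^ 2) by ring.
  apply Rmult_le_compat_r; [apply pow2_ge_0|]. apply Rmult_le_compat_l; [lra|]. apply exp_le_mono, Hv.
Qed.

Lemma ps_lim v : is_lim_seq (fun n => rsum (fun k => pterm k v) n) (ps v).
Proof. apply (psi_lim (exp v)), exp_pos. Qed.

Lemma ps_tail v v0 n : v0 <= v -> 0 <= ps v - rsum (fun k => pterm k v) n <= exp (- (PI * exp v0)) ^ n / (1 - exp (- (PI * exp v0))).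
Proof.
  intros Hv. assert (P := PI_RGT_0). assert (E := exp_pos v0). set (q := exp (- (PI * exp v0))).
  assert (Hq : 0 <= q < 1) by (apply exp_neg_lt1, Rmult_lt_0_compat; lra).
  assert (L : is_lim_seq (fun j => rsum (fun k => pterm k v) (j + n) - rsum (fun k => pterm k v) n) (ps v - rsum (fun k => pterm k v) n)).
  { apply is_lim_seq_minus'; [|apply is_lim_seq_const]. apply (is_lim_seq_incr_n (fun m => rsum (fun k => pterm k v) m) n), ps_lim. }
  assert (B : forall j, 0 <= rsum (fun k => pterm k v) (j + n) - rsum (fun k => pterm k v) n <= q ^ n / (1 - q)).
  { intros j. rewrite Nat.add_comm, rsum_split.
    replace (rsum (fun k => pterm k v) n + rsum (fun i => pterm (n + i) v) j - rsum (fun k => pterm k v) n) with (rsum (fun i => pterm (n + i) v) j) by ring.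
    split; [apply rsum_nonneg; intros; left; apply exp_pos|]. eapply Rle_trans; [|apply (geom_block q n j Hq)].
    apply rsum_le. intros; apply pterm_bound, Hv. }
  split.
  - apply (is_lim_seq_le (fun _ => 0) _ 0 (ps v - rsum (fun k => pterm k v) n)) with (3 := L); [apply B|apply is_lim_seq_const].
  - apply (is_lim_seq_le _ (fun _ => q ^ n / (1 - q)) (ps v - rsum (fun k => pterm k v) n) (q ^ n / (1 - q))) with (2 := L); [apply B|apply is_lim_seq_const].
Qed.

Lemma continuous_pterm k v : continuous (pterm k) v.
Proof. apply continuous_ex_derive. unfold pterm. auto_derive. auto. Qed.

Lemma continuous_rsum (f : nat -> R -> R) n v : (forall k, continuous (f k) v) -> continuous (fun v => rsum (fun k => f k v) n) v.
Proof.
  intros H. induction n; [apply continuous_const|]. apply (continuous_plus (V := R_NormedModule) (fun v => rsum (fun k => f k v) n) (f n)); auto.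
Qed.

Lemma tail_small v0 eps : 0 < eps -> exists n, exp (- (PI * exp v0)) ^ n / (1 - exp (- (PI * exp v0))) < eps.
Proof.
  intros He. assert (P := PI_RGT_0). assert (E := exp_pos v0). set (q := exp (- (PI * exp v0))).
  assert (Hq : 0 <= q < 1) by (apply exp_neg_lt1, Rmult_lt_0_compat; lra).
  assert (G : is_lim_seq (fun n => q ^ n) 0) by (apply is_lim_seq_geom; rewrite Rabs_pos_eq; lra).
  apply is_lim_seq_spec in G. assert (P1 : 0 < eps * (1 - q)) by (apply Rmult_lt_0_compat; lra).
  destruct (G (mkposreal _ P1)) as [n Hn]. exists n. specialize (Hn n (Nat.le_refl _)). simpl in Hn.
  rewrite Rminus_0_r in Hn. assert (Hn2 := Rle_lt_trans _ _ _ (Rle_abs _) Hn). apply Rlt_div_l; lra.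
Qed.

Lemma continuous_ps v : continuous ps v.
Proof.
  apply continuous_eps. intros eps He. destruct (tail_small (v - 1) (eps / 3)) as [n Hn]; [lra|].
  destruct (proj2 (continuous_eps _ _) (continuous_rsum pterm n v (fun k => continuous_pterm k v)) (eps / 3)) as [d [Hd Hd']]; [lra|].
  exists (Rmin d 1). split; [apply Rmin_pos; lra|]. intros y Hy.
  specialize (Hd' y (Rlt_le_trans _ _ _ Hy (Rmin_l _ _))). assert (Hy1 := Rlt_le_trans _ _ _ Hy (Rmin_r _ _)).
  apply Rabs_lt_between in Hy1. assert (T1 := ps_tail v (v - 1) n ltac:(lra)). assert (T2 := ps_tail y (v - 1) n ltac:(lra)).
  apply Rabs_lt_between in Hd'. apply Rabs_lt_between. lra.
Qed.

Lemma ps_nonneg v : 0 <= ps v. Proof. apply psi_nonneg, exp_pos. Qed.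

Lemma ps_decay v : 0 <= v -> ps v <= 3 * exp (- exp v).
Proof.
  intros Hv. assert (P := PI2_3_2). unfold PI2 in P. assert (A := exp_ineq1_le v).
  assert (T := ps_tail v v 1 (Rle_refl _)). cbn [rsum] in T.
  assert (E0 : pterm 0 v = exp (- (PI * exp v))) by (unfold pterm; do 2 f_equal; simpl; ring).
  rewrite E0 in T. set (q := exp (- (PI * exp v))) in *. assert (Q0 : 0 < q) by apply exp_pos.
  assert (Q1 : q <= exp (- exp v)). { apply exp_le_mono. nra. }
  assert (Q2 : q <= / 4).
  { unfold q. rewrite exp_Ropp. apply Rinv_le_contravar; [lra|]. generalize (exp_ineq1_le (PI * exp v)). nra. }
  assert (q / (1 - q) <= 4 / 3 * q).
  { apply Rle_div_l; [lra|]. nra. }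
  assert (q ^ 1 / (1 - q) = q / (1 - q)) by (simpl; f_equal; ring). lra.
Qed.

(** The integral of [psi x * x ^ (z - 1)] over [1 <= x <= e ^ n] in the variable [v = ln x]; each
    one is entire in [z]. *)
Definition En (n : nat) (z : C) : C := CI (fun v => RtoC (ps v) * Cexp (RtoC v * z))%C 0 (INR n).

Lemma En_conts z a b : conts (fun v => RtoC (ps v) * Cexp (RtoC v * z))%C a b.
Proof.
  apply (conts_mult (fun v => RtoC (ps v))).
  - intros t _. apply rcont_RtoC, continuous_ps.
  - intros t _. eapply rder_rcont, rder_Cexp_lin.
Qed.

Lemma hol_En n z : hol (En n) z.
Proof.
  assert (Hn := pos_INR n).
  exists (CI (fun v => RtoC v * (RtoC (ps v) * Cexp (RtoC v * z)))%C 0 (INR n)).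
  assert (C2 : forall z, conts (fun v => RtoC v * (RtoC (ps v) * Cexp (RtoC v * z)))%C 0 (INR n)).
  { intros w. apply (conts_mult (fun v => RtoC v)); [|apply En_conts]. intros t _. apply rcont_RtoC, continuous_id. }
  destruct (conts_bounded _ _ _ (En_conts z 0 (INR n))) as [M [HM Hb]].
  apply (cder_quad _ _ _ (M * (INR n ^ 2 * exp (INR n)) * (INR n - 0)) 1); [lra| |].
  { repeat apply Rmult_le_pos; try lra; try (left; apply exp_pos). }
  intros h Hh. unfold En. rewrite <- CI_minus by (try lra; apply En_conts).
  rewrite (Cmult_comm _ h), <- CI_scal by (try lra; apply C2). rewrite <- CI_minus.
  - eapply Rle_trans; [apply (CI_bound _ (M * (INR n ^ 2 * exp (INR n)) * Cmod h ^ 2)); [lra| |]|right; ring].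
    + intros t Ht. apply rcont_minus; [apply rcont_minus|].
      * apply (En_conts _ 0 (INR n) t Ht). * apply (En_conts _ 0 (INR n) t Ht).
      * apply rcont_mult; [apply rcont_const|apply (C2 z t Ht)].
    + intros t Ht.
      replace (RtoC (ps t) * Cexp (RtoC t * (z + h)) - RtoC (ps t) * Cexp (RtoC t * z) - h * (RtoC t * (RtoC (ps t) * Cexp (RtoC t * z))))%C
        with ((RtoC (ps t) * Cexp (RtoC t * z)) * (Cexp (RtoC t * h) - 1 - RtoC t * h))%C.
      2: { rewrite Cmult_plus_distr_l, Cexp_plus. ring. }
      rewrite Cmod_mult, Rmult_assoc. apply Rmult_le_compat; try apply Cmod_ge_0; [apply Hb, Ht|].
      eapply Rle_trans; [apply Cexp_sub2_bound|]. rewrite Cmod_mult, Cmod_R, Rabs_pos_eq by lra.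
      assert (B := Cmod_ge_0 h).
      replace (INR n ^ 2 * exp (INR n) * Cmod h ^ 2) with ((INR n * Cmod h) ^ 2 * exp (INR n)) by ring.
      apply Rmult_le_compat; [apply pow2_ge_0|left; apply exp_pos| |].
      * apply pow_incr. split; [apply Rmult_le_pos; lra|]. apply Rmult_le_compat_r; lra.
      * apply exp_le_mono. nra.
  - lra.
  - intros t Ht. apply rcont_minus; apply (En_conts _ 0 (INR n) t Ht).
  - intros t Ht. apply rcont_mult; [apply rcont_const|apply (C2 z t Ht)].
Qed.

(** The doubly exponential decay of [ps] beats [e ^ (K v)] by a full factor [e ^ (- v)], which makes
    the limit locally uniform in [z]. *)
Lemma En_step K n z : 0 < K -> Re z <= K ->
  Cmod (En (S n) z - En n z)%C <= 3 * exp ((K + 1) ^ 2) * exp (- (1 * INR n)) - 3 * exp ((K + 1) ^ 2) * exp (- (1 * INR (S n))).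
Proof.
  intros HK Hz. unfold En. assert (Hn := pos_INR n).
  rewrite <- (CI_Chasles _ 0 (INR n) (INR (S n))) by (try (rewrite S_INR; lra); try lra; apply En_conts).
  match goal with |- Cmod (?a + ?b - ?a)%C <= _ => replace (a + b - a)%C with b by ring end.
  assert (HS : INR n <= INR (S n)) by (rewrite S_INR; lra).
  eapply Rle_trans.
  { apply (CI_bound_fun _ (fun v => (3 * exp ((K + 1) ^ 2)) * exp (- 1 * v) + 0 * exp (- 1 * v)) _ _ HS (En_conts _ _ _)).
    - eexists. apply is_RInt_lin2; apply exR_exp_lin.
    - intros t Ht. rewrite Cmod_mult, Cmod_R, Cmod_Cexp, Rabs_pos_eq by apply ps_nonneg.
      replace (Re (RtoC t * z)) with (t * Re z) by (destruct z; csimp; ring).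
      rewrite Rmult_0_l, Rplus_0_r, Rmult_assoc.
      apply Rle_trans with (3 * (exp (- exp t) * exp (K * t))).
      + rewrite <- Rmult_assoc. apply Rmult_le_compat; [apply ps_nonneg|left; apply exp_pos|apply ps_decay; lra|]. apply exp_le_mono. nra.
      + apply Rmult_le_compat_l; [lra|]. rewrite <- exp_plus. assert (G := gf_upper K t HK ltac:(lra)). unfold gf in G.
        replace (- exp t + K * t) with (K * t - exp t) by ring. replace (- 1 * t) with (- t) by ring. exact G. }
  rewrite RInt_lin2 by apply exR_exp_lin. rewrite RInt_exp_lin by lra.
  replace (- (1 * INR n)) with (- 1 * INR n) by ring. replace (- (1 * INR (S n))) with (- 1 * INR (S n)) by ring. right. field.
Qed.

Definition EE (z : C) : C := Clim (fun n => En n z).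

Lemma EE_approx K z n : 0 < K -> Re z <= K -> Cmod (En n z - EE z)%C <= 3 * exp ((K + 1) ^ 2) * exp (- (1 * INR n)).
Proof.
  intros HK Hz.
  assert (B0 : is_lim_seq (fun n => 3 * exp ((K + 1) ^ 2) * exp (- (1 * INR n))) 0).
  { rewrite <- (Rmult_0_r (3 * exp ((K + 1) ^ 2))). apply lim_scal, exp_negINR_lim. lra. }
  destruct (telescope_limit (fun n => En n z) _ B0 (fun n => En_step K n z HK Hz)) as [l Hl].
  replace (EE z) with l; [apply Hl|]. symmetry. apply is_Clim_unique. eapply is_Clim_bound; [exact B0|exact Hl].
Qed.

Lemma EE_lim z : is_Clim (fun n => En n z) (EE z).
Proof.
  set (K := Rabs (Re z) + 1). assert (HK : 0 < K) by (unfold K; generalize (Rabs_pos (Re z)); lra).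
  eapply is_Clim_bound; [|intros n; apply (EE_approx K z n HK); unfold K; generalize (Rle_abs (Re z)); lra].
  rewrite <- (Rmult_0_r (3 * exp ((K + 1) ^ 2))). apply lim_scal, exp_negINR_lim. lra.
Qed.

Lemma hol_EE z : hol EE z.
Proof.
  set (K := Rabs (Re z) + 1). assert (HK : 0 < K) by (unfold K; generalize (Rabs_pos (Re z)); lra).
  apply (hol_unif_limit En EE z 1); [lra|intros; apply hol_En|].
  intros eps He.
  assert (B0 : is_lim_seq (fun n => 3 * exp ((K + 1) ^ 2) * exp (- (1 * INR n))) 0).
  { rewrite <- (Rmult_0_r (3 * exp ((K + 1) ^ 2))). apply lim_scal, exp_negINR_lim. lra. }
  apply is_lim_seq_spec in B0. destruct (B0 (mkposreal eps He)) as [N HN]. exists N. intros n h Hn Hh. specialize (HN n Hn). simpl pos in HN.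
  rewrite Rminus_0_r in HN. assert (HN2 := Rle_lt_trans _ _ _ (Rle_abs _) HN).
  eapply Rle_trans; [apply (EE_approx K); [exact HK|]|left; exact HN2].
  replace (Re (z + h)) with (Re z + Re h) by reflexivity. unfold K. generalize (Rle_abs (Re z)) (re_le_Cmod h) (Rle_abs (Re h)). lra.
Qed.

Definition L0 (s : C) : C := (EE (s / 2) + EE ((1 - s) / 2))%C.

Lemma hol_half f z : hol f z -> hol (fun s => f s / 2)%C z.
Proof. intros H. apply hol_div; [exact H|apply hol_const|]. intros E. apply RtoC_inj in E. lra. Qed.

Lemma hol_L0 s : hol L0 s.
Proof.
  apply (hol_plus (fun s => EE (s / 2))%C (fun s => EE ((1 - s) / 2))%C).
  - apply (hol_comp (fun s => s / 2)%C EE); [apply hol_half, hol_id|apply hol_EE].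
  - apply (hol_comp (fun s => (1 - s) / 2)%C EE); [|apply hol_EE]. apply hol_half. apply hol_minus; [apply hol_const|apply hol_id].
Qed.

(* Riemann's formula: with [x = e ^ v], [L0 s] is the integral of
   [psi x (x ^ (s / 2) + x ^ ((1 - s) / 2)) / x] over [x >= 1], and
   [- 1 / s] times the reciprocal of Gamma at [s / 2] is written
   [- 1 / 2] times its value at [s / 2 + 1] to be entire. *)
Definition zf (s : C) : C :=
  (Rcpow PI (s / 2) * ((L0 s + / (s - 1)) * rG (s / 2) - / 2 * rG (s / 2 + 1)))%C.

Lemma hol_zf (s : C) : s <> 1%C -> hol zf s.
Proof.
  intros H1. apply (hol_mult (fun s => Rcpow PI (s / 2))%C).
  - apply hol_Rcpow, hol_half, hol_id.
  - apply hol_minus.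
    + apply hol_mult; [apply hol_plus; [apply hol_L0|]|].
      * apply hol_inv; [apply hol_minus; [apply hol_id|apply hol_const]|apply Cminus_neq0, H1].
      * apply (hol_comp (fun s => s / 2)%C rG); [apply hol_half, hol_id|apply hol_rG].
    + apply hol_mult; [apply hol_const|].
      apply (hol_comp (fun s => s / 2 + 1)%C rG); [|apply hol_rG]. apply hol_plus; [apply hol_half, hol_id|apply hol_const].
Qed.

(** Monotone-convergence interchange: nonnegative terms bounded by their limits allow the sum over
    [k] and the limit in [n] to be exchanged. *)
Lemma double_sup_lim (a : nat -> nat -> R) (A : nat -> R) (T : nat -> R) (S : R) :
  (forall k n, 0 <= a k n <= A k) -> (forall k, is_lim_seq (a k) (A k)) ->
  (forall n, is_lim_seq (rsum (fun k => a k n)) (T n)) -> is_lim_seq (rsum A) S -> is_lim_seq T S.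
Proof.
  intros H1 H2 H3 H4.
  assert (U : forall n, T n <= S).
  { intros n. apply (is_lim_seq_le (rsum (fun k => a k n)) (rsum A) (T n) S); [|apply H3|exact H4]. intros m. apply rsum_le. intros; apply H1. }
  assert (L : forall n M, rsum (fun k => a k n) M <= T n).
  { intros n M. apply (is_lim_seq_incr_compare (rsum (fun k => a k n)) (T n) (H3 n)). intros m. simpl. generalize (H1 m n). lra. }
  apply is_lim_seq_spec. intros eps. assert (He := cond_pos eps).
  apply is_lim_seq_spec in H4. assert (P : 0 < eps / 2) by lra. destruct (H4 (mkposreal _ P)) as [M HM]. specialize (HM M (Nat.le_refl _)). simpl in HM.
  assert (F := rsum_lim (fun n k => a k n) A M H2). apply is_lim_seq_spec in F. destruct (F (mkposreal _ P)) as [N HN].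
  exists N. intros n Hn. specialize (HN n Hn). simpl in HN. specialize (L n M). specialize (U n).
  apply Rabs_lt_between in HM. apply Rabs_lt_between in HN. apply Rabs_lt_between. lra.
Qed.

Lemma RIntext (f g : R -> R) a b : (forall v, f v = g v) -> RInt f a b = RInt g a b.
Proof. intros H. apply RInt_ext. intros; apply H. Qed.

Lemma RInt_neg (f : R -> R) b : (forall v, continuous f v) -> RInt f (- b) 0 = RInt (fun v => f (- v)) 0 b.
Proof.
  intros C. assert (Cn : forall p q, ex_RInt (fun v => f (- v)) p q).
  { intros. apply (ex_RInt_continuous (V := R_CompleteNormedModule)). intros v _. apply (continuous_comp (fun v => - v) f); [|apply C].
    apply continuous_ex_derive. auto_derive. auto. }
  assert (K := RInt_comp_lin (V := R_CompleteNormedModule) f (-1) 0 b 0).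
  assert (E : forall p q, ex_RInt f p q) by (intros; apply (ex_RInt_continuous (V := R_CompleteNormedModule)); intros; apply C).
  specialize (K (E _ _)). replace (-1 * b + 0) with (- b) in K by ring. replace (-1 * 0 + 0) with 0 in K by ring.
  transitivity (RInt (fun y => -1 * f (- y)) b 0).
  - rewrite <- K. apply RIntext. intros v. unfold scal; simpl; unfold mult; simpl. do 2 f_equal. ring.
  - assert (S := opp_RInt_swap (V := R_CompleteNormedModule) (fun v => f (- v)) b 0 (Cn _ _)). rewrite <- S.
    transitivity (-1 * RInt (fun v => f (- v)) b 0); [|unfold opp; simpl; ring].
    apply is_RInt_unique. apply (is_RInt_scal (V := R_NormedModule)), (RInt_correct (V := R_CompleteNormedModule)), Cn.
Qed.

Lemma RIntCh (f : R -> R) a b c : (forall p q, ex_RInt f p q) -> RInt f a b + RInt f b c = RInt f a c.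
Proof. intros E. apply (RInt_Chasles (V := R_CompleteNormedModule)); apply E. Qed.

Definition mt (x : R) (k n : nat) : R := RInt (fun v => pterm k v * exp (x * v)) (- INR n) (INR n).

Definition ck (k : nat) : R := PI * INR (S k) ^ 2.

Lemma ck_pos k : 0 < ck k.
Proof. apply Rmult_lt_0_compat; [apply PI_RGT_0|apply pow_lt, INR_S_pos]. Qed.

Lemma cont_mul_exp (f : R -> R) x v : continuous f v -> continuous (fun v => f v * exp (x * v)) v.
Proof. intros H. apply (continuous_mult (K := R_AbsRing) f (fun v => exp (x * v))); [exact H|]. apply continuous_ex_derive. auto_derive. auto. Qed.

Lemma exR_cont (f : R -> R) a b : (forall v, continuous f v) -> ex_RInt f a b.
Proof. intros H. apply (ex_RInt_continuous (V := R_CompleteNormedModule)). intros; apply H. Qed.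

Lemma mt_eq x k n : mt x k n = RInt (fun v => exp (x * v - ck k * exp v)) (- INR n) (INR n).
Proof. apply RIntext. intros v. unfold pterm, ck. rewrite <- exp_plus. f_equal. ring. Qed.

Lemma mt_lim x k : 0 < x -> is_lim_seq (mt x k) (Rpower (ck k) (- x) * Gam x).
Proof. intros Hx. eapply is_lim_seq_ext; [intros n; symmetry; apply mt_eq|]. apply mellin_lim; [exact Hx|apply ck_pos]. Qed.

Lemma mt_bounds x k n : 0 < x -> 0 <= mt x k n <= Rpower (ck k) (- x) * Gam x.
Proof.
  intros Hx. assert (C : forall p q, ex_RInt (fun v => pterm k v * exp (x * v)) p q).
  { intros. apply exR_cont. intros v. apply cont_mul_exp, continuous_pterm. }
  assert (P : forall v, 0 <= pterm k v * exp (x * v)) by (intros; apply Rmult_le_pos; left; apply exp_pos).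
  split.
  - apply RInt_ge_0; [generalize (pos_INR n); lra|apply C|intros; apply P].
  - apply (is_lim_seq_incr_compare (mt x k) _ (mt_lim x k Hx)). intros m. unfold mt. rewrite S_INR. generalize (pos_INR m); intros.
    apply RInt_sub_le; try lra; auto.
Qed.

Lemma rsum_RInt (f : nat -> R -> R) a b M : (forall k v, continuous (f k) v) ->
  rsum (fun k => RInt (f k) a b) M = RInt (fun v => rsum (fun k => f k v) M) a b.
Proof.
  intros H. induction M; [simpl; rewrite RInt_const; unfold scal; simpl; unfold mult; simpl; ring|].
  cbn [rsum]. rewrite IHM. symmetry. apply (RInt_plus (V := R_CompleteNormedModule) (fun v => rsum (fun k => f k v) M) (f M)); apply exR_cont; intros; auto.
  apply continuous_rsum; auto.
Qed.

Lemma mt_sum x n : is_lim_seq (rsum (fun k => mt x k n)) (RInt (fun v => ps v * exp (x * v)) (- INR n) (INR n)).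
Proof.
  assert (Hn := pos_INR n). set (J := RInt (fun v => exp (x * v)) (- INR n) (INR n)).
  assert (EJ : forall a b, ex_RInt (fun v => exp (x * v)) a b) by apply (exR_exp_lin x).
  assert (HJ : 0 <= J) by (apply RInt_ge_0; [lra|apply EJ|intros; left; apply exp_pos]).
  set (q := exp (- (PI * exp (- INR n)))).
  assert (Hq : 0 <= q < 1) by (apply exp_neg_lt1, Rmult_lt_0_compat; [apply PI_RGT_0|apply exp_pos]).
  assert (E1 : forall M a b, ex_RInt (fun v => (ps v - rsum (fun k => pterm k v) M) * exp (x * v)) a b).
  { intros M a b. apply exR_cont. intros v. apply (cont_mul_exp (fun v => ps v - rsum (fun k => pterm k v) M)). apply (continuous_minus (V := R_NormedModule)); [apply continuous_ps|].
    apply (continuous_rsum pterm M v). intros; apply continuous_pterm. }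
  assert (Eps : forall a b, ex_RInt (fun v => ps v * exp (x * v)) a b) by (intros; apply exR_cont; intros; apply cont_mul_exp, continuous_ps).
  assert (D : forall M, RInt (fun v => ps v * exp (x * v)) (- INR n) (INR n) - rsum (fun k => mt x k n) M = RInt (fun v => (ps v - rsum (fun k => pterm k v) M) * exp (x * v)) (- INR n) (INR n)).
  { intros M. unfold mt. rewrite rsum_RInt by (intros; apply cont_mul_exp, continuous_pterm).
    assert (L := RInt_lin2 (fun v => ps v * exp (x * v)) (fun v => rsum (fun k => pterm k v * exp (x * v)) M) (- INR n) (INR n) 1 (-1) (Eps _ _)).
    replace (RInt (fun v => ps v * exp (x * v)) (- INR n) (INR n) - RInt (fun v => rsum (fun k => pterm k v * exp (x * v)) M) (- INR n) (INR n)) with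
     (1 * RInt (fun v => ps v * exp (x * v)) (- INR n) (INR n) + -1 * RInt (fun v => rsum (fun k => pterm k v * exp (x * v)) M) (- INR n) (INR n)) by ring.
    rewrite <- L.
    - apply RIntext. intros v. rewrite (rsum_ext (fun k => pterm k v * exp (x * v)) (fun k => exp (x * v) * pterm k v)) by (intros; ring). rewrite rsum_scal. ring.
    - apply exR_cont. intros v. apply (continuous_rsum (fun k v => pterm k v * exp (x * v)) M v). intros. apply cont_mul_exp, continuous_pterm. }
  assert (G : is_lim_seq (fun M => RInt (fun v => ps v * exp (x * v)) (- INR n) (INR n) - J * (q ^ M * / (1 - q))) (RInt (fun v => ps v * exp (x * v)) (- INR n) (INR n) - J * (0 * / (1 - q)))).
  { apply is_lim_seq_minus'; [apply is_lim_seq_const|]. apply lim_scal. apply is_lim_seq_mult'; [|apply is_lim_seq_const]. apply is_lim_seq_geom. rewrite Rabs_pos_eq; lra. }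
  replace (RInt (fun v => ps v * exp (x * v)) (- INR n) (INR n)) with (RInt (fun v => ps v * exp (x * v)) (- INR n) (INR n) - J * (0 * / (1 - q))) by ring.
  apply (is_lim_seq_le_le (fun M => RInt (fun v => ps v * exp (x * v)) (- INR n) (INR n) - J * (q ^ M * / (1 - q))) _ (fun _ => RInt (fun v => ps v * exp (x * v)) (- INR n) (INR n)  - J * (0 * / (1 - q)))); [|exact G|apply is_lim_seq_const].
  intros M. specialize (D M).
  assert (B1 : 0 <= RInt (fun v => (ps v - rsum (fun k => pterm k v) M) * exp (x * v)) (- INR n) (INR n)).
  { apply RInt_ge_0; [lra|apply E1|]. intros v Hv. apply Rmult_le_pos; [apply (ps_tail v v M); lra|left; apply exp_pos]. }
  assert (B2 : RInt (fun v => (ps v - rsum (fun k => pterm k v) M) * exp (x * v)) (- INR n) (INR n) <= J * (q ^ M * / (1 - q))).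
  { unfold J. rewrite (Rmult_comm (RInt _ _ _)). rewrite <- (RInt_scal (V := R_CompleteNormedModule) (fun v => exp (x * v)) _ _ (q ^ M * / (1 - q))) by apply EJ.
    apply RInt_le; [lra|apply E1|apply (ex_RInt_scal (V := R_NormedModule)), EJ|]. intros v Hv. apply Rmult_le_compat_r; [left; apply exp_pos|].
    apply (ps_tail v (- INR n) M); lra. }
  lra.
Qed.

Lemma ps_reflect v : ps (- v) = exp (/ 2 * v) * ps v + (exp (/ 2 * v) - 1) / 2.
Proof.
  unfold ps. assert (T := theta_identity (exp (- v)) (exp_pos _)). rewrite exp_Ropp, Rinv_inv in T.
  assert (E : / sqrt (/ exp v) = exp (/ 2 * v)).
  { replace (/ exp v) with (exp (- (/ 2 * v)) * exp (- (/ 2 * v))).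
    - rewrite sqrt_square by (left; apply exp_pos). rewrite exp_Ropp, Rinv_inv. reflexivity.
    - rewrite <- exp_plus, <- exp_Ropp. f_equal. field. }
  rewrite E, <- exp_Ropp in T. lra.
Qed.

Definition Ereal (x : R) (n : nat) : R := RInt (fun v => ps v * exp (x * v)) 0 (INR n).

Lemma En_real x n : En n (RtoC x) = RtoC (Ereal x n).
Proof.
  unfold En, Ereal, CI. apply Ceq; cbn [Re Im RtoC fst snd].
  - apply RIntext. intros v. rewrite <- RtoC_mult, Cexp_R, <- RtoC_mult. simpl. do 2 f_equal. ring.
  - rewrite (RIntext _ (fun _ => 0)).
    + rewrite RInt_const. unfold scal; simpl; unfold mult; simpl; ring.
    + intros v. rewrite <- RtoC_mult, Cexp_R, <- RtoC_mult. reflexivity.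
Qed.

(** The half [v < 0] is reflected by the theta identity, which turns [x] into [1 / 2 - x] and leaves
    two elementary integrals; in the limit these become the terms [1 / (s - 1)] and [- 1 / s], where
    [s = 2 x]. *)
Lemma mellin_split x n : x <> 0 -> x <> / 2 ->
  RInt (fun v => ps v * exp (x * v)) (- INR n) (INR n) =
  Ereal x n + Ereal (/ 2 - x) n + / 2 * ((exp ((/ 2 - x) * INR n) - 1) / (/ 2 - x) - (exp (- x * INR n) - 1) / (- x)).
Proof.
  intros H0 H1.
  assert (Eps : forall y a b, ex_RInt (fun v => ps v * exp (y * v)) a b) by (intros; apply exR_cont; intros; apply cont_mul_exp, continuous_ps).
  rewrite <- (RIntCh _ _ 0) by apply Eps. rewrite RInt_neg by (intros; apply cont_mul_exp, continuous_ps).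
  rewrite (RIntext _ (fun v => 1 * (ps v * exp ((/ 2 - x) * v)) + 1 * (/ 2 * exp ((/ 2 - x) * v) + - / 2 * exp (- x * v)))).
  2: { intros v. rewrite ps_reflect.
       replace ((/ 2 - x) * v) with (/ 2 * v + - x * v) by ring. rewrite exp_plus. replace (x * - v) with (- x * v) by ring. field. }
  assert (EL : forall a b, ex_RInt (fun v => / 2 * exp ((/ 2 - x) * v) + - / 2 * exp (- x * v)) a b).
  { intros a b. eexists. apply (is_RInt_lin2 (fun v => exp ((/ 2 - x) * v)) (fun v => exp (- x * v)) a b (/ 2) (- / 2)); apply exR_exp_lin. }
  rewrite (RInt_lin2 (fun v => ps v * exp ((/ 2 - x) * v)) (fun v => / 2 * exp ((/ 2 - x) * v) + - / 2 * exp (- x * v)) 0 (INR n) 1 1 (Eps (/ 2 - x) 0 (INR n)) (EL 0 (INR n))).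
  rewrite (RInt_lin2 (fun v => exp ((/ 2 - x) * v)) (fun v => exp (- x * v)) 0 (INR n) (/ 2) (- / 2) (exR_exp_lin (/ 2 - x) 0 (INR n)) (exR_exp_lin (- x) 0 (INR n))).
  rewrite !RInt_exp_lin by lra.
  rewrite !Rmult_0_r, exp_0. unfold Ereal. match goal with |- @eq _ ?a ?b => change (@eq R a b) end. ring.
Qed.

Lemma csum_RtoC f N : csum (fun n => RtoC (f n)) N = RtoC (rsum f N).
Proof. induction N; [reflexivity|]. simpl. rewrite IHN, <- RtoC_plus. reflexivity. Qed.

(** The limit of the truncated Mellin transform of [psi] is evaluated twice: termwise it is
    [PI ^ (- x) Gam x] times zeta at [s = 2 x], and by [mellin_split] it is
    [L0 s + 1 / (s - 1) - 1 / s]. *)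
Lemma zf_real s : 1 < s -> zf (RtoC s) = zeta0 (RtoC s).
Proof.
  intros Hs. set (x := s / 2). assert (Hx : / 2 < x) by (unfold x; lra).
  assert (EL : is_Clim (fun n => RtoC (Ereal x n + Ereal (/ 2 - x) n)) (L0 (RtoC s))).
  { unfold L0. replace (RtoC s / 2)%C with (RtoC x) by (unfold x; rewrite RtoC_div; reflexivity || lra).
    replace ((1 - RtoC s) / 2)%C with (RtoC (/ 2 - x)).
    2: { unfold x. rewrite RtoC_minus, RtoC_inv, RtoC_div by lra. field. }
    eapply is_Clim_ext; [|apply is_Clim_plus; apply EE_lim]. intros n. cbv beta. rewrite !En_real, RtoC_plus. reflexivity. }
  assert (ELr := is_Clim_re _ _ EL). cbn [Re RtoC fst] in ELr.
  assert (ELi := is_Clim_im _ _ EL). cbn [Im RtoC snd] in ELi.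
  assert (L0r : L0 (RtoC s) = RtoC (Re (L0 (RtoC s)))).
  { apply Ceq; [reflexivity|]. simpl. assert (U := is_lim_seq_unique _ _ ELi). rewrite Lim_seq_const in U. injection U as U. symmetry; exact U. }
  set (l := Re (L0 (RtoC s))) in *.
  assert (LT : is_lim_seq (fun n => RInt (fun v => ps v * exp (x * v)) (- INR n) (INR n)) (l + / 2 * ((0 - 1) / (/ 2 - x) - (0 - 1) / (- x)))).
  { eapply is_lim_seq_ext; [intros n; symmetry; apply mellin_split; lra|].
    assert (X : forall c, 0 < c -> is_lim_seq (fun n => (exp (- c * INR n) - 1) / - c) ((0 - 1) / - c)).
    { intros c Hc. unfold Rdiv. apply is_lim_seq_mult'; [|apply is_lim_seq_const]. apply is_lim_seq_minus'; [|apply is_lim_seq_const].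
      eapply is_lim_seq_ext; [|apply (exp_negINR_lim c Hc)]. intros n. cbv beta. f_equal. ring. }
    apply is_lim_seq_plus'; [exact ELr|]. apply lim_scal. apply is_lim_seq_minus'.
    - replace (/ 2 - x) with (- (x - / 2)) by ring. apply X. lra.
    - apply X. lra. }
  set (z := Re (zeta0 (RtoC s))).
  assert (Zc : is_Clim (csum (fun n => RtoC (Rpower (INR (S n)) (- s)))) (zeta0 (RtoC s))).
  { eapply is_Clim_ext; [|apply zeta0_dirichlet; simpl; lra]. intros n. apply csum_ext. intros k _. cbv beta. rewrite <- RtoC_opp. apply Rcpow_RtoC. }
  assert (Zc' : is_Clim (fun N => RtoC (rsum (fun n => Rpower (INR (S n)) (- s)) N)) (zeta0 (RtoC s))).
  { eapply is_Clim_ext; [|exact Zc]. intros n. apply csum_RtoC. }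
  assert (Zr := is_Clim_re _ _ Zc'). assert (Zi := is_Clim_im _ _ Zc'). cbn [Re Im RtoC fst snd] in Zr, Zi. fold z in Zr.
  assert (Zz : zeta0 (RtoC s) = RtoC z).
  { apply Ceq; [reflexivity|]. simpl. assert (U := is_lim_seq_unique _ _ Zi). rewrite Lim_seq_const in U. injection U as U. symmetry; exact U. }
  assert (LT2 : is_lim_seq (fun n => RInt (fun v => ps v * exp (x * v)) (- INR n) (INR n)) (Rpower PI (- x) * Gam x * z)).
  { apply (double_sup_lim (mt x) (fun k => Rpower (ck k) (- x) * Gam x)).
    - intros; apply mt_bounds; lra.
    - intros; apply mt_lim; lra.
    - intros; apply mt_sum.
    - eapply is_lim_seq_ext; [|apply (lim_scal (Rpower PI (- x) * Gam x) _ _ Zr)]. intros N. cbv beta. rewrite <- rsum_scal. apply rsum_ext. intros k _.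
      unfold ck. rewrite <- Rpower_mult_distr by (try apply PI_RGT_0; apply pow_lt, INR_S_pos).
      rewrite <- (Rpower_pow 2), Rpower_mult by apply INR_S_pos. replace (INR 2 * - x) with (- s) by (unfold x; simpl; field). ring. }
  assert (U := is_lim_seq_unique _ _ LT). rewrite (is_lim_seq_unique _ _ LT2) in U. injection U as U.
  assert (G := Gam_rG x ltac:(lra)).
  assert (Gs := rG_shift (RtoC x)).
  unfold zf. rewrite L0r, Zz.
  replace (RtoC s / 2)%C with (RtoC x) by (unfold x; rewrite RtoC_div; reflexivity || lra).
  rewrite Rcpow_RtoC.
  assert (NG : rG (RtoC x) <> 0%C) by (apply rG_neq0; simpl; lra).
  assert (Nx : RtoC x <> 0%C) by (intros E; apply RtoC_inj in E; lra).
  assert (E1 : rG (RtoC x + 1) = (rG (RtoC x) / RtoC x)%C) by (rewrite Gs; field; exact Nx).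
  rewrite E1.
  replace (RtoC s - 1)%C with (RtoC (s - 1)) by (rewrite RtoC_minus; reflexivity).
  rewrite <- RtoC_inv by lra.
  assert (PP : Rpower PI x * Rpower PI (- x) = 1) by (rewrite <- Rpower_plus, Rplus_opp_r; unfold Rpower; rewrite Rmult_0_l, exp_0; reflexivity).
  transitivity (RtoC (Rpower PI x) * (RtoC (l + / (s - 1) - / s) * rG (RtoC x)))%C.
  { rewrite RtoC_minus, RtoC_plus. f_equal. replace (RtoC (/ s)) with (/ 2 * / RtoC x)%C; [field; exact Nx|].
    unfold x. rewrite RtoC_inv, RtoC_div by lra. field. intros E; apply RtoC_inj in E; lra. }
  replace (l + / (s - 1) - / s) with (Rpower PI (- x) * Gam x * z).
  2: { rewrite U. unfold x. field. lra. }
  rewrite !RtoC_mult.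
  transitivity (RtoC (Rpower PI x * Rpower PI (- x)) * (RtoC (Gam x) * rG (RtoC x)) * RtoC z)%C; [rewrite RtoC_mult; ring|].
  rewrite PP, G. ring.
Qed.

Lemma hol_zf_sub_zeta0 (s : C) : 0 < Re s -> s <> 1%C -> hol (fun w => zf w - zeta0 w)%C s.
Proof. intros H H1. apply hol_minus; [apply hol_zf, H1|apply hol_zeta0; assumption]. Qed.

(** Agreement on the real half-line spreads to discs centred on it, and such discs exhaust the
    half-plane as the centre moves to the right. *)
Lemma zf_zeta0 (s : C) : 1 < Re s -> zf s = zeta0 s.
Proof.
  intros Hs. set (x := Re s) in *. set (y := Im s). set (e := (x - 1) / 2). assert (He : 0 < e) by (unfold e; lra).
  assert (Y : 0 <= y ^ 2 / e) by (apply Rle_mult_inv_pos; [apply pow2_ge_0|exact He]).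
  assert (K : y ^ 2 = y ^ 2 / e * e) by (field; lra). set (t := y ^ 2 / e) in *. assert (Hxe : x = 1 + 2 * e) by (unfold e; field). clearbody t e.
  (* The square of centre [R] and half-side [R - 1 - e] stays in [Re >= 1 + e]; its inscribed disc
     contains [s] as soon as [R] is large compared with [y ^ 2 / e]. *)
  set (R := x + t + 1).
  assert (D : (zf (RtoC R + (s - RtoC R)) - zeta0 (RtoC R + (s - RtoC R)))%C = 0%C).
  { apply (identity_disc (fun w => zf w - zeta0 w)%C (RtoC R) (R - 1 - e)).
    - unfold R. lra.
    - intros u v Hu Hv. simpl in Hu, Hv. apply hol_zf_sub_zeta0; [simpl; lra|]. intros E. injection E as E1 E2. lra.
    - intros d Hd. exists (RtoC (d / 2)). split; [intros E; apply RtoC_inj in E; lra|]. split; [rewrite Cmod_R, Rabs_pos_eq; lra|].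
      rewrite <- RtoC_plus, zf_real by (unfold R; lra). ring.
    - assert (Q : Cmod (s - RtoC R) ^ 2 < (R - 1 - e) ^ 2).
      { rewrite Cmod2_alt. replace (Re (s - RtoC R)) with (x - R) by (unfold x; destruct s; csimp; ring).
        replace (Im (s - RtoC R)) with y by (unfold y; destruct s; csimp; ring).
        unfold R. rewrite Hxe.
        rewrite K. simpl. nra. }
      apply Rsqr_incrst_0; [unfold Rsqr; simpl in Q; lra|apply Cmod_ge_0|unfold R; lra]. }
  replace (RtoC R + (s - RtoC R))%C with s in D by ring.
  replace (zf s) with ((zf s - zeta0 s) + zeta0 s)%C by ring. rewrite D. ring.
Qed.

Lemma is_zeta_zf : is_riemann_zeta zf.
Proof.
  split.
  - intros s Hs. apply is_series_Clim. rewrite zf_zeta0 by exact Hs. apply zeta0_dirichlet, Hs.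
  - intros s Hs. apply ex_derive_hol, hol_zf, Hs.
Qed.

Lemma zeta_spec : is_riemann_zeta zeta.
Proof. unfold zeta. apply epsilon_spec. exists zf. apply is_zeta_zf. Qed.

Lemma zeta_hol (s : C) : s <> 1%C -> hol zeta s.
Proof. intros H. apply ex_derive_hol, zeta_spec, H. Qed.

Lemma zeta_dirichlet s : 1 < Re s -> zeta s = zeta0 s.
Proof.
  intros Hs. eapply is_Clim_inj; [|apply zeta0_dirichlet, Hs]. apply is_series_Clim. apply zeta_spec, Hs.
Qed.

(** A single square reaches [s]: for [c = (x + y, x + y)] the distance from [s] to [c] is
    [|s| < x + y], so a half-side [b] strictly between keeps the square in the open first quadrant,
    away from the pole, while the centre has real part above 1. Applied to both [zeta] and [zf]. *)
Lemma quadrant_identity f s : (forall w : C, w <> 1%C -> hol f w) -> (forall w, 1 < Re w -> f w = zeta0 w) ->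
  0 < Re s -> 1 < Im s -> f s = zeta0 s.
Proof.
  intros Hf Hd1 Hx Hy. set (x := Re s) in *. set (y := Im s) in *.
  set (c := (x + y, x + y) : C).
  set (a := sqrt (x ^ 2 + y ^ 2)).
  assert (Ha0 : 0 < x ^ 2 + y ^ 2) by (apply sumsq_pos; left; lra).
  assert (Ha : 0 < a) by (apply sqrt_lt_R0, Ha0). assert (Ha2 : a ^ 2 = x ^ 2 + y ^ 2) by (apply pow2_sqrt; lra).
  assert (Hax : a < x + y). { apply Rsqr_incrst_0; [|lra|lra]. unfold Rsqr. simpl in Ha2. nra. }
  set (b := (a + (x + y)) / 2).
  assert (H1 : forall u v : R, (x + y) - b <= u -> (x + y) - b <= v -> ((u, v) : C) <> 1%C).
  { intros u v Hu Hv E. injection E as E1 E2. unfold b in Hv. lra. }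
  assert (D : (f (c + (s - c)) - zeta0 (c + (s - c)))%C = 0%C).
  { apply (identity_disc (fun w => f w - zeta0 w)%C c b).
    - unfold b; lra.
    - intros u v Hu Hv. simpl in Hu, Hv. apply hol_minus; [apply Hf|apply hol_zeta0]; [apply H1; lra|simpl; unfold b in Hu; lra|apply H1; lra].
    - intros d Hd. exists (RtoC (d / 2)). split; [intros E; apply RtoC_inj in E; lra|]. split; [rewrite Cmod_R, Rabs_pos_eq; lra|].
      rewrite Hd1; [ring|]. simpl. lra.
    - assert (Q : Cmod (s - c) ^ 2 < b ^ 2).
      { rewrite Cmod2_alt. replace (Re (s - c)) with (- y) by (unfold c, x, y; destruct s; csimp; ring).
        replace (Im (s - c)) with (- x) by (unfold c, x, y; destruct s; csimp; ring).
        replace ((- y) ^ 2 + (- x) ^ 2) with (a ^ 2) by (rewrite Ha2; ring). unfold b. simpl. nra. }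
      apply Rsqr_incrst_0; [unfold Rsqr; simpl in Q; lra|apply Cmod_ge_0|unfold b; lra]. }
  replace (c + (s - c))%C with s in D by ring.
  replace (f s) with ((f s - zeta0 s) + zeta0 s)%C by ring. rewrite D. ring.
Qed.

Lemma zeta_zeta0 s : 0 < Re s -> 1 < Im s -> zeta s = zeta0 s.
Proof. apply quadrant_identity; [apply zeta_hol|apply zeta_dirichlet]. Qed.

Lemma zeta_zf s : 0 < Re s -> 1 < Im s -> zeta s = zf s.
Proof.
  intros Hx Hy. rewrite zeta_zeta0 by assumption. symmetry. apply quadrant_identity; try assumption; [apply hol_zf|apply zf_zeta0].
Qed.

Ltac reqR := match goal with |- @eq _ ?a ?b => change (@eq R a b) end.

(** * The argument of Gamma on the critical line *)

Definition aj (j : nat) : R := 1 / 4 + INR j.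

Lemma aj_pos j : 0 < aj j. Proof. unfold aj. generalize (pos_INR j). lra. Qed.

(* Argument of the n-th term of Euler's limit at [1 / 4 + i y]. *)
Definition phn (N : nat) (y : R) : R := y * ln (INR N) - rsum (fun j => atan (y / aj j)) (S N).

Definition dphn (N : nat) (y : R) : R := ln (INR N) - rsum (fun j => aj j / (aj j ^ 2 + y ^ 2)) (S N).

Lemma aj_sq_pos j y : 0 < aj j ^ 2 + y ^ 2.
Proof. apply sumsq_pos. left. generalize (aj_pos j). lra. Qed.

Lemma is_derive_rsum (f f' : nat -> R -> R) n y : (forall k, is_derive (f k) y (f' k y)) ->
  is_derive (fun y => rsum (fun k => f k y) n) y (rsum (fun k => f' k y) n).
Proof.
  intros H. induction n; [exact (is_dconst 0 y)|].
  apply (is_derive_plus (K := R_AbsRing) (V := R_NormedModule) (fun y => rsum (fun k => f k y) n) (f n)); auto.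
Qed.

Lemma phn_derive N y : is_derive (phn N) y (dphn N y).
Proof.
  unfold phn, dphn.
  apply (is_derive_minus (K := R_AbsRing) (V := R_NormedModule) (fun y => y * ln (INR N)) (fun y => rsum (fun j => atan (y / aj j)) (S N))).
  - auto_derive; [auto|]. ring.
  - apply (is_derive_rsum (fun j y => atan (y / aj j)) (fun j y => aj j / (aj j ^ 2 + y ^ 2))).
    intros k. assert (P := aj_pos k). assert (Q := aj_sq_pos k y).
    apply is_derive_val with (l := / (1 + (y / aj k) ^ 2) * / aj k).
    + eapply is_derive_val; [apply (is_derive_comp (K := R_AbsRing) (V := R_NormedModule) atan (fun y => y / aj k) y (/ (1 + (y / aj k) ^ 2)) (/ aj k))|].
      * apply is_derive_Reals, derivable_pt_lim_atan.
      * auto_derive; [auto|]. field. lra.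
      * unfold scal; simpl; unfold mult; simpl. apply Rmult_comm.
    + reqR. field. split; [lra|]. simpl in *; lra.
Qed.

Lemma continuous_dphn N y : continuous (dphn N) y.
Proof.
  unfold dphn. apply (continuous_minus (V := R_NormedModule) (fun _ => ln (INR N))); [apply continuous_const|].
  apply (continuous_rsum (fun j y => aj j / (aj j ^ 2 + y ^ 2)) (S N) y). intros k. apply continuous_ex_derive. auto_derive.
  generalize (aj_sq_pos k y). simpl. lra.
Qed.

Lemma phn_0 N : phn N 0 = 0.
Proof.
  unfold phn. rewrite (rsum_ext _ (fun _ => 0)), rsum_const; [ring|]. intros. unfold Rdiv. rewrite Rmult_0_l. apply atan_0.
Qed.

Lemma phn_int N y : 0 <= y -> phn N y = RInt (dphn N) 0 y.
Proof. intros Hy. rewrite (RIntD (phn N) (dphn N)); [rewrite phn_0; ring|apply phn_derive|apply continuous_dphn]. Qed.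

(** The increment of the logarithm and the new term of the sum both equal [1 / (n + 2)] up to
    [O((1 + y ^ 2) / n ^ 2)]. *)
Lemma dphn_step n y : Rabs (dphn (S (S n)) y - dphn (S n) y) <= (2 + y ^ 2) * / INR (S n) - (2 + y ^ 2) * / INR (S (S n)).
Proof.
  rewrite <- Rmult_minus_distr_l, <- inv_step.
  destruct (ln_ratio_bounds n) as [_ [L1 L2]].
  unfold dphn. rewrite (rsum_S _ (S (S n))). set (X := rsum _ (S (S n))).
  assert (Hx := INR_S_ge1 n). set (x := INR (S n)) in *.
  assert (Em : INR (S (S n)) = x + 1) by (rewrite (S_INR (S n)); reflexivity). rewrite Em in *.
  assert (Ea : aj (S (S n)) = x + 1 + 1 / 4) by (unfold aj; rewrite Em; ring). rewrite Ea.
  set (a := x + 1 + 1 / 4). set (d := / (x * (x + 1))) in *.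
  assert (Y : 0 <= y ^ 2) by apply pow2_ge_0.
  assert (P1 : 0 < a ^ 2 + y ^ 2) by (apply sumsq_pos; left; unfold a; lra).
  assert (D1 : / (x + 1) - a / (a ^ 2 + y ^ 2) = / 4 * / ((x + 1) * a) + y ^ 2 * / (a * (a ^ 2 + y ^ 2))).
  { unfold a in *. field. repeat split; try lra. }
  assert (B1 : 0 < / ((x + 1) * a) <= d).
  { unfold d, a. split; [apply Rinv_0_lt_compat; nra|]. apply Rinv_le_contravar; nra. }
  assert (B2 : 0 < / (a * (a ^ 2 + y ^ 2)) <= d).
  { unfold d. split; [apply Rinv_0_lt_compat, Rmult_lt_0_compat; [unfold a; lra|exact P1]|]. apply Rinv_le_contravar; [nra|].
    assert (a ^ 2 + y ^ 2 >= x * (x + 1)) by (unfold a in *; nra). assert (1 <= a) by (unfold a; lra). nra. }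
  assert (B3 : y ^ 2 * / (a * (a ^ 2 + y ^ 2)) <= y ^ 2 * d) by (apply Rmult_le_compat_l; lra).
  assert (B4 : 0 <= y ^ 2 * / (a * (a ^ 2 + y ^ 2))) by (apply Rmult_le_pos; lra).
  apply Rabs_le. split; lra.
Qed.

(** The real part of the digamma function at [1 / 4 + i y]. *)
Definition dph (y : R) : R := real (Lim_seq (fun n => dphn (S n) y)).

Lemma dph_approx n y : Rabs (dphn (S n) y - dph y) <= (2 + y ^ 2) * / INR (S n).
Proof.
  destruct (telescope_limit (fun n => RtoC (dphn (S n) y)) (fun n => (2 + y ^ 2) * / INR (S n))) as [l Hl].
  - rewrite <- (Rmult_0_r (2 + y ^ 2)). apply lim_scal.
    apply (is_lim_seq_inv (fun n => INR (S n)) p_infty); [apply (is_lim_seq_incr_1 INR), is_lim_seq_INR|discriminate].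
  - intros m. rewrite <- RtoC_minus, Cmod_R. apply dphn_step.
  - assert (L := is_Clim_re _ _ (is_Clim_invINR _ _ _ Hl)). cbn [Re RtoC fst] in L.
    assert (E : dph y = Re l) by (unfold dph; rewrite (is_lim_seq_unique _ _ L); reflexivity).
    rewrite E. specialize (Hl n). eapply Rle_trans; [|exact Hl]. eapply Rle_trans; [|apply re_le_Cmod]. right. reflexivity.
Qed.

Lemma continuous_dph y : continuous dph y.
Proof.
  apply continuous_eps. intros eps He.
  set (A := 2 + (Rabs y + 1) ^ 2). assert (HA : 0 < A) by (unfold A; generalize (pow2_ge_0 (Rabs y + 1)); lra).
  destruct (INR_unbounded (3 * A / eps)) as [n Hn].
  assert (Hb : A * / INR (S n) < eps / 3).
  { apply (Rmult_lt_reg_r (INR (S n))); [apply INR_S_pos|]. rewrite Rmult_assoc, Rinv_l by (generalize (INR_S_pos n); lra).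
    rewrite S_INR. apply Rgt_lt, Rlt_div_l in Hn; [|exact He]. lra. }
  destruct (proj2 (continuous_eps _ _) (continuous_dphn (S n) y) (eps / 3)) as [d [Hd Hd']]; [lra|].
  exists (Rmin d 1). split; [apply Rmin_pos; lra|]. intros z Hz.
  specialize (Hd' z (Rlt_le_trans _ _ _ Hz (Rmin_l _ _))). assert (Hz1 := Rlt_le_trans _ _ _ Hz (Rmin_r _ _)).
  assert (Zb : forall u, Rabs u <= Rabs y + 1 -> (2 + u ^ 2) * / INR (S n) <= A * / INR (S n)).
  { intros u Hu. apply Rmult_le_compat_r; [left; apply Rinv_0_lt_compat, INR_S_pos|]. unfold A. rewrite <- (pow2_abs u).
    assert (Rabs u ^ 2 <= (Rabs y + 1) ^ 2) by (apply pow_incr; split; [apply Rabs_pos|exact Hu]). lra. }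
  assert (A1 := dph_approx n y). assert (A2 := dph_approx n z).
  assert (Z1 := Zb y ltac:(lra)). assert (Z2 := Zb z).
  assert (Rabs z <= Rabs y + 1). { replace z with (y + (z - y)) by ring. eapply Rle_trans; [apply Rabs_triang|]. lra. }
  specialize (Z2 H). apply Rabs_le_between in A1. apply Rabs_le_between in A2. apply Rabs_lt_between in Hd'. apply Rabs_lt_between. lra.
Qed.

(** The continuous argument of Gamma at [1 / 4 + i y] that vanishes at 0. As an integral it is
    differentiable by construction; [ph_lim] and [rG_polar] justify the name. *)
Definition ph (y : R) : R := RInt dph 0 y.

Lemma exR_dph a b : ex_RInt dph a b. Proof. apply exR_cont, continuous_dph. Qed.

Lemma ph_derive y : is_derive ph y (dph y).
Proof.
  apply (is_derive_RInt (V := R_NormedModule) dph ph 0 y); [|apply continuous_dph].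
  exists (mkposreal 1 Rlt_0_1). intros z _. apply (RInt_correct (V := R_CompleteNormedModule)), exR_dph.
Qed.

Lemma dphn_even N y : dphn N (- y) = dphn N y.
Proof. unfold dphn. f_equal. apply rsum_ext. intros. f_equal. f_equal. ring. Qed.

Lemma dph_even y : dph (- y) = dph y.
Proof. unfold dph. f_equal. apply Lim_seq_ext. intros; apply dphn_even. Qed.

Lemma phn_odd N y : phn N (- y) = - phn N y.
Proof.
  unfold phn. rewrite (rsum_ext (fun j => atan (- y / aj j)) (fun j => -1 * atan (y / aj j))), rsum_scal; [ring|].
  intros k _. replace (- y / aj k) with (- (y / aj k)) by (unfold Rdiv; ring). rewrite atan_opp. ring.
Qed.

Lemma ph_odd y : ph (- y) = - ph y.
Proof.
  unfold ph. assert (N := RInt_neg dph y continuous_dph).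
  rewrite (RIntext (fun v => dph (- v)) dph) in N by apply dph_even.
  rewrite <- N. apply (Rplus_eq_reg_l (RInt dph (- y) 0)). rewrite Rplus_opp_r.
  rewrite (RIntCh dph (- y) 0 (- y) exR_dph). apply (RInt_point (V := R_CompleteNormedModule)).
Qed.

Lemma ph_lim_pos y : 0 <= y -> is_lim_seq (fun n => phn (S n) y) (ph y).
Proof.
  intros Hy.
  assert (B : forall n, Rabs (phn (S n) y - ph y) <= y * (2 + y ^ 2) * / INR (S n)).
  { intros n. rewrite phn_int by exact Hy. unfold ph.
    assert (E : ex_RInt (dphn (S n)) 0 y) by apply exR_cont, continuous_dphn.
    replace (RInt (dphn (S n)) 0 y - RInt dph 0 y) with (1 * RInt (dphn (S n)) 0 y + -1 * RInt dph 0 y) by ring.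
    rewrite <- RInt_lin2 by (exact E || apply exR_dph).
    eapply Rle_trans; [apply (abs_RInt_le_const _ 0 y ((2 + y ^ 2) * / INR (S n)) Hy)|right; ring].
    - eexists. apply is_RInt_lin2; [exact E|apply exR_dph].
    - intros t Ht. replace (1 * dphn (S n) t + -1 * dph t) with (dphn (S n) t - dph t) by ring. eapply Rle_trans; [apply dph_approx|].
      apply Rmult_le_compat_r; [left; apply Rinv_0_lt_compat, INR_S_pos|]. assert (t ^ 2 <= y ^ 2) by (apply pow_incr; lra). lra. }
  assert (L : is_Clim (fun n => RtoC (phn (S n) y)) (RtoC (ph y))).
  { eapply is_Clim_invINR. intros n. rewrite <- RtoC_minus, Cmod_R. apply B. }
  exact (is_Clim_re _ _ L).
Qed.

Lemma ph_lim y : is_lim_seq (fun n => phn (S n) y) (ph y).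
Proof.
  destruct (Rle_dec 0 y) as [H|H]; [apply ph_lim_pos, H|].
  assert (L := ph_lim_pos (- y) ltac:(lra)). rewrite ph_odd in L. rewrite <- (Ropp_involutive (ph y)).
  eapply is_lim_seq_ext; [|apply (proj1 (is_lim_seq_opp _ _) L)]. intros n. cbv beta. rewrite phn_odd. ring.
Qed.

Lemma polar_atan a y : 0 < a -> ((a, y) : C) = (RtoC (Cmod (a, y)) * Cexp (Ci * RtoC (atan (y / a))))%C.
Proof.
  intros Ha. set (s := sqrt (1 + (y / a) ^ 2)).
  assert (Q : 0 < 1 + (y / a) ^ 2) by (generalize (pow2_ge_0 (y / a)); lra).
  assert (Hs : 0 < s) by (apply sqrt_lt_R0, Q).
  assert (Em : Cmod (a, y) = a * s).
  { unfold Cmod, s; cbn [fst snd]. rewrite <- (sqrt_pow2 a) at 2 by lra. rewrite <- sqrt_mult by (apply pow2_ge_0 || lra). f_equal. field. lra. }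
  assert (E2 : (y / a)² = (y / a) ^ 2) by (unfold Rsqr; ring).
  assert (Ec : cos (atan (y / a)) = / s) by (rewrite cos_atan, E2; fold s; field; lra).
  assert (Es : sin (atan (y / a)) = y / a / s) by (rewrite sin_atan, E2; reflexivity).
  rewrite Em. unfold Cexp.
  replace (Ci * RtoC (atan (y / a)))%C with ((0, atan (y / a)) : C) by (apply Ceq; csimp; ring).
  cbn [Re Im fst snd]. rewrite exp_0, Ec, Es. apply Ceq; csimp; field; lra.
Qed.

Definition cis (f : R) : C := Cexp (Ci * RtoC f).

(** Here [f] is any argument of [w], so arguments add under products without reduction modulo
    [2 PI]. *)
Definition polar (w : C) (f : R) : Prop := w = (RtoC (Cmod w) * cis f)%C.

Lemma cis_eq f : cis f = (cos f, sin f).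
Proof.
  unfold cis. replace (Ci * RtoC f)%C with ((0, f) : C) by (apply Ceq; csimp; ring). unfold Cexp; cbn [Re Im fst snd].
  rewrite exp_0. f_equal; ring.
Qed.

Lemma cis_plus a b : cis (a + b) = (cis a * cis b)%C.
Proof. unfold cis. rewrite <- Cexp_plus. f_equal. rewrite RtoC_plus. ring. Qed.

Lemma cis_0 : cis 0 = 1%C.
Proof. unfold cis. rewrite Cmult_0_r. apply Cexp_0. Qed.

Lemma cis_opp a : (cis a * cis (- a))%C = 1%C.
Proof. rewrite <- cis_plus, Rplus_opp_r. apply cis_0. Qed.

Lemma Cmod_cis a : Cmod (cis a) = 1.
Proof. unfold cis. rewrite Cmod_Cexp. replace (Re (Ci * RtoC a)) with 0 by (csimp; ring). apply exp_0. Qed.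

Lemma polar_mult u v a b : polar u a -> polar v b -> polar (u * v) (a + b).
Proof.
  unfold polar. intros H1 H2. rewrite Cmod_mult, RtoC_mult, cis_plus. rewrite H1 at 1. rewrite H2 at 1. ring.
Qed.

Lemma polar_real x : 0 <= x -> polar (RtoC x) 0.
Proof. intros H. unfold polar. rewrite Cmod_R, Rabs_pos_eq, cis_0 by exact H. ring. Qed.

Lemma polar_Cexp z : polar (Cexp z) (Im z).
Proof.
  unfold polar. rewrite Cmod_Cexp, cis_eq. unfold Cexp. apply Ceq; csimp; ring.
Qed.

Lemma cis_continuous f g (l : R) : is_lim_seq f l -> (forall n : nat, g n = cis (f n)) -> is_Clim g (cis l).
Proof.
  intros H E. apply is_Clim_pair.
  - rewrite cis_eq. cbn [Re fst]. apply is_lim_seq_ext with (fun n => cos (f n)); [intros; rewrite E, cis_eq; reflexivity|].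
    apply (is_lim_seq_continuous cos f l); [apply continuity_cos|exact H].
  - rewrite cis_eq. cbn [Im snd]. apply is_lim_seq_ext with (fun n => sin (f n)); [intros; rewrite E, cis_eq; reflexivity|].
    apply (is_lim_seq_continuous sin f l); [apply continuity_sin|exact H].
Qed.

Lemma polar_lim w f (l : C) (p : R) : (forall n : nat, polar (w n) (f n)) -> is_Clim w l -> is_lim_seq f p -> polar l p.
Proof.
  intros H Hw Hf. unfold polar. eapply is_Clim_inj; [exact Hw|].
  apply is_Clim_ext with (fun n => RtoC (Cmod (w n)) * cis (f n))%C; [intros; symmetry; apply H|].
  apply is_Clim_mult.
  - apply is_Clim_pair; [apply (is_Clim_Cmod _ _ Hw)|apply is_lim_seq_const].
  - eapply cis_continuous; [exact Hf|reflexivity].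
Qed.

Definition q4 (y : R) : C := (1 / 4, y).

Lemma rising_polar y n : polar (rising (q4 y) n) (rsum (fun j => atan (y / aj j)) (S n)).
Proof.
  assert (K : forall j, polar (aj j, y) (atan (y / aj j))) by (intros j; apply polar_atan, aj_pos).
  induction n.
  - simpl. rewrite Rplus_0_l. replace (q4 y) with ((aj 0, y) : C) by (unfold q4, aj; simpl; f_equal; ring). apply (K O).
  - rewrite rsum_S. change (rising (q4 y) (S n)) with (rising (q4 y) n * ((q4 y) + RtoC (INR (S n))))%C.
    apply polar_mult; [exact IHn|]. replace ((q4 y) + RtoC (INR (S n)))%C with ((aj (S n), y) : C); [apply K|].
    unfold q4, aj. apply Ceq; cbn [Re Im Cplus RtoC fst snd]; ring.
Qed.

Lemma rg_polar y n : polar (rg n (q4 y)) (- phn n y).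
Proof.
  replace (- phn n y) with (rsum (fun j => atan (y / aj j)) (S n) + 0 + Im (- (q4 y) * RtoC (ln (INR n)))%C).
  2: { unfold phn, q4. cbn [Im Cmult Copp RtoC fst snd]. ring. }
  unfold rg. apply polar_mult; [apply polar_mult; [apply rising_polar|]|apply polar_Cexp].
  rewrite <- RtoC_inv by apply INR_fact_neq_0. apply polar_real. left; apply Rinv_0_lt_compat, INR_fact_lt_0.
Qed.

Lemma rG_polar y : polar (rG (q4 y)) (- ph y).
Proof.
  apply (polar_lim (fun n => rg (S n) (q4 y)) (fun n => - phn (S n) y)); [intros; apply rg_polar|apply rG_lim|].
  apply (proj1 (is_lim_seq_opp _ (ph y))), ph_lim.
Qed.

Lemma Cmod_rG_conj y : Cmod (rG (q4 (- y))) = Cmod (rG (q4 y)).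
Proof.
  assert (L1 := is_Clim_Cmod _ _ (rG_lim (q4 y))). assert (L2 := is_Clim_Cmod _ _ (rG_lim (q4 (- y)))).
  assert (E : forall n, Cmod (rg n (q4 (- y))) = Cmod (rg n (q4 y))).
  { intros n. unfold rg. rewrite !Cmod_mult, !Cmod_Rcpow. f_equal. f_equal.
    induction n; cbn [rising].
    - unfold Cmod, q4; cbn [fst snd]. f_equal. ring.
    - rewrite !Cmod_mult, IHn. f_equal. unfold Cmod, q4; cbn [fst snd Cplus RtoC]. f_equal. ring. }
  apply (is_lim_seq_ext _ _ _ (fun n => E (S n))) in L2.
  assert (U1 := is_lim_seq_unique _ _ L1). assert (U2 := is_lim_seq_unique _ _ L2). cbv beta in U1, U2.
  assert (U : Finite (Cmod (rG (q4 (- y)))) = Finite (Cmod (rG (q4 y)))) by (etransitivity; [symmetry; exact U2|exact U1]).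
  injection U; auto.
Qed.

(** * The phase of chi and the realness of Hardy's function *)

(** The Riemann-Siegel theta function. *)
Definition theta (t : R) : R := ph (t / 2) - t / 2 * ln PI.

Definition dtheta (t : R) : R := / 2 * dph (t / 2) - / 2 * ln PI.

Lemma theta_derive t : is_derive theta t (dtheta t).
Proof.
  unfold theta, dtheta. apply (is_derive_minus (K := R_AbsRing) (V := R_NormedModule) (fun t => ph (t / 2)) (fun t => t / 2 * ln PI)).
  - apply (is_derive_comp (K := R_AbsRing) (V := R_NormedModule) ph (fun t => t / 2) t (dph (t / 2)) (/ 2)); [apply ph_derive|]. auto_derive; [auto|]. reqR. field.
  - auto_derive; [auto|]. reqR. field.
Qed.

Lemma theta_0 : theta 0 = 0.
Proof. unfold theta. replace (0 / 2) with 0 by field. unfold ph. rewrite RInt_point. unfold zero; simpl. ring. Qed.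

Lemma continuous_dtheta t : continuous dtheta t.
Proof.
  unfold dtheta. apply (continuous_minus (V := R_NormedModule) (fun t => / 2 * dph (t / 2)) (fun _ => / 2 * ln PI)); [|apply continuous_const].
  apply (continuous_scal_r (V := R_NormedModule) (/ 2) (fun t => dph (t / 2))). apply (continuous_comp (fun t => t / 2) dph); [|apply continuous_dph].
  apply continuous_ex_derive. auto_derive. auto.
Qed.

Lemma chi_crit t : chi (crit t) = cis (- (2 * theta t)).
Proof.
  unfold chi.
  replace ((1 - crit t) / 2)%C with (q4 (- (t / 2))).
  2: { apply Ceq; unfold q4, crit, Cdiv; csimp; field. }
  replace (crit t / 2)%C with (q4 (t / 2)).
  2: { apply Ceq; unfold q4, crit, Cdiv; csimp; field. }
  set (y := t / 2).
  assert (P1 : 0 < Re (q4 y)) by (simpl; lra). assert (P2 : 0 < Re (q4 (- y))) by (simpl; lra).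
  rewrite (proj2 (Cgamma_rG _ P1)), (proj2 (Cgamma_rG _ P2)).
  assert (N1 := rG_neq0 _ P1). assert (N2 := rG_neq0 _ P2).
  assert (A1 := rG_polar y). assert (A2 := rG_polar (- y)). rewrite ph_odd, Ropp_involutive in A2.
  unfold polar in A1, A2. rewrite Cmod_rG_conj in A2.
  assert (M : 0 < Cmod (rG (q4 y))) by apply Cmod_gt_0, N1.
  rewrite A1, A2 at 1.
  replace (Rcpow PI (crit t - RtoC (1 / 2))) with (cis (t * ln PI)).
  2: { unfold Rcpow, cis. f_equal. apply Ceq; csimp; ring. }
  set (m := RtoC (Cmod (rG (q4 y)))) in *.
  assert (Nm : m <> 0%C) by (intros E; apply RtoC_inj in E; lra).
  replace (- (2 * theta t)) with (- ph y + - ph y + t * ln PI) by (unfold theta; fold y; unfold y; field).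
  rewrite !cis_plus.
  assert (I := cis_opp (ph y)). assert (Nc : cis (ph y) <> 0%C) by (intros E; rewrite E, Cmult_0_l in I; apply RtoC_inj in I; lra).
  assert (Nc2 : cis (- ph y) <> 0%C) by (intros E; rewrite E, Cmult_0_r in I; apply RtoC_inj in I; lra).
  assert (I2 : (/ cis (ph y))%C = cis (- ph y)) by (rewrite <- (Cmult_1_l (/ cis (ph y))), <- I; field; exact Nc).
  transitivity (cis (- ph y) * / cis (ph y) * cis (t * ln PI))%C; [field; auto|]. rewrite I2. reflexivity.
Qed.

Lemma continuous_theta t : continuous theta t.
Proof. apply (ex_derive_continuous (V := R_NormedModule)). eexists. apply theta_derive. Qed.

Lemma rcont_cis f t : continuous f t -> rcont (fun u => cis (f u)) t.
Proof.
  intros H. split; (eapply continuous_ext; [intros u; rewrite cis_eq; reflexivity|]).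
  - apply (continuous_comp f cos); [exact H|]. apply continuity_pt_filterlim, continuity_cos.
  - apply (continuous_comp f sin); [exact H|]. apply continuity_pt_filterlim, continuity_sin.
Qed.

Lemma rcont_continuous (w : R -> C) t : rcont w t <-> continuous w t.
Proof.
  split.
  - intros [H1 H2] P [e He].
    destruct (proj2 (continuous_eps _ _) H1 e (cond_pos e)) as [d1 [D1 E1]].
    destruct (proj2 (continuous_eps _ _) H2 e (cond_pos e)) as [d2 [D2 E2]].
    exists (mkposreal _ (Rmin_pos _ _ D1 D2)). intros y Hy. apply He. split.
    + apply E1. eapply Rlt_le_trans; [exact Hy|apply Rmin_l].
    + apply E2. eapply Rlt_le_trans; [exact Hy|apply Rmin_r].
  - intros H. split.
    + apply (continuous_comp w fst); [exact H|apply continuous_fst].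
    + apply (continuous_comp w snd); [exact H|apply continuous_snd].
Qed.

Lemma chi_inv_sqrt_exists : is_chi_inv_sqrt (fun t => cis (theta t)).
Proof.
  split; [|split].
  - intros t. apply rcont_continuous, rcont_cis, continuous_theta.
  - rewrite theta_0. apply cis_0.
  - intros t. rewrite chi_crit, <- !cis_plus. replace (theta t + theta t + - (2 * theta t)) with 0 by ring. apply cis_0.
Qed.

(** Two admissible branches differ by a continuous factor [r] with values 1 and -1 that equals 1 at
    0; the intermediate value theorem excludes a change of sign. *)
Lemma chi_inv_sqrt_eq t : chi_inv_sqrt t = cis (theta t).
Proof.
  assert (S : is_chi_inv_sqrt chi_inv_sqrt) by (unfold chi_inv_sqrt at 1; apply epsilon_spec; eexists; apply chi_inv_sqrt_exists).
  set (w := chi_inv_sqrt) in *. clearbody w. destruct S as (S1 & S2 & S3).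
  set (r := fun u => (w u * cis (- theta u))%C).
  assert (R2 : forall u, r u = 1%C \/ r u = (- (1))%C).
  { intros u. specialize (S3 u). rewrite chi_crit in S3.
    assert (E : (r u * r u)%C = 1%C).
    { unfold r. rewrite <- S3. replace (- (2 * theta u)) with (- theta u + - theta u) by ring. rewrite cis_plus. ring. }
    assert (F : ((r u - 1) * (r u + 1))%C = 0%C) by (replace ((r u - 1) * (r u + 1))%C with (r u * r u - 1)%C by ring; rewrite E; ring).
    destruct (excluded_middle_informative ((r u - 1)%C = 0%C)) as [A|A].
    - left. replace (r u) with ((r u - 1) + 1)%C by ring. rewrite A. ring.
    - right. destruct (excluded_middle_informative ((r u + 1)%C = 0%C)) as [B|B]; [|exfalso; apply (Cmult_neq_0 _ _ A B F)].
      replace (r u) with ((r u + 1) - 1)%C by ring. rewrite B. ring. }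
  assert (Rc : forall u, continuous (fun u => Re (r u)) u).
  { intros u. apply (rcont_mult w (fun u => cis (- theta u))); [apply rcont_continuous, S1|]. apply rcont_cis. apply (continuous_opp (V := R_NormedModule)), continuous_theta. }
  assert (R0 : Re (r 0) = 1) by (unfold r; rewrite S2, theta_0, Ropp_0, cis_0; simpl; ring).
  assert (R1 : r t = 1%C).
  { destruct (R2 t) as [A|A]; [exact A|exfalso].
    assert (At : Re (r t) = -1) by (rewrite A; simpl; ring).
    destruct (IVT_gen (fun u => Re (r u)) 0 t 0) as [c [_ Hc]].
    - intros u. apply continuity_pt_filterlim, Rc.
    - rewrite R0, At. unfold Rmin, Rmax. destruct (Rle_dec 1 (-1)); lra.
    - destruct (R2 c) as [B|B]; rewrite B in Hc; simpl in Hc; lra. }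
  assert (I := cis_opp (theta t)).
  replace (w t) with (r t * cis (theta t))%C by (unfold r; rewrite <- Cmult_assoc, (Cmult_comm (cis (- theta t))), I; ring).
  rewrite R1. ring.
Qed.

Lemma Cexp_conj z : Cexp (Cconj z) = Cconj (Cexp z).
Proof. unfold Cexp, Cconj. destruct z as [a b]. cbn [Re Im fst snd]. rewrite cos_neg, sin_neg. f_equal. ring. Qed.

Lemma Cexp_conj_scal v z : Cexp (RtoC v * Cconj z) = Cconj (Cexp (RtoC v * z)).
Proof. rewrite <- Cexp_conj. f_equal. apply Ceq; destruct z; unfold Cconj; csimp; ring. Qed.

Lemma En_conj n z : En n (Cconj z) = Cconj (En n z).
Proof.
  apply Ceq.
  - change (Re (Cconj (En n z))) with (Re (En n z)). unfold En, CI. cbn [Re fst].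
    apply RIntext. intros v. rewrite Cexp_conj_scal. destruct (Cexp (RtoC v * z)). unfold Cconj; csimp. ring.
  - change (Im (Cconj (En n z))) with (- Im (En n z)). unfold En, CI. cbn [Im snd].
    rewrite (RIntext _ (fun v => (-1) * Im (RtoC (ps v) * Cexp (RtoC v * z)) + 0 * 0)).
    + rewrite (RInt_lin2 (fun v => Im (RtoC (ps v) * Cexp (RtoC v * z))) (fun _ => 0) 0 (INR n) (-1) 0); [reqR; ring| |apply ex_RInt_const].
      apply (conts_ex_im (fun v => RtoC (ps v) * Cexp (RtoC v * z))%C); [apply pos_INR|apply En_conts].
    + intros v. rewrite Cexp_conj_scal. destruct (Cexp (RtoC v * z)). unfold Cconj; csimp. ring.
Qed.

Lemma EE_conj_im z : Im (EE z + EE (Cconj z)) = 0.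
Proof.
  assert (L := is_Clim_im _ _ (is_Clim_plus _ _ _ _ (EE_lim z) (EE_lim (Cconj z)))).
  apply (is_lim_seq_ext _ (fun _ => 0)) in L.
  - assert (U := is_lim_seq_unique _ _ L). rewrite Lim_seq_const in U. injection U; auto.
  - intros n. rewrite En_conj. destruct (En n z). unfold Cconj; csimp. ring.
Qed.

(** The factor [PI ^ (s / 2) rG (s / 2)] has argument [- theta t]. What remains is real: [L0 s]
    because [1 - s] is the conjugate of [s], and [1 / (s - 1) - 1 / s] because it equals
    [- 1 / (1 / 4 + t ^ 2)]. *)
Lemma zf_crit_real t : Im (zf (crit t) * cis (theta t)) = 0.
Proof.
  set (s := crit t). unfold zf.
  assert (E1 : (s / 2)%C = (q4 (t / 2))) by (unfold s, crit; apply Ceq; unfold q4, crit, Cdiv; csimp; field).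
  assert (G := rG_shift (s / 2)).
  assert (N2 : (s / 2)%C <> 0%C) by (rewrite E1; intros E; injection E; lra).
  assert (Ns : s <> 0%C) by (unfold s, crit; intros E; injection E; lra).
  assert (N1 : (s - 1)%C <> 0%C) by (intros E; apply (f_equal Re) in E; unfold s, crit in E; csimp; lra).
  assert (G2 : (/ 2 * rG (s / 2 + 1))%C = (/ s * rG (s / 2))%C).
  { rewrite G. field. exact Ns. }
  rewrite G2.
  replace (Rcpow PI (s / 2) * ((L0 s + / (s - 1)) * rG (s / 2) - / s * rG (s / 2)))%C with
    ((L0 s + (/ (s - 1) - / s)) * (Rcpow PI (s / 2) * rG (s / 2)))%C by ring.
  assert (P : polar (Rcpow PI (s / 2) * rG (s / 2)) (t / 2 * ln PI + - ph (t / 2))).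
  { apply polar_mult; [|rewrite E1; apply rG_polar]. replace (t / 2 * ln PI) with (Im (s / 2 * RtoC (ln PI))) by (rewrite E1; csimp; ring). apply polar_Cexp. }
  unfold polar in P. rewrite P.
  replace (t / 2 * ln PI + - ph (t / 2)) with (- theta t) by (unfold theta; ring).
  assert (I := cis_opp (theta t)). set (m := Cmod _).
  replace ((L0 s + (/ (s - 1) - / s)) * (RtoC m * cis (- theta t)) * cis (theta t))%C with
    (RtoC m * (L0 s + (/ (s - 1) - / s)) * (cis (theta t) * cis (- theta t)))%C by ring.
  rewrite I, Cmult_1_r.
  assert (IL : Im (L0 s) = 0).
  { unfold L0. replace ((1 - s) / 2)%C with (Cconj (s / 2)); [apply EE_conj_im|].
    rewrite E1. unfold s, crit. apply Ceq; unfold Cdiv, Cconj; csimp; field. }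
  assert (IR : (/ (s - 1) - / s)%C = RtoC (- / (1 / 4 + t ^ 2))).
  { assert (Q : 0 < 1 / 4 + t ^ 2) by (generalize (pow2_ge_0 t); lra).
    assert (Es : (s * (s - 1))%C = RtoC (- (1 / 4 + t ^ 2))) by (unfold s, crit; apply Ceq; csimp; field).
    replace (/ (s - 1) - / s)%C with (/ (s * (s - 1)))%C by (field; auto). rewrite Es, <- RtoC_inv by lra. f_equal. field. lra. }
  rewrite IR. destruct (L0 s) as [a b]. simpl in IL. subst b. csimp. ring.
Qed.

(** The projection [Re] in [hardy_Z] loses nothing at height above 1, where [zeta] and [zf] are
    known to agree. *)
Lemma hardy_Z_C t : 1 < t -> RtoC (hardy_Z t) = (zeta (crit t) * cis (theta t))%C.
Proof.
  intros Ht. unfold hardy_Z. rewrite chi_inv_sqrt_eq. apply Ceq; [reflexivity|]. simpl.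
  assert (E := zf_crit_real t). rewrite <- zeta_zf in E by (simpl; lra). symmetry. exact E.
Qed.

Lemma zeta_cder (s : C) : s <> 1%C -> cder zeta s (C_derive zeta s).
Proof. intros H. destruct (zeta_hol s H) as [l Hl]. rewrite (is_C_derive_unique zeta s l); [exact Hl|]. apply is_derive_cder, Hl. Qed.

Lemma rder_cis f t l : is_derive f t l -> rder (fun u => cis (f u)) t (Ci * RtoC l * cis (f t)).
Proof.
  intros H. rewrite cis_eq. split.
  - apply (is_derive_ext (fun u => cos (f u))); [intros; rewrite cis_eq; reflexivity|].
    eapply is_derive_val; [apply (is_derive_comp (K := R_AbsRing) (V := R_NormedModule) cos f t (- sin (f t)) l); [apply is_derive_Reals, derivable_pt_lim_cos|exact H]|].
    unfold scal; simpl; unfold mult; simpl. ring.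
  - apply (is_derive_ext (fun u => sin (f u))); [intros; rewrite cis_eq; reflexivity|].
    eapply is_derive_val; [apply (is_derive_comp (K := R_AbsRing) (V := R_NormedModule) sin f t (cos (f t)) l); [apply is_derive_Reals, derivable_pt_lim_sin|exact H]|].
    unfold scal; simpl; unfold mult; simpl. ring.
Qed.

Definition dZ (t : R) : R := Re (Ci * C_derive zeta (crit t) * cis (theta t) + zeta (crit t) * (Ci * RtoC (dtheta t) * cis (theta t))).

Lemma crit_neq1 t : crit t <> 1%C.
Proof. unfold crit. intros E. injection E. lra. Qed.

Lemma hardy_Z_derive t : is_derive hardy_Z t (dZ t).
Proof.
  unfold hardy_Z. apply (is_derive_ext (fun t => Re (zeta (crit t) * cis (theta t)))).
  { intros u. rewrite chi_inv_sqrt_eq. reflexivity. }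
  apply (rder_mult (fun t => zeta (crit t)) (fun t => cis (theta t)) t); [|apply rder_cis, theta_derive].
  apply (cder_rder_ver zeta (1 / 2) t). apply zeta_cder, crit_neq1.
Qed.

Lemma continuous_dZ t : continuous dZ t.
Proof.
  assert (A : rcont (fun t => zeta (crit t)) t).
  { apply (rcont_comp zeta crit); [apply hol_ccont, zeta_hol, crit_neq1|apply rcont_ver]. }
  assert (B : rcont (fun t => C_derive zeta (crit t)) t).
  { apply (rcont_comp (C_derive zeta) crit); [|apply rcont_ver].
    apply (hol_deriv_ccont zeta (C_derive zeta) (crit t) (1 / 2)); [lra|]. intros h Hh. apply zeta_cder.
    apply ball_neq. eapply Rlt_le_trans; [exact Hh|]. eapply Rle_trans; [|apply re_le_Cmod].
    replace (Re (crit t - 1)) with (- (1 / 2)) by (unfold crit; csimp; field). rewrite Rabs_left; lra. }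
  assert (C : rcont (fun t => cis (theta t)) t) by apply rcont_cis, continuous_theta.
  assert (D : rcont (fun t => RtoC (dtheta t)) t) by apply rcont_RtoC, continuous_dtheta.
  apply (rcont_plus (fun t => Ci * C_derive zeta (crit t) * cis (theta t))%C (fun t => zeta (crit t) * (Ci * RtoC (dtheta t) * cis (theta t)))%C).
  - apply (rcont_mult (fun t => Ci * C_derive zeta (crit t))%C); [|exact C]. apply rcont_mult; [apply rcont_const|exact B].
  - apply (rcont_mult (fun t => zeta (crit t))); [exact A|]. apply (rcont_mult (fun t => Ci * RtoC (dtheta t))%C); [|exact C].
    apply rcont_mult; [apply rcont_const|exact D].
Qed.

(** * Windows with a Gaussian weight *)

Fixpoint sumC {A} (f : A -> C) (l : list A) : C :=
  match l with nil => 0%C | a :: l => (f a + sumC f l)%C end.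

Fixpoint sumR {A} (f : A -> R) (l : list A) : R :=
  match l with nil => 0 | a :: l => f a + sumR f l end.

Lemma sumC_ext {A} (f g : A -> C) l : (forall a, In a l -> f a = g a) -> sumC f l = sumC g l.
Proof. induction l; intros H; simpl; [reflexivity|]. rewrite H, IHl; [reflexivity| |left; reflexivity]. intros; apply H; right; assumption. Qed.

Lemma sumR_ext {A} (f g : A -> R) l : (forall a, In a l -> f a = g a) -> sumR f l = sumR g l.
Proof. induction l; intros H; simpl; [reflexivity|]. rewrite H, IHl; [reflexivity| |left; reflexivity]. intros; apply H; right; assumption. Qed.

Lemma sumC_app {A} (f : A -> C) l l' : sumC f (l ++ l') = (sumC f l + sumC f l')%C.
Proof. induction l; simpl; [ring|]. rewrite IHl. ring. Qed.

Lemma sumR_app {A} (f : A -> R) l l' : sumR f (l ++ l') = sumR f l + sumR f l'.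
Proof. induction l; simpl; [ring|]. rewrite IHl. ring. Qed.

Lemma sumC_map {A B} (h : A -> B) (f : B -> C) l : sumC f (map h l) = sumC (fun a => f (h a)) l.
Proof. induction l; simpl; congruence. Qed.

Lemma sumC_scal {A} c (f : A -> C) l : sumC (fun a => c * f a)%C l = (c * sumC f l)%C.
Proof. induction l; simpl; [ring|]. rewrite IHl. ring. Qed.

Lemma sumR_scal {A} c (f : A -> R) l : sumR (fun a => c * f a) l = c * sumR f l.
Proof. induction l; simpl; [ring|]. rewrite IHl. ring. Qed.

Lemma sumR_plus {A} (f g : A -> R) l : sumR (fun a => f a + g a) l = sumR f l + sumR g l.
Proof. induction l; simpl; [ring|]. rewrite IHl. ring. Qed.

Lemma sumR_le {A} (f g : A -> R) l : (forall a, In a l -> f a <= g a) -> sumR f l <= sumR g l.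
Proof. induction l; intros H; simpl; [lra|]. apply Rplus_le_compat; [apply H; left; reflexivity|]. apply IHl. intros; apply H; right; assumption. Qed.

Lemma sumR_const {A} c (l : list A) : sumR (fun _ => c) l = INR (length l) * c.
Proof. induction l; [simpl; ring|]. cbn [sumR length]. rewrite IHl, S_INR. ring. Qed.

Lemma sumR_nonneg {A} (f : A -> R) l : (forall a, In a l -> 0 <= f a) -> 0 <= sumR f l.
Proof. intros H. replace 0 with (sumR (fun _ : A => 0) l) by (rewrite sumR_const; ring). apply sumR_le, H. Qed.

Lemma sumC_Cmod {A} (f : A -> C) l : Cmod (sumC f l) <= sumR (fun a => Cmod (f a)) l.
Proof. induction l; simpl; [rewrite Cmod_0; lra|]. eapply Rle_trans; [apply Cmod_triangle|]. lra. Qed.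

Lemma sumC_Cmod_const {A} (f : A -> C) l K : (forall a, In a l -> Cmod (f a) <= K) -> Cmod (sumC f l) <= INR (length l) * K.
Proof. intros H. eapply Rle_trans; [apply sumC_Cmod|]. rewrite <- sumR_const. apply sumR_le, H. Qed.

Lemma sumC_mult {A B} (f : A -> C) (g : B -> C) l l' : (sumC f l * sumC g l')%C = sumC (fun a => sumC (fun b => f a * g b)%C l') l.
Proof. induction l; simpl; [ring|]. rewrite sumC_scal, <- IHl. ring. Qed.

Lemma sumC_conj {A} (f : A -> C) l : Cconj (sumC f l) = sumC (fun a => Cconj (f a)) l.
Proof. induction l; simpl; [unfold Cconj; apply Ceq; csimp; ring|]. rewrite <- IHl. unfold Cconj; apply Ceq; csimp; ring. Qed.

Lemma sumR_RtoC {A} (f : A -> R) l : RtoC (sumR f l) = sumC (fun a => RtoC (f a)) l.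
Proof. induction l; simpl; [reflexivity|]. rewrite RtoC_plus, IHl. reflexivity. Qed.

Lemma sumC_Re {A} (f : A -> C) l : Re (sumC f l) = sumR (fun a => Re (f a)) l.
Proof. induction l; simpl; [reflexivity|]. rewrite <- IHl. reflexivity. Qed.

Lemma sumC_hol {A} (f : A -> C -> C) l z : (forall a, In a l -> hol (f a) z) -> hol (fun s => sumC (fun a => f a s) l) z.
Proof.
  induction l; intros H; simpl; [apply hol_const|]. apply (hol_plus (f a)); [apply H; left; reflexivity|].
  apply IHl. intros; apply H; right; assumption.
Qed.

Lemma sumC_conts {A} (f : A -> R -> C) l a b : (forall x, In x l -> conts (f x) a b) -> conts (fun t => sumC (fun x => f x t) l) a b.
Proof.
  induction l; intros H; simpl; [apply conts_const|]. apply (conts_plus (f a0)); [apply H; left; reflexivity|].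
  apply IHl. intros; apply H; right; assumption.
Qed.

Lemma sumC_cder {A} (f : A -> C -> C) f' l z : (forall a, In a l -> cder (f a) z (f' a)) -> cder (fun s => sumC (fun a => f a s) l) z (sumC f' l).
Proof.
  induction l; intros H; simpl; [apply cder_const|]. apply (cder_plus (f a)); [apply H; left; reflexivity|].
  apply IHl. intros; apply H; right; assumption.
Qed.

Lemma CI_sumC {A} (f : A -> R -> C) l a b : a <= b -> (forall x, In x l -> conts (f x) a b) ->
  CI (fun t => sumC (fun x => f x t) l) a b = sumC (fun x => CI (f x) a b) l.
Proof.
  intros Hab. induction l; intros H; simpl.
  - rewrite CI_const. ring.
  - rewrite (CI_plus (f a0) (fun t => sumC (fun x => f x t) l)); [|exact Hab| |].
    + rewrite IHl; [reflexivity|]. intros; apply H; right; assumption.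
    + apply H; left; reflexivity.
    + apply sumC_conts. intros; apply H; right; assumption.
Qed.

(** All [N ^ k] products, listed with multiplicity, so that sums over the list are [k]-th powers of
    sums over [1 .. N]. *)
Fixpoint prods (k N : nat) : list nat :=
  match k with O => [1%nat] | S k => flat_map (fun a => map (Nat.mul a) (prods k N)) (seq 1 N) end.

Lemma sumC_flat_map {A B} (f : B -> C) (h : A -> list B) l : sumC f (flat_map h l) = sumC (fun a => sumC f (h a)) l.
Proof. induction l; simpl; [reflexivity|]. rewrite sumC_app, IHl. reflexivity. Qed.

Lemma prods_range k N x : In x (prods k N) -> (1 <= x <= N ^ k)%nat.
Proof.
  revert x. induction k; simpl; intros x H; [lia|]. apply in_flat_map in H. destruct H as [a [Ha H]].
  apply in_map_iff in H. destruct H as [y [E H]]. apply in_seq in Ha. apply IHk in H. nia.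
Qed.

Lemma prods_length k N : length (prods k N) = (N ^ k)%nat.
Proof.
  induction k; [reflexivity|]. simpl. rewrite flat_map_constant_length with (c := (N ^ k)%nat); [rewrite length_seq; lia|].
  intros a _. rewrite length_map. exact IHk.
Qed.

Lemma csum_sumC f N : csum f N = sumC (fun n => f (pred n)) (seq 1 N).
Proof.
  induction N; [reflexivity|]. rewrite seq_S, sumC_app, <- IHN. simpl. ring.
Qed.

Lemma prods_pow k N z : sumC (fun x => Rcpow (INR x) z) (prods k N) = (csum (fun n => Rcpow (INR (S n)) z) N ^ k)%C.
Proof.
  induction k; [cbn [prods sumC INR Cpow]; rewrite Rcpow_one; ring|].
  cbn [prods Cpow]. rewrite sumC_flat_map, <- IHk, csum_sumC, sumC_mult. apply sumC_ext. intros a Ha. rewrite sumC_map.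
  apply sumC_ext. intros b Hb. apply in_seq in Ha. apply prods_range in Hb. replace (S (pred a)) with a by lia.
  rewrite mult_INR. apply Rcpow_mult_base; apply lt_0_INR; lia.
Qed.

(** * Contour shifts under a Gaussian *)

Lemma shift_bound f x1 x2 y1 y2 K : x1 <= x2 -> y1 <= y2 ->
  (forall x y, x1 <= x <= x2 -> y1 <= y <= y2 -> hol f (x, y)) ->
  (forall x, x1 <= x <= x2 -> Cmod (f (x, y1)) <= K /\ Cmod (f (x, y2)) <= K) ->
  Cmod (CI (fun y => f (x1, y)) y1 y2 - CI (fun y => f (x2, y)) y1 y2) <= 2 * K * (x2 - x1).
Proof.
  intros Hx Hy Hh Hb. assert (G := goursat f x1 x2 y1 y2 Hx Hy Hh). unfold bdr in G.
  set (P := CI (fun u => f (u, y1)) x1 x2) in *. set (Q := CI (fun u => f (u, y2)) x1 x2) in *.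
  assert (HP : Cmod P <= K * (x2 - x1)).
  { apply CI_bound; [exact Hx| |intros t Ht; apply (Hb t Ht)]. apply conts_hor. intros; apply hol_ccont, Hh; lra. }
  assert (HQ : Cmod Q <= K * (x2 - x1)).
  { apply CI_bound; [exact Hx| |intros t Ht; apply (Hb t Ht)]. apply conts_hor. intros; apply hol_ccont, Hh; lra. }
  set (U := CI (fun y => f (x1, y)) y1 y2) in *. set (V := CI (fun y => f (x2, y)) y1 y2) in *.
  assert (E : (U - V)%C = ((- Ci) * (P - Q) + Ci * (P + Ci * V - Q - Ci * U))%C).
  { transitivity (- Ci * Ci * (U - V))%C; [|ring]. replace (- Ci * Ci)%C with (RtoC 1) by (apply Ceq; csimp; ring). ring. }
  rewrite E, G, Cmult_0_r, Cplus_0_r, Cmod_mult, Cmod_opp.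
  replace (Cmod Ci) with 1 by (unfold Ci, Cmod; cbn [fst snd]; replace (0 ^ 2 + 1 ^ 2) with 1 by ring; rewrite sqrt_1; reflexivity).
  generalize (Cmod_tri_minus P Q). lra.
Qed.

(** The entire function [e ^ (u ^ 2 / D ^ 2)]: it is the Gaussian weight on the imaginary axis, and
    its modulus exceeds that weight by at most a factor [e] for [|Re u| <= D], which permits shifts
    by [D]. *)
Definition gW (D : R) (u : C) : C := Cexp (u * u * RtoC (/ D ^ 2)).

Lemma hol_gW D z : hol (gW D) z.
Proof. apply hol_Cexp. apply (hol_mult (fun u => u * u)%C); [apply hol_mult; apply hol_id|apply hol_const]. Qed.

Lemma Cmod_gW D x y : 0 < D -> Cmod (gW D (x, y)) = exp ((x ^ 2 - y ^ 2) / D ^ 2).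
Proof. intros H. unfold gW. rewrite Cmod_Cexp. f_equal. csimp. field. lra. Qed.

(* Shift the contour by [D] to the side on which [exp (rho u)] decays. *)
Lemma osc (q : C -> C) rho D B Q eta : 0 < D -> 0 <= B -> 0 <= Q ->
  (forall x y, - D <= x <= D -> - B <= y <= B -> hol q (x, y)) ->
  (forall x y, - D <= x <= D -> - B <= y <= B -> Cmod (q (x, y)) <= Q) -> eta <= Rabs rho ->
  Cmod (CI (fun y => Cexp (RtoC rho * (0, y)) * gW D (0, y) * q (0, y))%C (- B) B) <=
    Q * (2 * B * exp (1 - eta * D) + 2 * D * exp (1 - (B / D) ^ 2)).
Proof.
  intros HD HB HQ Hh Hq He.
  set (f := fun u => (Cexp (RtoC rho * u) * gW D u * q u)%C).
  assert (Fh : forall x y, - D <= x <= D -> - B <= y <= B -> hol f (x, y)).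
  { intros x y Hx Hy. apply (hol_mult (fun u => Cexp (RtoC rho * u) * gW D u)%C); [|apply Hh; assumption].
    apply (hol_mult (fun u => Cexp (RtoC rho * u))); [|apply hol_gW]. apply hol_Cexp, hol_mult; [apply hol_const|apply hol_id]. }
  assert (Fb : forall x y, - D <= x <= D -> - B <= y <= B -> Cmod (f (x, y)) <= exp (rho * x + 1 - (y / D) ^ 2) * Q).
  { intros x y Hx Hy. unfold f. rewrite !Cmod_mult, Cmod_gW, Cmod_Cexp, <- exp_plus by exact HD.
    apply Rmult_le_compat; [left; apply exp_pos|apply Cmod_ge_0| |apply Hq; assumption]. apply exp_le_mono.
    replace (Re (RtoC rho * (x, y))) with (rho * x) by (csimp; ring).
    assert (x ^ 2 / D ^ 2 <= 1) by (apply <- Rle_div_l; [nra|nra]).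
    replace ((x ^ 2 - y ^ 2) / D ^ 2) with (x ^ 2 / D ^ 2 - (y / D) ^ 2) by (field; lra). lra. }
  assert (BD : 0 <= (B / D) ^ 2) by apply pow2_ge_0.
  assert (Hend : forall x y, - D <= x <= D -> rho * x <= 0 -> y = B \/ y = - B -> Cmod (f (x, y)) <= exp (1 - (B / D) ^ 2) * Q).
  { intros x y Hx Hr Hy. eapply Rle_trans; [apply Fb; [exact Hx|lra]|]. apply Rmult_le_compat_r; [exact HQ|]. apply exp_le_mono.
    replace ((y / D) ^ 2) with ((B / D) ^ 2) by (destruct Hy; subst y; field; lra). lra. }
  assert (Hside : forall x, - D <= x <= D -> rho * x <= - eta * D -> Cmod (CI (fun y => f (x, y)) (- B) B) <= exp (1 - eta * D) * Q * (2 * B)).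
  { intros x Hx Hr. replace (2 * B) with (B - - B) by ring. apply CI_bound; [lra| |].
    - apply conts_ver. intros; apply hol_ccont, Fh; lra.
    - intros y Hy. eapply Rle_trans; [apply Fb; lra|]. apply Rmult_le_compat_r; [exact HQ|]. apply exp_le_mono. generalize (pow2_ge_0 (y / D)). lra. }
  assert (Main : forall x, (x = D \/ x = - D) -> rho * x <= - eta * D -> rho * x <= 0 -> Cmod (CI (fun y => f (0, y)) (- B) B - CI (fun y => f (x, y)) (- B) B) <= 2 * (exp (1 - (B / D) ^ 2) * Q) * D).
  { intros x [E|E] Hr Hr0; subst x.
    - eapply Rle_trans; [apply (shift_bound f 0 D (- B) B (exp (1 - (B / D) ^ 2) * Q)); [lra|lra| |]|lra].
      + intros; apply Fh; lra.
      + intros x Hx. assert (rho * x <= 0) by nra. split; (apply Hend; [lra|lra|auto]).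
    - rewrite Cmod_minus_sym. eapply Rle_trans; [apply (shift_bound f (- D) 0 (- B) B (exp (1 - (B / D) ^ 2) * Q)); [lra|lra| |]|lra].
      + intros; apply Fh; lra.
      + intros x Hx. assert (rho * x <= 0) by nra. split; (apply Hend; [lra|lra|auto]). }
  assert (Fin : forall x, (x = D \/ x = - D) -> rho * x <= - eta * D -> rho * x <= 0 -> Cmod (CI (fun y => f (0, y)) (- B) B) <= Q * (2 * B * exp (1 - eta * D) + 2 * D * exp (1 - (B / D) ^ 2))).
  { intros x H1 H2 H3. assert (M := Main x H1 H2 H3). assert (S := Hside x ltac:(destruct H1; subst; lra) H2).
    set (I0 := CI (fun y => f (0, y)) (- B) B) in *. set (I1 := CI (fun y => f (x, y)) (- B) B) in *.
    replace I0 with ((I0 - I1) + I1)%C by ring. eapply Rle_trans; [apply Cmod_triangle|]. lra. }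
  destruct (Rle_dec 0 rho) as [P|P].
  - rewrite Rabs_pos_eq in He by exact P. apply (Fin (- D)); [auto|nra|nra].
  - rewrite Rabs_left in He by lra. apply (Fin D); [auto|nra|nra].
Qed.

(** * A rational approximation to the derivative of theta *)

Definition gz (s : C) : C := ((s - RtoC (1 / 2)) * RtoC (/ 2))%C.

(** At [z = i y] this is the summand [a / (a ^ 2 + y ^ 2)] of [dphn], continued to a rational
    function with real poles; [gz] carries the critical line to the imaginary axis. *)
Definition gt (j : nat) (z : C) : C := (RtoC (aj j) * / ((RtoC (aj j) - z) * (RtoC (aj j) + z)))%C.

(* On the critical line this approximates [theta'], with error [O(t ^ 2 / N)],
   and it is holomorphic off the real axis. *)
Definition gn (N : nat) (s : C) : C :=
  (RtoC (/ 2 * ln (INR N) - / 2 * ln PI) - RtoC (/ 2) * csum (fun j => gt j (gz s)) (S N))%C.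

Lemma csum_Re f N : Re (csum f N) = rsum (fun j => Re (f j)) N.
Proof. induction N; [reflexivity|]. rewrite rsum_S, <- IHN. reflexivity. Qed.

Lemma csum_Cmod f N : Cmod (csum f N) <= rsum (fun j => Cmod (f j)) N.
Proof. induction N; [simpl; rewrite Cmod_0; lra|]. rewrite rsum_S. cbn [csum]. eapply Rle_trans; [apply Cmod_triangle|]. lra. Qed.

Lemma gn_crit N t : gn N (crit t) = RtoC (/ 2 * dphn N (t / 2) - / 2 * ln PI).
Proof.
  unfold gn. rewrite (csum_ext _ (fun j => RtoC (aj j / (aj j ^ 2 + (t / 2) ^ 2)))).
  - rewrite csum_RtoC, <- RtoC_mult, <- RtoC_minus. f_equal. unfold dphn. ring.
  - intros j _. unfold gt. assert (P := aj_sq_pos j (t / 2)).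
    replace ((RtoC (aj j) - gz (crit t)) * (RtoC (aj j) + gz (crit t)))%C with (RtoC (aj j ^ 2 + (t / 2) ^ 2)).
    + rewrite <- RtoC_inv, <- RtoC_mult by lra. reflexivity.
    + unfold gz, crit. apply Ceq; csimp; field.
Qed.

Lemma gz_Im s : Im (gz s) = Im s / 2.
Proof. unfold gz. csimp. field. Qed.

Lemma gt_den_lower j z : Im z ^ 2 <= Cmod ((RtoC (aj j) - z) * (RtoC (aj j) + z)).
Proof.
  rewrite Cmod_mult. assert (A := im_le_Cmod (RtoC (aj j) - z)). assert (B := im_le_Cmod (RtoC (aj j) + z)).
  replace (Im (RtoC (aj j) - z)) with (- Im z) in A by (csimp; ring). replace (Im (RtoC (aj j) + z)) with (Im z) in B by (csimp; ring).
  rewrite Rabs_Ropp in A. rewrite <- Rsqr_pow2, Rsqr_abs. unfold Rsqr. apply Rmult_le_compat; auto using Rabs_pos.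
Qed.

Lemma gt_den_neq0 j z : Im z <> 0 -> ((RtoC (aj j) - z) * (RtoC (aj j) + z))%C <> 0%C.
Proof.
  intros H E. assert (L := gt_den_lower j z). rewrite E, Cmod_0 in L. assert (0 < Im z ^ 2); [|lra].
  rewrite <- Rsqr_pow2. apply Rsqr_pos_lt, H.
Qed.

Lemma hol_gn N s : Im s <> 0 -> hol (gn N) s.
Proof.
  intros H. unfold gn. apply (hol_minus (fun _ => RtoC (/ 2 * ln (INR N) - / 2 * ln PI))); [apply hol_const|].
  apply (hol_mult (fun _ => RtoC (/ 2))); [apply hol_const|].
  apply (hol_csum (fun j s => gt j (gz s))). intros j.
  assert (G : hol gz s).
  { unfold gz. apply (hol_mult (fun s => (s - RtoC (1 / 2))%C)); [apply (hol_minus (fun s => s)); [apply hol_id|apply hol_const]|apply hol_const]. }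
  unfold gt. apply (hol_mult (fun _ => RtoC (aj j))); [apply hol_const|].
  apply (hol_inv (fun s => (RtoC (aj j) - gz s) * (RtoC (aj j) + gz s))%C).
  - apply (hol_mult (fun s => RtoC (aj j) - gz s)%C (fun s => RtoC (aj j) + gz s)%C).
    + apply (hol_minus (fun _ => RtoC (aj j))); [apply hol_const|exact G].
    + apply (hol_plus (fun _ => RtoC (aj j))); [apply hol_const|exact G].
  - apply gt_den_neq0. rewrite gz_Im. lra.
Qed.

Lemma ln_le_pred x : 0 < x -> ln x <= x - 1.
Proof. intros H. generalize (exp_ineq1_le (ln x)). rewrite exp_ln by exact H. lra. Qed.

Lemma ln_le_x x : 1 <= x -> 0 <= ln x <= x.
Proof.
  intros H. split; [rewrite <- ln_1; apply ln_le; lra|]. generalize (ln_le_pred x). lra.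
Qed.

(** A crude bound is enough: it enters the error terms as a power of [T], absorbed there by the
    Gaussian or by a long Dirichlet polynomial. *)
Lemma gn_bound N s : (1 <= N)%nat -> 2 <= Im s -> Cmod (gn N s) <= 3 * (INR N + 1) ^ 2.
Proof.
  intros HN Hs. assert (n1 : 1 <= INR N) by (apply (le_INR 1); exact HN).
  unfold gn. eapply Rle_trans; [apply Cmod_tri_minus|]. rewrite Cmod_R, Cmod_mult, Cmod_R, (Rabs_pos_eq (/ 2)) by lra.
  assert (K : Cmod (csum (fun j => gt j (gz s)) (S N)) <= (INR N + 1) * (INR N + 1)).
  { eapply Rle_trans; [apply csum_Cmod|]. replace ((INR N + 1) * (INR N + 1)) with (rsum (fun _ => INR N + 1) (S N)) by (rewrite rsum_const, S_INR; ring).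
    apply rsum_le. intros j Hj. unfold gt. rewrite Cmod_mult, Cmod_R, (Rabs_pos_eq (aj j)) by (left; apply aj_pos).
    assert (D := gt_den_lower j (gz s)). rewrite gz_Im in D.
    rewrite Cmod_inv. 2: { apply gt_den_neq0. rewrite gz_Im; lra. }
    set (d := Cmod _) in *. assert (1 <= d) by nra.
    assert (/ d <= 1) by (rewrite <- Rinv_1; apply Rinv_le_contravar; lra).
    assert (aj j <= INR N + 1) by (unfold aj; assert (INR j <= INR N) by (apply le_INR; lia); lra).
    assert (0 < / d) by (apply Rinv_0_lt_compat; lra). generalize (aj_pos j). nra. }
  assert (L1 := ln_le_x _ n1). assert (LP := ln_le_x PI ltac:(generalize PI2_1; lra)). generalize PI_4. intros P4.
  assert (Rabs (/ 2 * ln (INR N) - / 2 * ln PI) <= INR N + 2) by (apply Rabs_le; lra).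
  nra.
Qed.

(* Telescoping form of [x / (x ^ 2 + y ^ 2)], summing to a logarithm. *)
Lemma tele_term x y : 2 <= y -> - (1 / 2) <= x ->
  x / (x ^ 2 + y ^ 2) <= (ln (x + y) - 2 * y / (x + y)) - (ln (x + y - 1) - 2 * y / (x + y - 1)).
Proof.
  intros Hy Hx. set (p := x + y). assert (Hp : 1 < p) by (unfold p; lra).
  assert (Q : 0 < x ^ 2 + y ^ 2) by (generalize (pow2_ge_0 x); nra).
  assert (A : / p <= ln p - ln (p - 1)).
  { assert (E : ln (p - 1) = ln p + ln (1 - / p)).
    { rewrite <- ln_mult; [f_equal; field; lra|lra|]. assert (/ p < 1) by (rewrite <- Rinv_1; apply Rinv_lt_contravar; lra). lra. }
    assert (I : ln (1 - / p) <= - / p).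
    { assert (0 < 1 - / p) by (assert (/ p < 1) by (rewrite <- Rinv_1; apply Rinv_lt_contravar; lra); lra).
      generalize (ln_le_pred (1 - / p)). lra. }
    lra. }
  assert (B : / p ^ 2 <= / (p - 1) - / p).
  { replace (/ (p - 1) - / p) with (/ ((p - 1) * p)) by (field; lra). apply Rinv_le_contravar; nra. }
  assert (C0 : x / (x ^ 2 + y ^ 2) <= / p + 2 * y * / p ^ 2).
  { replace (/ p + 2 * y * / p ^ 2) with ((p + 2 * y) / p ^ 2) by (field; lra).
    apply <- Rle_div_l; [|lra]. unfold Rdiv. rewrite Rmult_assoc, (Rmult_comm (/ p ^ 2)), <- Rmult_assoc.
    change (x <= (p + 2 * y) * (x ^ 2 + y ^ 2) / p ^ 2). apply -> Rle_div_r; [|nra]. unfold p.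
    assert ((x + y + 2 * y) * (x ^ 2 + y ^ 2) - x * (x + y) ^ 2 = x ^ 2 * y + 3 * y ^ 3) by ring.
    assert (0 <= x ^ 2 * y) by (generalize (pow2_ge_0 x); nra). assert (0 <= y ^ 3) by (apply pow_le; lra). lra. }
  unfold Rdiv. fold p. nra.
Qed.

Lemma tele_sum x0 y n : 2 <= y -> - (1 / 2) <= x0 ->
  rsum (fun j => (x0 + INR j) / ((x0 + INR j) ^ 2 + y ^ 2)) (S n) <= ln (x0 + INR n + y) - ln (x0 + y - 1) + 2 * y / (x0 + y - 1).
Proof.
  intros Hy Hx.
  assert (K : rsum (fun j => (x0 + INR j) / ((x0 + INR j) ^ 2 + y ^ 2)) (S n) <=
    (ln (x0 + INR n + y) - 2 * y / (x0 + INR n + y)) - (ln (x0 + y - 1) - 2 * y / (x0 + y - 1))).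
  { induction n.
    - rewrite rsum_S. cbn [rsum INR]. rewrite Rplus_0_r, Rplus_0_l. apply tele_term; assumption.
    - rewrite rsum_S. assert (T := tele_term (x0 + INR (S n)) y Hy ltac:(generalize (pos_INR (S n)); lra)).
      replace (x0 + INR (S n) + y - 1) with (x0 + INR n + y) in T by (rewrite S_INR; ring). lra. }
  assert (0 < 2 * y / (x0 + INR n + y)); [|lra]. apply Rdiv_lt_0_compat; [lra|]. generalize (pos_INR n); lra.
Qed.

(** Partial fractions on the line [Re s = 2], where [gz s] has real part [3 / 4]. *)
Lemma gt_Re j y : y <> 0 -> Re (gt j (3 / 4, y)) =
  / 2 * ((aj j - 3 / 4) / ((aj j - 3 / 4) ^ 2 + y ^ 2) + (aj j + 3 / 4) / ((aj j + 3 / 4) ^ 2 + y ^ 2)).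
Proof.
  intros Hy. set (a := aj j).
  assert (P1 : 0 < (a - 3 / 4) ^ 2 + y ^ 2) by (apply sumsq_pos; auto). assert (P2 : 0 < (a + 3 / 4) ^ 2 + y ^ 2) by (apply sumsq_pos; auto).
  assert (E1 : (/ (RtoC a - (((3 / 4)%R, y) : C)))%C = ((a - 3 / 4) / ((a - 3 / 4) ^ 2 + y ^ 2), y / ((a - 3 / 4) ^ 2 + y ^ 2))).
  { unfold Cinv. apply Ceq; csimp; f_equal; try ring; f_equal; ring. }
  assert (E2 : (/ (RtoC a + (((3 / 4)%R, y) : C)))%C = ((a + 3 / 4) / ((a + 3 / 4) ^ 2 + y ^ 2), - y / ((a + 3 / 4) ^ 2 + y ^ 2))).
  { unfold Cinv. apply Ceq; csimp; f_equal; try ring; f_equal; ring. }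
  assert (E : gt j (3 / 4, y) = (RtoC (/ 2) * (/ (RtoC a - (((3 / 4)%R, y) : C)) + / (RtoC a + (((3 / 4)%R, y) : C))))%C).
  { assert (N1 : (RtoC a - (((3 / 4)%R, y) : C))%C <> 0%C) by (intros E; apply (f_equal Im) in E; csimp; lra).
    assert (N2 : (RtoC a + (((3 / 4)%R, y) : C))%C <> 0%C) by (intros E; apply (f_equal Im) in E; csimp; lra).
    unfold gt. fold a. set (z := (((3 / 4)%R, y) : C)) in *. rewrite RtoC_inv by lra. field. repeat split; auto; intros E; apply RtoC_inj in E; lra. }
  rewrite E, E1, E2. csimp. ring.
Qed.

(** By telescoping, each of the two partial-fraction sums is at most [ln (N / t) + O(1)], so [ln N]
    cancels and half of [ln t] is left: the expected size of [theta'], now on the line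
    [Re s = 2]. *)
Lemma gn_Re_lower : exists K, 0 <= K /\ forall N t, 8 <= t -> t <= INR N -> / 2 * ln t - K <= Re (gn N (2, t)).
Proof.
  set (K := / 2 * ln PI + / 2 * (ln 3 + ln 4 + 8)).
  assert (P1 : 0 <= ln PI) by (apply ln_le_x; generalize PI2_1; lra). assert (P3 := ln_le_x 3 ltac:(lra)). assert (P4 := ln_le_x 4 ltac:(lra)).
  exists K. split; [unfold K; lra|]. intros N t Ht HN.
  set (y := t / 2). assert (Hy : 2 <= y) by (unfold y; lra).
  unfold gn. replace (gz (2, t)) with ((3 / 4, y) : C) by (unfold gz, y; apply Ceq; csimp; field).
  set (S0 := csum (fun j => gt j (3 / 4, y)) (S N)).
  replace (Re _) with (/ 2 * ln (INR N) - / 2 * ln PI - / 2 * Re S0) by (csimp; ring).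
  assert (HS : Re S0 <= ln (INR N) - ln t + (ln 3 + ln 4 + 8)).
  { unfold S0. rewrite csum_Re.
    rewrite (rsum_ext _ (fun j => / 2 * ((- (1 / 2) + INR j) / ((- (1 / 2) + INR j) ^ 2 + y ^ 2) + (1 + INR j) / ((1 + INR j) ^ 2 + y ^ 2)))).
    2: { intros j _. rewrite gt_Re by lra. unfold aj. replace (1 / 4 + INR j - 3 / 4) with (- (1 / 2) + INR j) by field.
         replace (1 / 4 + INR j + 3 / 4) with (1 + INR j) by field. reflexivity. }
    rewrite rsum_scal, rsum_plus.
    assert (T1 := tele_sum (- (1 / 2)) y N Hy ltac:(lra)). assert (T2 := tele_sum 1 y N Hy ltac:(lra)).
    assert (Up : forall x0, x0 <= 1 -> - (1/2) <= x0 -> ln (x0 + INR N + y) <= ln (INR N) + ln 3).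
    { intros x0 Hx Hx'. rewrite <- ln_mult by lra. apply ln_le; unfold y in *; lra. }
    assert (Lo : forall x0, - (1 / 2) <= x0 -> ln t - ln 4 <= ln (x0 + y - 1)).
    { intros x0 Hx. rewrite <- ln_div by lra. apply ln_le; unfold y in *; lra. }
    assert (R1 : 2 * y / (- (1 / 2) + y - 1) <= 8) by (apply <- Rle_div_l; lra).
    assert (R2 : 2 * y / (1 + y - 1) <= 8) by (apply <- Rle_div_l; lra).
    assert (U1 := Up (- (1/2)) ltac:(lra) ltac:(lra)). assert (U2 := Up 1 ltac:(lra) ltac:(lra)).
    assert (L1 := Lo (- (1/2)) ltac:(lra)). assert (L2 := Lo 1 ltac:(lra)).
    lra. }
  unfold K. lra.
Qed.

(** * Diagonal extraction and the mean square *)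

Definition osc_err (D B eta : R) : R := 2 * B * exp (1 - eta * D) + 2 * D * exp (1 - (B / D) ^ 2).

Definition wg (D y : R) : R := exp (- (y ^ 2 / D ^ 2)).

Definition gmass (D B : R) : R := RInt (wg D) (- B) B.

Definition lnd (m n : nat) : R := ln (INR m) - ln (INR n).

(** For lists of products, counted with multiplicity, this is the sum of [1 / (x_1 ... x_k)] over
    pairs of tuples with equal products. *)
Definition diag (lM lR : list nat) : R :=
  sumR (fun m => sumR (fun n => if Nat.eq_dec m n then / INR m else 0) lR) lM.

Lemma gW_line D y : 0 < D -> gW D (0, y) = RtoC (wg D y).
Proof. intros H. unfold gW. replace ((0, y) * (0, y) * RtoC (/ D ^ 2))%C with (RtoC (- (y ^ 2 / D ^ 2))); [apply Cexp_R|]. apply Ceq; csimp; field; lra. Qed.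

Lemma continuous_wg D y : 0 < D -> continuous (wg D) y.
Proof. intros H. unfold wg. apply continuous_ex_derive. auto_derive. nra. Qed.

Lemma RIntC a b (c : R) : RInt (fun _ : R => c) a b = (b - a) * c.
Proof. apply (RInt_const (V := R_CompleteNormedModule)). Qed.

Lemma gmass_lower D B : 0 < D -> D <= B -> 2 * D * exp (- 1) <= gmass D B.
Proof.
  intros HD HB. unfold gmass.
  assert (E : forall a b, ex_RInt (wg D) a b) by (intros; apply exR_cont; intros; apply continuous_wg, HD).
  assert (P : forall a b, a <= b -> 0 <= RInt (wg D) a b).
  { intros a b Hab. apply RInt_ge_0; [exact Hab|apply E|]. intros; left; apply exp_pos. }
  assert (E1 := RIntCh (wg D) (- B) (- D) B E). assert (E2 := RIntCh (wg D) (- D) D B E).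
  assert (2 * D * exp (- 1) <= RInt (wg D) (- D) D).
  { assert (K := RIntC (- D) D (exp (- 1))).
    replace (2 * D * exp (- 1)) with ((D - - D) * exp (- 1)) by ring. rewrite <- K.
    apply RInt_le; [lra|apply ex_RInt_const|apply E|]. intros x Hx. apply exp_le_mono.
    assert (x ^ 2 / D ^ 2 <= 1) by (apply <- Rle_div_l; nra). lra. }
  generalize (P (- B) (- D) ltac:(lra)) (P D B HB). lra.
Qed.

Lemma sumC_minus {A} (f g : A -> C) l : (sumC f l - sumC g l)%C = sumC (fun a => f a - g a)%C l.
Proof. induction l; simpl; [ring|]. rewrite <- IHl. ring. Qed.

(** Every pair with [m <> n] has a frequency [lnd m n] of size at least [eta] and is handled by
    [osc]; on the diagonal the oscillating factor is 1. Stated with coefficients [c] and smooth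
    factors [q], to serve both the mean square and the first moment. *)
Lemma bilinear (lM lR : list nat) (c : nat -> nat -> C) (q : nat -> C -> C) D B Q eta A : 0 < D -> 0 <= B -> 0 <= Q ->
  (forall m x y, In m lM -> - D <= x <= D -> - B <= y <= B -> hol (q m) (x, y)) ->
  (forall m x y, In m lM -> - D <= x <= D -> - B <= y <= B -> Cmod (q m (x, y)) <= Q) ->
  (forall m n, In m lM -> In n lR -> m <> n -> eta <= Rabs (lnd m n)) ->
  (forall m n, In m lM -> In n lR -> Cmod (c m n) <= A) ->
  Cmod (CI (fun y => sumC (fun m => sumC (fun n => c m n * (Cexp (RtoC (lnd m n) * (0, y)) * gW D (0, y) * q m (0, y)))%C lR) lM) (- B) B
    - sumC (fun m => sumC (fun n => if Nat.eq_dec m n then c m n * CI (fun y => gW D (0, y) * q m (0, y)) (- B) B else 0)%C lR) lM)%C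
  <= INR (length lM) * (INR (length lR) * (A * (Q * osc_err D B eta))).
Proof.
  intros HD HB HQ Hh Hq He Hc.
  assert (Cc : forall m n, In m lM -> conts (fun y => Cexp (RtoC (lnd m n) * (0, y)) * gW D (0, y) * q m (0, y))%C (- B) B).
  { intros m n Hm. apply (conts_ver (fun u => Cexp (RtoC (lnd m n) * u) * gW D u * q m u)%C). intros y Hy. apply hol_ccont.
    apply (hol_mult (fun u => Cexp (RtoC (lnd m n) * u) * gW D u)%C); [|apply Hh; [exact Hm|lra|lra]].
    apply (hol_mult (fun u => Cexp (RtoC (lnd m n) * u))); [|apply hol_gW]. apply hol_Cexp, hol_mult; [apply hol_const|apply hol_id]. }
  rewrite (CI_sumC (fun m y => sumC (fun n => c m n * (Cexp (RtoC (lnd m n) * (0, y)) * gW D (0, y) * q m (0, y)))%C lR)).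
  2: lra. 2: { intros m Hm. apply sumC_conts. intros n _. apply conts_mult; [apply conts_const|apply Cc, Hm]. }
  rewrite sumC_minus. apply sumC_Cmod_const. intros m Hm.
  rewrite (CI_sumC (fun n y => c m n * (Cexp (RtoC (lnd m n) * (0, y)) * gW D (0, y) * q m (0, y)))%C).
  2: lra. 2: { intros n _. apply conts_mult; [apply conts_const|apply Cc, Hm]. }
  rewrite sumC_minus. apply sumC_Cmod_const. intros n Hn.
  assert (HA : 0 <= A) by (eapply Rle_trans; [apply Cmod_ge_0|apply (Hc m n Hm Hn)]).
  assert (O : 0 <= osc_err D B eta).
  { unfold osc_err. generalize (exp_pos (1 - eta * D)) (exp_pos (1 - (B / D) ^ 2)). nra. }
  rewrite (CI_scal (c m n)); [|lra|apply Cc, Hm]. destruct (Nat.eq_dec m n) as [E|E].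
  - subst n. replace (CI (fun t => Cexp (RtoC (lnd m m) * (0, t)) * gW D (0, t) * q m (0, t))%C (- B) B) with (CI (fun y => gW D (0, y) * q m (0, y))%C (- B) B).
    + match goal with |- Cmod (?a - ?a) <= _ => replace (a - a)%C with (RtoC 0) by ring end.
      rewrite Cmod_0. apply Rmult_le_pos; [exact HA|]. apply Rmult_le_pos; assumption.
    + apply CI_ext; [lra|]. intros t _. unfold lnd. rewrite Rminus_diag, Cmult_0_l, Cexp_0. ring.
  - rewrite Cminus_0_r, Cmod_mult. apply Rmult_le_compat; try apply Cmod_ge_0; [apply Hc; assumption|].
    apply osc; auto.
Qed.

(** On the critical line [s - 1] is minus the conjugate of [s], so this is the holomorphic
    continuation of the conjugate of the sum of [m ^ (- s)]. Since [m ^ (- s) m ^ (s - 1) = 1 / m]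
    for every [s], contour shifts leave the weight of the diagonal pairs unchanged. *)
Definition dualpoly (l : list nat) (s : C) : C := sumC (fun m => Rcpow (INR m) (s - 1)) l.

Lemma Rcpow_conj a s : Cconj (Rcpow a s) = Rcpow a (Cconj s).
Proof. unfold Rcpow. rewrite <- Cexp_conj. f_equal. unfold Cconj; apply Ceq; csimp; ring. Qed.

Lemma Rcpow_m1 m : (1 <= m)%nat -> Rcpow (INR m) (- (1)) = RtoC (/ INR m).
Proof.
  intros H. assert (0 < INR m) by (apply lt_0_INR; lia). replace (- (1))%C with (RtoC (- (1))) by (apply Ceq; csimp; ring).
  rewrite Rcpow_RtoC, Rpower_Ropp, Rpower_1 by assumption. reflexivity.
Qed.

Lemma Cmod_Rcpow_le1 m s : (1 <= m)%nat -> Re s <= 0 -> Cmod (Rcpow (INR m) s) <= 1.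
Proof.
  intros H Hs. rewrite Cmod_Rcpow. rewrite <- (Rpower_O (INR m)) by (apply lt_0_INR; lia). apply Rle_Rpower; [apply (le_INR 1 m H)|exact Hs].
Qed.

Lemma Rcpow_shift m (s u : C) : Rcpow (INR m) (s + u) = (Rcpow (INR m) s * Cexp (RtoC (ln (INR m)) * u))%C.
Proof. rewrite Rcpow_plus. unfold Rcpow. f_equal. f_equal. ring. Qed.

Lemma CI_RtoC f a b : CI (fun t => RtoC (f t)) a b = RtoC (RInt f a b).
Proof.
  unfold CI, RtoC. f_equal. transitivity (RInt (fun _ : R => 0) a b); [reflexivity|]. rewrite RIntC. apply Rmult_0_r.
Qed.

Lemma mean_square (l : list nat) t0 D B eta : 0 < D -> 0 <= B -> (forall m, In m l -> (1 <= m)%nat) ->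
  (forall m n, In m l -> In n l -> m <> n -> eta <= Rabs (lnd m n)) ->
  RInt (fun y => Cmod (dualpoly l (crit (t0 + y))) ^ 2 * wg D y) (- B) B <= diag l l * gmass D B + INR (length l) * INR (length l) * osc_err D B eta.
Proof.
  intros HD HB Hl He.
  (* The values at the centre [t0] go into the coefficients, so that [y] appears only through the
     frequency [lnd m n]. *)
  set (c := fun m n : nat => (Rcpow (INR m) (crit t0 - 1) * Rcpow (INR n) (Cconj (crit t0) - 1))%C).
  assert (K := bilinear l l c (fun _ _ => 1%C) D B 1 eta 1 HD HB ltac:(lra)
    (fun _ x y _ _ _ => hol_const 1%C (x, y)) (fun _ _ _ _ _ _ => Req_le _ _ Cmod_1) He).
  assert (Hc : forall m n, In m l -> In n l -> Cmod (c m n) <= 1).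
  { intros m n Hm Hn. unfold c. rewrite Cmod_mult. rewrite <- (Rmult_1_l 1). apply Rmult_le_compat; try apply Cmod_ge_0; apply Cmod_Rcpow_le1; auto; unfold crit, Cconj; csimp; lra. }
  specialize (K Hc).
  rewrite (CI_ext _ (fun y => RtoC (Cmod (dualpoly l (crit (t0 + y))) ^ 2 * wg D y))) in K; [|lra|].
  2: { intros y _. rewrite RtoC_mult, <- gW_line by exact HD.
    rewrite Cmod2_conj. unfold dualpoly. rewrite sumC_conj, sumC_mult.
    rewrite (Cmult_comm _ (gW D (0, y))), <- sumC_scal. apply sumC_ext. intros m Hm. rewrite <- sumC_scal. apply sumC_ext. intros n Hn.
    rewrite Rcpow_conj. unfold c.
    replace (crit (t0 + y) - 1)%C with ((crit t0 - 1) + (0, y))%C at 1 by (unfold crit; apply Ceq; csimp; ring).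
    replace (Cconj (crit (t0 + y) - 1))%C with ((Cconj (crit t0) - 1) + - (0, y))%C by (unfold crit, Cconj; apply Ceq; csimp; ring).
    rewrite !Rcpow_shift. unfold lnd.
    replace (RtoC (ln (INR m) - ln (INR n)) * (0, y))%C with (RtoC (ln (INR m)) * (0, y) + RtoC (ln (INR n)) * - (0, y))%C by (rewrite RtoC_minus; ring).
    rewrite Cexp_plus. ring. }
  rewrite CI_RtoC in K.
  set (J := RInt _ _ _) in *.
  assert (E : sumC (fun m => sumC (fun n => if Nat.eq_dec m n then c m n * CI (fun y => gW D (0, y) * 1) (- B) B else 0)%C l) l = RtoC (diag l l * gmass D B)).
  { unfold diag. rewrite (Rmult_comm _ (gmass D B)), <- sumR_scal, sumR_RtoC. apply sumC_ext. intros m Hm.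
    rewrite <- sumR_scal, sumR_RtoC. apply sumC_ext. intros n Hn. destruct (Nat.eq_dec m n) as [E|E]; [|f_equal; ring].
    subst n. unfold c. rewrite <- Rcpow_plus. replace (crit t0 - 1 + (Cconj (crit t0) - 1))%C with (- (1))%C by (unfold crit, Cconj; apply Ceq; csimp; field).
    rewrite Rcpow_m1 by auto. rewrite (CI_ext _ (fun y => RtoC (wg D y))); [|lra|intros; rewrite gW_line by exact HD; ring].
    rewrite CI_RtoC, <- RtoC_mult. f_equal. unfold gmass. ring. }
  rewrite E, <- RtoC_minus, Cmod_R in K. generalize (Rle_abs (J - diag l l * gmass D B)). lra.
Qed.

(* Windows are parametrised by [u = s - s2 t0], so that the critical line is
   [Re u = - 3 / 2]. *)
Definition s2 (t0 : R) : C := (2, t0).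

(** The factor [k gn] minus the logarithmic derivative [ln m + 2 u / D ^ 2] of the [m]-th term
    [m ^ (s - 1) gW]. *)
Definition qfac (k N : nat) (D t0 : R) (m : nat) (u : C) : C :=
  (RtoC (INR k) * gn N (s2 t0 + u) - RtoC (ln (INR m)) - u * RtoC (2 / D ^ 2))%C.

Definition testU (lM : list nat) (D t0 : R) (u : C) : C := (dualpoly lM (s2 t0 + u) * gW D u)%C.

(* [testP = k gn testU - testU'], see [cder_testU]. *)
Definition testP (k N : nat) (lM : list nat) (D t0 : R) (u : C) : C :=
  sumC (fun m => Rcpow (INR m) (s2 t0 + u - 1) * (gW D u * qfac k N D t0 m u))%C lM.

Lemma cder_gW D u : 0 < D -> cder (gW D) u (u * RtoC (2 / D ^ 2) * gW D u).
Proof.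
  intros HD. unfold gW at 1.
  replace (u * RtoC (2 / D ^ 2) * gW D u)%C with (gW D u * ((1 * u + u * 1) * RtoC (/ D ^ 2) + (u * u) * 0))%C.
  2: { replace (RtoC (2 / D ^ 2)) with (RtoC 2 * RtoC (/ D ^ 2))%C by (rewrite <- RtoC_mult; reflexivity). ring. }
  apply (cder_comp (fun u => u * u * RtoC (/ D ^ 2))%C Cexp); [|apply cder_Cexp].
  apply (cder_mult (fun u => u * u)%C); [|apply cder_const]. apply (cder_mult (fun u => u) (fun u => u)); apply cder_id.
Qed.

Lemma cder_testU k N lM D t0 u : 0 < D ->
  cder (testU lM D t0) u (RtoC (INR k) * gn N (s2 t0 + u) * testU lM D t0 u - testP k N lM D t0 u).
Proof.
  intros HD.
  replace (RtoC (INR k) * gn N (s2 t0 + u) * testU lM D t0 u - testP k N lM D t0 u)%C with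
   (sumC (fun m => Rcpow (INR m) (s2 t0 + u - 1) * RtoC (ln (INR m)) * (0 + 1 - 0))%C lM * gW D u + dualpoly lM (s2 t0 + u) * (u * RtoC (2 / D ^ 2) * gW D u))%C.
  2: { unfold testU, testP, dualpoly, qfac. induction lM; cbn [sumC]; [ring|].
       match goal with |- (?a * _ + _ = _)%C => idtac end.
       match type of IHlM with (?x = ?y)%C => idtac end.
       set (g := gn N (s2 t0 + u)) in *. set (w := gW D u) in *. set (kk := RtoC (INR k)) in *. set (d := RtoC (2 / D ^ 2)) in *.
       match type of IHlM with (sumC ?f1 _ * _ + sumC ?f2 _ * _)%C = (_ - sumC ?f3 _)%C =>
         set (c1 := sumC f1 lM) in *; set (c2 := sumC f2 lM) in *; set (c3 := sumC f3 lM) in * end.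
       replace c3 with (kk * g * (c2 * w) - (c1 * w + c2 * (u * d * w)))%C by (rewrite IHlM; ring). ring. }
  apply (cder_mult (fun u => dualpoly lM (s2 t0 + u))); [|apply cder_gW, HD].
  unfold dualpoly. apply (sumC_cder (fun m u => Rcpow (INR m) (s2 t0 + u - 1))). intros m _.
  apply (cder_comp (fun u => s2 t0 + u - 1)%C (Rcpow (INR m))); [|apply cder_Rcpow].
  apply (cder_minus (fun u => s2 t0 + u)%C); [|apply cder_const]. apply (cder_plus (fun _ => s2 t0)); [apply cder_const|apply cder_id].
Qed.

Lemma Cpow_diff a b K n : Cmod a <= K -> Cmod b <= K -> Cmod (a ^ S n - b ^ S n)%C <= INR (S n) * K ^ n * Cmod (a - b)%C.
Proof.
  intros Ha Hb. assert (K0 : 0 <= K) by (eapply Rle_trans; [apply Cmod_ge_0|exact Ha]).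
  induction n.
  - cbn [Cpow]. rewrite !Cmult_1_r. simpl. lra.
  - change (a ^ S (S n))%C with (a * a ^ S n)%C. change (b ^ S (S n))%C with (b * b ^ S n)%C.
    replace (a * a ^ S n - b * b ^ S n)%C with ((a - b) * a ^ S n + b * (a ^ S n - b ^ S n))%C by ring.
    eapply Rle_trans; [apply Cmod_triangle|]. rewrite !Cmod_mult, Cmod_pow.
    assert (P : Cmod a ^ S n <= K ^ S n) by (apply pow_incr; split; [apply Cmod_ge_0|exact Ha]).
    assert (Q : Cmod b * Cmod (a ^ S n - b ^ S n)%C <= K * (INR (S n) * K ^ n * Cmod (a - b)%C)) by (apply Rmult_le_compat; auto; apply Cmod_ge_0).
    assert (P2 : Cmod (a - b) * Cmod a ^ S n <= Cmod (a - b) * K ^ S n) by (apply Rmult_le_compat_l; [apply Cmod_ge_0|exact P]).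
    rewrite (S_INR (S n)). change (K ^ S n) with (K * K ^ n) in *. nra.
Qed.

Lemma inv_le1 x : 1 <= x -> / x <= 1.
Proof. intros H. replace 1 with (/ 1) by field. apply Rinv_le_contravar; lra. Qed.

Definition inz (T : R) (s : C) : Prop := 1 / 2 <= Re s <= 2 /\ T <= Im s <= 3 * T.

Lemma inz_aux T s : 11 <= T -> inz T s -> 0 < Re s /\ 1 < Im s /\ s <> 1%C /\ Cmod s / Re s + / Cmod (s - 1) <= T ^ 2.
Proof.
  intros HT [Hr Hi]. assert (N1 : s <> 1%C) by (intros E; rewrite E in Hi; simpl in Hi; lra).
  split; [lra|]. split; [lra|]. split; [exact N1|].
  assert (A : Cmod s <= 2 + 3 * T).
  { eapply Rle_trans; [apply Cmod_le_abs|]. rewrite !Rabs_pos_eq by lra. lra. }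
  assert (B : 1 <= Cmod (s - 1)).
  { eapply Rle_trans; [|apply im_le_Cmod]. replace (Im (s - 1)) with (Im s) by (csimp; ring). rewrite Rabs_pos_eq by lra. lra. }
  assert (Cmod s / Re s <= 2 * (2 + 3 * T)) by (apply <- Rle_div_l; [generalize (Cmod_ge_0 s); nra|lra]).
  assert (/ Cmod (s - 1) <= 1) by (apply inv_le1, B). assert (5 + 6 * T <= T ^ 2) by nra. lra.
Qed.

Lemma zeta_inz T s : 11 <= T -> inz T s -> Cmod (zeta s) <= T ^ 2.
Proof.
  intros HT H. destruct (inz_aux T s HT H) as (A & B & C & E). rewrite zeta_zeta0 by assumption.
  eapply Rle_trans; [apply zeta0_bound; assumption|exact E].
Qed.

Definition dirpoly (R : nat) (s : C) : C := csum (fun n => Rcpow (INR (S n)) (- s)) R.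

Lemma zeta_dirpoly T s R : 11 <= T -> inz T s -> Re s = 2 -> (1 <= R)%nat -> Cmod (zeta s - dirpoly R s) <= T ^ 2 * / INR (S R).
Proof.
  intros HT H Hr HR. destruct (inz_aux T s HT H) as (A & B & C & E). rewrite zeta_zeta0 by assumption.
  eapply Rle_trans; [apply zeta0_tail; [lra|exact HR]|]. rewrite Hr.
  replace (- (2 - 1)) with (- (1)) by ring. rewrite Rpower_Ropp, Rpower_1 by apply INR_S_pos.
  apply Rmult_le_compat_r; [left; apply Rinv_0_lt_compat, INR_S_pos|]. rewrite <- Hr. exact E.
Qed.

Lemma dirpoly_bound T s R : 11 <= T -> inz T s -> Re s = 2 -> (1 <= R)%nat -> Cmod (dirpoly R s) <= 2 * T ^ 2.
Proof.
  intros HT H Hr HR. replace (dirpoly R s) with (zeta s - (zeta s - dirpoly R s))%C by ring.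
  eapply Rle_trans; [apply Cmod_tri_minus|]. assert (Z := zeta_inz T s HT H). assert (Y := zeta_dirpoly T s R HT H Hr HR).
  assert (/ INR (S R) <= 1) by (apply inv_le1, INR_S_ge1). assert (0 <= T ^ 2) by apply pow2_ge_0. nra.
Qed.

Lemma dualpoly_crit l t : (forall m, In m l -> (1 <= m)%nat) -> Cmod (dualpoly l (crit t)) <= INR (length l).
Proof.
  intros Hl. rewrite <- (Rmult_1_r (INR (length l))). apply sumC_Cmod_const. intros m Hm. apply Cmod_Rcpow_le1; [apply Hl, Hm|]. unfold crit; csimp; lra.
Qed.

Lemma exp_9_4 : exp (9 / 4) <= 27.
Proof.
  apply Rle_trans with (exp 3); [apply exp_le_mono; lra|]. replace 3 with (1 + 1 + 1) by ring. rewrite !exp_plus.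
  generalize exp_le_3 (exp_pos 1). intros. assert (exp 1 * exp 1 <= 9) by nra. nra.
Qed.

(** Between the lines [Re s = 1 / 2] and [Re s = 2] the weight grows by at most [e ^ (9 / 4)]; this
    is the source of the factors 27. *)
Lemma gW_bound D x y : 1 <= D -> - (3 / 2) <= x <= 0 -> Cmod (gW D (x, y)) <= 27 * wg D y.
Proof.
  intros HD Hx. rewrite Cmod_gW by lra. unfold wg. apply Rle_trans with (exp (9 / 4) * exp (- (y ^ 2 / D ^ 2))).
  - rewrite <- exp_plus. apply exp_le_mono. replace ((x ^ 2 - y ^ 2) / D ^ 2) with (x ^ 2 / D ^ 2 - y ^ 2 / D ^ 2) by (field; lra).
    assert (x ^ 2 / D ^ 2 <= 9 / 4) by (apply <- Rle_div_l; nra). lra.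
  - apply Rmult_le_compat_r; [left; apply exp_pos|apply exp_9_4].
Qed.

Lemma wg_le1 D y : 0 < D -> wg D y <= 1.
Proof.
  intros HD. unfold wg. rewrite <- exp_0. apply exp_le_mono. assert (0 <= y ^ 2 / D ^ 2); [|lra]. apply Rdiv_le_0_compat; nra.
Qed.

Lemma s2_crit t0 (y : R) : (s2 t0 + ((- (3 / 2))%R, y))%C = crit (t0 + y).
Proof. unfold s2, crit. apply Ceq; csimp; field. Qed.

(** * The first moment *)

Definition dG (k : nat) (t : R) : R := INR k * hardy_Z t ^ (k - 1) * dZ t.

Lemma cis_opp_INR k f : (cis f ^ k * cis (- (INR k * f)))%C = 1%C.
Proof.
  induction k; [simpl; rewrite Rmult_0_l, Ropp_0, cis_0; ring|].
  replace (- (INR (S k) * f)) with (- f + - (INR k * f)) by (rewrite S_INR; ring). rewrite cis_plus. cbn [Cpow].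
  transitivity ((cis f * cis (- f)) * (cis f ^ k * cis (- (INR k * f))))%C; [ring|]. rewrite IHk, cis_opp. ring.
Qed.

Lemma G_zeta k t : 1 < t -> (RtoC (hardy_Z t ^ k) * cis (- (INR k * theta t)))%C = (zeta (crit t) ^ k)%C.
Proof.
  intros Ht. rewrite RtoC_pow, hardy_Z_C, Cpow_mult_l by exact Ht.
  transitivity (zeta (crit t) ^ k * (cis (theta t) ^ k * cis (- (INR k * theta t))))%C; [ring|]. rewrite cis_opp_INR. ring.
Qed.

Lemma G_derive k t : is_derive (fun t => hardy_Z t ^ k) t (dG k t).
Proof.
  unfold dG. eapply is_derive_val; [apply (is_derive_pow hardy_Z k t (dZ t)), hardy_Z_derive|].
  replace (pred k) with (k - 1)%nat by lia. reqR. ring.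
Qed.

Lemma continuous_hardy_Z t : continuous hardy_Z t.
Proof. apply (ex_derive_continuous (V := R_NormedModule)). eexists. apply hardy_Z_derive. Qed.

Lemma continuous_pow (f : R -> R) n t : continuous f t -> continuous (fun t => f t ^ n) t.
Proof.
  intros H. induction n; [apply continuous_const|]. apply (continuous_mult (K := R_AbsRing) f (fun t => f t ^ n)); assumption.
Qed.

Lemma continuous_dG k t : continuous (dG k) t.
Proof.
  unfold dG. apply (continuous_mult (K := R_AbsRing) (fun t => INR k * hardy_Z t ^ (k - 1)) dZ); [|apply continuous_dZ].
  apply (continuous_mult (K := R_AbsRing) (fun _ => INR k)); [apply continuous_const|]. apply continuous_pow, continuous_hardy_Z.
Qed.

Lemma continuous_shift (f : R -> R) t0 y : (forall t, continuous f t) -> continuous (fun y => f (t0 + y)) y.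
Proof. intros H. apply (continuous_comp (fun y => t0 + y) f); [|apply H]. apply continuous_ex_derive. auto_derive. auto. Qed.

Lemma hol_s2 t0 u : hol (fun u => s2 t0 + u)%C u.
Proof. apply (hol_plus (fun _ => s2 t0)); [apply hol_const|apply hol_id]. Qed.

Lemma hol_testU lM D t0 u : 0 < D -> hol (testU lM D t0) u.
Proof. intros H. eexists. apply (cder_testU 0 0 lM D t0 u H). Qed.

Lemma hol_qfac k N D t0 m u : Im (s2 t0 + u) <> 0 -> hol (qfac k N D t0 m) u.
Proof.
  intros H. unfold qfac. apply (hol_minus (fun u => RtoC (INR k) * gn N (s2 t0 + u) - RtoC (ln (INR m)))%C).
  - apply (hol_minus (fun u => RtoC (INR k) * gn N (s2 t0 + u))%C); [|apply hol_const].
    apply (hol_mult (fun _ => RtoC (INR k))); [apply hol_const|]. apply (hol_comp (fun u => s2 t0 + u)%C (gn N)); [apply hol_s2|apply hol_gn, H].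
  - apply (hol_mult (fun u => u)); [apply hol_id|apply hol_const].
Qed.

Lemma hol_testP k N lM D t0 u : Im (s2 t0 + u) <> 0 -> hol (testP k N lM D t0) u.
Proof.
  intros H. apply (sumC_hol (fun m u => Rcpow (INR m) (s2 t0 + u - 1) * (gW D u * qfac k N D t0 m u))%C). intros m _.
  apply (hol_mult (fun u => Rcpow (INR m) (s2 t0 + u - 1)) (fun u => gW D u * qfac k N D t0 m u)%C).
  - apply hol_Rcpow. apply (hol_minus (fun u => s2 t0 + u)%C); [apply hol_s2|apply hol_const].
  - apply (hol_mult (gW D)); [apply hol_gW|apply hol_qfac, H].
Qed.

Definition crit_int (k N : nat) (lM : list nat) (D t0 : R) (y : R) : C :=
  (zeta (s2 t0 + ((- (3 / 2))%R, y)) ^ k * testP k N lM D t0 ((- (3 / 2))%R, y))%C.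

Definition first_moment (k : nat) (lM : list nat) (D B t0 : R) : R :=
  RInt (fun y => Rabs (dG k (t0 + y)) * Cmod (dualpoly lM (crit (t0 + y))) * wg D y) (- B) B.

(* [G' e ^ (- i k theta) = (zeta ^ k)' + i k theta' zeta ^ k] on the critical line. *)
Lemma by_parts k N lM D B t0 T : 11 <= T -> 1 <= D -> 0 <= B -> T <= t0 - B -> t0 + B <= 3 * T ->
  (forall m, In m lM -> (1 <= m)%nat) ->
  Cmod (CI (crit_int k (S N) lM D t0) (- B) B) <= 27 * first_moment k lM D B t0 +
    (54 * T ^ (2 * k) * INR (length lM) * wg D B +
     2 * B * (27 * INR k * T ^ (2 * k) * INR (length lM) * ((2 + (3 * T) ^ 2) * / INR (S N)))).
Proof.
  intros HT HD HB Ht1 Ht2 Hl. set (f := crit_int k (S N) lM D t0).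
  set (U := fun y : R => testU lM D t0 ((- (3 / 2))%R, y)).
  set (G := fun t : R => hardy_Z t ^ k).
  set (H := fun y : R => (RtoC (G (t0 + y)%R) * cis (- (INR k * theta (t0 + y))) * U y)%C).
  set (A1 := fun y : R => (RtoC (dG k (t0 + y)) * cis (- (INR k * theta (t0 + y))) * U y)%C).
  set (d := fun t : R => dphn (S N) (t / 2) - dph (t / 2)).
  set (E := fun y : R => (Ci * RtoC (INR k * (/ 2 * d (t0 + y)%R)) * (zeta (s2 t0 + ((- (3 / 2))%R, y)) ^ k * U y))%C).
  assert (Hz : forall y, - B <= y <= B -> inz T (s2 t0 + ((- (3 / 2))%R, y))).
  { intros y Hy. rewrite s2_crit. unfold inz, crit; cbn [Re Im fst snd]. lra. }
  assert (HG : forall y, - B <= y <= B -> (RtoC (G (t0 + y)%R) * cis (- (INR k * theta (t0 + y))))%C = (zeta (s2 t0 + ((- (3 / 2))%R, y)) ^ k)%C).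
  { intros y Hy. rewrite s2_crit. apply G_zeta. lra. }
  assert (cU : forall y, rcont U y).
  { intros y. apply (rcont_comp (testU lM D t0) (fun y => ((- (3 / 2))%R, y))); [apply hol_ccont, hol_testU; lra|apply rcont_ver]. }
  assert (cth : forall y, rcont (fun y => cis (- (INR k * theta (t0 + y)))) y).
  { intros y. apply (rcont_cis (fun y => - (INR k * theta (t0 + y)))). apply (continuous_opp (V := R_NormedModule) (fun y => INR k * theta (t0 + y))).
    apply (continuous_scal_r (V := R_NormedModule) (INR k) (fun y => theta (t0 + y))). apply continuous_shift. intros; apply continuous_theta. }
  assert (cA1 : conts A1 (- B) B).
  { intros y _. apply (rcont_mult (fun y => RtoC (dG k (t0 + y)) * cis (- (INR k * theta (t0 + y))))%C U); [|apply cU].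
    apply (rcont_mult (fun y => RtoC (dG k (t0 + y)))); [|apply cth]. apply rcont_RtoC, continuous_shift. intros; apply continuous_dG. }
  assert (cz : forall y, - B <= y <= B -> rcont (fun y : R => zeta (s2 t0 + ((- (3 / 2))%R, y)) ^ k)%C y).
  { intros y Hy. apply (rcont_pow (fun y : R => zeta (s2 t0 + ((- (3 / 2))%R, y)))).
    apply (rcont_comp (fun u => zeta (s2 t0 + u)) (fun y : R => ((- (3 / 2))%R, y))); [|apply rcont_ver].
    apply hol_ccont, (hol_comp (fun u => s2 t0 + u)%C zeta); [apply hol_s2|]. apply zeta_hol.
    destruct (inz_aux T _ HT (Hz y Hy)) as (_ & _ & N1 & _). exact N1. }
  assert (cd : forall y, continuous (fun y => INR k * (/ 2 * d (t0 + y)%R)) y).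
  { intros y. apply (continuous_scal_r (V := R_NormedModule) (INR k) (fun y => / 2 * d (t0 + y)%R)).
    apply (continuous_scal_r (V := R_NormedModule) (/ 2) (fun y => d (t0 + y)%R)). apply continuous_shift. intros t. unfold d.
    apply (continuous_comp (fun t => t / 2) (fun y => dphn (S N) y - dph y)); [apply continuous_ex_derive; auto_derive; auto|].
    apply (continuous_minus (V := R_NormedModule)); [apply continuous_dphn|apply continuous_dph]. }
  assert (cE : conts E (- B) B).
  { intros y Hy. apply (rcont_mult (fun y => Ci * RtoC (INR k * (/ 2 * d (t0 + y)%R)))%C).
    - apply (rcont_mult (fun _ => Ci)); [apply rcont_const|]. apply rcont_RtoC, cd.
    - apply (rcont_mult _ U); [apply cz, Hy|apply cU]. }
  assert (cf : conts f (- B) B).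
  { intros y Hy. apply (rcont_mult (fun y : R => zeta (s2 t0 + ((- (3 / 2))%R, y)) ^ k)%C); [apply cz, Hy|].
    apply (rcont_comp (testP k (S N) lM D t0) (fun y : R => ((- (3 / 2))%R, y))); [|apply rcont_ver].
    apply hol_ccont, hol_testP. rewrite s2_crit. unfold crit; cbn [Im snd]. lra. }
  (* The derivative of [H], which equals [zeta ^ k] times the test function. [A1] carries the
     derivative of [hardy_Z ^ k], [f] is the integrand to be shifted, and [E] is the price of [gn]
     in place of [theta']. The boundary values of [H] are small because of the Gaussian. *)
  set (H' := fun y => (A1 y + E y - Ci * f y)%C).
  assert (cH' : conts H' (- B) B).
  { intros y Hy. apply (rcont_minus (fun y => A1 y + E y)%C (fun y => Ci * f y)%C).
    - apply rcont_plus; [apply cA1, Hy|apply cE, Hy].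
    - apply (rcont_mult (fun _ => Ci)); [apply rcont_const|apply cf, Hy]. }
  assert (dH : forall y, - B <= y <= B -> rder H y (H' y)).
  { intros y Hy.
    assert (D1 : rder (fun y => RtoC (G (t0 + y)%R)) y (RtoC (dG k (t0 + y)))).
    { apply rder_RtoC. eapply is_derive_val; [apply (is_derive_comp (K := R_AbsRing) (V := R_NormedModule) G (fun y => t0 + y) y (dG k (t0 + y)) 1)|].
      - apply G_derive.
      - auto_derive; [auto|reqR; ring].
      - unfold scal; simpl; unfold mult; simpl. ring. }
    assert (D2 : rder (fun y => cis (- (INR k * theta (t0 + y)))) y (Ci * RtoC (- (INR k * dtheta (t0 + y))) * cis (- (INR k * theta (t0 + y))))).
    { apply (rder_cis (fun y => - (INR k * theta (t0 + y)))).
      apply (is_derive_opp (K := R_AbsRing) (V := R_NormedModule) (fun y => INR k * theta (t0 + y)) y (INR k * dtheta (t0 + y))).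
      apply (is_derive_scal (fun y => theta (t0 + y)) y (INR k) (dtheta (t0 + y))).
      eapply is_derive_val; [apply (is_derive_comp (K := R_AbsRing) (V := R_NormedModule) theta (fun y => t0 + y) y (dtheta (t0 + y)) 1)|].
      - apply theta_derive.
      - auto_derive; [auto|reqR; ring].
      - unfold scal; simpl; unfold mult; simpl. ring. }
    assert (D3 := cder_rder_ver (testU lM D t0) (- (3 / 2)) y _ (cder_testU k (S N) lM D t0 ((- (3 / 2))%R, y) ltac:(lra))).
    eapply rder_val; [apply (rder_mult (fun y => RtoC (G (t0 + y)%R) * cis (- (INR k * theta (t0 + y))))%C U); [apply (rder_mult _ _ y _ _ D1 D2)|exact D3]|].
    unfold H', A1, E, f, crit_int. rewrite <- (HG y Hy). fold (U y).
    replace (testU lM D t0 ((- (3 / 2))%R, y)) with (U y) by reflexivity.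
    rewrite s2_crit, gn_crit. unfold d, dtheta.
    set (c := cis (- (INR k * theta (t0 + y)))). set (g := RtoC (G (t0 + y)%R)). set (P := testP _ _ _ _ _ _). set (a := dphn _ _). set (b := dph _).
    set (l := ln PI). set (kk := INR k). set (dg := RtoC (dG k (t0 + y))). set (u := U y).
    rewrite !RtoC_mult, !RtoC_opp, !RtoC_mult, !RtoC_minus, !RtoC_mult. ring. }
  assert (CD := CI_deriv H H' (- B) B ltac:(lra) dH cH').
  assert (CS : CI H' (- B) B = (CI A1 (- B) B + CI E (- B) B - Ci * CI f (- B) B)%C).
  { unfold H'. rewrite (CI_minus (fun y => A1 y + E y)%C (fun y => Ci * f y)%C); [|lra| |].
    - rewrite (CI_plus A1 E), (CI_scal Ci f); auto; lra.
    - intros y Hy. apply rcont_plus; [apply cA1, Hy|apply cE, Hy].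
    - intros y Hy. apply (rcont_mult (fun _ => Ci)); [apply rcont_const|apply cf, Hy]. }
  assert (Ef : CI f (- B) B = (- Ci * (CI A1 (- B) B + CI E (- B) B - (H B - H (- B)%R)))%C).
  { rewrite <- CD, CS. transitivity (- Ci * Ci * CI f (- B) B)%C; [|ring]. replace (- Ci * Ci)%C with (RtoC 1) by (apply Ceq; csimp; ring). ring. }
  assert (UB : forall y, Cmod (U y) <= 27 * (Cmod (dualpoly lM (crit (t0 + y))) * wg D y)).
  { intros y. unfold U, testU. rewrite s2_crit, Cmod_mult. assert (G1 := gW_bound D (- (3 / 2)) y HD ltac:(lra)).
    generalize (Cmod_ge_0 (dualpoly lM (crit (t0 + y)))). nra. }
  assert (UB2 : forall y, Cmod (U y) <= 27 * (INR (length lM) * wg D y)).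
  { intros y. eapply Rle_trans; [apply UB|]. apply Rmult_le_compat_l; [lra|]. apply Rmult_le_compat_r; [left; apply exp_pos|apply dualpoly_crit, Hl]. }
  assert (ZB : forall y, - B <= y <= B -> Cmod (zeta (s2 t0 + ((- (3 / 2))%R, y)) ^ k) <= T ^ (2 * k)).
  { intros y Hy. rewrite Cmod_pow, pow_mult. apply pow_incr. split; [apply Cmod_ge_0|apply zeta_inz; [exact HT|apply Hz, Hy]]. }
  assert (B1 : Cmod (CI A1 (- B) B) <= 27 * first_moment k lM D B t0).
  { unfold first_moment.
    assert (X : ex_RInt (fun y => Rabs (dG k (t0 + y)) * Cmod (dualpoly lM (crit (t0 + y))) * wg D y) (- B) B).
    { apply exR_cont. intros y. apply (continuous_mult (K := R_AbsRing) (fun y => Rabs (dG k (t0 + y)) * Cmod (dualpoly lM (crit (t0 + y))))); [|apply continuous_wg; lra].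
      apply (continuous_mult (K := R_AbsRing) (fun y => Rabs (dG k (t0 + y)))).
      - apply (continuous_comp (fun y => dG k (t0 + y)) Rabs); [apply continuous_shift; intros; apply continuous_dG|apply continuous_Rabs].
      - apply rcont_Cmod. apply (rcont_comp (dualpoly lM) (fun y => crit (t0 + y))).
        + apply hol_ccont. apply (sumC_hol (fun m s => Rcpow (INR m) (s - 1))). intros m _. apply hol_Rcpow, (hol_minus (fun s => s)); [apply hol_id|apply hol_const].
        + split; cbn [crit Re Im fst snd]; [apply continuous_const|apply continuous_ex_derive; auto_derive; auto]. }
    replace (27 * _) with (RInt (fun y => 27 * (Rabs (dG k (t0 + y)) * Cmod (dualpoly lM (crit (t0 + y))) * wg D y) + 0 * 0) (- B) B).
    2: { rewrite (RInt_lin2 (fun y => Rabs (dG k (t0 + y)) * Cmod (dualpoly lM (crit (t0 + y))) * wg D y) (fun _ => 0) (- B) B 27 0 X (ex_RInt_const _ _ _)). reqR. ring. }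
    apply CI_bound_fun; [lra|exact cA1| |].
    - eexists. apply (is_RInt_lin2 (fun y => Rabs (dG k (t0 + y)) * Cmod (dualpoly lM (crit (t0 + y))) * wg D y) (fun _ => 0)); [exact X|apply ex_RInt_const].
    - intros y Hy. unfold A1. rewrite !Cmod_mult, Cmod_R, Cmod_cis. generalize (UB y) (Rabs_pos (dG k (t0 + y))). nra. }
  assert (dB : forall y, - B <= y <= B -> Rabs (/ 2 * d (t0 + y)%R) <= (2 + (3 * T) ^ 2) * / INR (S N)).
  { intros y Hy. rewrite Rabs_mult, (Rabs_pos_eq (/ 2)) by lra. assert (A := dph_approx N ((t0 + y) / 2)). unfold d.
    assert (0 < / INR (S N)) by apply Rinv_0_lt_compat, INR_S_pos.
    assert (((t0 + y) / 2) ^ 2 <= (3 * T) ^ 2) by (apply pow_incr; lra). generalize (Rabs_pos (dphn (S N) ((t0 + y) / 2) - dph ((t0 + y) / 2))). nra. }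
  assert (B2 : Cmod (CI E (- B) B) <= 27 * INR k * T ^ (2 * k) * INR (length lM) * ((2 + (3 * T) ^ 2) * / INR (S N)) * (B - - B)).
  { apply CI_bound; [lra|exact cE|]. intros y Hy. unfold E. rewrite !Cmod_mult, Cmod_Ci, Cmod_R, Rabs_mult, (Rabs_pos_eq (INR k)) by apply pos_INR.
    assert (Y1 := dB y Hy). assert (Y2 := ZB y Hy). assert (Y3 := UB2 y). assert (Y4 := wg_le1 D y ltac:(lra)).
    assert (Y5 : Cmod (U y) <= 27 * INR (length lM)) by (generalize (pos_INR (length lM)); nra).
    assert (Z : Cmod (zeta (s2 t0 + ((- (3 / 2))%R, y)) ^ k) * Cmod (U y) <= T ^ (2 * k) * (27 * INR (length lM))) by (apply Rmult_le_compat; auto; apply Cmod_ge_0).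
    assert (W : INR k * Rabs (/ 2 * d (t0 + y)%R) <= INR k * ((2 + (3 * T) ^ 2) * / INR (S N))) by (apply Rmult_le_compat_l; [apply pos_INR|exact Y1]).
    rewrite Rmult_1_l. eapply Rle_trans; [apply Rmult_le_compat; [|apply Rmult_le_pos; apply Cmod_ge_0|exact W|exact Z]|].
    - apply Rmult_le_pos; [apply pos_INR|apply Rabs_pos].
    - right. ring. }
  assert (HBd : forall y, (y = B \/ y = - B) -> Cmod (H y) <= 27 * T ^ (2 * k) * INR (length lM) * wg D B).
  { intros y Hy. unfold H. rewrite HG, Cmod_mult by lra.
    replace (wg D B) with (wg D y) by (unfold wg; destruct Hy; subst y; f_equal; f_equal; unfold Rdiv; ring).
    replace (27 * T ^ (2 * k) * INR (length lM) * wg D y) with (T ^ (2 * k) * (27 * (INR (length lM) * wg D y))) by ring.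
    apply Rmult_le_compat; try apply Cmod_ge_0; [apply ZB; lra|apply UB2]. }
  assert (H1 := HBd B (or_introl eq_refl)). assert (H2 := HBd (- B) (or_intror eq_refl)).
  rewrite Ef, Cmod_mult, Cmod_opp, Cmod_Ci, Rmult_1_l.
  eapply Rle_trans; [apply Cmod_tri_minus|].
  assert (T1 := Cmod_triangle (CI A1 (- B) B) (CI E (- B) B)). assert (T2 := Cmod_tri_minus (H B) (H (- B))). lra.
Qed.

Definition Qb (k N : nat) (K D B : R) : R := INR k * (3 * (INR N + 1) ^ 2) + K + 2 * (D + B).

Lemma Qb_pos k N K D B : 1 <= K -> 1 <= D -> 0 <= B -> 0 <= Qb k N K D B.
Proof.
  intros H1 H2 H3. unfold Qb. assert (0 <= INR k * (3 * (INR N + 1) ^ 2)).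
  { apply Rmult_le_pos; [apply pos_INR|]. generalize (pow2_ge_0 (INR N + 1)). lra. }
  lra.
Qed.

Lemma qfac_bound k N D B t0 T K m x y : (1 <= N)%nat -> 2 <= T -> 1 <= D -> T <= t0 - B -> 1 <= INR m -> INR m <= K ->
  - D <= x <= D -> - B <= y <= B -> Cmod (qfac k N D t0 m (x, y)) <= Qb k N K D B.
Proof.
  intros HN HT HD Ht H1 H2 Hx Hy. unfold qfac, Qb.
  eapply Rle_trans; [apply Cmod_tri_minus|]. apply Rplus_le_compat.
  - eapply Rle_trans; [apply Cmod_tri_minus|]. rewrite Cmod_mult, !Cmod_R, (Rabs_pos_eq (INR k)) by apply pos_INR.
    apply Rplus_le_compat.
    + apply Rmult_le_compat_l; [apply pos_INR|]. apply gn_bound; [exact HN|]. unfold s2; csimp; lra.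
    + assert (L := ln_le_x _ H1). rewrite Rabs_pos_eq; lra.
  - rewrite Cmod_mult, Cmod_R. assert (A : Cmod (x, y) <= D + B).
    { eapply Rle_trans; [apply Cmod_le_abs|]. cbn [Re Im fst snd]. apply Rplus_le_compat; apply Rabs_le; lra. }
    assert (0 < / D ^ 2) by (apply Rinv_0_lt_compat; nra). assert (/ D ^ 2 <= 1) by (apply inv_le1; nra).
    rewrite Rabs_pos_eq by (unfold Rdiv; lra). unfold Rdiv. generalize (Cmod_ge_0 (x, y)). nra.
Qed.

Lemma Rcpow_le_K m K s : 1 <= INR m -> INR m <= K -> Re s <= 1 -> Cmod (Rcpow (INR m) s) <= K.
Proof.
  intros H1 H2 Hs. rewrite Cmod_Rcpow. apply Rle_trans with (Rpower (INR m) 1); [|rewrite Rpower_1; lra].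
  apply Rle_Rpower; lra.
Qed.

Lemma testP_bound k N lM D B t0 T K x y : (1 <= N)%nat -> 2 <= T -> 3 / 2 <= D -> T <= t0 - B ->
  (forall m, In m lM -> 1 <= INR m <= K) -> 1 <= K ->
  - (3 / 2) <= x <= 0 -> - B <= y <= B -> Cmod (testP k N lM D t0 (x, y)) <= INR (length lM) * (K * (27 * wg D y * Qb k N K D B)).
Proof.
  intros HN HT HD Ht Hl HK Hx Hy. apply sumC_Cmod_const. intros m Hm. destruct (Hl m Hm) as [H1 H2].
  rewrite !Cmod_mult. apply Rmult_le_compat; [apply Cmod_ge_0|apply Rmult_le_pos; apply Cmod_ge_0| |].
  - apply Rcpow_le_K; auto. unfold s2; csimp; lra.
  - apply Rmult_le_compat; try apply Cmod_ge_0; [apply gW_bound; lra|]. apply (qfac_bound k N D B t0 T K); auto; lra.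
Qed.

(** The move from the critical line to [Re s = 2]. The horizontal sides have length [3 / 2] and
    carry the weight [wg D B] at the ends of the window. *)
Lemma shift_line k N lM D B t0 T K : (1 <= N)%nat -> 11 <= T -> 3 / 2 <= D -> 0 <= B -> T <= t0 - B -> t0 + B <= 3 * T ->
  (forall m, In m lM -> 1 <= INR m <= K) -> 1 <= K ->
  Cmod (CI (crit_int k N lM D t0) (- B) B - CI (fun y => zeta (s2 t0 + (0, y)) ^ k * testP k N lM D t0 (0, y)) (- B) B)%C <=
   3 * (T ^ (2 * k) * (INR (length lM) * (K * (27 * wg D B * Qb k N K D B)))).
Proof.
  intros HN HT HD HB Ht1 Ht2 Hl HK.
  set (E := T ^ (2 * k) * (INR (length lM) * (K * (27 * wg D B * Qb k N K D B)))).
  replace (3 * E) with (2 * E * (0 - - (3 / 2))) by field.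
  assert (Hz : forall x y, - (3 / 2) <= x <= 0 -> - B <= y <= B -> inz T (s2 t0 + (x, y))).
  { intros x y Hx Hy. unfold inz, s2; csimp. lra. }
  apply (shift_bound (fun u => zeta (s2 t0 + u) ^ k * testP k N lM D t0 u)%C); [lra|lra| |].
  - intros x y Hx Hy. apply (hol_mult (fun u => zeta (s2 t0 + u) ^ k)%C).
    + apply (hol_pow (fun u => zeta (s2 t0 + u))). apply (hol_comp (fun u => s2 t0 + u)%C zeta); [apply hol_s2|]. apply zeta_hol.
      destruct (inz_aux T _ HT (Hz x y Hx Hy)) as (_ & _ & N1 & _). exact N1.
    + apply hol_testP. unfold s2; csimp; lra.
  - intros x Hx.
    assert (K1 : forall y, - B <= y <= B -> wg D y = wg D B -> Cmod (zeta (s2 t0 + (x, y)) ^ k * testP k N lM D t0 (x, y)) <= E).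
    { intros y Hy Ey. rewrite Cmod_mult. unfold E. rewrite <- Ey. apply Rmult_le_compat; try apply Cmod_ge_0.
      - rewrite Cmod_pow, pow_mult. apply pow_incr. split; [apply Cmod_ge_0|apply zeta_inz; [exact HT|apply Hz; assumption]].
      - apply (testP_bound k N lM D B t0 T K); auto; lra. }
    split; apply K1; try lra. unfold wg. f_equal. f_equal. unfold Rdiv. ring.
Qed.

(** On [Re s = 2] the Dirichlet series past [R] is at most [T ^ 2 / (R + 1)], and [R] will be a high
    power of [T]. *)
Lemma replace_dirpoly k N lM D B t0 T K R : (1 <= N)%nat -> 11 <= T -> 3 / 2 <= D -> 0 <= B -> T <= t0 - B -> t0 + B <= 3 * T ->
  (forall m, In m lM -> 1 <= INR m <= K) -> 1 <= K -> (1 <= R)%nat ->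
  Cmod (CI (fun y => zeta (s2 t0 + (0, y)) ^ S k * testP (S k) N lM D t0 (0, y)) (- B) B -
        CI (fun y => dirpoly R (s2 t0 + (0, y)) ^ S k * testP (S k) N lM D t0 (0, y)) (- B) B)%C <=
   INR (S k) * (2 * T ^ 2) ^ k * (T ^ 2 * / INR (S R)) * (INR (length lM) * (K * (27 * Qb (S k) N K D B))) * (2 * B).
Proof.
  intros HN HT HD HB Ht1 Ht2 Hl HK HR.
  assert (Hz : forall y, - B <= y <= B -> inz T (s2 t0 + (0, y))) by (intros y Hy; unfold inz, s2; csimp; lra).
  assert (cP : conts (fun y => testP (S k) N lM D t0 (0, y)) (- B) B).
  { apply conts_ver. intros y Hy. apply hol_ccont, hol_testP. unfold s2; csimp; lra. }
  assert (c1 : conts (fun y => zeta (s2 t0 + (0, y)) ^ S k * testP (S k) N lM D t0 (0, y))%C (- B) B).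
  { apply (conts_mult (fun y => zeta (s2 t0 + (0, y)) ^ S k)%C); [|exact cP]. apply (conts_ver (fun u => zeta (s2 t0 + u) ^ S k)%C).
    intros y Hy. apply hol_ccont, (hol_pow (fun u => zeta (s2 t0 + u))), (hol_comp (fun u => s2 t0 + u)%C zeta); [apply hol_s2|].
    apply zeta_hol. destruct (inz_aux T _ HT (Hz y Hy)) as (_ & _ & N1 & _). exact N1. }
  assert (c2 : conts (fun y => dirpoly R (s2 t0 + (0, y)) ^ S k * testP (S k) N lM D t0 (0, y))%C (- B) B).
  { apply (conts_mult (fun y => dirpoly R (s2 t0 + (0, y)) ^ S k)%C); [|exact cP]. apply (conts_ver (fun u => dirpoly R (s2 t0 + u) ^ S k)%C).
    intros y Hy. apply hol_ccont, (hol_pow (fun u => dirpoly R (s2 t0 + u))). unfold dirpoly.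
    apply (hol_csum (fun n u => Rcpow (INR (S n)) (- (s2 t0 + u)))). intros n. apply hol_Rcpow, hol_opp, hol_s2. }
  rewrite <- (CI_minus _ _ (- B) B ltac:(lra) c1 c2). replace (2 * B) with (B - - B) by ring.
  apply CI_bound; [lra| |].
  - intros y Hy. apply (rcont_minus _ _ y (c1 y Hy) (c2 y Hy)).
  - intros y Hy. set (p := testP _ _ _ _ _ _). set (a := zeta _). set (b := dirpoly _ _).
    replace (a ^ S k * p - b ^ S k * p)%C with ((a ^ S k - b ^ S k) * p)%C by ring. rewrite Cmod_mult.
    apply Rmult_le_compat; try apply Cmod_ge_0.
    + assert (H2 : Re (s2 t0 + (0, y)) = 2) by (unfold s2; csimp; ring).
      assert (K1 : Cmod a <= 2 * T ^ 2) by (generalize (zeta_inz T _ HT (Hz y Hy)) (pow2_ge_0 T); fold a; lra).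
      assert (K2 : Cmod b <= 2 * T ^ 2) by (apply dirpoly_bound; auto).
      eapply Rle_trans; [apply (Cpow_diff a b _ k K1 K2)|]. apply Rmult_le_compat_l; [|apply zeta_dirpoly; auto].
      apply Rmult_le_pos; [apply pos_INR|apply pow_le; generalize (pow2_ge_0 T); lra].
    + eapply Rle_trans; [apply (testP_bound (S k) N lM D B t0 T K); auto; lra|].
      apply Rmult_le_compat_l; [apply pos_INR|]. apply Rmult_le_compat_l; [lra|].
      apply Rmult_le_compat_r; [apply Qb_pos; lra|]. generalize (wg_le1 D y ltac:(lra)). lra.
Qed.

(** The integrand is bilinear in the terms [n ^ (- s)] of the Dirichlet polynomial and the terms
    [m ^ (s - 1)] of [testP]. On the diagonal the coefficient is [1 / m > 0], so a lower bound for
    the real part of [qfac] is all that is required. *)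
Lemma diagonal_line k N lM D B t0 T K R eta ell : (1 <= N)%nat -> 2 <= T -> 1 <= D -> 0 <= B -> T <= t0 - B ->
  (forall m, In m lM -> 1 <= INR m <= K) -> 1 <= K ->
  (forall m n, In m lM -> In n (prods k R) -> m <> n -> eta <= Rabs (lnd m n)) ->
  (forall m y, In m lM -> - B <= y <= B -> ell <= Re (qfac k N D t0 m (0, y))) ->
  ell * gmass D B * diag lM (prods k R) - INR (length lM) * (INR (R ^ k) * (K * (Qb k N K D B * osc_err D B eta))) <=
   Re (CI (fun y => dirpoly R (s2 t0 + (0, y)) ^ k * testP k N lM D t0 (0, y)) (- B) B)%C.
Proof.
  intros HN HT HD HB Ht Hl HK He Hq.
  set (c := fun m n : nat => (Rcpow (INR n) (- s2 t0) * Rcpow (INR m) (s2 t0 - 1))%C).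
  assert (ImN : forall x y, - B <= y <= B -> Im (s2 t0 + (x, y)) <> 0) by (intros x y Hy; unfold s2; csimp; lra).
  assert (Kb := bilinear lM (prods k R) c (fun m => qfac k N D t0 m) D B (Qb k N K D B) eta K ltac:(lra) HB (Qb_pos _ _ _ _ _ HK HD HB)).
  specialize (Kb (fun m x y _ _ Hy => hol_qfac k N D t0 m (x, y) (ImN x y Hy))).
  specialize (Kb (fun m x y Hm Hx Hy => qfac_bound k N D B t0 T K m x y HN HT HD Ht (proj1 (Hl m Hm)) (proj2 (Hl m Hm)) Hx Hy)).
  specialize (Kb He). rewrite prods_length in Kb.
  assert (Hc : forall m n, In m lM -> In n (prods k R) -> Cmod (c m n) <= K).
  { intros m n Hm Hn. unfold c. rewrite Cmod_mult, <- (Rmult_1_l K). destruct (Hl m Hm). apply Rmult_le_compat; try apply Cmod_ge_0.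
    - apply Cmod_Rcpow_le1; [apply (prods_range k R n Hn)|unfold s2; csimp; lra].
    - apply Rcpow_le_K; auto. unfold s2; csimp; lra. }
  specialize (Kb Hc).
  rewrite (CI_ext _ (fun y => dirpoly R (s2 t0 + (0, y)) ^ k * testP k N lM D t0 (0, y))%C) in Kb; [|lra|].
  2: { intros y Hy. unfold dirpoly. rewrite <- prods_pow. unfold testP. rewrite Cmult_comm, sumC_mult. apply sumC_ext. intros m Hm. apply sumC_ext. intros n Hn.
       replace (s2 t0 + (0, y) - 1)%C with ((s2 t0 - 1) + (0, y))%C by ring. replace (- (s2 t0 + (0, y)))%C with (- s2 t0 + - (0, y))%C by ring.
       rewrite !Rcpow_shift. unfold c, lnd.
       replace (RtoC (ln (INR m) - ln (INR n)) * (0, y))%C with (RtoC (ln (INR m)) * (0, y) + RtoC (ln (INR n)) * - (0, y))%C by (rewrite RtoC_minus; ring).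
       rewrite Cexp_plus. ring. }
  set (I := CI (fun y => dirpoly R (s2 t0 + (0, y)) ^ k * testP k N lM D t0 (0, y))%C (- B) B) in *.
  set (Dg := sumC _ lM) in Kb.
  assert (Hd : ell * gmass D B * diag lM (prods k R) <= Re Dg).
  { unfold Dg, diag. rewrite sumC_Re, <- sumR_scal. apply sumR_le. intros m Hm. rewrite sumC_Re, <- sumR_scal. apply sumR_le. intros n Hn.
    destruct (Nat.eq_dec m n) as [E|E]; [|cbn [Re RtoC fst]; lra]. subst n.
    destruct (Hl m Hm) as [H1 H2]. assert (Hm1 : (1 <= m)%nat) by (apply (prods_range k R m Hn)).
    unfold c. rewrite <- Rcpow_plus. replace (- s2 t0 + (s2 t0 - 1))%C with (- (1))%C by ring. rewrite Rcpow_m1 by exact Hm1.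
    assert (cc : conts (fun y => gW D (0, y) * qfac k N D t0 m (0, y))%C (- B) B).
    { apply (conts_ver (fun u => gW D u * qfac k N D t0 m u)%C). intros y Hy. apply hol_ccont, (hol_mult (gW D)); [apply hol_gW|apply hol_qfac, ImN, Hy]. }
    assert (X : ell * gmass D B <= Re (CI (fun y => gW D (0, y) * qfac k N D t0 m (0, y)) (- B) B)%C).
    { unfold CI. cbn [Re fst]. unfold gmass.
      assert (Ew : ex_RInt (wg D) (- B) B) by (apply exR_cont; intros; apply continuous_wg; lra).
      replace (ell * RInt (wg D) (- B) B) with (RInt (fun y => ell * wg D y + 0 * 0) (- B) B).
      2: { rewrite (RInt_lin2 (wg D) (fun _ => 0) (- B) B ell 0 Ew (ex_RInt_const _ _ _)). reqR. ring. }
      apply RInt_le; [lra| |apply (conts_ex_re _ (- B) B ltac:(lra) cc)|].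
      - eexists. apply (is_RInt_lin2 (wg D) (fun _ => 0) (- B) B ell 0 Ew (ex_RInt_const _ _ _)).
      - intros y Hy. rewrite gW_line by lra. assert (Y := Hq m y Hm ltac:(lra)). destruct (qfac k N D t0 m (0, y)) as [a b]. cbn [Re fst] in Y. csimp.
        assert (0 < wg D y) by apply exp_pos. fold (wg D y). nra. }
    assert (ReS : forall r (J : C), Re (RtoC r * J) = r * Re J) by (intros r [a b]; csimp; ring). rewrite ReS.
    rewrite Rmult_comm. apply Rmult_le_compat_l; [left; apply Rinv_0_lt_compat; lra|exact X]. }
  assert (Q := re_le_Cmod (I - Dg)). replace (Re (I - Dg)) with (Re I - Re Dg) in Q by (csimp; ring).
  generalize (Rabs_le_between (Re I - Re Dg) (Cmod (I - Dg))). intros [W _]. specialize (W Q). lra.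
Qed.

Lemma ln_diff_lower a b : 0 < b -> b <= a -> 1 - b / a <= ln a - ln b.
Proof.
  intros Hb Hab. assert (0 < b / a) by (apply Rdiv_lt_0_compat; lra). assert (L := ln_le_pred (b / a) H). rewrite ln_div in L by lra. lra.
Qed.

(** Only [m] is bounded by [K], as [n] may run over the much longer Dirichlet polynomial: the
    nearest competitors of [m] are [m - 1] and [m + 1]. *)
Lemma lnd_lower K m n : (1 <= m)%nat -> (1 <= n)%nat -> INR m <= K -> 1 <= K -> m <> n -> / (2 * K) <= Rabs (lnd m n).
Proof.
  intros Hm Hn HK K1 Hne. unfold lnd. assert (m1 := le_INR 1 m Hm). assert (n1 := le_INR 1 n Hn). cbn [INR] in m1, n1.
  destruct (Nat.lt_gt_cases m n) as [Q _]. destruct (Q Hne) as [H|H].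
  - assert (H1 : INR m + 1 <= INR n) by (rewrite <- S_INR; apply le_INR; lia).
    assert (L := ln_diff_lower (INR n) (INR m) ltac:(lra) ltac:(lra)). rewrite Rabs_left1 by (assert (ln (INR m) <= ln (INR n)) by (apply ln_le; lra); lra).
    assert (INR m / INR n <= INR m / (INR m + 1)) by (apply Rmult_le_compat_l; [lra|apply Rinv_le_contravar; lra]).
    replace (INR m / (INR m + 1)) with (1 - / (INR m + 1)) in H0 by (field; lra).
    assert (/ (2 * K) <= / (INR m + 1)) by (apply Rinv_le_contravar; lra). lra.
  - assert (H1 : INR n + 1 <= INR m) by (rewrite <- S_INR; apply le_INR; lia).
    assert (L := ln_diff_lower (INR m) (INR n) ltac:(lra) ltac:(lra)). rewrite Rabs_pos_eq by (assert (ln (INR n) <= ln (INR m)) by (apply ln_le; lra); lra).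
    assert (INR n / INR m <= (INR m - 1) / INR m) by (apply Rmult_le_compat_r; [left; apply Rinv_0_lt_compat; lra|lra]).
    replace ((INR m - 1) / INR m) with (1 - / INR m) in H0 by (field; lra).
    assert (/ (2 * K) <= / INR m) by (apply Rinv_le_contravar; lra). lra.
Qed.

Lemma sumR_map {A B} (h : A -> B) (f : B -> R) l : sumR f (map h l) = sumR (fun a => f (h a)) l.
Proof. induction l; simpl; congruence. Qed.

Lemma sumR_flat_map {A B} (f : B -> R) (h : A -> list B) l : sumR f (flat_map h l) = sumR (fun a => sumR f (h a)) l.
Proof. induction l; simpl; [reflexivity|]. rewrite sumR_app, IHl. reflexivity. Qed.

Lemma sumR_prods_mono k M N (f : nat -> R) : (M <= N)%nat -> (forall n, 0 <= f n) -> sumR f (prods k M) <= sumR f (prods k N).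
Proof.
  intros HMN. revert f. induction k; intros f Hf; [apply Rle_refl|]. cbn [prods]. rewrite !sumR_flat_map.
  replace (seq 1 N) with (seq 1 M ++ seq (1 + M) (N - M)) by (rewrite <- seq_app; f_equal; lia). rewrite sumR_app.
  assert (0 <= sumR (fun a => sumR f (map (Nat.mul a) (prods k N))) (seq (1 + M) (N - M))).
  { apply sumR_nonneg. intros a _. apply sumR_nonneg. intros; apply Hf. }
  assert (sumR (fun a => sumR f (map (Nat.mul a) (prods k M))) (seq 1 M) <= sumR (fun a => sumR f (map (Nat.mul a) (prods k N))) (seq 1 M)); [|lra].
  apply sumR_le. intros a _. rewrite !sumR_map. apply IHk. intros; apply Hf.
Qed.

Lemma diag_mono k lM M R : (forall m, In m lM -> (1 <= m)%nat) -> (M <= R)%nat -> diag lM (prods k M) <= diag lM (prods k R).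
Proof.
  intros Hl H. apply sumR_le. intros m Hm. apply sumR_prods_mono; [exact H|]. intros n. destruct (Nat.eq_dec m n); [|lra].
  left; apply Rinv_0_lt_compat, lt_0_INR. generalize (Hl m Hm). lia.
Qed.

(** Cauchy-Schwarz in linear form; the free parameter [lam] will be a small multiple of [ln T]. *)
Lemma first_moment_cs k lM D B t0 lam : 0 < D -> 0 <= B -> 0 < lam ->
  first_moment k lM D B t0 <= lam / 2 * RInt (fun y => Cmod (dualpoly lM (crit (t0 + y))) ^ 2 * wg D y) (- B) B
    + / (2 * lam) * RInt (fun y => dG k (t0 + y) ^ 2 * wg D y) (- B) B.
Proof.
  intros HD HB Hlam.
  assert (cA : forall y, continuous (fun y => Cmod (dualpoly lM (crit (t0 + y)))) y).
  { intros y. apply rcont_Cmod. apply (rcont_comp (dualpoly lM) (fun y => crit (t0 + y))).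
    + apply hol_ccont. apply (sumC_hol (fun m s => Rcpow (INR m) (s - 1))). intros m _. apply hol_Rcpow, (hol_minus (fun s => s)); [apply hol_id|apply hol_const].
    + split; cbn [crit Re Im fst snd]; [apply continuous_const|apply continuous_ex_derive; auto_derive; auto]. }
  assert (cw : forall y, continuous (wg D) y) by (intros; apply continuous_wg, HD).
  assert (cd : forall y, continuous (fun y => dG k (t0 + y)) y) by (intros; apply continuous_shift; intros; apply continuous_dG).
  assert (e1 : ex_RInt (fun y => Cmod (dualpoly lM (crit (t0 + y))) ^ 2 * wg D y) (- B) B).
  { apply exR_cont. intros y. apply (continuous_mult (K := R_AbsRing) (fun y => Cmod (dualpoly lM (crit (t0 + y))) ^ 2)); [apply (continuous_pow (fun y => Cmod (dualpoly lM (crit (t0 + y))))), cA|apply cw]. }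
  assert (e2 : ex_RInt (fun y => dG k (t0 + y) ^ 2 * wg D y) (- B) B).
  { apply exR_cont. intros y. apply (continuous_mult (K := R_AbsRing) (fun y => dG k (t0 + y) ^ 2)); [apply (continuous_pow (fun y => dG k (t0 + y))), cd|apply cw]. }
  unfold first_moment. rewrite <- (RInt_lin2 _ _ (- B) B (lam / 2) (/ (2 * lam)) e1 e2).
  apply RInt_le; [lra| |eexists; apply (is_RInt_lin2 _ _ (- B) B (lam / 2) (/ (2 * lam)) e1 e2)|].
  - apply exR_cont. intros y. apply (continuous_mult (K := R_AbsRing) (fun y => Rabs (dG k (t0 + y)) * Cmod (dualpoly lM (crit (t0 + y))))); [|apply cw].
    apply (continuous_mult (K := R_AbsRing) (fun y => Rabs (dG k (t0 + y)))); [|apply cA].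
    apply (continuous_comp (fun y => dG k (t0 + y)) Rabs); [apply cd|apply continuous_Rabs].
  - intros y _. set (a := Cmod _). assert (0 < wg D y) by apply exp_pos. set (w := wg D y) in *. rewrite <- (pow2_abs (dG k (t0 + y))). set (d := Rabs _).
    (* AM-GM: [lam a ^ 2 / 2 + d ^ 2 / (2 lam) - d a = (lam a - d) ^ 2 / (2 lam)] *)
    assert (E : lam / 2 * a ^ 2 + / (2 * lam) * d ^ 2 - d * a = / (2 * lam) * (lam * a - d) ^ 2) by (field; lra).
    assert (0 <= / (2 * lam) * (lam * a - d) ^ 2) by (apply Rmult_le_pos; [left; apply Rinv_0_lt_compat; lra|apply pow2_ge_0]). nra.
Qed.

(** The summands are, in order, the two errors of [by_parts] and those of [shift_line],
    [replace_dirpoly] and [diagonal_line]. *)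
Definition err_I (k N Q : nat) (T K D B eta : R) : R :=
  54 * T ^ (2 * S k) * K * wg D B + 2 * B * (27 * INR (S k) * T ^ (2 * S k) * K * ((2 + (3 * T) ^ 2) * / INR (S N)))
  + 3 * (T ^ (2 * S k) * (K * (K * (27 * wg D B * Qb (S k) (S N) K D B))))
  + INR (S k) * (2 * T ^ 2) ^ k * (T ^ 2 * / INR (S Q)) * (K * (K * (27 * Qb (S k) (S N) K D B))) * (2 * B)
  + K * (INR (Q ^ S k) * (K * (Qb (S k) (S N) K D B * osc_err D B eta))).

(** With [P = gmass D B * S0], the chain of approximations bounds the first moment below by a
    multiple of [L P], while the mean square is at most [2 P]; the quotient of squares is of order
    [L ^ 2 P]. The two tuple lengths differ: [M] for the test polynomial, [W] for the approximation
    of zeta. *)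
Lemma window k M N W D B t0 T L : 11 <= T -> 3 / 2 <= D -> D <= B -> T <= t0 - B -> t0 + B <= 3 * T -> (1 <= M <= W)%nat ->
  let K := INR (M ^ S k) in let eta := / (2 * K) in
  let S0 := diag (prods (S k) M) (prods (S k) M) in
  8 <= L -> 1 <= S0 ->
  (forall t, T <= t <= 3 * T -> L / 2 <= INR (S k) * Re (gn (S N) (2, t)) - ln K) ->
  err_I k N W T K D B eta <= 2 -> K * K * osc_err D B eta <= 1 ->
  L ^ 2 * S0 * D / 40000 <= RInt (fun y => dG (S k) (t0 + y) ^ 2 * wg D y) (- B) B.
Proof.
  intros HT HD HDB Ht1 Ht2 HM K eta S0 HL HS Hq HeI HeJ.
  set (l := prods (S k) M) in *.
  assert (HB : 0 <= B) by lra.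
  assert (Hl : forall m, In m l -> (1 <= m)%nat) by (intros m Hm; apply (prods_range (S k) M m Hm)).
  assert (Hl2 : forall m, In m l -> 1 <= INR m <= K).
  { intros m Hm. destruct (prods_range (S k) M m Hm) as [A1 A2]. split; [apply (le_INR 1), A1|apply le_INR, A2]. }
  assert (HK : 1 <= K).
  { unfold K. apply (le_INR 1). apply Nat.neq_0_lt_0, Nat.pow_nonzero. lia. }
  assert (Len : INR (length l) = K) by (unfold l; rewrite prods_length; reflexivity).
  set (g := gmass D B). assert (Hg := gmass_lower D B ltac:(lra) HDB). fold g in Hg.
  assert (e1 : 1 / 3 <= exp (- 1)).
  { replace (- 1) with (- (1)) by ring. rewrite exp_Ropp. generalize exp_le_3 (exp_pos 1). intros. unfold Rdiv. rewrite Rmult_1_l. apply Rinv_le_contravar; lra. }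
  assert (Hg2 : 2 / 3 * D <= g) by nra.
  assert (Heta : forall R0 m n, In m l -> In n (prods (S k) R0) -> m <> n -> eta <= Rabs (lnd m n)).
  { intros R0 m n Hm Hn. apply lnd_lower; [apply Hl, Hm|apply (prods_range _ _ _ Hn)|apply Hl2, Hm|exact HK]. }
  assert (P1 := by_parts (S k) N l D B t0 T HT ltac:(lra) HB Ht1 Ht2 Hl).
  assert (P2 := shift_line (S k) (S N) l D B t0 T K ltac:(lia) HT HD HB Ht1 Ht2 Hl2 HK).
  assert (P3 := replace_dirpoly k (S N) l D B t0 T K W ltac:(lia) HT HD HB Ht1 Ht2 Hl2 HK ltac:(lia)).
  assert (Hell : forall m y, In m l -> - B <= y <= B -> L / 2 <= Re (qfac (S k) (S N) D t0 m (0, y))).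
  { intros m y Hm Hy. unfold qfac. replace (s2 t0 + (0, y))%C with ((2, t0 + y) : C) by (unfold s2; apply Ceq; csimp; ring).
    assert (Q := Hq (t0 + y) ltac:(lra)). destruct (Hl2 m Hm) as [A1 A2]. assert (ln (INR m) <= ln K) by (apply ln_le; lra).
    set (z := gn _ _) in *. clearbody z. destruct z as [a b]. cbn [Re fst] in Q. csimp. lra. }
  assert (P4 := diagonal_line (S k) (S N) l D B t0 T K W eta (L / 2) ltac:(lia) ltac:(lra) ltac:(lra) HB Ht1 Hl2 HK (Heta W) Hell).
  fold g in P4.
  assert (Pd : S0 <= diag l (prods (S k) W)) by (apply diag_mono; [exact Hl|lia]).
  rewrite Len in *.
  set (I1 := CI (crit_int (S k) (S N) l D t0) (- B) B) in *.
  set (I2 := CI (fun y => zeta (s2 t0 + (0, y)) ^ S k * testP (S k) (S N) l D t0 (0, y))%C (- B) B) in *.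
  set (I3 := CI (fun y => dirpoly W (s2 t0 + (0, y)) ^ S k * testP (S k) (S N) l D t0 (0, y))%C (- B) B) in *.
  set (FM := first_moment (S k) l D B t0) in *.
  assert (R3 : Re I3 <= Cmod I1 + Cmod (I1 - I2)%C + Cmod (I2 - I3)%C).
  { assert (A := re_le_Cmod I3). assert (A1 := Rle_abs (Re I3)).
    assert (Cmod I3 <= Cmod I1 + Cmod (I1 - I2)%C + Cmod (I2 - I3)%C); [|lra].
    replace I3 with (I1 - (I1 - I2) - (I2 - I3))%C at 1 by ring. eapply Rle_trans; [apply Cmod_tri_minus|]. generalize (Cmod_tri_minus I1 (I1 - I2)). lra. }
  assert (Main : L / 2 * g * S0 <= 27 * FM + 2).
  { assert (L / 2 * g * S0 <= L / 2 * g * diag l (prods (S k) W)) by (apply Rmult_le_compat_l; nra).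
    unfold err_I in HeI. lra. }
  assert (PJ := mean_square l t0 D B eta ltac:(lra) HB Hl (Heta M)). rewrite Len in PJ. fold S0 g in PJ.
  set (J := RInt (fun y => Cmod (dualpoly l (crit (t0 + y))) ^ 2 * wg D y) (- B) B) in *.
  (* This [lam] makes the mean-square term [lam / 2 * 2 P = L P / 216], half of the lower bound
     [L P / 108] for [FM]. *)
  assert (CS := first_moment_cs (S k) l D B t0 (L / 216) ltac:(lra) HB ltac:(lra)). fold FM J in CS.
  set (X := RInt (fun y => dG (S k) (t0 + y) ^ 2 * wg D y) (- B) B) in *.
  set (P := g * S0). assert (HP : 1 <= P) by (unfold P; rewrite <- (Rmult_1_l 1); apply Rmult_le_compat; lra).
  (* As [8 <= L] and [1 <= P], the error 2 is at most half of [L P / 2]; the remaining [L P / 4] is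
     divided by 27. *)
  assert (M1 : L / 108 * P <= FM).
  { assert (L / 2 * P <= 27 * FM + 2) by (unfold P; lra). assert (8 * P <= L * P) by (apply Rmult_le_compat_r; lra). lra. }
  assert (J1 : J <= 2 * P) by (unfold P in *; lra).
  assert (C1 : FM <= L / 216 * P + 108 / L * X).
  { replace (108 / L) with (/ (2 * (L / 216))) by (field; lra). assert (L / 216 / 2 * J <= L / 216 / 2 * (2 * P)) by (apply Rmult_le_compat_l; lra). lra. }
  assert (X1 : L * P / 216 <= 108 / L * X) by lra.
  assert (X2 : L ^ 2 * P / 23328 <= X).
  { assert (Ar : forall x p : R, L * p / 216 <= 108 / L * x -> L ^ 2 * p / 23328 <= x).
    { intros x p Hx. apply (Rmult_le_compat_l (L / 108)) in Hx; [|lra]. replace (L / 108 * (108 / L * x)) with x in Hx by (field; lra). lra. }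
    apply Ar, X1. }
  (* Here [23328 = 108 * 216], and the loss [2 D / 3 <= g] turns it into 34992, rounded up to
     40000. *)
  apply Rle_trans with (L ^ 2 * P / 23328); [|exact X2].
  assert (0 <= L ^ 2 * S0) by (apply Rmult_le_pos; [apply pow2_ge_0|lra]).
  unfold P. replace (L ^ 2 * (g * S0)) with (L ^ 2 * S0 * g) by ring.
  assert (L ^ 2 * S0 * (2 / 3 * D) <= L ^ 2 * S0 * g) by (apply Rmult_le_compat_l; assumption).
  assert (0 <= L ^ 2 * S0 * D) by (apply Rmult_le_pos; lra). lra.
Qed.

(* A bounded increasing function whose increments dominate [1 / (1 + z ^ 2)]. *)
Definition gsig (z : R) : R := z / (1 + Rabs z).

Lemma gsig_bound z : - 1 <= gsig z <= 1.
Proof.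
  unfold gsig. assert (0 <= Rabs z) by apply Rabs_pos. apply Rabs_le_between. unfold Rdiv. rewrite Rabs_mult, (Rabs_pos_eq (/ _)) by (left; apply Rinv_0_lt_compat; lra).
  apply <- Rle_div_l; lra.
Qed.

Lemma gsig_step z : / (1 + z ^ 2) <= 4 * (gsig (z + 1) - gsig z).
Proof.
  assert (Q : 0 < 1 + z ^ 2) by (generalize (pow2_ge_0 z); lra). unfold gsig.
  destruct (Rle_dec 0 z) as [H|H].
  - rewrite !Rabs_pos_eq by lra. replace (4 * ((z + 1) / (1 + (z + 1)) - z / (1 + z))) with (/ ((1 + z) * (2 + z) / 4)) by (field; lra).
    apply Rinv_le_contravar; nra.
  - destruct (Rle_dec z (- 1)) as [H'|H'].
    + rewrite !Rabs_left1 by lra. replace (4 * ((z + 1) / (1 + - (z + 1)) - z / (1 + - z))) with (/ ((- z) * (1 - z) / 4)) by (field; lra).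
      apply Rinv_le_contravar; nra.
    + rewrite (Rabs_pos_eq (z + 1)), (Rabs_left z) by lra.
      replace (4 * ((z + 1) / (1 + (z + 1)) - z / (1 + - z))) with (4 * (1 - 2 * z - 2 * z ^ 2) / ((2 + z) * (1 - z))) by (field; lra).
      apply Rle_trans with 1; [apply inv_le1; generalize (pow2_ge_0 z); lra|]. apply -> Rle_div_r; [nra|]. nra.
Qed.

Lemma gauss_sum x n : rsum (fun j => exp (- (x - INR j) ^ 2)) n <= 8.
Proof.
  assert (rsum (fun j => exp (- (x - INR j) ^ 2)) n <= 4 * (gsig (INR n - x) - gsig (- x))).
  { induction n; [cbn [rsum INR]; rewrite Rminus_0_l; lra|]. rewrite rsum_S.
    assert (G := gsig_step (INR n - x)). replace (INR n - x + 1) with (INR (S n) - x) in G by (rewrite S_INR; ring).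
    assert (exp (- (x - INR n) ^ 2) <= / (1 + (INR n - x) ^ 2)); [|lra].
    replace (- (x - INR n) ^ 2) with (- (INR n - x) ^ 2) by ring. rewrite exp_Ropp. set (q := (INR n - x) ^ 2).
    assert (0 <= q) by apply pow2_ge_0. apply Rinv_le_contravar; [lra|]. generalize (exp_ineq1_le q). lra. }
  generalize (gsig_bound (INR n - x)) (gsig_bound (- x)). lra.
Qed.

(** * Summation over overlapping windows *)

Lemma RInt_shift (f : R -> R) t0 a b : (forall t, continuous f t) -> RInt (fun y => f (t0 + y)) a b = RInt f (t0 + a) (t0 + b).
Proof.
  intros H. assert (E := RInt_comp_lin f 1 t0 a b). replace (1 * a + t0) with (t0 + a) in E by ring. replace (1 * b + t0) with (t0 + b) in E by ring.
  rewrite <- E by (apply exR_cont, H). apply RIntext. intros v. unfold scal; simpl; unfold mult; simpl. rewrite Rmult_1_l. f_equal. ring.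
Qed.

Lemma RInt_subset (f : R -> R) a b a' b' : (forall t, continuous f t) -> (forall t, 0 <= f t) -> a' <= a -> a <= b -> b <= b' ->
  RInt f a b <= RInt f a' b'.
Proof.
  intros Hc Hp H1 H2 H3. assert (E : forall p q, ex_RInt f p q) by (intros; apply exR_cont, Hc).
  assert (C1 := RIntCh f a' a b' E). assert (C2 := RIntCh f a b b' E).
  assert (P : forall p q, p <= q -> 0 <= RInt f p q) by (intros; apply RInt_ge_0; auto).
  generalize (P a' a H1) (P b b' H3). lra.
Qed.

Lemma RInt_rsum (f : nat -> R -> R) n a b : (forall j t, continuous (f j) t) ->
  rsum (fun j => RInt (f j) a b) n = RInt (fun t => rsum (fun j => f j t) n) a b.
Proof.
  intros H. induction n; [cbn [rsum]; rewrite RIntC; symmetry; apply Rmult_0_r|]. rewrite rsum_S, IHn.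
  rewrite (RIntext (fun t => rsum (fun j => f j t) (S n)) (fun t => 1 * rsum (fun j => f j t) n + 1 * f n t)) by (intros; rewrite rsum_S; ring).
  rewrite (RInt_lin2 (fun t => rsum (fun j => f j t) n) (f n)); [reqR; ring| |apply exR_cont, H].
  apply exR_cont. intros t. apply (continuous_rsum f n t). intros j. apply H.
Qed.

(** The centres are [D] apart although each window has half-width [B], so the windows overlap
    heavily; their Gaussian weights nevertheless sum to at most 8 at every point. *)
Lemma windows_sum k T H D B c n : 0 < D -> 0 <= B -> 0 <= H ->
  (forall j, (j < n)%nat -> B + INR j * D + B <= H) ->
  (forall j, (j < n)%nat -> c <= RInt (fun y => dG k (T + B + INR j * D + y) ^ 2 * wg D y) (- B) B) ->
  INR n * c <= 8 * RInt (fun t => dG k t ^ 2) T (T + H).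
Proof.
  intros HD HB HH Hj Hc.
  set (f := fun (j : nat) (t : R) => dG k t ^ 2 * wg D (t - (T + B + INR j * D))).
  assert (cw : forall x t, continuous (fun t => wg D (t - x)) t).
  { intros x t. apply (continuous_comp (fun t => t - x) (wg D)); [apply continuous_ex_derive; auto_derive; auto|apply continuous_wg, HD]. }
  assert (cf : forall j t, continuous (f j) t).
  { intros j t. apply (continuous_mult (K := R_AbsRing) (fun t => dG k t ^ 2)); [apply continuous_pow, continuous_dG|apply cw]. }
  assert (fp : forall j t, 0 <= f j t) by (intros; apply Rmult_le_pos; [apply pow2_ge_0|left; apply exp_pos]).
  assert (E : forall p q, ex_RInt (fun t => dG k t ^ 2) p q) by (intros; apply exR_cont; intros; apply continuous_pow, continuous_dG).
  apply Rle_trans with (rsum (fun j => RInt (f j) T (T + H)) n).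
  - rewrite <- rsum_const. apply rsum_le. intros j Hn. eapply Rle_trans; [apply (Hc j Hn)|].
    set (x := T + B + INR j * D).
    rewrite (RIntext _ (fun y => f j (x + y))).
    2: { intros y. unfold f. fold x. replace (x + y - x) with y by ring. reflexivity. }
    rewrite (RInt_shift (f j) x (- B) B (cf j)). assert (Q := Hj j Hn). assert (0 <= INR j * D) by (apply Rmult_le_pos; [apply pos_INR|lra]).
    apply RInt_subset; [apply cf|apply fp| | |]; unfold x; lra.
  - rewrite (RInt_rsum f n T (T + H) cf).
    apply Rle_trans with (RInt (fun t => 8 * dG k t ^ 2 + 0 * 0) T (T + H)).
    + apply RInt_le; [lra| | |].
      * apply exR_cont. intros t. apply (continuous_rsum f n t). intros; apply cf.
      * eexists. apply (is_RInt_lin2 (fun t => dG k t ^ 2) (fun _ => 0) T (T + H) 8 0 (E _ _) (ex_RInt_const _ _ _)).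
      * intros t _. unfold f. rewrite rsum_scal.
        rewrite (rsum_ext _ (fun j => exp (- ((t - T - B) / D - INR j) ^ 2))).
        -- assert (G := gauss_sum ((t - T - B) / D) n). generalize (pow2_ge_0 (dG k t)). nra.
        -- intros j _. unfold wg. f_equal. field. lra.
    + rewrite (RInt_lin2 (fun t => dG k t ^ 2) (fun _ => 0) T (T + H) 8 0 (E _ _) (ex_RInt_const _ _ _)). rewrite Rmult_0_l, Rplus_0_r. apply Rle_refl.
Qed.

(** * Size of the error terms *)

(** Bundling the sign with the bound makes the relation stable under products, so that long error
    terms are majorised factor by factor. *)
Definition le0 (a b : R) : Prop := 0 <= a <= b.

Lemma le0_mult a b A B : le0 a A -> le0 b B -> le0 (a * b) (A * B).
Proof. intros [H1 H2] [H3 H4]. split; [apply Rmult_le_pos; assumption|apply Rmult_le_compat; assumption]. Qed.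

Lemma le0_refl a : 0 <= a -> le0 a a.
Proof. intros. split; lra. Qed.

(** In the exponent [(n + 1) ln T - (ln T) ^ 2] is at most -4, and [e ^ (- 4) <= 2 ^ (- 4)]. *)
Lemma pow_small p T w : 1 <= T -> 2 * INR p + 4 <= ln T -> w <= exp (- ln T ^ 2) -> forall a n, 0 <= a <= T -> (n <= p)%nat -> a * T ^ n * w <= 1 / 16.
Proof.
  intros HT HL Hw a n Ha Hn. set (L := ln T) in *. assert (P := pos_INR p). assert (ET : T = exp L) by (unfold L; rewrite exp_ln; lra).
  assert (a * T ^ n <= exp (INR (S n) * L)).
  { rewrite <- exp_INR_pow. change (exp L ^ S n) with (exp L * exp L ^ n). rewrite <- ET. apply Rmult_le_compat_r; [apply pow_le; lra|lra]. }
  assert (0 <= a * T ^ n) by (apply Rmult_le_pos; [lra|apply pow_le; lra]).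
  apply Rle_trans with (exp (INR (S n) * L) * exp (- L ^ 2)).
  - apply Rle_trans with (a * T ^ n * exp (- L ^ 2)); [apply Rmult_le_compat_l; assumption|]. apply Rmult_le_compat_r; [left; apply exp_pos|assumption].
  - rewrite <- exp_plus. apply le_INR in Hn. apply Rle_trans with (exp (- (4 * 1))).
    + apply exp_le_mono. rewrite S_INR. nra.
    + rewrite exp_Ropp. replace (4 * 1) with (INR 4 * 1) by (simpl; ring). rewrite <- exp_INR_pow. unfold Rdiv. rewrite Rmult_1_l. apply Rinv_le_contravar; [lra|].
      assert (2 <= exp 1) by (generalize (exp_ineq1_le 1); lra). replace 16 with (2 ^ 4) by ring. apply pow_incr. lra.
Qed.

(** All quantities are replaced by powers of [T]. The exponent [nu] leaves [T ^ (- 3)] in the error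
    of replacing [theta'], [w] leaves [T ^ (- 2)] in the error of truncating the Dirichlet series,
    and [p] dominates every power of [T] that meets the factor [exp (- (ln T) ^ 2)]. *)
Lemma err_small k N W nu w p T K D B eta : nu = (2 * S k + 8)%nat -> w = (3 * k + 2 * nu + 10)%nat -> p = (w * S k + 2 * nu + 2 * S k + 8)%nat ->
  600 <= T -> INR (S k) <= T -> 1 <= K <= T -> 1 <= D <= T -> 0 <= B <= T -> B = D * ln T -> ln T ^ 2 <= eta * D ->
  T ^ nu <= INR (S N) -> INR N <= T ^ nu -> T ^ w <= INR (S W) -> INR W <= T ^ w -> 2 * INR p + 4 <= ln T ->
  err_I k N W T K D B eta <= 2 /\ K * K * osc_err D B eta <= 1.
Proof.
  intros Enu Ew Ep HT Hk HK HD HB EB Heta HN1 HN2 HW1 HW2 HL.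
  assert (Tp : forall n, 0 < T ^ n) by (intros; apply pow_lt; lra).
  assert (lT : le0 T T) by (apply le0_refl; lra). assert (lK : le0 K T) by (split; lra). assert (lB : le0 B T) by (split; lra).
  assert (lk : le0 (INR (S k)) T) by (split; [apply pos_INR|exact Hk]).
  assert (lTn : forall n, le0 (T ^ n) (T ^ n)) by (intros; apply le0_refl, Rlt_le, Tp).
  assert (lc : forall c, 0 <= c -> le0 c c) by (intros; apply le0_refl; assumption).
  assert (Ewg : wg D B = exp (- ln T ^ 2)) by (unfold wg; f_equal; rewrite EB; field; lra).
  set (g := exp (- ln T ^ 2)) in *. assert (gp : 0 < g) by apply exp_pos. assert (lg : le0 g g) by (apply lc; lra).
  assert (Sm := pow_small p T g ltac:(lra) HL (Rle_refl _)).
  assert (T1 : T <= T ^ nu). { replace T with (T ^ 1) at 1 by ring. apply Rle_pow; [lra|lia]. }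
  assert (lq : le0 (Qb (S k) (S N) K D B) (T ^ (2 * nu + 2))).
  { split; [apply Qb_pos; lra|]. unfold Qb. rewrite (S_INR N).
    assert (A : INR N + 1 + 1 <= 2 * T ^ nu) by lra. assert (A0 : 0 <= INR N + 1 + 1) by (generalize (pos_INR N); lra).
    assert (A2 : (INR N + 1 + 1) ^ 2 <= (2 * T ^ nu) ^ 2) by (apply pow_incr; lra).
    assert (A3 : INR (S k) * (3 * (INR N + 1 + 1) ^ 2) <= T * (3 * (2 * T ^ nu) ^ 2)).
    { apply Rmult_le_compat; [apply pos_INR| |exact Hk|lra]. generalize (pow2_ge_0 (INR N + 1 + 1)). lra. }
    replace (T ^ (2 * nu + 2)) with (T * (T * (T ^ nu) ^ 2)) by (rewrite pow_add, (Nat.mul_comm 2 nu), pow_mult; ring).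
    set (X := (T ^ nu) ^ 2) in *. assert (1 <= X) by (unfold X; nra). replace (T * (3 * (2 * T ^ nu) ^ 2)) with (12 * (T * X)) in A3 by (unfold X; ring).
    assert (T <= T * X) by (rewrite <- (Rmult_1_r T) at 1; apply Rmult_le_compat_l; lra). assert (600 * (T * X) <= T * (T * X)) by (apply Rmult_le_compat_r; nra). lra. }
  set (q := Qb (S k) (S N) K D B) in *.
  assert (iN : le0 (/ INR (S N)) (/ T ^ nu)) by (split; [left; apply Rinv_0_lt_compat, INR_S_pos|apply Rinv_le_contravar; auto]).
  assert (iW : le0 (/ INR (S W)) (/ T ^ w)) by (split; [left; apply Rinv_0_lt_compat, INR_S_pos|apply Rinv_le_contravar; auto]).
  assert (lo : le0 (osc_err D B eta) (12 * T * g)).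
  { unfold osc_err. assert (E1 : exp (1 - eta * D) <= 3 * g).
    { unfold Rminus. rewrite exp_plus. apply Rmult_le_compat; [left; apply exp_pos|left; apply exp_pos|apply exp_le_3|]. apply exp_le_mono. lra. }
    assert (E2 : exp (1 - (B / D) ^ 2) <= 3 * g).
    { replace (B / D) with (ln T) by (rewrite EB; field; lra). unfold Rminus. rewrite exp_plus. apply Rmult_le_compat; [left; apply exp_pos|left; apply exp_pos|apply exp_le_3|]. apply exp_le_mono. lra. }
    generalize (exp_pos (1 - eta * D)) (exp_pos (1 - (B / D) ^ 2)). intros P1 P2.
    assert (B * exp (1 - eta * D) <= T * (3 * g)) by (apply Rmult_le_compat; lra). assert (D * exp (1 - (B / D) ^ 2) <= T * (3 * g)) by (apply Rmult_le_compat; lra).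
    assert (0 <= B * exp (1 - eta * D)) by (apply Rmult_le_pos; lra). assert (0 <= D * exp (1 - (B / D) ^ 2)) by (apply Rmult_le_pos; lra). split; lra. }
  assert (inv16 : / T <= 1 / 600) by (unfold Rdiv; rewrite Rmult_1_l; apply Rinv_le_contravar; lra).
  split.
  - unfold err_I. rewrite Ewg. fold q.
    set (a := (2 * S k)%nat) in *.
    assert (F1 : le0 (54 * T ^ a * K * g) (54 * T ^ a * T * g)) by (repeat apply le0_mult; auto; apply lc; lra).
    assert (F2 : le0 (2 * B * (27 * INR (S k) * T ^ a * K * ((2 + (3 * T) ^ 2) * / INR (S N)))) (2 * T * (27 * T * T ^ a * T * ((10 * T ^ 2) * / T ^ nu)))).
    { repeat apply le0_mult; auto; try (apply lc; lra). split; [generalize (pow2_ge_0 (3 * T)); lra|nra]. }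
    assert (F3 : le0 (3 * (T ^ a * (K * (K * (27 * g * q))))) (3 * (T ^ a * (T * (T * (27 * g * T ^ (2 * nu + 2))))))) by (repeat apply le0_mult; auto; apply lc; lra).
    assert (F4 : le0 (INR (S k) * (2 * T ^ 2) ^ k * (T ^ 2 * / INR (S W)) * (K * (K * (27 * q))) * (2 * B))
       (T * T ^ (3 * k) * (T ^ 2 * / T ^ w) * (T * (T * (27 * T ^ (2 * nu + 2)))) * (2 * T))).
    { repeat apply le0_mult; auto; try (apply lc; lra). rewrite pow_mult. split; [apply pow_le; generalize (pow2_ge_0 T); lra|].
      apply pow_incr. split; [generalize (pow2_ge_0 T); lra|]. replace (T ^ 3) with (T * T ^ 2) by ring. apply Rmult_le_compat_r; [apply pow2_ge_0|lra]. }
    assert (F5 : le0 (K * (INR (W ^ S k) * (K * (q * osc_err D B eta)))) (T * (T ^ (w * S k) * (T * (T ^ (2 * nu + 2) * (12 * T * g)))))).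
    { repeat apply le0_mult; auto. rewrite pow_INR, pow_mult. split; [apply pow_le, pos_INR|apply pow_incr; split; [apply pos_INR|exact HW2]]. }
    destruct F1 as [_ F1], F2 as [_ F2], F3 as [_ F3], F4 as [_ F4], F5 as [_ F5].
    replace (54 * T ^ a * T * g) with (54 * T ^ (a + 1) * g) in F1 by (rewrite pow_add; ring).
    replace (2 * T * (27 * T * T ^ a * T * ((10 * T ^ 2) * / T ^ nu))) with (540 * / T ^ 3) in F2.
    2: { rewrite Enu. fold a. rewrite pow_add. field. repeat split; try (apply pow_nonzero); lra. }
    replace (3 * (T ^ a * (T * (T * (27 * g * T ^ (2 * nu + 2)))))) with (81 * T ^ (a + 2 * nu + 4) * g) in F3 by (rewrite !pow_add; ring).
    replace (T * T ^ (3 * k) * (T ^ 2 * / T ^ w) * (T * (T * (27 * T ^ (2 * nu + 2)))) * (2 * T)) with (54 * / T ^ 2) in F4.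
    2: { rewrite Ew, !pow_add. field. repeat split; try (apply pow_nonzero); lra. }
    replace (T * (T ^ (w * S k) * (T * (T ^ (2 * nu + 2) * (12 * T * g))))) with (12 * T ^ (w * S k + 2 * nu + 5) * g) in F5 by (rewrite !pow_add; ring).
    assert (S1 := Sm 54 (a + 1)%nat ltac:(lra) ltac:(lia)). assert (S3 := Sm 81 (a + 2 * nu + 4)%nat ltac:(lra) ltac:(nia)).
    assert (S5 := Sm 12 (w * S k + 2 * nu + 5)%nat ltac:(lra) ltac:(lia)).
    assert (/ T ^ 2 <= / T) by (apply Rinv_le_contravar; nra). assert (/ T ^ 3 <= / T) by (apply Rinv_le_contravar; [lra|]; simpl; nra).
    lra.
  - assert (F : le0 (K * K * osc_err D B eta) (T * T * (12 * T * g))) by (repeat apply le0_mult; auto).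
    replace (T * T * (12 * T * g)) with (12 * T ^ 3 * g) in F by ring. assert (S1 := Sm 12 3%nat ltac:(lra) ltac:(lia)). destruct F. lra.
Qed.

(** * The arithmetic sum *)

Fixpoint tuples {A} (n : nat) (l : list A) : list (list A) :=
  match n with O => [nil] | S n => flat_map (fun a => map (cons a) (tuples n l)) l end.

Lemma in_tuples {A} n (l : list A) t : In t (tuples n l) <-> length t = n /\ forall a, In a t -> In a l.
Proof.
  revert t. induction n; intros t; simpl.
  - split; [intros [H|[]]; subst; split; [reflexivity|intros a []]|]. intros [H _]. left. destruct t; [reflexivity|discriminate].
  - rewrite in_flat_map. split.
    + intros [a [Ha H]]. apply in_map_iff in H. destruct H as [u [E H]]. subst t. apply IHn in H. destruct H as [H1 H2].
      split; [simpl; lia|]. intros b [Hb|Hb]; [subst; exact Ha|auto].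
    + intros [H1 H2]. destruct t as [|a t]; [discriminate|]. exists a. split; [apply H2; left; reflexivity|]. apply in_map, IHn.
      split; [simpl in H1; lia|]. intros b Hb. apply H2. right. exact Hb.
Qed.

Lemma NoDup_map_in {A B} (h : A -> B) l : NoDup l -> (forall a a', In a l -> In a' l -> h a = h a' -> a = a') -> NoDup (map h l).
Proof.
  intros Hl. induction Hl as [|a l Ha Hl IH]; intros Hi; [constructor|]. simpl. constructor.
  - intros H. apply in_map_iff in H. destruct H as [b [E Hb]]. apply Ha. rewrite <- (Hi b a); [exact Hb|right; exact Hb|left; reflexivity|exact E].
  - apply IH. intros; apply Hi; [right|right|]; assumption.
Qed.

Lemma NoDup_flat_map_cons {A} (l : list A) (ts : list (list A)) : NoDup l -> NoDup ts -> NoDup (flat_map (fun a => map (cons a) ts) l).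
Proof.
  intros Hl Ht. induction Hl as [|a l Ha Hl IH]; [constructor|]. simpl. apply NoDup_app; [|exact IH|].
  - apply NoDup_map_in; [exact Ht|]. intros u v _ _ E. injection E; auto.
  - intros t H1 H2. apply in_map_iff in H1. destruct H1 as [u [E _]]. subst t. apply in_flat_map in H2. destruct H2 as [b [Hb H2]].
    apply in_map_iff in H2. destruct H2 as [v [E _]]. injection E; intros; subst. contradiction.
Qed.

Lemma NoDup_tuples {A} n (l : list A) : NoDup l -> NoDup (tuples n l).
Proof.
  intros H. induction n; [constructor; [intros []|constructor]|]. apply NoDup_flat_map_cons; assumption.
Qed.

Lemma sumR_incl {A} (f : A -> R) l l' : (forall a, 0 <= f a) -> NoDup l -> incl l l' -> sumR f l <= sumR f l'.
Proof.
  intros Hf H. revert l'. induction H as [|a l Ha Hl IH]; intros l' Hi; [apply sumR_nonneg; auto|].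
  destruct (in_split a l' (Hi a (or_introl eq_refl))) as [l1 [l2 E]]. subst l'. rewrite sumR_app. cbn [sumR].
  assert (sumR f l <= sumR f (l1 ++ l2)).
  { apply IH. intros b Hb. assert (Hb' := Hi b (or_intror Hb)). apply in_app_or in Hb'. apply in_or_app.
    destruct Hb' as [X|[X|X]]; [left; exact X|subst; contradiction|right; exact X]. }
  rewrite sumR_app in H. lra.
Qed.

Lemma sumR_inj {A B} (h : A -> B) (f : B -> R) l l' : (forall b, 0 <= f b) -> NoDup l ->
  (forall a a', In a l -> In a' l -> h a = h a' -> a = a') -> (forall a, In a l -> In (h a) l') -> sumR (fun a => f (h a)) l <= sumR f l'.
Proof.
  intros Hf Hl Hi Hin. rewrite <- sumR_map. apply sumR_incl; [exact Hf|apply NoDup_map_in; assumption|].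
  - intros b Hb. apply in_map_iff in Hb. destruct Hb as [a [E Ha]]. subst b. apply Hin, Ha.
Qed.

Lemma sumR_filter {A} (p : A -> bool) (f : A -> R) l : sumR f (filter p l) = sumR (fun a => if p a then f a else 0) l.
Proof. induction l; simpl; [reflexivity|]. destruct (p a); simpl; rewrite IHl; ring. Qed.

Lemma sumR_swap {A B} (f : A -> B -> R) l l' : sumR (fun a => sumR (f a) l') l = sumR (fun b => sumR (fun a => f a b) l) l'.
Proof.
  induction l; simpl; [induction l'; simpl; [reflexivity|rewrite <- IHl'; ring]|]. rewrite IHl, <- sumR_plus. reflexivity.
Qed.

Lemma sumR_list_prod {A B} (f : A * B -> R) l l' : sumR f (list_prod l l') = sumR (fun a => sumR (fun b => f (a, b)) l') l.
Proof. induction l; simpl; [reflexivity|]. rewrite sumR_app, sumR_map, IHl. reflexivity. Qed.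

(** * Finite products and matrices with coprime entries *)

Fixpoint npr (f : nat -> nat) (n : nat) : nat := match n with O => 1%nat | S n => (f O * npr (fun i => f (S i)) n)%nat end.

Fixpoint rpr (f : nat -> R) (n : nat) : R := match n with O => 1 | S n => f O * rpr (fun i => f (S i)) n end.

Definition lprod (l : list nat) : nat := fold_right Nat.mul 1%nat l.

Lemma npr_ext f g n : (forall i, (i < n)%nat -> f i = g i) -> npr f n = npr g n.
Proof. revert f g. induction n; intros f g H; [reflexivity|]. cbn [npr]. rewrite H by lia. f_equal. apply IHn. intros; apply H; lia. Qed.

Lemma npr_app f a b : npr f (a + b) = (npr f a * npr (fun i => f (a + i)%nat) b)%nat.
Proof. revert f. induction a; intros f; cbn [npr Nat.add]; [symmetry; apply Nat.mul_1_l|]. rewrite IHa, Nat.mul_assoc. reflexivity. Qed.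

Lemma npr_mult f g n : npr (fun i => f i * g i)%nat n = (npr f n * npr g n)%nat.
Proof. revert f g. induction n; intros f g; cbn [npr]; [reflexivity|]. rewrite IHn. ring. Qed.

Lemma npr_1 n : npr (fun _ => 1%nat) n = 1%nat.
Proof. induction n; simpl; lia. Qed.

Lemma npr_swap f a b : npr (fun i => npr (fun j => f i j) b) a = npr (fun j => npr (fun i => f i j) a) b.
Proof.
  revert f. induction a; intros f; cbn [npr]; [symmetry; apply npr_1|].
  rewrite (IHa (fun i => f (S i))), <- npr_mult. reflexivity.
Qed.

Lemma npr_block f a b : npr f (a * b) = npr (fun i => npr (fun j => f (i * b + j)%nat) b) a.
Proof.
  revert f. induction a; intros f; [reflexivity|]. cbn [Nat.mul npr]. rewrite npr_app, IHa. f_equal.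
  apply npr_ext. intros i _. apply npr_ext. intros j _. f_equal. lia.
Qed.

Lemma npr_extract f n j : (j < n)%nat -> npr f n = (f j * npr (fun i => if Nat.eqb i j then 1 else f i) n)%nat.
Proof.
  revert f j. induction n; intros f j H; [lia|]. destruct j; cbn [npr Nat.eqb].
  - rewrite Nat.mul_1_l. f_equal.
  - rewrite (IHn (fun i => f (S i)) j) by lia. ring.
Qed.

Lemma npr_pos f n : (forall i, (i < n)%nat -> (1 <= f i)%nat) -> (1 <= npr f n)%nat.
Proof.
  revert f. induction n; intros f H; simpl; [lia|]. assert (1 <= f O)%nat by (apply H; lia).
  assert (1 <= npr (fun i => f (S i)) n)%nat by (apply IHn; intros; apply H; lia). nia.
Qed.

Lemma npr_le f n N : (forall i, (i < n)%nat -> (f i <= N)%nat) -> (npr f n <= N ^ n)%nat.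
Proof.
  revert f. induction n; intros f H; simpl; [lia|]. apply Nat.mul_le_mono; [apply H; lia|]. apply IHn. intros; apply H; lia.
Qed.

Lemma gcd_one_r a : Nat.gcd a 1 = 1%nat.
Proof. apply Nat.divide_1_r, Nat.gcd_divide_r. Qed.

Lemma gcd_one_mul a b c : Nat.gcd a b = 1%nat -> Nat.gcd a c = 1%nat -> Nat.gcd a (b * c) = 1%nat.
Proof.
  intros H1 H2. destruct (Nat.gcd_divide a (b * c)) as [D1 D2]. set (d := Nat.gcd a (b * c)) in *.
  assert (E : Nat.gcd d b = 1%nat).
  { apply Nat.divide_1_r. rewrite <- H1. destruct (Nat.gcd_divide d b) as [F1 F2]. apply Nat.gcd_greatest; [apply (Nat.divide_trans _ _ _ F1 D1)|exact F2]. }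
  apply Nat.divide_1_r. rewrite <- H2. apply Nat.gcd_greatest; [exact D1|apply (Nat.gauss _ _ _ D2 E)].
Qed.

Lemma npr_coprime a f n : (forall i, (i < n)%nat -> Nat.gcd a (f i) = 1%nat) -> Nat.gcd a (npr f n) = 1%nat.
Proof.
  revert f. induction n; intros f H; cbn [npr]; [apply gcd_one_r|].
  apply gcd_one_mul; [apply H; lia|apply IHn; intros; apply H; lia].
Qed.

Lemma npr_lprod f s n : npr (fun i => f (s + i)%nat) n = lprod (map f (seq s n)).
Proof.
  revert s. induction n; intros s; [reflexivity|]. cbn [npr seq map lprod fold_right]. rewrite Nat.add_0_r. f_equal.
  fold (lprod (map f (seq (S s) n))). rewrite <- IHn. apply npr_ext. intros; f_equal; lia.
Qed.

Lemma npr_nth t : npr (fun i => nth i t 1%nat) (length t) = lprod t.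
Proof. induction t; [reflexivity|]. cbn [length npr nth]. rewrite IHt. reflexivity. Qed.

Lemma rpr_extract f n j : (j < n)%nat -> rpr f n = f j * rpr (fun i => if Nat.eqb i j then 1 else f i) n.
Proof.
  revert f j. induction n; intros f j H; [lia|]. destruct j; cbn [rpr Nat.eqb]; [ring|].
  rewrite (IHn (fun i => f (S i)) j) by lia. cbn [Nat.eqb]. ring.
Qed.

Lemma rpr_le f g n : (forall i, (i < n)%nat -> 0 <= f i <= g i) -> 0 <= rpr f n <= rpr g n.
Proof.
  revert f g. induction n; intros f g H; cbn [rpr]; [lra|].
  destruct (IHn (fun i => f (S i)) (fun i => g (S i)) ltac:(intros; apply H; lia)). destruct (H O ltac:(lia)).
  split; [apply Rmult_le_pos; assumption|apply Rmult_le_compat; assumption].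
Qed.

Lemma rpr_const c n : rpr (fun _ => c) n = c ^ n.
Proof. induction n; simpl; [reflexivity|]. rewrite IHn. reflexivity. Qed.

Lemma rpr_ext f g n : (forall i, (i < n)%nat -> f i = g i) -> rpr f n = rpr g n.
Proof. revert f g. induction n; intros f g H; [reflexivity|]. cbn [rpr]. rewrite H by lia. f_equal. apply IHn. intros; apply H; lia. Qed.

Lemma rpr_mult f g n : rpr (fun i => f i * g i) n = rpr f n * rpr g n.
Proof. revert f g. induction n; intros f g; cbn [rpr]; [ring|]. rewrite IHn. ring. Qed.

Lemma rpr_nonneg f n : (forall i, (i < n)%nat -> 0 <= f i) -> 0 <= rpr f n.
Proof. intros H. apply (rpr_le f f n). intros i Hi. generalize (H i Hi). lra. Qed.

Lemma tuples_rpr (w : nat -> nat -> R) n E :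
  sumR (fun t => rpr (fun i => w i (nth i t 1%nat)) n) (tuples n E) = rpr (fun i => sumR (w i) E) n.
Proof.
  revert w. induction n; intros w; [cbn [tuples sumR rpr]; ring|]. cbn [tuples rpr]. rewrite sumR_flat_map.
  rewrite (sumR_ext _ (fun a => rpr (fun i => sumR (w (S i)) E) n * w O a)).
  - rewrite sumR_scal. ring.
  - intros a _. rewrite sumR_map. cbn [nth]. rewrite sumR_scal, (IHn (fun i => w (S i))). ring.
Qed.

Lemma prods_tuples k N : prods k N = map lprod (tuples k (seq 1 N)).
Proof.
  assert (E : forall ts l, flat_map (fun a => map (Nat.mul a) (map lprod ts)) l = map lprod (flat_map (fun a => map (cons a) ts) l)).
  { intros ts l. induction l; [reflexivity|]. cbn [flat_map]. rewrite IHl, map_app, !map_map. reflexivity. }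
  induction k; [reflexivity|]. cbn [prods tuples]. rewrite IHk. apply E.
Qed.

Definition row (k : nat) (z : list nat) (i : nat) : nat := npr (fun j => nth (i * k + j) z 1%nat) k.

Definition col (k : nat) (z : list nat) (j : nat) : nat := npr (fun i => nth (i * k + j) z 1%nat) k.

Definition pairwise_coprime (z : list nat) : Prop :=
  forall p q, (p < length z)%nat -> (q < length z)%nat -> p <> q -> Nat.gcd (nth p z 1%nat) (nth q z 1%nat) = 1%nat.

Lemma row_prod k z : length z = (k * k)%nat -> npr (row k z) k = lprod z.
Proof. intros H. unfold row. rewrite <- (npr_block (fun p => nth p z 1%nat)), <- H. apply npr_nth. Qed.

Lemma col_prod k z : length z = (k * k)%nat -> npr (col k z) k = lprod z.
Proof. intros H. rewrite <- (row_prod k z H). unfold col, row. rewrite <- (npr_swap (fun i j => nth (i * k + j) z 1%nat)). reflexivity. Qed.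

(* A [k] by [k] matrix with pairwise coprime entries is recovered from its row
   and column products; it is stored as a list of length [k * k]. *)
Lemma entry_gcd k z i j : length z = (k * k)%nat -> pairwise_coprime z -> (i < k)%nat -> (j < k)%nat ->
  Nat.gcd (row k z i) (col k z j) = nth (i * k + j) z 1%nat.
Proof.
  intros Hz Hc Hi Hj. unfold row, col. rewrite (npr_extract _ k j Hj), (npr_extract (fun i => nth (i * k + j) z 1%nat) k i Hi).
  rewrite Nat.gcd_mul_mono_l. rewrite <- (Nat.mul_1_r (nth (i * k + j) z 1%nat)) at 2. f_equal.
  apply npr_coprime. intros i' Hi'. destruct (Nat.eqb_spec i' i) as [E|E]; [apply gcd_one_r|].
  rewrite Nat.gcd_comm. apply npr_coprime. intros j' Hj'. destruct (Nat.eqb_spec j' j) as [F|F]; [apply gcd_one_r|].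
  apply Hc; [rewrite Hz; nia|rewrite Hz; nia|]. nia.
Qed.

Lemma entries_inj k z z' : length z = (k * k)%nat -> length z' = (k * k)%nat -> pairwise_coprime z -> pairwise_coprime z' ->
  (forall i, (i < k)%nat -> row k z i = row k z' i) -> (forall j, (j < k)%nat -> col k z j = col k z' j) -> z = z'.
Proof.
  intros H1 H2 C1 C2 Hr Hcl. apply (nth_ext z z' 1%nat 1%nat); [lia|]. intros p Hp. rewrite H1 in Hp.
  assert (k0 : (k <> 0)%nat) by (intros E; subst k; simpl in Hp; lia).
  assert (E := Nat.div_mod p k k0). assert (B := Nat.mod_upper_bound p k k0).
  assert (A : (p / k < k)%nat) by (apply Nat.Div0.div_lt_upper_bound; lia).
  replace p with (p / k * k + p mod k)%nat by lia.
  rewrite <- (entry_gcd k z), <- (entry_gcd k z') by assumption. rewrite Hr, Hcl by assumption. reflexivity.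
Qed.

Definition eqw (xy : list nat * list nat) : R := if Nat.eq_dec (lprod (fst xy)) (lprod (snd xy)) then / INR (lprod (fst xy)) else 0.

Lemma INR_inv_nonneg n : 0 <= / INR n.
Proof. destruct n; [simpl; rewrite Rinv_0; lra|]. left. apply Rinv_0_lt_compat, INR_S_pos. Qed.

Lemma diag_tuples k M : diag (prods k M) (prods k M) = sumR eqw (list_prod (tuples k (seq 1 M)) (tuples k (seq 1 M))).
Proof.
  rewrite sumR_list_prod, prods_tuples. unfold diag. rewrite sumR_map. apply sumR_ext. intros x _. rewrite sumR_map. reflexivity.
Qed.

Lemma lprod_seq f k : lprod (map f (seq 0 k)) = npr f k.
Proof. rewrite <- npr_lprod. reflexivity. Qed.

(** Sending a matrix to its tuples of row and column products is injective on pairwise coprime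
    matrices and lands in the pairs counted by [diag]: the two total products coincide, and each row
    or column product is at most [N ^ k]. *)
Lemma coprime_sum_le k N M (l : list (list nat)) : NoDup l -> (N ^ k <= M)%nat ->
  (forall z, In z l -> length z = (k * k)%nat /\ pairwise_coprime z /\ forall a, In a z -> (1 <= a <= N)%nat) ->
  sumR (fun z => / INR (lprod z)) l <= diag (prods k M) (prods k M).
Proof.
  intros Hl HM Hz. rewrite diag_tuples.
  set (h := fun z => (map (row k z) (seq 0 k), map (col k z) (seq 0 k))).
  rewrite (sumR_ext _ (fun z => eqw (h z))).
  2: { intros z Hin. destruct (Hz z Hin) as (L & _ & _). unfold eqw, h. cbn [fst snd]. rewrite !lprod_seq, (row_prod k z L), (col_prod k z L).
       destruct (Nat.eq_dec (lprod z) (lprod z)); [reflexivity|contradiction]. }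
  (* The maximum with 1 covers the default value of [nth] outside the list. *)
  assert (Hn : forall z p, In z l -> (1 <= nth p z 1%nat <= Nat.max 1 N)%nat).
  { intros z p Hin. destruct (Hz z Hin) as (_ & _ & B). destruct (Nat.lt_ge_cases p (length z)) as [G|G].
    - specialize (B _ (nth_In z 1%nat G)). lia.
    - rewrite nth_overflow by exact G. lia. }
  apply sumR_inj.
  - intros xy. unfold eqw. destruct (Nat.eq_dec _ _); [apply INR_inv_nonneg|lra].
  - exact Hl.
  - intros z z' H1 H2 E. destruct (Hz z H1) as (L1 & C1 & _). destruct (Hz z' H2) as (L2 & C2 & _).
    injection E. intros E2 E1. apply (entries_inj k); auto; intros i Hi.
    + revert E1; rewrite map_ext_in_iff; intros Q; apply Q, in_seq; lia.
    + revert E2; rewrite map_ext_in_iff; intros Q; apply Q, in_seq; lia.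
  - intros z Hin. unfold h. apply in_prod; apply in_tuples; (split; [rewrite length_map, length_seq; reflexivity|]);
      intros a Ha; apply in_map_iff in Ha; destruct Ha as [i [E Hi]]; subst a; apply in_seq in Hi; apply in_seq.
    + assert (1 <= row k z i)%nat by (apply npr_pos; intros; apply Hn, Hin).
      assert (row k z i <= N ^ k)%nat; [|lia]. apply npr_le. intros j Hj. destruct (Hz z Hin) as (L & _ & B). apply B. apply nth_In. rewrite L. nia.
    + assert (1 <= col k z i)%nat by (apply npr_pos; intros; apply Hn, Hin).
      assert (col k z i <= N ^ k)%nat; [|lia]. apply npr_le. intros j Hj. destruct (Hz z Hin) as (L & _ & B). apply B. apply nth_In. rewrite L. nia.
Qed.

(** * Pairwise coprime tuples in an arithmetic progression *)

(** With [Q = m!], as chosen later, no element has a divisor in [2 .. m]. This makes common divisors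
    rare at the cost of a constant factor in the harmonic sum. *)
Definition prog (Q n : nat) : list nat := map (fun i => 1 + Q * i)%nat (seq 0 n).

Definition dvb (d e : nat) : bool := Nat.eqb (e mod d) 0.

Definition sig (Q n : nat) : R := sumR (fun e => / INR e) (prog Q n).

Lemma dvb_spec d e : d <> 0%nat -> dvb d e = true <-> Nat.divide d e.
Proof. intros H. unfold dvb. rewrite Nat.eqb_eq. apply Nat.Lcm0.mod_divide. Qed.

(* A block of [d] consecutive [i] contains at most one with [d] dividing
   [1 + Q i], and there [1 + Q i >= d (1 + Q (i / d))]. *)
Lemma sig_mult Q n d : (1 <= Q)%nat -> (1 <= d)%nat -> sumR (fun e => if dvb d e then / INR e else 0) (prog Q n) <= sig Q n * / INR d.
Proof.
  intros HQ Hd. unfold sig, prog. rewrite !sumR_map. rewrite <- (sumR_filter (fun i => dvb d (1 + Q * i))).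
  assert (d0 : 0 < INR d) by (apply lt_0_INR; lia).
  apply Rle_trans with (sumR (fun i => / INR d * / INR (1 + Q * (i / d))) (filter (fun i => dvb d (1 + Q * i)) (seq 0 n))).
  - apply sumR_le. intros i Hi. apply filter_In in Hi. destruct Hi as [_ Hi]. apply dvb_spec in Hi; [|lia]. destruct Hi as [m Hm].
    rewrite <- Rinv_mult, <- mult_INR. apply Rinv_le_contravar; [apply lt_0_INR; nia|]. apply le_INR.
    assert (E := Nat.Div0.mul_div_le i d). assert (Q * (i / d) < m)%nat; [|nia]. apply (Nat.mul_lt_mono_pos_r d); nia.
  - rewrite Rmult_comm, <- sumR_scal. apply (sumR_inj (fun i => i / d)%nat (fun t => / INR d * / INR (1 + Q * t))).
    + intros b. apply Rmult_le_pos; apply INR_inv_nonneg.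
    + apply NoDup_filter, seq_NoDup.
    + intros i i' Hi Hi' E. apply filter_In in Hi, Hi'. destruct Hi as [_ Hi], Hi' as [_ Hi'].
      apply dvb_spec in Hi; [|lia]. apply dvb_spec in Hi'; [|lia].
      assert (Cop : Nat.gcd d Q = 1%nat).
      { apply Nat.divide_1_r. destruct (Nat.gcd_divide d Q) as [F1 F2].
        apply (Nat.divide_add_cancel_r _ (Q * i)); [apply Nat.divide_mul_l, F2|]. rewrite Nat.add_comm. apply (Nat.divide_trans _ _ _ F1 Hi). }
      assert (K : forall a b, Nat.divide d (1 + Q * a) -> Nat.divide d (1 + Q * b) -> (a <= b)%nat -> (a / d = b / d)%nat -> a = b).
      { intros a b Da Db Hab Eq. assert (Nat.divide d (Q * (b - a))).
        { replace (Q * (b - a))%nat with ((1 + Q * b) - (1 + Q * a))%nat by nia. apply Nat.divide_sub_r; assumption. }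
        apply Nat.gauss in H; [|exact Cop]. destruct H as [m Hm].
        assert (Ma := Nat.div_mod a d ltac:(lia)). assert (Mb := Nat.div_mod b d ltac:(lia)).
        assert (Ua := Nat.mod_upper_bound a d ltac:(lia)). assert (Ub := Nat.mod_upper_bound b d ltac:(lia)).
        rewrite Eq in Ma. destruct m; [lia|nia]. }
      destruct (Nat.le_ge_cases i i') as [G|G]; [apply K; assumption|symmetry; apply K; auto].
    + intros i Hi. apply filter_In in Hi. destruct Hi as [Hi _]. apply in_seq in Hi. apply in_seq.
      assert (i / d <= i)%nat by (apply Nat.Div0.div_le_upper_bound; nia). lia.
Qed.

Lemma inv_sq_tail m c : (1 <= m)%nat -> sumR (fun d => (/ INR d) ^ 2) (seq (S m) c) <= / INR m - / INR (m + c).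
Proof.
  intros Hm. induction c; [rewrite Nat.add_0_r; simpl; lra|]. rewrite seq_S, sumR_app. cbn [sumR]. rewrite Rplus_0_r.
  replace (S m + c)%nat with (S (m + c)) by lia. rewrite Nat.add_succ_r. set (x := (m + c)%nat) in *.
  assert (0 < INR x) by (apply lt_0_INR; unfold x; lia). rewrite S_INR.
  assert ((/ (INR x + 1)) ^ 2 <= / INR x - / (INR x + 1)); [|lra].
  replace (/ INR x - / (INR x + 1)) with (/ (INR x * (INR x + 1))) by (field; lra). rewrite pow_inv. apply Rinv_le_contravar; nra.
Qed.

Lemma sumR_mem {A} (f : A -> R) l a : (forall b, 0 <= f b) -> In a l -> f a <= sumR f l.
Proof.
  intros Hf. induction l; intros H; [destruct H|]. cbn [sumR]. assert (0 <= sumR f l) by (apply sumR_nonneg; auto).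
  destruct H as [H|H]; [subst; lra|]. generalize (IHl H) (Hf a0). lra.
Qed.

Definition badw (p q d i e : nat) : R := if (Nat.eqb i p || Nat.eqb i q)%bool then (if dvb d e then / INR e else 0) else / INR e.

(** For [p <> q] this is the weight [1 / lprod z] of a tuple of length [K] if [d] divides its
    entries [p] and [q], and 0 otherwise. The product form lets the sum over tuples factorise; the
    two marked factors then each gain [1 / d] from [sig_mult]. *)
Definition badt (K p q d : nat) (z : list nat) : R := if Nat.eqb p q then 0 else rpr (fun i => badw p q d i (nth i z 1%nat)) K.

Lemma badw_nonneg p q d i e : 0 <= badw p q d i e.
Proof. unfold badw. destruct (_ || _)%bool; [destruct (dvb d e); [|lra]|]; apply INR_inv_nonneg. Qed.

Lemma badt_nonneg K p q d z : 0 <= badt K p q d z.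
Proof. unfold badt. destruct (Nat.eqb p q); [lra|]. apply rpr_nonneg. intros; apply badw_nonneg. Qed.

Lemma rpr_inv z : rpr (fun i => / INR (nth i z 1%nat)) (length z) = / INR (lprod z).
Proof. induction z; [simpl; rewrite Rinv_1; reflexivity|]. cbn [length rpr nth lprod fold_right]. fold (lprod z). rewrite IHz, mult_INR, Rinv_mult. reflexivity. Qed.

Lemma sig_nonneg Q n : 0 <= sig Q n.
Proof. apply sumR_nonneg. intros; apply INR_inv_nonneg. Qed.

Lemma badt_sum K p q d Q n : (1 <= Q)%nat -> (1 <= d)%nat -> (p < K)%nat -> (q < K)%nat ->
  sumR (badt K p q d) (tuples K (prog Q n)) <= sig Q n ^ K * (/ INR d) ^ 2.
Proof.
  intros HQ Hd Hp Hq. assert (i0 := INR_inv_nonneg d). assert (s0 := sig_nonneg Q n). unfold badt. destruct (Nat.eqb_spec p q) as [E|E].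
  - rewrite sumR_const, Rmult_0_r. apply Rmult_le_pos; [apply pow_le, s0|apply pow2_ge_0].
  - rewrite tuples_rpr. set (c := / INR d) in *. set (g := fun i => if (Nat.eqb i p || Nat.eqb i q)%bool then c else 1).
    eapply Rle_trans; [apply (rpr_le _ (fun i => sig Q n * g i))|].
    + intros i _. split; [apply sumR_nonneg; intros; apply badw_nonneg|]. unfold g, badw. destruct (_ || _)%bool; [apply sig_mult; assumption|].
      rewrite Rmult_1_r. apply Rle_refl.
    + rewrite rpr_mult, rpr_const. apply Rmult_le_compat_l; [apply pow_le, s0|].
      rewrite (rpr_extract g K p Hp), (rpr_extract _ K q Hq). rewrite (rpr_ext _ (fun _ => 1)), rpr_const, pow1.
      * unfold g. rewrite !Nat.eqb_refl, Bool.orb_true_r. destruct (Nat.eqb_spec q p); [lia|]. cbn [orb]. lra.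
      * intros i _. unfold g. destruct (Nat.eqb i q), (Nat.eqb i p); reflexivity.
Qed.

Lemma fact_divide d m : (1 <= d <= m)%nat -> Nat.divide d (fact m).
Proof.
  induction m; intros H; [lia|]. cbn [fact]. change (fact m + m * fact m)%nat with (S m * fact m)%nat.
  destruct (Nat.eq_dec d (S m)) as [E|E]; [subst; apply Nat.divide_factor_l|]. apply Nat.divide_mul_r, IHm. lia.
Qed.

(* A common divisor of two elements of [prog (fact m) n] is prime to [fact m],
   hence 1 or larger than [m]. *)
Lemma bad_witness K m n z : (1 <= m)%nat -> In z (tuples K (prog (fact m) n)) -> ~ pairwise_coprime z ->
  exists p q d, (p < K)%nat /\ (q < K)%nat /\ In d (seq (S m) (1 + fact m * n)) /\ badt K p q d z = / INR (lprod z).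
Proof.
  intros Hm Hz Hb. apply in_tuples in Hz. destruct Hz as [Lz Ez].
  assert (exists p q, (p < K)%nat /\ (q < K)%nat /\ p <> q /\ Nat.gcd (nth p z 1%nat) (nth q z 1%nat) <> 1%nat) as (p & q & Hp & Hq & Hpq & Hg).
  { apply NNPP. intros H. apply Hb. intros p q Hp Hq Hpq. apply NNPP. intros Hg. apply H. exists p, q. rewrite Lz in Hp, Hq. auto. }
  set (d := Nat.gcd (nth p z 1%nat) (nth q z 1%nat)) in *.
  destruct (Nat.gcd_divide (nth p z 1%nat) (nth q z 1%nat)) as [D1 D2]. fold d in D1, D2.
  assert (Hin := Ez _ (nth_In z 1%nat ltac:(rewrite Lz; exact Hp))). apply in_map_iff in Hin. destruct Hin as [i [Ei Hi]]. apply in_seq in Hi.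
  assert (d0 : d <> 0%nat). { intros E. rewrite E in D1. apply Nat.divide_0_l in D1. lia. }
  assert (dm : (m < d)%nat).
  { apply Nat.lt_nge. intros G. assert (F := fact_divide d m ltac:(lia)). rewrite <- Ei in D1. apply Hg. apply Nat.divide_1_r.
    apply (Nat.divide_add_cancel_r _ (fact m * i)); [apply Nat.divide_mul_l, F|]. rewrite Nat.add_comm. exact D1. }
  assert (dle : (d <= nth p z 1)%nat) by (apply Nat.divide_pos_le; [lia|exact D1]).
  exists p, q, d. split; [exact Hp|]. split; [exact Hq|]. split.
  - apply in_seq. assert (fact m * i <= fact m * n)%nat by (apply Nat.mul_le_mono_l; lia). lia.
  - unfold badt. destruct (Nat.eqb_spec p q); [contradiction|]. rewrite <- rpr_inv, Lz. apply rpr_ext. intros j Hj. unfold badw.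
    destruct (Nat.eqb_spec j p) as [E|E]; [subst j; rewrite (proj2 (dvb_spec d _ d0) D1); reflexivity|].
    destruct (Nat.eqb_spec j q) as [F|F]; [subst j; rewrite (proj2 (dvb_spec d _ d0) D2)|]; reflexivity.
Qed.

Lemma sumR_le_const {A} (f : A -> R) c l : (forall a, In a l -> f a <= c) -> sumR f l <= INR (length l) * c.
Proof. intros H. rewrite <- sumR_const. apply sumR_le, H. Qed.

Definition goodb (z : list nat) : bool := if excluded_middle_informative (pairwise_coprime z) then true else false.

(** Union bound: a bad tuple has two entries with a common divisor [d > m], so the bad tuples weigh
    at most [K ^ 2] times the sum of [1 / d ^ 2] over [d > m], that is a fraction
    [K ^ 2 / m <= 1 / 2] of the total. *)
Lemma good_sum K m n : (1 <= m)%nat -> 2 * INR K ^ 2 <= INR m ->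
  sig (fact m) n ^ K / 2 <= sumR (fun z => / INR (lprod z)) (filter goodb (tuples K (prog (fact m) n))).
Proof.
  intros Hm HK. set (Q := fact m). assert (HQ : (1 <= Q)%nat) by (apply lt_O_fact). set (s := sig Q n ^ K). set (ts := tuples K (prog Q n)).
  assert (s0 : 0 <= s) by (apply pow_le, sig_nonneg). assert (m0 : 1 <= INR m) by (apply (le_INR 1), Hm).
  assert (Tot : sumR (fun z => / INR (lprod z)) ts = s).
  { unfold s. rewrite <- rpr_const. transitivity (rpr (fun _ => sumR (fun e => / INR e) (prog Q n)) K); [|reflexivity].
    rewrite <- (tuples_rpr (fun _ e => / INR e)). apply sumR_ext. intros z Hz. apply in_tuples in Hz. destruct Hz as [Lz _]. rewrite <- rpr_inv, Lz. reflexivity. }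
  rewrite sumR_filter.
  set (ds := seq (S m) (1 + Q * n)).
  assert (Bad : sumR (fun z => if goodb z then 0 else / INR (lprod z)) ts <= s / 2).
  { apply Rle_trans with (sumR (fun z => sumR (fun p => sumR (fun q => sumR (fun d => badt K p q d z) ds) (seq 0 K)) (seq 0 K)) ts).
    - apply sumR_le. intros z Hz. unfold goodb. destruct (excluded_middle_informative _) as [G|G].
      + apply sumR_nonneg; intros; apply sumR_nonneg; intros; apply sumR_nonneg; intros; apply badt_nonneg.
      + destruct (bad_witness K m n z Hm Hz G) as (p & q & d & Hp & Hq & Hd & E). rewrite <- E.
        eapply Rle_trans; [|apply (sumR_mem (fun p => sumR (fun q => sumR (fun d => badt K p q d z) ds) (seq 0 K)) (seq 0 K) p)].
        * eapply Rle_trans; [|apply (sumR_mem (fun q => sumR (fun d => badt K p q d z) ds) (seq 0 K) q)].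
          -- apply (sumR_mem (fun d => badt K p q d z)); [intros; apply badt_nonneg|exact Hd].
          -- intros; apply sumR_nonneg; intros; apply badt_nonneg.
          -- apply in_seq; lia.
        * intros; apply sumR_nonneg; intros; apply sumR_nonneg; intros; apply badt_nonneg.
        * apply in_seq; lia.
    - rewrite sumR_swap. apply Rle_trans with (INR (length (seq 0 K)) * (INR (length (seq 0 K)) * (s * / INR m))).
      + apply sumR_le_const. intros p Hp. rewrite sumR_swap. apply sumR_le_const. intros q Hq. rewrite sumR_swap.
        apply in_seq in Hp, Hq. apply Rle_trans with (sumR (fun d => s * (/ INR d) ^ 2) ds).
        * apply sumR_le. intros d Hd. apply in_seq in Hd. apply badt_sum; lia.
        * rewrite sumR_scal. apply Rmult_le_compat_l; [exact s0|]. eapply Rle_trans; [apply inv_sq_tail, Hm|]. generalize (INR_inv_nonneg (m + (1 + Q * n))). lra.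
      + rewrite length_seq. replace (INR K * (INR K * (s * / INR m))) with (s * (INR K ^ 2 / INR m)) by (field; lra).
        unfold Rdiv at 2. apply Rmult_le_compat_l; [exact s0|]. apply <- Rle_div_l; lra. }
  assert (Sum : sumR (fun z => if goodb z then / INR (lprod z) else 0) ts + sumR (fun z => if goodb z then 0 else / INR (lprod z)) ts = s).
  { rewrite <- sumR_plus, <- Tot. apply sumR_ext. intros z _. destruct (goodb z); ring. }
  lra.
Qed.

(** Comparison with the harmonic sum through [1 + Q i <= (1 + Q) (i + 1)]. *)
Lemma sig_lower Q n : ln (INR (S n)) * / INR (1 + Q) <= sig Q n.
Proof.
  unfold sig, prog. rewrite sumR_map. induction n; [simpl; rewrite ln_1; lra|]. rewrite seq_S, sumR_app. cbn [sumR]. rewrite Rplus_0_r, Nat.add_0_l.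
  assert (A : ln (INR (S (S n))) <= ln (INR (S n)) + / INR (S n)).
  { assert (P := INR_S_pos n). rewrite (S_INR (S n)). assert (E : ln (INR (S n) + 1) = ln (INR (S n)) + ln (1 + / INR (S n))).
    { rewrite <- ln_mult; [f_equal; field; lra|exact P|]. generalize (Rinv_0_lt_compat _ P). lra. }
    rewrite E. generalize (ln_le_pred (1 + / INR (S n))) (Rinv_0_lt_compat _ P). lra. }
  assert (Bq : / INR (S n) * / INR (1 + Q) <= / INR (1 + Q * n)).
  { rewrite <- Rinv_mult, <- mult_INR. apply Rinv_le_contravar; [apply lt_0_INR; lia|apply le_INR; nia]. }
  assert (C0 := INR_inv_nonneg (1 + Q)). nra.
Qed.

Lemma diag_lower k : exists c M1 : R, 0 < c /\
  forall M : nat, M1 <= INR M -> (1 <= M)%nat -> c * ln (INR M) ^ (S k ^ 2) <= diag (prods (S k) M) (prods (S k) M).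
Proof.
  (* [K] is the number of matrix entries, and [m = 2 K ^ 2] is the threshold of [good_sum]. The
     modulus [Q] therefore depends on [k] alone and costs only a constant. *)
  set (K := (S k ^ 2)%nat). set (m := (2 * K ^ 2)%nat). set (Q := fact m). set (kk := INR (S k)). assert (kp : 0 < kk) by apply INR_S_pos.
  assert (HK : (1 <= K)%nat) by (unfold K; simpl; lia). assert (Hm : (1 <= m)%nat) by (unfold m; simpl; nia).
  assert (HQ : (1 <= Q)%nat) by apply lt_O_fact. assert (q1 : 1 <= INR Q) by (apply (le_INR 1), HQ).
  set (lq := ln (2 * INR Q)). assert (lq0 : 0 <= lq) by (apply ln_le_x; lra).
  set (b := / INR (1 + Q)). assert (b0 : 0 < b) by (apply Rinv_0_lt_compat, lt_0_INR; lia).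
  (* The threshold makes [ln M / kk >= 2 lq + 1], so dividing by [2 Q] costs at most half of this
     logarithm, whence the [2 * kk]; the last factor [1 / 2] is that of [good_sum]. *)
  exists ((b / (2 * kk)) ^ K / 2), (exp (kk * (2 * lq + 1))). split.
  { apply Rdiv_lt_0_compat; [|lra]. apply pow_lt, Rdiv_lt_0_compat; lra. }
  intros M HM M1. assert (m1 : 1 <= INR M) by (apply (le_INR 1), M1).
  set (LM := ln (INR M)). assert (HL : kk * (2 * lq + 1) <= LM).
  { unfold LM. rewrite <- (ln_exp (kk * (2 * lq + 1))). apply ln_le; [apply exp_pos|exact HM]. }
  (* The root of [M] of order [S k]: entries up to [y] keep row and column products below [M]. *)
  set (y := exp (LM / kk)).
  assert (Hy : 2 * lq + 1 <= LM / kk) by (apply -> Rle_div_r; [lra|exact kp]).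
  assert (y2 : 2 <= y) by (unfold y; generalize (exp_ineq1_le (LM / kk)); lra).
  assert (yk : y ^ S k = INR M). { unfold y. rewrite exp_INR_pow. fold kk. replace (kk * (LM / kk)) with LM by (field; lra). apply exp_ln. lra. }
  destruct (nfl_spec ((y - 1) / INR Q) ltac:(apply Rdiv_le_0_compat; lra)) as [N1 N2]. set (n := nfl ((y - 1) / INR Q)) in *.
  assert (N1' : INR n * INR Q <= y - 1) by (apply <- Rle_div_r; [exact N1|lra]).
  set (N := (1 + Q * n)%nat).
  assert (HN : (N ^ S k <= M)%nat).
  { apply INR_le. rewrite pow_INR, <- yk. apply pow_incr. split; [apply pos_INR|]. unfold N. rewrite plus_INR, mult_INR. simpl (INR 1). lra. }
  assert (Hn : LM / (2 * kk) <= ln (INR (S n))).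
  { assert (A : y / (2 * INR Q) <= INR (S n)).
    { rewrite S_INR. apply Rle_trans with ((y - 1) / INR Q); [|lra]. replace (y / (2 * INR Q)) with (y / 2 / INR Q) by (field; lra).
      apply Rmult_le_compat_r; [left; apply Rinv_0_lt_compat; lra|lra]. }
    apply ln_le in A; [|apply Rdiv_lt_0_compat; lra]. rewrite ln_div in A by lra. fold lq in A. unfold y in A. rewrite ln_exp in A.
    replace (LM / (2 * kk)) with (LM / kk / 2) by (field; lra). lra. }
  assert (Sg : b / (2 * kk) * LM <= sig Q n).
  { eapply Rle_trans; [|apply sig_lower]. fold b. replace (b / (2 * kk) * LM) with (LM / (2 * kk) * b) by (field; lra). apply Rmult_le_compat_r; lra. }
  assert (L0 : 0 <= LM) by (apply ln_le_x; exact m1).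
  apply Rle_trans with (sig Q n ^ K / 2).
  - replace ((b / (2 * kk)) ^ K / 2 * LM ^ K) with ((b / (2 * kk) * LM) ^ K / 2) by (rewrite Rpow_mult_distr; field).
    apply Rmult_le_compat_r; [lra|]. apply pow_incr. split; [|exact Sg]. apply Rmult_le_pos; [left; apply Rdiv_lt_0_compat; lra|exact L0].
  - eapply Rle_trans; [apply good_sum; [exact Hm|]|].
    + unfold m. rewrite mult_INR, pow_INR. simpl (INR 2). lra.
    + apply (coprime_sum_le (S k) N M); [|exact HN|].
      * apply NoDup_filter, NoDup_tuples. unfold prog. apply NoDup_map_in; [apply seq_NoDup|]. intros a a' _ _ E. fold Q in E. nia.
      * intros z Hz. apply filter_In in Hz. destruct Hz as [Hz G]. apply in_tuples in Hz. destruct Hz as [Lz Ez]. split; [|split].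
        -- rewrite Lz. unfold K. simpl. lia.
        -- unfold goodb in G. destruct (excluded_middle_informative _) as [g|g]; [exact g|discriminate].
        -- intros a Ha. apply Ez in Ha. apply in_map_iff in Ha. destruct Ha as [i [E Hi]]. apply in_seq in Hi. subst a. unfold N.
           assert (fact m * i <= Q * n)%nat by (apply Nat.mul_le_mono_l; lia). lia.
Qed.

(** * Choice of parameters *)

Lemma exp_ge_sq C b L : 0 < b -> 0 <= C -> 0 <= L -> 27 * C * / b ^ 3 <= L -> C * L ^ 2 <= exp (b * L).
Proof.
  intros Hb HC HL H. replace (b * L) with (INR 3 * (b * L / 3)) by (simpl; field). rewrite <- exp_INR_pow.
  assert (0 <= b * L / 3) by (apply Rmult_le_pos; [apply Rmult_le_pos; lra|lra]).
  apply Rle_trans with ((b * L / 3) ^ 3).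
  - replace ((b * L / 3) ^ 3) with (b ^ 3 / 27 * L * L ^ 2) by field. apply Rmult_le_compat_r; [apply pow2_ge_0|].
    assert (0 < b ^ 3) by (apply pow_lt, Hb). apply (Rmult_le_compat_l (b ^ 3 / 27)) in H; [|lra].
    replace (b ^ 3 / 27 * (27 * C * / b ^ 3)) with C in H by (field; lra). exact H.
  - apply pow_incr. split; [assumption|]. generalize (exp_ineq1_le (b * L / 3)). lra.
Qed.

Lemma Rpower_exp T b : Rpower T b = exp (b * ln T).
Proof. reflexivity. Qed.

Lemma hardy_moment_lower (k : nat) (alpha c M1 : R) : (1 <= k)%nat -> 0 < alpha <= 1 -> 0 < c ->
  (forall M : nat, M1 <= INR M -> (1 <= M)%nat -> c * ln (INR M) ^ (S k ^ 2) <= diag (prods (S k) M) (prods (S k) M)) ->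
  exists c' T0, 0 < c' /\ forall T H, T0 <= T -> Rpower T alpha <= H <= T ->
    c' * (H * ln T ^ (S k ^ 2 + 2)) <= RInt (fun t => dG (S k) t ^ 2) T (T + H).
Proof.
  intros Hk Ha Hc Har.
  destruct gn_Re_lower as [K0 [HK0 Hgn]].
  set (kk := INR (S k)). assert (Hkk : 2 <= kk) by (apply (le_INR 2); lia).
  (* Windows have scale [D = T ^ be] and half-width [B = D * ln T]; since [T ^ alpha = T ^ (8 be)],
     many of them fit in an interval of length [H]. *)
  set (be := alpha / 8). assert (Hbe : 0 < be <= 1 / 8) by (unfold be; lra).
  (* The factors run up to [M], about [T ^ de], so their products stay below [K <= T ^ (be / 2)],
     the square root of [D]. *)
  set (de := be / (2 * kk)). assert (Hde : 0 < de) by (unfold de; apply Rdiv_lt_0_compat; lra).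
  assert (Hde1 : de <= be / 4) by (unfold de; apply Rmult_le_compat_l; [lra|apply Rinv_le_contravar; lra]).
  set (nu := (2 * S k + 8)%nat). set (w := (3 * k + 2 * nu + 10)%nat). set (p := (w * S k + 2 * nu + 2 * S k + 8)%nat).
  set (q := (S k ^ 2)%nat). assert (Hq1 : (1 <= q)%nat) by (unfold q; simpl; lia).
  (* Lower thresholds for [L = ln T]: [e1] gives [6 B <= H], [e2] gives [L ^ 2 <= eta * D], [e3]
     gives [2 <= de * L], [e4] brings [M] above [M1], [e5] gives [1 <= S0], [e6] gives
     [1 <= be * L], and [e7] absorbs the constant [K0] of [gn_Re_lower]. *)
  set (e1 := 27 * 6 * / be ^ 3). assert (P1 : 0 <= e1) by (unfold e1; assert (0 < / be ^ 3) by (apply Rinv_0_lt_compat, pow_lt; lra); lra).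
  set (e2 := 27 * 2 * / (be / 2) ^ 3). assert (P2 : 0 <= e2) by (unfold e2; assert (0 < / (be / 2) ^ 3) by (apply Rinv_0_lt_compat, pow_lt; lra); lra).
  set (e3 := 2 / de). assert (P3 : 0 < e3) by (apply Rdiv_lt_0_compat; lra).
  set (e4 := Rabs M1 / de). assert (P4 : 0 <= e4) by (apply Rdiv_le_0_compat; [apply Rabs_pos|lra]).
  assert (cde : 0 < c * de) by (apply Rmult_lt_0_compat; assumption).
  set (e5 := 2 / (c * de)). assert (P5 : 0 < e5) by (apply Rdiv_lt_0_compat; lra).
  set (e6 := / be). assert (P6 : 0 < e6) by (apply Rinv_0_lt_compat; lra).
  set (e7 := 4 * kk * K0). assert (P7 : 0 <= e7) by (unfold e7; nra).
  set (L0 := 600 + kk + e1 + e2 + e3 + e4 + e5 + e6 + e7 + (2 * INR p + 4)). assert (Pp := pos_INR p).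
  (* Here [640000 = 40000 * 8 * 2]: the constant of [window], the overlap of the weights, and the
     half of [H] covered by the steps between centres. The factor [de / 2] compares [ln M] with
     [ln T]. *)
  exists (c * (de / 2) ^ q / 640000), (exp L0). split.
  { apply Rdiv_lt_0_compat; [|lra]. apply Rmult_lt_0_compat; [exact Hc|apply pow_lt; lra]. }
  intros T H HT [HH1 HH2].
  assert (T0 : 0 < T) by (generalize (exp_pos L0); lra).
  set (L := ln T). assert (HL : L0 <= L) by (unfold L; rewrite <- (ln_exp L0); apply ln_le; [apply exp_pos|exact HT]).
  assert (ET : T = exp L) by (unfold L; rewrite exp_ln; lra).
  assert (HLT : L + 1 <= T) by (rewrite ET; generalize (exp_ineq1_le L); lra).
  assert (HL600 : 600 <= L) by (unfold L0 in HL; lra).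
  set (D := exp (be * L)). set (B := D * L).
  assert (beL : be * L <= 1 / 8 * L) by (apply Rmult_le_compat_r; lra).
  assert (be1 : 1 <= be * L). { assert (e6 <= L) by (unfold L0 in HL; lra). unfold e6 in H0. apply (Rmult_le_compat_l be) in H0; [|lra]. rewrite Rinv_r in H0; lra. }
  assert (HD : 2 <= D) by (unfold D; generalize (exp_ineq1_le (be * L)); lra).
  assert (HDT : D <= T) by (rewrite ET; apply exp_le_mono; nra).
  assert (HDB : D <= B) by (unfold B; rewrite <- (Rmult_1_r D) at 1; apply Rmult_le_compat_l; lra).
  assert (H6 : 6 * B <= H).
  { eapply Rle_trans; [|exact HH1]. rewrite Rpower_exp. fold L. replace (alpha * L) with (be * L + (7 * be) * L) by (unfold be; field). rewrite exp_plus. fold D. unfold B.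
    replace (6 * (D * L)) with (D * (6 * L)) by ring. apply Rmult_le_compat_l; [lra|]. apply Rle_trans with (exp (be * L)); [|apply exp_le_mono; nra].
    apply Rle_trans with (6 * L ^ 2); [nra|]. apply exp_ge_sq; try lra. fold e1. unfold L0 in HL; lra. }
  assert (HBT : B <= T) by lra.
  set (M := nfl (Rpower T de)).
  assert (HdeL : 2 <= de * L). { assert (e3 <= L) by (unfold L0 in HL; lra). unfold e3 in H0. apply (Rmult_le_compat_l de) in H0; [|lra]. replace (de * (2 / de)) with 2 in H0 by (field; lra). exact H0. }
  assert (Em : de * L + 1 <= Rpower T de) by (rewrite Rpower_exp; fold L; generalize (exp_ineq1_le (de * L)); lra).
  destruct (nfl_spec (Rpower T de) ltac:(lra)) as [M2 M3]. fold M in M2, M3.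
  assert (M1' : (1 <= M)%nat) by (apply INR_le; cbn [INR]; lra).
  assert (TdT : Rpower T de <= T) by (rewrite Rpower_exp, ET; unfold L; rewrite ln_exp; apply exp_le_mono; fold L; rewrite <- (Rmult_1_l L) at 2; apply Rmult_le_compat_r; lra).
  set (K := INR (M ^ S k)).
  assert (HK : K <= exp (be / 2 * L)).
  { unfold K. rewrite pow_INR. apply Rle_trans with (Rpower T de ^ S k); [apply pow_incr; split; [apply pos_INR|exact M2]|].
    rewrite Rpower_exp, exp_INR_pow. apply exp_le_mono. fold L kk. right. unfold de. field. lra. }
  assert (HK1 : 1 <= K). { unfold K. apply (le_INR 1). apply Nat.neq_0_lt_0, Nat.pow_nonzero. lia. }
  assert (HlnK : ln K <= be / 2 * L) by (rewrite <- (ln_exp (be / 2 * L)); apply ln_le; lra).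
  set (eta := / (2 * K)).
  (* [D] is the square of [T ^ (be / 2)] and [K] is at most one such factor, so [eta * D] is at
     least half of the other. *)
  assert (Heta : L ^ 2 <= eta * D).
  { assert (Q : 2 * L ^ 2 <= exp (be / 2 * L)) by (apply exp_ge_sq; try lra; fold e2; unfold L0 in HL; lra).
    assert (ED : D = exp (be / 2 * L) * exp (be / 2 * L)) by (unfold D; rewrite <- exp_plus; f_equal; field).
    unfold eta. rewrite Rmult_comm. change (L ^ 2 <= D / (2 * K)). apply -> Rle_div_r; [|lra]. rewrite ED. set (x := exp (be / 2 * L)) in *.
    assert (0 <= L ^ 2) by apply pow2_ge_0. replace (L ^ 2 * (2 * K)) with (2 * L ^ 2 * K) by ring. apply Rmult_le_compat; lra. }
  (* [N] is the length of the approximation to [theta'] and [W] that of the Dirichlet polynomial,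
     with the exponents required by [err_small]. *)
  set (N := nfl (T ^ nu)). set (W := nfl (T ^ w)).
  assert (Tp : forall n, (1 <= n)%nat -> T <= T ^ n). { intros n Hn. replace T with (T ^ 1) at 1 by ring. apply Rle_pow; [lra|exact Hn]. }
  destruct (nfl_spec (T ^ nu) ltac:(generalize (Tp nu ltac:(unfold nu; lia)); lra)) as [N2 N3]. fold N in N2, N3.
  destruct (nfl_spec (T ^ w) ltac:(generalize (Tp w ltac:(unfold w; lia)); lra)) as [W2 W3]. fold W in W2, W3.
  assert (HMW : (M <= W)%nat).
  { apply Nat.lt_succ_r, INR_lt. rewrite S_INR. generalize (Tp w ltac:(unfold w; lia)). lra. }
  set (S0 := diag (prods (S k) M) (prods (S k) M)).
  assert (HlnM : de / 2 * L <= ln (INR M)).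
  { assert (Rpower T de * exp (- (1)) <= INR M).
    { assert (exp (- (1)) <= / 2) by (rewrite exp_Ropp; apply Rinv_le_contravar; [lra|generalize (exp_ineq1_le 1); lra]). assert (Rpower T de * exp (- (1)) <= Rpower T de * / 2) by (apply Rmult_le_compat_l; lra). lra. }
    rewrite Rpower_exp, <- exp_plus in H0. fold L in H0. assert (H3 : ln (exp (de * L + - (1))) <= ln (INR M)) by (apply ln_le; [apply exp_pos|exact H0]).
    rewrite ln_exp in H3. lra. }
  assert (HS : c * (de / 2 * L) ^ q <= S0).
  { eapply Rle_trans; [|apply Har; [|exact M1']].
    - apply Rmult_le_compat_l; [lra|]. apply pow_incr. split; [lra|exact HlnM].
    - apply Rle_trans with (de * L); [|lra]. eapply Rle_trans; [apply Rle_abs|].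
      assert (e4 <= L) by (unfold L0 in HL; lra). unfold e4 in H0. apply (Rmult_le_compat_l de) in H0; [|lra]. replace (de * (Rabs M1 / de)) with (Rabs M1) in H0 by (field; lra). exact H0. }
  assert (HS1 : 1 <= S0).
  { eapply Rle_trans; [|exact HS]. assert (e5 <= L) by (unfold L0 in HL; lra).
    assert (1 <= c * (de / 2 * L)). { unfold e5 in H0. apply (Rmult_le_compat_l (c * de / 2)) in H0; [|lra]. replace (c * de / 2 * (2 / (c * de))) with 1 in H0 by (field; lra). lra. }
    apply Rle_trans with (c * (de / 2 * L)); [assumption|]. apply Rmult_le_compat_l; [lra|].
    set (x := de / 2 * L) in *. assert (1 <= x) by (unfold x; lra). replace x with (x ^ 1) at 1 by ring. apply Rle_pow; assumption. }
  (* As [kk >= 2], the main term is at least [L]; the constant takes at most [L / 4] and [ln K] at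
     most [L / 16], so the logarithm of the products does not cancel [k theta']. *)
  assert (Hq : forall t, T <= t <= 3 * T -> L / 2 <= INR (S k) * Re (gn (S N) (2, t)) - ln K).
  { intros t Ht. assert (TT : 3 * T <= INR (S N)).
    { assert (T ^ 2 <= T ^ nu) by (apply Rle_pow; [lra|unfold nu; lia]). rewrite S_INR. assert (3 * T <= T ^ 2) by (simpl; rewrite Rmult_1_r; apply Rmult_le_compat_r; lra). lra. }
    assert (G := Hgn (S N) t ltac:(lra) ltac:(lra)). assert (L <= ln t) by (apply ln_le; lra). fold kk.
    assert (kk * (L / 2 - K0) <= kk * Re (gn (S N) (2, t))) by (apply Rmult_le_compat_l; lra).
    assert (2 * (L / 2) <= kk * (L / 2)) by (apply Rmult_le_compat_r; lra).
    assert (be / 2 * L <= 1 / 16 * L) by (apply Rmult_le_compat_r; lra). assert (G7 : e7 <= L) by (unfold L0 in HL; lra). unfold e7 in G7. lra. }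
  assert (HKT : K <= T) by (eapply Rle_trans; [exact HK|]; rewrite ET; apply exp_le_mono; lra).
  destruct (err_small k N W nu w p T K D B eta eq_refl eq_refl eq_refl ltac:(lra) ltac:(fold kk; unfold L0 in HL; lra) (conj HK1 HKT) ltac:(lra) ltac:(lra) eq_refl Heta
    ltac:(rewrite S_INR; lra) N2 ltac:(rewrite S_INR; lra) W2 ltac:(fold L; unfold L0 in HL; lra)) as [Er1 Er2].
  (* The number of centres at spacing [D] whose full windows fit into [[T, T + H]]. Rounding and
     margins cost [2 B + D <= 3 B <= H / 2]. *)
  set (nc := nfl ((H - 2 * B) / D)).
  destruct (nfl_spec ((H - 2 * B) / D) ltac:(apply Rdiv_le_0_compat; lra)) as [C1 C2]. fold nc in C1, C2.
  assert (C1' : INR nc * D <= H - 2 * B) by (apply <- Rle_div_r; [exact C1|lra]).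
  assert (Cj : forall j, (j < nc)%nat -> B + INR j * D + B <= H).
  { intros j Hj. assert (INR j <= INR nc) by (apply le_INR; lia). assert (INR j * D <= INR nc * D) by (apply Rmult_le_compat_r; lra). lra. }
  assert (WS := windows_sum (S k) T H D B (L ^ 2 * S0 * D / 40000) nc ltac:(lra) ltac:(lra) ltac:(lra) Cj).
  assert (Wn : forall j, (j < nc)%nat -> L ^ 2 * S0 * D / 40000 <= RInt (fun y => dG (S k) (T + B + INR j * D + y) ^ 2 * wg D y) (- B) B).
  { intros j Hj. assert (0 <= INR j * D) by (apply Rmult_le_pos; [apply pos_INR|lra]). assert (Y := Cj j Hj).
    apply (window k M N W D B (T + B + INR j * D) T L); try assumption; try lra; auto. }
  specialize (WS Wn). set (X := RInt _ _ _) in *. clearbody X.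
  assert (C3 : H / 2 <= INR nc * D).
  { assert (A : (H - 2 * B) <= (INR nc + 1) * D) by (apply Rlt_le in C2; apply -> Rle_div_l; [exact C2|lra]). lra. }
  assert (P0 : 0 <= L ^ 2 * S0 / 40000) by (apply Rmult_le_pos; [apply Rmult_le_pos; [apply pow2_ge_0|lra]|lra]).
  assert (C4 : H / 2 * (L ^ 2 * S0 / 40000) <= 8 * X).
  { eapply Rle_trans; [apply Rmult_le_compat_r; [exact P0|exact C3]|]. eapply Rle_trans; [|exact WS]. right. field. }
  rewrite pow_add. fold L.
  assert (H0 : 0 <= H * L ^ 2) by (apply Rmult_le_pos; [lra|apply pow2_ge_0]).
  assert (C5 : H * L ^ 2 * (c * (de / 2 * L) ^ q) <= H * L ^ 2 * S0) by (apply Rmult_le_compat_l; assumption).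
  rewrite Rpow_mult_distr in C5.
  replace (c * (de / 2) ^ q / 640000 * (H * (L ^ q * L ^ 2))) with (H * L ^ 2 * (c * ((de / 2) ^ q * L ^ q)) / 640000) by field. lra.
Qed.

Theorem theorem1 :
  riemann_hypothesis ->
  forall (k : nat) (alpha : R),
    (2 <= k)%nat ->
    0 < alpha <= 1 ->
    exists c T0 : R,
      0 < c /\
      forall T H : R,
        T0 <= T ->
        Rpower T alpha <= H <= T ->
        RInt (fun t : R => (Derive hardy_Z t) ^ 2 * (hardy_Z t) ^ (2 * k - 2))
             T (T + H)
        >= c * (H * (ln T) ^ (k ^ 2 + 2)).
Proof.
  intros _ k alpha Hk Ha. destruct k as [|k]; [lia|]. destruct (diag_lower k) as (c & M1 & Hc & HM).
  destruct (hardy_moment_lower k alpha c M1 ltac:(lia) Ha Hc HM) as (c' & T0 & Hc' & HT).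
  assert (kp := INR_S_pos k).
  exists (c' / INR (S k) ^ 2), T0. split; [apply Rdiv_lt_0_compat; [exact Hc'|apply pow_lt, kp]|].
  intros T H H1 H2. specialize (HT T H H1 H2). apply Rle_ge.
  set (f := fun t => Derive hardy_Z t ^ 2 * hardy_Z t ^ (2 * S k - 2)).
  assert (E : forall t, dG (S k) t ^ 2 = INR (S k) ^ 2 * f t + 0 * 0).
  { intros t. unfold f, dG. rewrite (is_derive_unique _ _ _ (hardy_Z_derive t)). replace (2 * S k - 2)%nat with ((S k - 1) * 2)%nat by lia.
    rewrite pow_mult. ring. }
  assert (Ef : ex_RInt f T (T + H)).
  { apply exR_cont. intros t. apply (continuous_ext (fun t => dZ t ^ 2 * hardy_Z t ^ (2 * S k - 2))).
    - intros u. unfold f. rewrite (is_derive_unique _ _ _ (hardy_Z_derive u)). reflexivity.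
    - apply (continuous_mult (K := R_AbsRing) (fun t => dZ t ^ 2)); apply continuous_pow; [apply continuous_dZ|apply continuous_hardy_Z]. }
  rewrite (RIntext _ _ T (T + H) E), (RInt_lin2 f (fun _ => 0) T (T + H) (INR (S k) ^ 2) 0 Ef (ex_RInt_const _ _ _)) in HT.
  set (I := RInt f T (T + H)) in *. clearbody I. rewrite Rmult_0_l, Rplus_0_r in HT.
  replace (c' / INR (S k) ^ 2 * (H * ln T ^ (S k ^ 2 + 2))) with (c' * (H * ln T ^ (S k ^ 2 + 2)) / INR (S k) ^ 2) by (field; lra).
  apply <- Rle_div_l; [lra|apply pow_lt, kp].
Qed.
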